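(* Let $(X,d,\mu)$ be a normal space of order $\theta$ with $0<\mu(X)<\infty$, and let $\mathcal F$, $(f_Q)_{Q\in\mathcal F}$, $(h_Q)_{Q\in\mathcal F}$ and the martingale Hardy space $H^1([\Sigma_n])$ be as in the context. Let $Y$ be the closed linear span of $\{f_Q:Q\in\mathcal F\}$ in $H^1(X,d,\mu)$, equipped with the norm of $H^1(X,d,\mu)$. Then the map $$T:Y\to H^1([\Sigma_n]),\qquad f_Q\mapsto h_Q\quad(Q\in\mathcal F),$$ extends to a bounded linear operator.
   Context: Normal space: $X$ is a set, $d:X\times X\to[0,\infty)$ is a quasi-metric (symmetric, $d(x,y)=0$ iff $x=y$, and $d(x,y)\le K'(d(x,z)+d(z,y))$ for a fixed $K'$), $B(x,r)=\{y: d(x,y)<r\}$, and $\mu$ is a non-negative measure on $X$ defined on a $\sigma$-algebra containing the balls. $(X,d,\mu)$ is normal of order $\theta>0$ if there are constants $A_1,A_2,K_1,K_2\in(0,\infty)$ with $K_2\le1\le K_1$ and $K_0>0$ such that for all $x\in X$, $r>0$: $A_1r\le\mu(B(x,r))$ if $r\le K_1\mu(X)$; $B(x,r)=X$ if $r>K_1\mu(X)$; $A_2r\ge\mu(B(x,r))$ if $r\ge K_2\mu(\{x\})$; $B(x,r)=\{x\}$ if $r<K_2\mu(\{x\})$; and $|d(x,z)-d(y,z)|\le K_0r^{1-\theta}d(x,y)^\theta$ whenever $d(x,z)<r$, $d(y,z)<r$. Atomic $H^1(X,d,\mu)$ (Coifman–Weiss): an atom is a function $a:X\to\mathbf R$ supported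 in a ball $B$ with $\|a\|_\infty\le\mu(B)^{-1}$ and $\int a\,d\mu=0$; since $\mu(X)<\infty$ the constant function $1/\mu(X)$ is also an atom. $H^1(X,d,\mu)$ is the space of all $f=\sum_i\lambda_ia_i$ (convergence in $L^1(\mu)$) with $a_i$ atoms and $\sum|\lambda_i|<\infty$, normed by the infimum of $\sum_i|\lambda_i|$ over all such representations. Dyadic cubes (David, Christ): $\mathcal E=\{Q^k_i:k\ge0,i\in I_k\}$ is a collection of subsets of $X$ with constants $\delta\in(0,1)$, $a_0,\eta>0$, $C_1,C_2<\infty$ such that for each $k$ the $Q_i^k$ ($i\in I_k$) cover $X$ up to a $\mu$-null set; if $l\ge k$ then either $Q^l_j\subset Q^k_i$ or $Q^l_j\cap Q^k_i=\emptyset$; for each $(k,i)$ and $l<k$ there is a unique $j$ with $Q^k_i\subset Q^l_j$; $\operatorname{diam}Q^k_i\le C_1\delta^k$; each $Q^k_i$ contains a ball $B(z^k_i,a_0\delta^k)$; and $\mu\{x\in Q^k_i:\operatorname{dist}(x,X\setminus Q^k_i)\le t\delta^k\}\le C_2t^\eta\mu(Q^k_i)$ for $t\ge0$. The indexing is such that $X$ is the only cube of level $0$ (up to a null set). $G_n(X|\mathcal E)$ is the set of cubes of level $n$, and for $Q\in G_n(X|\mathcal E)$, $G_1(Q|\mathcal E)$ is the set of cubes of level $n+1$ contained in $Q$; write $G_1(Q|\mathcal E)=\{P_0,\dots,P_{N}\}$, $N=N(Q)$. Martingale $H^1$: $\Sigma_n$ is the $\sigma$-algebra generated by the cubes of levels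 $\le n$, and $H^1([\Sigma_n])$ is the martingale Hardy space with norm $\|f\|=\left\|\left(\sum_{n\ge0}|E(f|\Sigma_n)-E(f|\Sigma_{n-1})|^2\right)^{1/2}\right\|_{L^1(\mu)}$, where $E(f|\Sigma_{-1})=0$. Functions $h_{Q,i}$, $1\le i\le N(Q)$: supported in $Q$, constant on each $P_j$, taking at most three values (including $0$), with $\int h_{Q,i}\,d\mu=0$, and $\frac1C(\sum\alpha_i^2)^{1/2}\le\|\sum_i\alpha_ih_{Q,i}\|_{L^2}\le C(\sum\alpha_i^2)^{1/2}$ for all real $\alpha_i$, with $C$ independent of $Q$, $N$ and $\delta$ (such systems were constructed by Maurey; the system $\{h_{Q,i}\}$ is an unconditional basis in $H^1([\Sigma_n])$, apart from constants). Smoothing: fix $0<\beta\le\theta$; $\operatorname{Lip}_\beta(f)=\sup_{x\ne y}|f(x)-f(y)|/d(x,y)^\beta$. For each $n$, $(\psi^{(n)}_k)_k$ is a partition of unity (nonnegative functions, uniformly bounded overlap, as constructed by Macías–Segovia) with $\sum_k\psi^{(n)}_k=1$, $\operatorname{diam}(\operatorname{supp}\psi^{(n)}_k)\le\tau\delta^n$, $\operatorname{Lip}_\beta(\psi^{(n)}_k)\le(\tau\delta^n)^{-\beta}$. Put $K_n(x,y)=\sum_k\psi_k^{(n)}(x)\psi^{(n)}_k(y)/\|\psi^{(n)}_k\|_1$, and for $Q\in G_n(X|\mathcal E)$ put $\tilde\varphi_{Q,i}(x)=\int_XK_{n+1}(x,y)h_{Q,i}(y)\,d\mu(y)$ and $\varphi_{Q,i}=\tilde\varphi_{Q,i}/\|\tilde\varphi_{Q,i}\|_2$.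 Family $\mathcal F$: fix a large constant $K$; split each $G_n(X|\mathcal E)$ into $\mathcal P_{n,1},\dots,\mathcal P_{n,l}$ ($l$ depending only on $K$ and the geometry of $X$) so that $\operatorname{dist}(P,Q)\ge K\max\{\mu(P),\mu(Q)\}$ for distinct $P,Q\in\mathcal P_{n,j}$. Fix integers $m\ge2$, $0<s\le m$, $1\le j\le l$ and $i_0\ge1$, and let $\mathcal F=\bigcup_{k\ge0}\mathcal P_{mk+s,j}\cup\{X\}$, keeping only those cubes $Q\neq X$ with $N(Q)\ge i_0$. Put $\varphi_Q=\varphi_{Q,i_0}$ and $h_Q=h_{Q,i_0}$ for $Q\in\mathcal F$, $Q\ne X$, and $\varphi_X=h_X=\mathbf 1_X$. The system $f_Q$: fix $0<\alpha<\beta/2$. The parameters are chosen so that $\tau$ is sufficiently small (in particular $\tau<1/(500C_1)$), $\delta$ is sufficiently small depending on $\tau$, $\beta$ and the geometry of $X$, $K$ is sufficiently large, and $m$ is sufficiently large depending on $\alpha,\beta,\delta,\tau$ and the geometry. Then the Gram matrix $G=(\int_X\varphi_Q\varphi_P\,d\mu)_{Q,P\in\mathcal F}$ is positive definite and invertible on $\ell^2(\mathcal F)$; with $(a_{P,Q})$ the coefficients of $G^{-1/2}$, put $f_Q=\sum_{P\in\mathcal F}a_{P,Q}\varphi_P$. The $f_Q$ form an orthonormal system in $L^2(X,\mu)$. *)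

(* Defs.v *)
From HB Require Import structures.
From mathcomp Require Import all_boot all_order all_algebra finmap.
From mathcomp Require Import all_classical all_reals all_analysis.

Set Implicit Arguments.
Unset Strict Implicit.
Unset Printing Implicit Defensive.

Import Order.TTheory GRing.Theory Num.Theory.
Import numFieldNormedType.Exports.

Local Open Scope classical_set_scope.
Local Open Scope ring_scope.

Section QuasiMetric.
Context {R : realType} {X : Type}.
Variable d : X -> X -> R.

Definition quasi_metric (K' : R) : Prop :=
  [/\ forall x y, 0 <= d x y,
      forall x y, d x y = d y x,
      forall x y, d x y = 0 <-> x = y
    & forall x y z, d x y <= K' * (d x z + d z y)].

Definition qball (x : X) (r : R) : set X := [set y | d x y < r].

Definition qdiam (A : set X) : \bar R :=
  ereal_sup [set (d u.1 u.2)%:E | u in A `*` A].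

(* The distance to the empty set is +oo. *)
Definition qdist (A B : set X) : \bar R :=
  ereal_inf [set (d u.1 u.2)%:E | u in A `*` B].

Definition Lip (beta : R) (f : X -> R) : \bar R :=
  ereal_sup [set (`|f u.1 - f u.2| / d u.1 u.2 `^ beta)%:E
            | u in [set u : X * X | u.1 <> u.2]].

End QuasiMetric.

Section Ell2.
Context {R : realType} {F : choiceType}.
Implicit Types (u v : F -> R) (A G : F -> F -> R).

Definition normE2 u : \bar R := \esum_(i in [set: F]) ((u i) ^+ 2)%:E.

Definition ell2 : set (F -> R) := [set u | (normE2 u < +oo)%E].

(* Unordered sum; meaningful for absolutely summable families. *)
Definition usum u : R :=
  fine (\esum_(i in [set: F]) (Num.max (u i) 0)%:E)
  - fine (\esum_(i in [set: F]) (Num.max (- u i) 0)%:E).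

Definition mxapp A u : F -> R := fun P => usum (fun Q => A P Q * u Q).

Definition bounded_mx A : Prop :=
  exists C : R, forall u, ell2 u ->
    (forall P, summable [set: F] (fun Q => (A P Q * u Q)%:E)) /\
    (normE2 (mxapp A u) <= C%:E * normE2 u)%E.

Definition positive_mx A : Prop :=
  (forall P Q, A P Q = A Q P) /\
  (forall u, ell2 u -> 0 <= usum (fun P => u P * mxapp A u P)).

Definition is_inv_sqrt_mx G A : Prop :=
  [/\ bounded_mx G, bounded_mx A, positive_mx A,
      forall u, ell2 u -> mxapp G (mxapp A (mxapp A u)) = u
    & forall u, ell2 u -> mxapp A (mxapp A (mxapp G u)) = u].

(* G^(-1/2): such a matrix is unique; the value is the junk matrix 0 when G is
   not positive definite, bounded and invertible on ell2. *)
Definition inv_sqrt_mx G : F -> F -> R :=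
  xget (fun _ _ => 0) [set A | is_inv_sqrt_mx G A].

End Ell2.

Section FunctionSpaces.
Context {R : realType} {disp : measure_display} {X : measurableType disp}.
Variable mu : {measure set X -> \bar R}.
Implicit Types (f g : X -> R).

Definition integrableR f : Prop := mu.-integrable [set: X] (EFin \o f).

Definition L2norm f : \bar R := 'N[mu]_2%:E[EFin \o f].

Definition L2_sum (F : choiceType) (u : F -> X -> R) (f : X -> R) : Prop :=
  [/\ measurable_fun [set: X] f, (L2norm f < +oo)%E &
   forall e : R, 0 < e -> exists s0 : {fset F}, forall s : {fset F},
     (s0 `<=` s)%fset ->
     (L2norm (fun x => f x - \sum_(P <- s) u P x)%R < e%:E)%E].

Definition normal_qmspace (d : X -> X -> R) (theta : R) : Prop :=
  [/\ exists K', quasi_metric d K',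
      forall x r, measurable (qball d x r),
      0 < theta &
   exists A1 A2 K1 K2 K0 : R,
   [/\ [/\ 0 < A1, 0 < A2, 0 < K2 & 0 < K0], K2 <= 1 <= K1 &
    forall x r, 0 < r ->
    [/\ (r%:E <= K1%:E * mu [set: X])%E ->
          ((A1 * r)%:E <= mu (qball d x r))%E,
        (K1%:E * mu [set: X] < r%:E)%E -> qball d x r = [set: X],
        (K2%:E * mu [set x] <= r%:E)%E ->
          (mu (qball d x r) <= (A2 * r)%:E)%E,
        (r%:E < K2%:E * mu [set x])%E -> qball d x r = [set x]
      & forall y z, d x z < r -> d y z < r ->
          `|d x z - d y z| <= K0 * r `^ (1 - theta) * d x y `^ theta]]].

Definition H1_atom (d : X -> X -> R) (a : X -> R) : Prop :=
  measurable_fun [set: X] a /\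
  ((exists x r,
     [/\ 0 < r,
         forall y, a y <> 0 -> qball d x r y,
         ('N[mu]_+oo[EFin \o a] <= ((fine (mu (qball d x r)))^-1)%:E)%E
       & \int[mu]_y a y = 0])
   \/ a = cst (fine (mu [set: X]))^-1).

Definition H1_representation (d : X -> X -> R) f
    (lambda : nat -> R) (a : nat -> X -> R) : Prop :=
  [/\ forall i, H1_atom d (a i),
      (\sum_(0 <= i <oo) `|lambda i|%:E < +oo)%E
    & (fun n => \int[mu]_x `|(f x - \sum_(i < n) lambda i * a i x)%:E|)%E
        @ \oo --> 0%E].

(* Equal to +oo when f has no atomic representation. *)
Definition atomic_H1norm (d : X -> X -> R) f : \bar R :=
  ereal_inf [set v | exists lambda a,
    H1_representation d f lambda a /\
    v = (\sum_(0 <= i <oo) `|lambda i|%:E)%E].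

Definition atomic_H1 (d : X -> X -> R) : set (X -> R) :=
  [set f | integrableR f /\ (atomic_H1norm d f < +oo)%E].

Definition atomic_H1_closed_span (d : X -> X -> R) (F : choiceType)
    (f : F -> X -> R) : set (X -> R) :=
  [set g | atomic_H1 d g /\ forall e : R, 0 < e ->
     exists (s : {fset F}) (c : F -> R),
       (atomic_H1norm d (fun x => g x - \sum_(Q <- s) c Q * f Q x)%R < e%:E)%E].

Definition is_cond_exp (S : set (set X)) f g : Prop :=
  [/\ measurable_fun [set: g_sigma_algebraType S]
        (g : g_sigma_algebraType S -> R),
      integrableR g
    & forall A, <<s S >> A -> \int[mu]_(x in A) g x = \int[mu]_(x in A) f x].

(* A version of the conditional expectation given <<s S >>. *)
Definition cond_exp (S : set (set X)) f : X -> R :=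
  xget (cst 0) [set g | is_cond_exp S f g].

(* [S n] generates the n-th sigma-algebra of the filtration. *)
Definition mart_diff (S : nat -> set (set X)) f (n : nat) : X -> R :=
  if n is n'.+1 then cond_exp (S n) f \- cond_exp (S n') f
  else cond_exp (S 0%N) f.

Definition mart_H1norm (S : nat -> set (set X)) f : \bar R :=
  (\int[mu]_x
     ((\sum_(0 <= n <oo) ((`|mart_diff S f n x| ^+ 2)%R)%:E) `^ (2^-1)))%E.

Definition mart_H1 (S : nat -> set (set X)) : set (X -> R) :=
  let T := g_sigma_algebraType (\bigcup_n S n) in
  [set f | [/\ integrableR f,
      exists2 g, measurable_fun [set: T] (g : T -> R) & f = g %[ae mu]
    & (mart_H1norm S f < +oo)%E]].

(* Elements of the spaces are functions, identified when equal mu-a.e. *)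
Definition bounded_linear_operator (Y : set (X -> R)) (nY : (X -> R) -> \bar R)
    (Z : set (X -> R)) (nZ : (X -> R) -> \bar R)
    (T : (X -> R) -> (X -> R)) : Prop :=
  [/\ forall g, Y g -> Z (T g),
      forall g1 g2, Y g1 -> Y g2 -> g1 = g2 %[ae mu] ->
        T g1 = T g2 %[ae mu],
      forall (c1 c2 : R) g1 g2, Y g1 -> Y g2 ->
        T (fun x => c1 * g1 x + c2 * g2 x) =
        (fun x => c1 * T g1 x + c2 * T g2 x) %[ae mu]
    & exists C : R, forall g, Y g -> (nZ (T g) <= C%:E * nY g)%E].

End FunctionSpaces.

Section Cubes.
Context {R : realType} {disp : measure_display} {X : measurableType disp}.
Variables (mu : {measure set X -> \bar R}) (d : X -> X -> R).
Context {I : nat -> choiceType}.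
Variable E : forall k, I k -> set X.

Record dyadic_cubes (delta a0 eta C1 C2 : R) : Prop := {
  cube_measurable : forall k i, measurable (@E k i) ;
  cube_cover : forall k, mu.-negligible (~` \bigcup_i @E k i) ;
  cube_nested : forall k l i j, (k <= l)%N ->
    (@E l j `<=` @E k i) \/ (@E l j `&` @E k i = set0) ;
  cube_ancestor : forall k l i, (l < k)%N ->
    exists! j, @E k i `<=` @E l j ;
  cube_diam : forall k i, (qdiam d (@E k i) <= (C1 * delta ^+ k)%:E)%E ;
  cube_ball : forall k i, exists z, qball d z (a0 * delta ^+ k) `<=` @E k i ;
  cube_boundary : forall k i t, 0 <= t ->
    (mu [set x | @E k i x /\
       (qdist d [set x] (~` @E k i) <= (t * delta ^+ k)%:E)%E]
     <= (C2 * t `^ eta)%:E * mu (@E k i))%E ;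
  cube_top : exists i : I 0%N, forall j, j = i }.

Definition subcubes n (i : I n) : set (I n.+1) :=
  [set j | @E n.+1 j `<=` @E n i].

(* The subcubes of a cube are P_0, ..., P_N with N = Nsub; there are finitely
   many of them as they are disjoint of measure bounded below. *)
Definition Nsub n (i : I n) : nat := #|` fset_set (subcubes i)|.-1.

Definition cubes_upto (n : nat) : set (set X) :=
  [set A | exists k (i : I k), (k <= n)%N /\ A = E i].

Definition haar_system (C : R) (h : forall n, I n -> nat -> X -> R) : Prop :=
  forall n (i : I n),
  (forall k, (1 <= k <= Nsub i)%N ->
    [/\ measurable_fun [set: X] (h n i k),
        forall x, h n i k x <> 0 -> E i x,
        forall j, subcubes i j -> forall x y, E j x -> E j y ->
          h n i k x = h n i k y,
        exists a b, forall x, [\/ h n i k x = 0, h n i k x = a | h n i k x = b]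
      & \int[mu]_x h n i k x = 0]) /\
  (forall alpha : nat -> R,
    let sz := Num.sqrt (\sum_(1 <= k < (Nsub i).+1) alpha k ^+ 2) in
    let nrm := L2norm mu
      (fun x => \sum_(1 <= k < (Nsub i).+1) alpha k * h n i k x) in
    ((C^-1 * sz)%:E <= nrm)%E /\ (nrm <= (C * sz)%:E)%E).

(* The n-th partition is a sequence indexed by nat; zero functions are allowed,
   so finite partitions are covered as well. *)
Definition partitions_of_unity (beta tau delta : R) (M : nat)
    (psi : nat -> nat -> X -> R) : Prop :=
  forall n,
  [/\ forall k, measurable_fun [set: X] (psi n k) /\
        forall x, 0 <= psi n k x,
      forall x, ([set k | psi n k x != 0] #<= `I_M)%card,
      forall x, series (fun k => psi n k x) @ \oo --> (1 : R),
      forall k, (qdiam d [set x | psi n k x != 0%R]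
                 <= (tau * delta ^+ n)%:E)%E
    & forall k, (Lip d beta (psi n k)
                 <= ((tau * delta ^+ n) `^ (- beta))%:E)%E].

Definition smoothing_kernel (psi : nat -> nat -> X -> R) (n : nat) (x y : X)
    : R :=
  limn (series (fun k => psi n k x * psi n k y / \int[mu]_z `|psi n k z|)).

Definition phi_tilde psi (h : forall n, I n -> nat -> X -> R)
    n (i : I n) (k : nat) : X -> R :=
  fun x => \int[mu]_y (smoothing_kernel psi n.+1 x y * h n i k y).

Definition phiQ psi h n (i : I n) (k : nat) : X -> R :=
  fun x => phi_tilde psi h i k x / fine (L2norm mu (phi_tilde psi h i k)).

(* [c n] splits the cubes of level n into l classes. *)
Definition separated_classes (K : R) (l : nat) (c : forall n, I n -> 'I_l)
    : Prop :=
  forall n (p q : I n), p <> q -> c n p = c n q ->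
    (K%:E * maxe (mu (E p)) (mu (E q)) <= qdist d (E p) (E q))%E.

Definition selected l (c : forall n, I n -> 'I_l) (m s : nat) (j : 'I_l)
    (i0 : nat) : set {n : nat & I n} :=
  [set q | [/\ exists k, tag q = (m * k + s)%N,
               c (tag q) (tagged q) = j
             & (i0 <= Nsub (tagged q))%N]].

(* None stands for the whole space X. *)
Definition cube_family l (c : forall n, I n -> 'I_l) m s j i0 : choiceType :=
  option {q : {n : nat & I n} | q \in selected c m s j i0}.

Definition phiF psi h l (c : forall n, I n -> 'I_l) m s j i0
    (q : cube_family c m s j i0) : X -> R :=
  if q is Some p then phiQ psi h (tagged (val p)) i0 else cst 1.

Definition hF (h : forall n, I n -> nat -> X -> R)
    l (c : forall n, I n -> 'I_l) m s j i0
    (q : cube_family c m s j i0) : X -> R :=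
  if q is Some p then h (tag (val p)) (tagged (val p)) i0 else cst 1.

End Cubes.

Definition gram_mx {R : realType} {disp : measure_display}
    {X : measurableType disp} (mu : {measure set X -> \bar R})
    {F : Type} (phi : F -> X -> R) (P Q : F) : R :=
  \int[mu]_x (phi P x * phi Q x).

(* f is the orthonormalization of phi by G^(-1/2), G the Gram matrix; each f Q
   is an arbitrary representative of its class in L^2. *)
Definition gram_orthonormalization {R : realType} {disp : measure_display}
    {X : measurableType disp} (mu : {measure set X -> \bar R})
    {F : choiceType} (phi : F -> X -> R) (f : F -> X -> R) : Prop :=
  forall Q, L2_sum mu
    (fun P x => inv_sqrt_mx (gram_mx mu phi) P Q * phi P x) (f Q).

(* Main.v *)
Require Import Defs.
From mathcomp Require Import all_boot all_order all_algebra finmap.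
From mathcomp Require Import all_classical all_reals all_analysis.
From mathcomp Require Import measurable_realfun ess_sup_inf.
From mathcomp Require Import ring lra zify.
Set Implicit Arguments.
Unset Strict Implicit.
Unset Printing Implicit Defensive.
Import Order.TTheory GRing.Theory Num.Theory.
Import numFieldNormedType.Exports.
Local Open Scope classical_set_scope.
Local Open Scope ring_scope.

(** The operator is [T g = sum_Q <g, f_Q> h_Q]. The [f_Q] are orthonormal, so it sends [f_Q] to
    [h_Q]; the content is the bound. It suffices to bound, uniformly over atoms [a] and finite
    subfamilies, the L1 norms of [sum <a, f_Q> h_Q] and of the square function
    [(sum <a, f_Q>^2 h_Q^2)^(1/2)] ([atom_M_bound], [atom_S_bound]). Both are seminorms in finitely
    many coefficients, and each coefficient is continuous in L1 because [f_Q] has a bounded version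
    ([bounded_version]), so the bounds pass to every [g] with an atomic representation
    ([fseminorm_transfer]). The partial sums over levels then converge in L1 ([psum_cauchy]) and are
    the conditional expectations of their limit ([psum_cond_exp]). Functions entering at the same
    stage have disjoint supports, so the square function above is the martingale one
    ([sum_psum_step], [mart_H1norm_bound]); [synth_bounded] collects this.

    For an atom the coefficients are [G^(-1/2)] applied to the pairings [<a, phi_P>]. Write
    [G = dg^2 (I - N)], where [dg] is 1 except at the whole space, which does not interact with the
    other cubes. With [w_P = mu(P)^(1/2)], the finer of two functions has mean zero and the coarser
    is Hoelder continuous, so [|N P Q| <= C (w_P / w_Q) th^(2 (lev P - lev Q))] when [P] is the
    finer cube ([N_le]). Interacting levels differ by at least [m], and separation leaves at most
    one interacting cube on each coarser level. Schur's test with the weights [w] and [v = w th^lev]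
    ([level_schur]) therefore gives a constant [eps <= delta / 4] for large [m]. Hence
    [G^(-1/2) = dg^-1 sum_j isc_j N^j], with the Taylor coefficients of [(1 - x)^(-1/2)]
    ([inv_sqrt_mxE]).

    Let the ball of the atom have measure about [delta^n0]. The coefficients at levels [>= n0]
    belong to cubes near the ball and have l2 norm of order [delta^(-n0/2)]; at coarser levels the
    cancellation of the atom bounds [sum |<a, phi_P>| w_P] ([cube_atom_data]). This shape persists
    under [N] ([molecule_step]): the localised part spreads to the next coarser scale while its l2
    norm gains [delta / 4], which more than pays for the larger support in Cauchy-Schwarz; what
    leaks to coarser levels is small in weighted l1, and this is enough because the L1 norm of [h_P]
    is at most a multiple of [w_P]. So [N^j] contributes [O(2^-j)] ([molecule_p]), and the series is
    summed in [molecule_invsqrt].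

    The geometric input is that of [phi_props]: size, Hoelder continuity, support and mean of the
    normalised smoothed functions. Smoothing leaves a Haar function unchanged away from thin
    boundary layers of the subcubes, which carry at most half of the mass when [tau] is small, so
    normalisation costs only a bounded factor. *)

(** * Unordered real sums *)

Section UnorderedSums.
Context {R : realType} {F : choiceType}.
Implicit Types (u v : F -> R) (s : {fset F}) (B l e : R).

Definition fsbounded u B := forall s, \sum_(i <- s) u i <= B.
(** Convergence along the net of finite subsets, with a real limit. Unlike [usum], which subtracts
    two extended sums, it is visibly linear; identities are proved for [hsum] and transported by
    [hsum_unique]. *)
Definition hsum u l := forall e, 0 < e ->
  exists s0 : {fset F}, forall s, (s0 `<=` s)%fset -> `|\sum_(i <- s) u i - l| <= e.

Lemma hsum_unique u l l' : hsum u l -> hsum u l' -> l = l'.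
Proof.
move=> H H'; apply/eqP; rewrite -subr_eq0 -normr_le0; apply/ler_addgt0Pr => e e0.
rewrite add0r.
have [s0 h0] := H _ (divr_gt0 e0 (ltr0Sn R 1)).
have [s1 h1] := H' _ (divr_gt0 e0 (ltr0Sn R 1)).
have a := h0 _ (fsubsetUl s0 s1); have b := h1 _ (fsubsetUr s0 s1).
rewrite distrC in a.
have := ler_normD (l - \sum_(i <- (s0 `|` s1)%fset) u i) (\sum_(i <- (s0 `|` s1)%fset) u i - l').
rewrite addrA subrK => /le_trans; apply.
by rewrite [leRHS](splitr e) lerD.
Qed.

Lemma hsumD u v l l' : hsum u l -> hsum v l' -> hsum (fun i => u i + v i) (l + l').
Proof.
move=> H H' e e0.
have [s0 h0] := H _ (divr_gt0 e0 (ltr0Sn R 1)).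
have [s1 h1] := H' _ (divr_gt0 e0 (ltr0Sn R 1)).
exists (s0 `|` s1)%fset => s ss.
rewrite big_split/= opprD addrACA (le_trans (ler_normD _ _))// [leRHS](splitr e) lerD//.
  by apply: h0; apply: fsubset_trans ss; exact: fsubsetUl.
by apply: h1; apply: fsubset_trans ss; exact: fsubsetUr.
Qed.

Lemma hsumZ c u l : hsum u l -> hsum (fun i => c * u i) (c * l).
Proof.
move=> H e e0.
have c0 : 0 < `|c| + 1 by rewrite ltr_wpDl.
have [s0 h0] := H _ (divr_gt0 e0 c0).
exists s0 => s ss; rewrite -mulr_sumr -mulrBr normrM.
have := h0 _ ss; rewrite ler_pdivlMr// mulrC => /(le_trans _); apply.
by rewrite ler_wpM2r// lerDl.
Qed.

Lemma hsumN u l : hsum u l -> hsum (fun i => - u i) (- l).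
Proof.
move=> /(hsumZ (-1)); rewrite mulN1r; congr hsum.
by apply/funext => i; rewrite mulN1r.
Qed.

Lemma hsumB u v l l' : hsum u l -> hsum v l' -> hsum (fun i => u i - v i) (l - l').
Proof. by move=> H /hsumN; exact: hsumD. Qed.

Lemma hsum_le u l B : hsum u l -> fsbounded u B -> l <= B.
Proof.
move=> H b; apply/ler_addgt0Pr => e e0.
have [s0 h0] := H _ e0; have := h0 s0 (fsubset_refl _).
rewrite ler_distlC => /andP[_ h]; have := b s0; lra.
Qed.

Lemma ler_sum_fsubset u s t : (forall i, 0 <= u i) -> (s `<=` t)%fset ->
  \sum_(i <- s) u i <= \sum_(i <- t) u i.
Proof.
move=> u0 st.
have -> : \sum_(i <- s) u i = \sum_(i <- s) (if i \in s then u i else 0).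
  by apply: eq_big_seq => i ->.
rewrite (big_fset_incl _ st)/=; last by move=> i _ /negbTE ->.
by apply: ler_sum => i _; case: ifP.
Qed.

Lemma hsum_sum_le u l s : (forall i, 0 <= u i) -> hsum u l -> \sum_(i <- s) u i <= l.
Proof.
move=> u0 H; apply/ler_addgt0Pr => e e0.
have [s0 h0] := H _ e0; have := h0 _ (fsubsetUl s0 s).
rewrite ler_distlC => /andP[h _]; apply: le_trans (_ : _ <= \sum_(i <- (s0 `|` s)%fset) u i) _ => //.
  by apply: ler_sum_fsubset => //; exact: fsubsetUr.
lra.
Qed.

Lemma hsum_ge0 u l : (forall i, 0 <= u i) -> hsum u l -> 0 <= l.
Proof. by move=> u0 /(hsum_sum_le fset0 u0); rewrite big_seq_fset0. Qed.

Lemma hsum_norm u l B : hsum u l -> fsbounded (fun i => `|u i|) B -> `|l| <= B.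
Proof.
move=> H b; rewrite ler_norml lerNl; apply/andP; split.
  apply: (hsum_le (hsumN H)) => s; apply: le_trans (b s).
  by apply: ler_sum => i _; rewrite lerNl lerNnormlW.
by apply: (hsum_le H) => s; apply: le_trans (b s); apply: ler_sum => i _; exact: ler_norm.
Qed.

Lemma hsum_fin u s : (forall i, i \notin s -> u i = 0) -> hsum u (\sum_(i <- s) u i).
Proof.
move=> us e e0; exists s => t st.
rewrite [X in `|X - _|](_ : _ = \sum_(i <- s) u i) ?subrr ?normr0 1?ltW//.
rewrite (big_fset_incl _ st)// => i it /= is_; exact: us.
Qed.

Lemma esum_EFin_fsbounded u B : (forall i, 0 <= u i) ->
  (\esum_(i in [set: F]) (u i)%:E <= B%:E)%E <-> fsbounded u B.
Proof.
move=> u0; split=> [h s|h].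
- rewrite -lee_fin -sumEFin; apply: le_trans h; apply: esum_ge.
  exists [set` s]; first by split=> //; exact: finite_fset.
  by rewrite fsbig_finite//= set_fsetK.
- rewrite ge_ereal_sup => //= _ [X [finX XI]] <-.
  by rewrite fsbig_finite//= sumEFin lee_fin; exact: h.
Qed.

Lemma fsbounded_esum_fin u B : (forall i, 0 <= u i) -> fsbounded u B ->
  (\esum_(i in [set: F]) (u i)%:E \is a fin_num)%E.
Proof.
move=> u0 /(esum_EFin_fsbounded _ u0) h.
rewrite ge0_fin_numE; last by apply: esum_ge0 => i _; rewrite lee_fin.
by rewrite (le_lt_trans h)// ltry.
Qed.

Lemma hsum_esum u B : (forall i, 0 <= u i) -> fsbounded u B ->
  hsum u (fine (\esum_(i in [set: F]) (u i)%:E)).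
Proof.
move=> u0 h; have fn := fsbounded_esum_fin u0 h.
set l := fine _; have lE : (\esum_(i in [set: F]) (u i)%:E)%E = l%:E by rewrite /l fineK.
have ub : fsbounded u l by apply/esum_EFin_fsbounded => //; rewrite lE.
move=> e e0.
have [s0 h0] : exists s0 : {fset F}, l - e < \sum_(i <- s0) u i.
  apply: contrapT => /forallNP hn.
  have : fsbounded u (l - e) by move=> s; rewrite leNgt; apply/negP; exact: hn.
  by move/(esum_EFin_fsbounded _ u0); rewrite lE lee_fin; lra.
exists s0 => s ss; have h1 := ub s.
have : \sum_(i <- s0) u i <= \sum_(i <- s) u i.
  by exact: ler_sum_fsubset.
rewrite ler_norml; lra.
Qed.

(** The absolute bound makes both extended sums in [usum] finite, so neither [fine] falls back to
    its default value 0. *)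
Lemma hsum_usum u B : fsbounded (fun i => `|u i|) B -> hsum u (usum u).
Proof.
move=> h.
have b1 : fsbounded (fun i => Num.max (u i) 0) B.
  move=> s; apply: le_trans (h s); apply: ler_sum => i _.
  by rewrite ge_max normr_ge0 ler_norm.
have b2 : fsbounded (fun i => Num.max (- u i) 0) B.
  move=> s; apply: le_trans (h s); apply: ler_sum => i _.
  by rewrite ge_max normr_ge0 -normrN ler_norm.
rewrite /usum; set a := fine _; set b := fine _.
rewrite [X in hsum X _](_ : u = fun i => Num.max (u i) 0 - Num.max (- u i) 0).
  apply: hsumB.
    by apply: (hsum_esum _ b1) => i; rewrite le_max lexx orbT.
  by apply: (hsum_esum _ b2) => i; rewrite le_max lexx orbT.
apply/funext => i; case: (leP (u i) 0) => ui; case: (leP (- u i) 0) => vi; lra.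
Qed.

Lemma usum_eq u B l : fsbounded (fun i => `|u i|) B -> hsum u l -> usum u = l.
Proof. by move=> /hsum_usum h1 h2; exact: hsum_unique h1 h2. Qed.

Lemma hsum_bounded u l : (forall i, 0 <= u i) -> hsum u l -> fsbounded u l.
Proof. by move=> u0 h s; exact: hsum_sum_le. Qed.

Lemma fsboundedN u B : fsbounded u B -> fsbounded u `|B|.
Proof. by move=> h s; rewrite (le_trans (h s))// ler_norm. Qed.

End UnorderedSums.

(** * The space ell2 and its inner product *)

Section SequenceSpace.
Context {R : realType} {F : choiceType}.
Implicit Types (u v w : F -> R) (A G : F -> F -> R) (s : {fset F}).

Definition sqbounded u (B : R) := fsbounded (fun i => u i ^+ 2) B.
Definition ip u v : R := usum (fun i => u i * v i).
Definition edelta (Q : F) : F -> R := fun P => (P == Q)%:R.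

Lemma normE2_le u B : (normE2 u <= B%:E)%E <-> sqbounded u B.
Proof. by apply: esum_EFin_fsbounded => i; exact: sqr_ge0. Qed.

Lemma ell2P u : ell2 u <-> exists B, sqbounded u B.
Proof.
split=> [|[B /normE2_le h]]; last by rewrite /ell2/= (le_lt_trans h)// ltry.
rewrite /ell2/= => h; exists (fine (normE2 u)); apply/normE2_le.
rewrite fineK// ge0_fin_numE//; apply: esum_ge0 => i _; rewrite lee_fin; exact: sqr_ge0.
Qed.

Lemma sqboundedD u v B C : sqbounded u B -> sqbounded v C ->
  sqbounded (fun i => u i + v i) (2 * B + 2 * C).
Proof.
move=> hu hv s; have := hu s; have := hv s => h1 h2.
apply: (@le_trans _ _ (2 * \sum_(i <- s) u i ^+ 2 + 2 * \sum_(i <- s) v i ^+ 2)).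
  rewrite !mulr_sumr -big_split/=; apply: ler_sum => i _.
  by have := sqr_ge0 (u i - v i); lra.
lra.
Qed.

Lemma sqboundedZ c u B : sqbounded u B -> sqbounded (fun i => c * u i) (c ^+ 2 * B).
Proof.
move=> h s; rewrite (eq_bigr (fun i => c ^+ 2 * u i ^+ 2)) => [|i _]; last by rewrite exprMn.
by rewrite -mulr_sumr ler_wpM2l// sqr_ge0.
Qed.

Lemma sqbounded_le u v B : (forall i, `|u i| <= `|v i|) -> sqbounded v B -> sqbounded u B.
Proof.
move=> uv h s; apply: le_trans (h s); apply: ler_sum => i _.
by rewrite -(real_normK (num_real (u i))) -(real_normK (num_real (v i))) lerXn2r ?nnegrE.
Qed.

Lemma ell2D u v : ell2 u -> ell2 v -> ell2 (fun i => u i + v i).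
Proof. by move=> /ell2P[B h] /ell2P[C h']; apply/ell2P; eexists; exact: sqboundedD h h'. Qed.

Lemma ell2Z c u : ell2 u -> ell2 (fun i => c * u i).
Proof. by move=> /ell2P[B h]; apply/ell2P; eexists; exact: sqboundedZ h. Qed.

Lemma ell2N u : ell2 u -> ell2 (fun i => - u i).
Proof. by move=> /ell2P[B h]; apply/ell2P; exists B; apply: sqbounded_le h => i; rewrite normrN. Qed.

Lemma ell2B u v : ell2 u -> ell2 v -> ell2 (fun i => u i - v i).
Proof. by move=> hu /ell2N; exact: ell2D. Qed.

Lemma ell2_le u v : (forall i, `|u i| <= `|v i|) -> ell2 v -> ell2 u.
Proof. by move=> uv /ell2P[B h]; apply/ell2P; exists B; exact: sqbounded_le h. Qed.

Lemma ell2_fin u s : (forall i, i \notin s -> u i = 0) -> ell2 u.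
Proof.
move=> us; apply/ell2P; exists (\sum_(i <- s) u i ^+ 2).
apply: (@hsum_bounded _ _ (fun i => u i ^+ 2)); first by move=> i; exact: sqr_ge0.
by apply: hsum_fin => i /us ->; rewrite expr0n.
Qed.

Lemma ell2_edelta Q : ell2 (edelta Q).
Proof.
apply: (@ell2_fin _ [fset Q]%fset) => i; rewrite inE /edelta => /negbTE ->//.
Qed.

Lemma ell2_0 : ell2 (fun _ : F => 0 : R).
Proof. exact: (@ell2_fin _ fset0). Qed.

Lemma fsbounded_mul u v B C : sqbounded u B -> sqbounded v C ->
  fsbounded (fun i => `|u i * v i|) ((B + C) / 2).
Proof.
move=> hu hv s; have := hu s; have := hv s => h1 h2.
apply: (@le_trans _ _ ((\sum_(i <- s) u i ^+ 2 + \sum_(i <- s) v i ^+ 2) / 2)); last first.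
  by rewrite ler_pM2r ?invr_gt0//; lra.
rewrite -big_split/= mulr_suml; apply: ler_sum => i _.
rewrite normrM -(real_normK (num_real (u i))) -(real_normK (num_real (v i))).
have := sqr_ge0 (`|u i| - `|v i|); lra.
Qed.

Lemma ip_hsum u v : ell2 u -> ell2 v -> hsum (fun i => u i * v i) (ip u v).
Proof. by move=> /ell2P[B hB] /ell2P[C hC]; exact: hsum_usum (fsbounded_mul hB hC). Qed.

Lemma ip_eq u v l : ell2 u -> ell2 v -> hsum (fun i => u i * v i) l -> ip u v = l.
Proof. by move=> hu hv; apply: hsum_unique; exact: ip_hsum. Qed.

Lemma ipC u v : ip u v = ip v u.
Proof. by rewrite /ip; congr usum; apply/funext => i; rewrite mulrC. Qed.

Lemma ipDl u v w : ell2 u -> ell2 v -> ell2 w ->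
  ip (fun i => u i + v i) w = ip u w + ip v w.
Proof.
move=> hu hv hw; apply: ip_eq => //; first exact: ell2D.
under eq_fun do rewrite mulrDl; apply: hsumD; exact: ip_hsum.
Qed.

Lemma ipZl c u w : ell2 u -> ell2 w -> ip (fun i => c * u i) w = c * ip u w.
Proof.
move=> hu hw; apply: ip_eq => //; first exact: ell2Z.
under eq_fun do rewrite -mulrA; apply: hsumZ; exact: ip_hsum.
Qed.

Lemma ipNl u w : ell2 u -> ell2 w -> ip (fun i => - u i) w = - ip u w.
Proof.
move=> hu hw; apply: ip_eq => //; first exact: ell2N.
under eq_fun do rewrite mulNr; apply: hsumN; exact: ip_hsum.
Qed.

Lemma ipBl u v w : ell2 u -> ell2 v -> ell2 w ->
  ip (fun i => u i - v i) w = ip u w - ip v w.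
Proof. by move=> hu hv hw; rewrite ipDl ?ipNl//; exact: ell2N. Qed.

Lemma ipDr u v w : ell2 u -> ell2 v -> ell2 w ->
  ip w (fun i => u i + v i) = ip w u + ip w v.
Proof. by move=> hu hv hw; rewrite !(ipC w) ipDl. Qed.

Lemma ipBr u v w : ell2 u -> ell2 v -> ell2 w ->
  ip w (fun i => u i - v i) = ip w u - ip w v.
Proof. by move=> hu hv hw; rewrite !(ipC w) ipBl. Qed.

Lemma ipZr c u w : ell2 u -> ell2 w -> ip w (fun i => c * u i) = c * ip w u.
Proof. by move=> hu hw; rewrite !(ipC w) ipZl. Qed.

Lemma ip_ge0 u : ell2 u -> 0 <= ip u u.
Proof. by move=> hu; apply: hsum_ge0 (ip_hsum hu hu) => i; rewrite -expr2 sqr_ge0. Qed.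

Lemma sqbounded_ip u : ell2 u -> sqbounded u (ip u u).
Proof.
move=> hu s; under eq_bigr do rewrite expr2.
apply: hsum_sum_le (ip_hsum hu hu) => i; by rewrite -expr2 sqr_ge0.
Qed.

Lemma ip_sqbounded u B : sqbounded u B -> ip u u <= B.
Proof.
move=> h; have hu : ell2 u by apply/ell2P; exists B.
apply: hsum_le (ip_hsum hu hu) _ => s; apply: le_trans (h s).
by under eq_bigr do rewrite -expr2.
Qed.

Lemma normE2_ip u : ell2 u -> normE2 u = (ip u u)%:E.
Proof.
move=> hu; apply/eqP; rewrite eq_le; apply/andP; split.
  by apply/normE2_le; exact: sqbounded_ip.
have h : (normE2 u \is a fin_num)%E.
  by rewrite ge0_fin_numE//; apply: esum_ge0 => i _; rewrite lee_fin; exact: sqr_ge0.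
by rewrite -(fineK h) lee_fin; apply: ip_sqbounded; apply/normE2_le; rewrite fineK.
Qed.

Lemma coord_le_ip u P : ell2 u -> u P ^+ 2 <= ip u u.
Proof. by move=> /sqbounded_ip/(_ [fset P]%fset); rewrite big_seq_fset1. Qed.

Lemma ip_eq0 u : ell2 u -> ip u u <= 0 -> u = (fun _ => 0).
Proof.
move=> hu h; apply/funext => P; apply/eqP; rewrite -sqrf_eq0 eq_le sqr_ge0 andbT.
exact: le_trans (coord_le_ip _ hu) h.
Qed.

Lemma ip_edelta u Q : ell2 u -> ip u (edelta Q) = u Q.
Proof.
move=> hu; apply: ip_eq => //; first exact: ell2_edelta.
have := @hsum_fin _ _ (fun i => u i * edelta Q i) [fset Q]%fset.
rewrite big_seq_fset1 /edelta eqxx mulr1; apply => i; rewrite inE => /negbTE ->.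
by rewrite mulr0.
Qed.

Lemma ip_amgm u v t : ell2 u -> ell2 v -> 0 < t ->
  `|ip u v| <= (t * ip u u + t^-1 * ip v v) / 2.
Proof.
move=> hu hv t0.
have hn (c : R) : 0 <= ip u u + 2 * c * ip u v + c ^+ 2 * ip v v.
  have h := ip_ge0 (ell2D hu (ell2Z c hv)).
  rewrite ipDl ?ipDr ?ipZl ?ipZr// in h; try exact: ell2Z; try (apply: ell2D => //; exact: ell2Z).
  by rewrite (ipC v u) in h; move: h; rewrite expr2; lra.
have a := hn t^-1; have b := hn (- t^-1).
have tt : t * t^-1 = 1 by rewrite divff// gt_eqF.
have e1 : t * (ip u u + 2 * t^-1 * ip u v + t^-1 ^+ 2 * ip v v) =
   t * ip u u + 2 * (t * t^-1) * ip u v + (t * t^-1) * t^-1 * ip v v by ring.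
have e2 : t * (ip u u + 2 * (- t^-1) * ip u v + (- t^-1) ^+ 2 * ip v v) =
   t * ip u u - 2 * (t * t^-1) * ip u v + (t * t^-1) * t^-1 * ip v v by ring.
have := mulr_ge0 (ltW t0) a; have := mulr_ge0 (ltW t0) b.
rewrite e1 e2 tt ler_norml; lra.
Qed.

(** Tails of a convergent sum of squares are small: finitely supported families are dense. *)
Lemma ell2_approx u (e : R) : ell2 u -> 0 < e -> exists s,
  ip (fun i => if i \in s then 0 else u i) (fun i => if i \in s then 0 else u i) <= e.
Proof.
move=> hu e0; have [s hs] := ip_hsum hu hu e0; exists s.
have h0 := hs s (fsubset_refl _).
have h1 : ell2 (fun i => if i \in s then 0 else u i).
  by apply: ell2_le hu => i; case: ifP; rewrite ?normr0.
apply: le_trans (_ : ip u u - \sum_(i <- s) u i * u i <= e); last first.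
  by move: h0; rewrite ler_distlC; lra.
rewrite le_eqVlt; apply/orP; left; apply/eqP; apply: ip_eq => //.
have -> : (fun i => (if i \in s then 0 else u i) * (if i \in s then 0 else u i)) =
  (fun i => u i * u i - (if i \in s then u i * u i else 0)).
  by apply/funext => i; case: ifP; rewrite ?mul0r ?subrr ?subr0.
apply: hsumB; first exact: ip_hsum.
have := @hsum_fin _ _ (fun i => if i \in s then u i * u i else 0) s.
rewrite (eq_big_seq (fun i => u i * u i)) => [|i /= ->//].
by apply => i /negbTE ->.
Qed.

Lemma hsum_sum (J : Type) (r : seq J) (f : J -> F -> R) (l : J -> R) :
  (forall j, hsum (f j) (l j)) ->
  hsum (fun i => \sum_(j <- r) f j i) (\sum_(j <- r) l j).
Proof.
move=> h; elim: r => [|j r IH].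
  have := @hsum_fin R F (fun i => \sum_(j <- [::]) f j i) fset0.
  by rewrite big_seq_fset0 big_nil; apply => i _; rewrite big_nil.
by under eq_fun do rewrite big_cons; rewrite big_cons; exact: hsumD.
Qed.
End SequenceSpace.

(** Exact identities between series of operators are obtained below by comparing n-th partial sums
    and letting a geometric error vanish. *)
Lemma le0_geometric (R : realType) (x C q : R) :
  0 <= q < 1 -> (forall n : nat, x <= C * q ^+ n) -> x <= 0.
Proof.
move=> /andP[q0 q1] h.
have h1 : (fun n : nat => C * q ^+ n) @ \oo --> C * (0 : R).
  by apply: cvgMr; apply: cvg_expr; rewrite ger0_norm.
rewrite mulr0 in h1.
by apply: (cvgr_to_ge h1); exact: nearW.
Qed.

Ltac ell2 := solve [repeat match goal with
  | H : ell2 ?u |- ell2 ?u => exact H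
  | |- ell2 (edelta _) => exact: ell2_edelta
  | |- ell2 (fun i => GRing.add (@?a i) (GRing.opp (@?b i))) => apply: (@ell2B _ _ a b)
  | |- ell2 (fun i => GRing.add (@?a i) (@?b i)) => apply: (@ell2D _ _ a b)
  | |- ell2 (fun i => GRing.opp (@?b i)) => apply: (@ell2N _ _ b)
  | |- ell2 (fun i => GRing.mul ?c (@?b i)) => apply: (@ell2Z _ _ c b)
  | H : forall u, ell2 u -> ell2 (?T u) |- ell2 (?T _) => apply: H
  end].

(** * Bounded operators on ell2 and uniqueness of positive square roots *)

Section Operators.
Context {R : realType} {F : choiceType}.
Implicit Types (u v w : F -> R) (T A B : (F -> R) -> (F -> R)) (s : {fset F}).

Definition nrm u : R := Num.sqrt (ip u u).

Lemma nrm_ge0 u : 0 <= nrm u. Proof. exact: sqrtr_ge0. Qed.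

Lemma sqr_nrm u : ell2 u -> nrm u ^+ 2 = ip u u.
Proof. by move=> hu; rewrite /nrm sqr_sqrtr// ip_ge0. Qed.

Lemma nrm_le u (b : R) : ell2 u -> 0 <= b -> (nrm u <= b) = (ip u u <= b ^+ 2).
Proof. by move=> hu b0; rewrite -sqr_nrm// ler_pXn2r ?nnegrE ?nrm_ge0. Qed.

Lemma ip0r u : ell2 u -> ip u (fun _ => 0) = 0.
Proof.
move=> hu; apply: ip_eq => //; first exact: ell2_0.
have := @hsum_fin R F (fun i => u i * 0) fset0.
by rewrite big_seq_fset0; apply => i _; rewrite mulr0.
Qed.

Lemma ip_quad (a b : R) u v : ell2 u -> ell2 v ->
  ip (fun i => a * u i + b * v i) (fun i => a * u i + b * v i) =
  a ^+ 2 * ip u u + 2 * (a * b) * ip u v + b ^+ 2 * ip v v.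
Proof.
move=> hu hv; rewrite ipDl; [|ell2..]; rewrite !ipZl; [|ell2..].
rewrite !ipDr; [|ell2..]; rewrite !ipZr; [|ell2..].
by rewrite (ipC v u); ring.
Qed.

Lemma ip_sub (c : R) u v : ell2 u -> ell2 v ->
  ip (fun i => u i - c * v i) (fun i => u i - c * v i) =
  ip u u - 2 * c * ip u v + c ^+ 2 * ip v v.
Proof.
move=> hu hv; have := ip_quad 1 (- c) hu hv.
rewrite (_ : (fun i => 1 * u i + - c * v i) = (fun i => u i - c * v i)); first by move=> ->; ring.
by apply/funext => i; ring.
Qed.

Lemma ip_add (c : R) u v : ell2 u -> ell2 v ->
  ip (fun i => u i + c * v i) (fun i => u i + c * v i) =
  ip u u + 2 * c * ip u v + c ^+ 2 * ip v v.
Proof.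
move=> hu hv; have := ip_quad 1 c hu hv.
rewrite (_ : (fun i => 1 * u i + c * v i) = (fun i => u i + c * v i)); first by move=> ->; ring.
by apply/funext => i; ring.
Qed.

(** Positivity of the square of [b u - x v] gives [b (a b - x^2) >= 0]; if [b = 0] then [v]
    vanishes. *)
Lemma cauchy_schwarz u v : ell2 u -> ell2 v -> `|ip u v| <= nrm u * nrm v.
Proof.
move=> hu hv; rewrite /nrm -sqrtrM ?ip_ge0// -sqrtr_sqr ler_wsqrtr//.
set a := ip u u; set b := ip v v; set x := ip u v.
have h : 0 <= b * (a * b - x ^+ 2).
  have := ip_ge0 (ell2D (ell2Z b hu) (ell2Z (- x) hv)).
  rewrite ip_quad// -/a -/b -/x => h; rewrite (_ : b * _ = b ^+ 2 * a + 2 * (b * - x) * x + (- x) ^+ 2 * b)//; ring.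
have : 0 <= b by exact: ip_ge0.
rewrite le_eqVlt => /predU1P[b0|b0]; last by move: h; rewrite pmulr_rge0// subr_ge0.
have v0 : v = fun _ => 0 by apply: ip_eq0 => //; rewrite -/b -b0.
have -> : x = 0 by rewrite /x v0; exact: ip0r.
by rewrite expr2 mul0r mulr_ge0 // ip_ge0.
Qed.

Lemma nrmD u v : ell2 u -> ell2 v -> nrm (fun i => u i + v i) <= nrm u + nrm v.
Proof.
move=> hu hv; have huv := ell2D hu hv.
rewrite nrm_le//; last by rewrite addr_ge0 ?nrm_ge0.
rewrite ipDl ?ipDr// (ipC v u) sqrrD !sqr_nrm//.
have := cauchy_schwarz hu hv; rewrite ler_norml => /andP[_]; lra.
Qed.

Lemma nrmZ c u : ell2 u -> nrm (fun i => c * u i) = `|c| * nrm u.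
Proof.
move=> hu; rewrite /nrm ipZl ?ipZr//; last exact: ell2Z.
by rewrite mulrA -expr2 sqrtrM ?sqr_ge0// sqrtr_sqr.
Qed.

Lemma nrmN u : ell2 u -> nrm (fun i => - u i) = nrm u.
Proof.
by move=> hu; have := nrmZ (-1) hu; rewrite normrN1 mul1r; under eq_fun do rewrite mulN1r.
Qed.

Lemma nrmB u v : ell2 u -> ell2 v -> nrm (fun i => u i - v i) <= nrm u + nrm v.
Proof. by move=> hu hv; rewrite -(nrmN hv) nrmD//; exact: ell2N. Qed.

Lemma coord_le_nrm u P : ell2 u -> `|u P| <= nrm u.
Proof. by move=> hu; rewrite -sqrtr_sqr ler_wsqrtr// coord_le_ip. Qed.

Lemma nrm_eq0 u : ell2 u -> nrm u <= 0 -> u = fun _ => 0.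
Proof.
move=> hu; rewrite nrm_le// expr0n/=; exact: ip_eq0.
Qed.

Lemma nrm0 : nrm (fun _ => 0) = 0.
Proof.
have h := nrmZ 0 (@ell2_0 R F); rewrite normr0 !mul0r in h; exact: h.
Qed.

(** [mxapp] returns junk outside ell2, so an operator is an arbitrary map whose linearity and bound
    are required on ell2 only. *)
Definition l2op T (C : R) := [/\ 0 <= C,
  forall u, ell2 u -> ell2 (T u),
  forall u v, ell2 u -> ell2 v -> T (fun i => u i + v i) = (fun i => T u i + T v i),
  forall c u, ell2 u -> T (fun i => c * u i) = (fun i => c * T u i)
  & forall u, ell2 u -> nrm (T u) <= C * nrm u].

Definition l2sym T := forall u v, ell2 u -> ell2 v -> ip (T u) v = ip u (T v).

Lemma l2opB T C u v : l2op T C -> ell2 u -> ell2 v ->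
  T (fun i => u i - v i) = (fun i => T u i - T v i).
Proof.
move=> [_ _ hD hZ _] hu hv.
rewrite (_ : (fun i => u i - v i) = (fun i => u i + (-1) * v i)); last first.
  by apply/funext => i; rewrite mulN1r.
rewrite hD ?hZ//; last exact: ell2Z.
by apply/funext => i; rewrite mulN1r.
Qed.

Lemma l2op_comp T1 T2 C1 C2 : l2op T1 C1 -> l2op T2 C2 -> l2op (T1 \o T2) (C1 * C2).
Proof.
move=> [c1 h1 D1 Z1 b1] [c2 h2 D2 Z2 b2]; split=> /=.
- exact: mulr_ge0.
- by move=> u hu; apply/h1/h2.
- by move=> u v hu hv; rewrite D2// D1//; exact: h2.
- by move=> c u hu; rewrite Z2// Z1//; exact: h2.
- by move=> u hu; rewrite (le_trans (b1 _ _))//; [exact: h2|rewrite -mulrA; apply: ler_wpM2l => //; exact: b2].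
Qed.

Lemma l2op_sub T1 T2 C1 C2 : l2op T1 C1 -> l2op T2 C2 ->
  l2op (fun u i => T1 u i - T2 u i) (C1 + C2).
Proof.
move=> [c1 h1 D1 Z1 b1] [c2 h2 D2 Z2 b2]; split=> /=.
- exact: addr_ge0.
- by move=> u hu; apply: ell2B; [exact: h1|exact: h2].
- by move=> u v hu hv; rewrite D2// D1//; apply/funext => i; ring.
- by move=> c u hu; rewrite Z2// Z1//; apply/funext => i; ring.
- move=> u hu; rewrite (le_trans (nrmB _ _))//; [exact: h1|exact: h2|].
  by rewrite mulrDl; apply: lerD; [exact: b1|exact: b2].
Qed.

(* Writing D = A - B one has (A + t) D = - D (B - t); for 2 t >= ||B|| the right
   factor has norm at most t whereas A + t is bounded below by more than t. *)
Lemma positive_sqrt_unique A B CA CB (c : R) : l2op A CA -> l2op B CB -> l2sym B ->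
  0 < c -> (forall u, ell2 u -> c * ip u u <= ip u (A u)) ->
  (forall u, ell2 u -> 0 <= ip u (B u)) ->
  (forall u, ell2 u -> A (A u) = B (B u)) ->
  forall u, ell2 u -> A u = B u.
Proof.
move=> hA hB symB c0 posA posB AABB.
have [cA A2 AD AZ bA] := hA; have [cB B2 BD BZ bB] := hB.
pose b := 1 + CB; have b0 : 0 < b by rewrite /b; lra.
(* Positivity of [B] at [x - b^-1 B x], where [b] exceeds the norm of [B], gives [B^2 <= b B]. *)
have Bsmall x : ell2 x -> ip (B x) (B x) <= b * ip x (B x).
  move=> hx; have hBx := B2 _ hx; have hBBx := B2 _ hBx.
  have hz := ell2B hx (ell2Z b^-1 hBx); have := posB _ hz.
  rewrite (l2opB hB)//; last exact: ell2Z.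
  rewrite BZ// ipBl; [|ell2..]; rewrite !ipBr; [|ell2..]; rewrite !ipZl; [|ell2..].
  rewrite !ipZr; [|ell2..]; rewrite -(symB x (B x))//.
  have : ip (B x) (B (B x)) <= b * ip (B x) (B x).
    apply: le_trans (ler_norm _) _; apply: le_trans (cauchy_schwarz hBx hBBx) _.
    apply: le_trans (_ : nrm (B x) * (CB * nrm (B x)) <= _).
      by apply: ler_wpM2l; [exact: nrm_ge0|exact: bB].
    rewrite mulrCA -expr2 sqr_nrm// ler_wpM2r ?ip_ge0// /b; lra.
  set y := ip (B x) (B x); set z := ip (B x) (B (B x)); set xx := ip x (B x) => h1 h2.
  have bb : b * b^-1 = 1 by rewrite divff// gt_eqF.
  have : 0 <= b * (xx - b^-1 * y - (b^-1 * y - b^-1 * (b^-1 * z))).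
    by rewrite mulr_ge0// ?ltW//; move: h2; lra.
  rewrite (_ : b * _ = b * xx - 2 * (b * b^-1) * y + (b * b^-1) * (b^-1 * z)); last by ring.
  rewrite bb; have : b^-1 * z <= y.
    by rewrite mulrC ler_pdivrMr// mulrC.
  lra.
pose D := fun u i => A u i - B u i.
have hD : l2op D (CA + CB) by exact: l2op_sub.
have [cD D2 DD DZ bD] := hD.
pose t := b / 2; have t0 : 0 < t by rewrite divr_gt0.
(* Contraction ratio for the squared norm of [D]; it is below 1 because [A >= c > 0]. *)
pose q := t ^+ 2 / (2 * t * c + t ^+ 2).
have q0 : 0 < 2 * t * c + t ^+ 2 by rewrite addr_gt0 ?exprn_gt0// !mulr_gt0.
have tc : 0 < t * c by rewrite mulr_gt0.
have q01 : 0 <= q < 1.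
  apply/andP; split; first by rewrite divr_ge0 ?sqr_ge0// ltW.
  by rewrite ltr_pdivrMr// mul1r; lra.
have key x : ell2 x -> (2 * t * c + t ^+ 2) * ip (D x) (D x) <=
    ip (D (fun i => B x i - t * x i)) (D (fun i => B x i - t * x i)).
  move=> hx; have hBx := B2 _ hx; have hAx := A2 _ hx; have hDx := D2 _ hx.
  have hADx := A2 _ hDx.
  have -> : D (fun i => B x i - t * x i) = fun i => - (A (D x) i + t * D x i).
    rewrite (l2opB hD)//; last exact: ell2Z.
    rewrite DZ// /D (l2opB hA)// AABB//; apply/funext => i; ring.
  rewrite ipNl; [|ell2..]; rewrite ipC ipNl; [|ell2..]; rewrite opprK ip_add//.
  have := posA _ hDx; have := ip_ge0 hADx; have := ip_ge0 hDx; rewrite (ipC (A _) (D x)).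
  set p := ip (D x) (D x); set r := ip (A _) (A _); set z := ip (D x) _ => p0 r0 h.
  have := ler_wpM2l (ltW t0) h; lra.
(* As [b = 2 t], the inequality [B^2 <= 2 t B] says exactly that [B - t] has norm at most [t]. *)
have step x : ell2 x -> ip (fun i => B x i - t * x i) (fun i => B x i - t * x i) <= t ^+ 2 * ip x x.
  move=> hx; have hBx := B2 _ hx.
  rewrite ip_sub//; have := Bsmall _ hx; rewrite (ipC (B x) x) expr2 /t; lra.
have fin n x : ell2 x -> ip (D x) (D x) <= (CA + CB) ^+ 2 * q ^+ n * ip x x.
  elim: n x => [|n IH] x hx.
    rewrite expr0 mulr1 -!sqr_nrm//; last exact: D2.
    by rewrite -exprMn; apply: lerXn2r; rewrite ?nnegrE ?mulr_ge0 ?nrm_ge0//; exact: bD.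
  have hy : ell2 (fun i => B x i - t * x i) by apply: ell2B; [exact: B2|exact: ell2Z].
  rewrite -(ler_pM2l q0); apply: le_trans (key _ hx) _; apply: le_trans (IH _ hy) _.
  apply: le_trans (ler_wpM2l _ (step _ hx)) _.
    by rewrite mulr_ge0 ?sqr_ge0// exprn_ge0//; case/andP: q01.
  rewrite le_eqVlt; apply/orP; left; apply/eqP.
  have qE : t ^+ 2 = (2 * t * c + t ^+ 2) * q.
    by rewrite /q mulrCA divff ?mulr1// gt_eqF.
  set y := 2 * t * c + t ^+ 2 in qE *; rewrite (exprS q) qE; ring.
move=> u hu; have /ip_eq0 Du0 : ip (D u) (D u) <= 0.
  apply: (@le0_geometric _ _ ((CA + CB) ^+ 2 * ip u u) q) => // n.
  by have := fin n _ hu; rewrite mulrAC.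
by apply/funext => i; apply/eqP; rewrite -subr_eq0 -/(D u i) Du0//; exact: D2.
Qed.
End Operators.

Lemma cvgn_sum (R : realType) (J : Type) (r : seq J) (f : J -> nat -> R) (l : J -> R) :
  (forall j, f j @ \oo --> l j) ->
  (fun n => \sum_(j <- r) f j n) @ \oo --> \sum_(j <- r) l j.
Proof.
move=> h; elim: r => [|j r IH].
  by rewrite big_nil; under eq_fun do rewrite big_nil; exact: cvg_cst.
by rewrite big_cons; under eq_fun do rewrite big_cons; exact: cvgD.
Qed.

(** * Taylor coefficients of the inverse square root *)

Section InvSqrtCoefficients.
Context {R : realType}.

(** Taylor coefficients of [(1 - x)^(-1/2)], that is [binomial(2n, n) / 4^n], defined through their
    ratio. *)
Fixpoint isc (n : nat) : R :=
  if n is n'.+1 then isc n' * ((2 * n'%:R + 1) / (2 * n'%:R + 2)) else 1.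

Lemma isc_rec n : (2 * n%:R + 2) * isc n.+1 = (2 * n%:R + 1) * isc n.
Proof.
have h : 0 < 2 * n%:R + 2 :> R by rewrite ltr_wpDl// mulr_ge0.
rewrite /=; field; exact: lt0r_neq0.
Qed.

Lemma isc_ge0 n : 0 <= isc n.
Proof.
by elim: n => [|n IH]//=; rewrite mulr_ge0// divr_ge0// addr_ge0// mulr_ge0.
Qed.

Lemma isc_le1 n : isc n <= 1.
Proof.
elim: n => [|n IH]//=.
have h : 0 < 2 * n%:R + 2 :> R by rewrite ltr_wpDl// mulr_ge0.
have h1 : (2 * n%:R + 1) / (2 * n%:R + 2) <= 1 :> R.
  by rewrite ler_pdivrMr// mul1r lerD2l ler1n.
have h2 : 0 <= (2 * n%:R + 1) / (2 * n%:R + 2) :> R.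
  by apply: divr_ge0; rewrite ?(ltW h)// addr_ge0// mulr_ge0.
by rewrite -[leRHS]mulr1; apply: ler_pM => //; exact: isc_ge0.
Qed.

Arguments isc : simpl never.

(** The square of [(1 - x)^(-1/2)] is [1 / (1 - x)]. Let [S n] be the convolution and [W n] the same
    sum weighted by [2 i]. The symmetry [i <-> n - i] gives [W n = n S n], the recurrence of [isc]
    gives [W (n+1) = W n + S n], and so [S] is constant. *)
Lemma isc_conv k : \sum_(i < k.+1) isc i * isc (k - i) = 1.
Proof.
pose S k := \sum_(i < k.+1) isc i * isc (k - i).
pose W k := \sum_(i < k.+1) (2 * i%:R) * (isc i * isc (k - i)).
have WS n : W n = n%:R * S n.
  have W' : W n = \sum_(i < n.+1) (2 * (n - i)%:R) * (isc i * isc (n - i)).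
    rewrite /W (reindex_inj rev_ord_inj)/=; apply: eq_bigr => i _.
    rewrite subSS subKn ?(leq_ord i)//; ring.
  have : W n + W n = 2 * (n%:R * S n).
    rewrite {2}W' /W /S -big_split/= !mulr_sumr; apply: eq_bigr => i _.
    rewrite natrB ?(leq_ord i)//; ring.
  lra.
have Wrec n : W n.+1 = W n + S n.
  rewrite {1}/W big_ord_recl/= mulr0 mul0r add0r /W /S -big_split/=.
  apply: eq_bigr => i _; rewrite /bump/= add1n subSS.
  transitivity ((2 * (i : nat)%:R + 2) * isc i.+1 * isc (n - i)); first by rewrite -natr1; ring.
  rewrite isc_rec; ring.
suff : S k = 1 by [].
elim: k => [|n IH]; first by rewrite /S big_ord_recl big_ord0/= mulr1 addr0.
have := Wrec n; rewrite !WS IH mulr1 => h.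
have h1 : 0 < n.+1%:R :> R by rewrite ltr0n.
apply: (mulfI (lt0r_neq0 h1)); rewrite h mulr1 -natr1//.
Qed.
End InvSqrtCoefficients.

(** * Geometrically convergent series in ell2 *)

Section Ell2Series.
Context {R : realType} {F : choiceType}.
Implicit Types (u v : F -> R) (s : {fset F}).
Local Notation q := (4^-1 : R).

Lemma geo_sum n m : \sum_(n <= j < m) q ^+ j <= 2 * q ^+ n.
Proof.
have q0 k : 0 <= q ^+ k by rewrite exprn_ge0.
case: (leqP m n) => [mn|nm]; first by rewrite big_geq// mulr_ge0.
suff : \sum_(n <= j < m) q ^+ j <= 2 * q ^+ n - 2 * q ^+ m.
  by move=> /le_trans; apply; rewrite gerBl mulr_ge0.
elim: m nm => // m IH; rewrite ltnS leq_eqVlt => /predU1P[<-|nm].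
  rewrite big_nat1 exprS; have := q0 n; set y := q ^+ n; lra.
rewrite big_nat_recr ?(ltnW nm)//= exprS; have := IH nm; have := q0 m.
set y := q ^+ m; set z := q ^+ n; set S := \sum_(_ <= _ < _) _; lra.
Qed.

Lemma ell2_sum (J : Type) (r : seq J) (x : J -> F -> R) :
  (forall j, ell2 (x j)) -> ell2 (fun P => \sum_(j <- r) x j P).
Proof.
move=> h; elim: r => [|j r IH].
  by under eq_fun do rewrite big_nil; exact: ell2_0.
by under eq_fun do rewrite big_cons; exact: ell2D.
Qed.

Lemma nrm_sum (J : Type) (r : seq J) (x : J -> F -> R) :
  (forall j, ell2 (x j)) -> nrm (fun P => \sum_(j <- r) x j P) <= \sum_(j <- r) nrm (x j).
Proof.
move=> h; elim: r => [|j r IH].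
  by under eq_fun do rewrite big_nil; rewrite nrm0 big_nil.
under eq_fun do rewrite big_cons; rewrite big_cons.
apply: le_trans (nrmD _ _) _ => //; first exact: ell2_sum.
by rewrite lerD2l.
Qed.

Section Series.
Variables (x : nat -> F -> R) (K : R).
Hypothesis x2 : forall j, ell2 (x j).
Hypothesis xK : forall j, nrm (x j) <= K * q ^+ j.

Definition sersum P : R := limn (series (fun j => x j P)).

Let K0 : 0 <= K. Proof. by have := xK 0; rewrite expr0 mulr1; apply: le_trans (nrm_ge0 _). Qed.

Lemma nrm_block n m : nrm (fun P => \sum_(n <= j < m) x j P) <= 2 * K * q ^+ n.
Proof.
apply: le_trans (nrm_sum _ x2) _.
apply: le_trans (_ : \sum_(n <= j < m) K * q ^+ j <= _).
  by apply: ler_sum => j _; exact: xK.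
rewrite -mulr_sumr (_ : 2 * K * q ^+ n = K * (2 * q ^+ n)); last by ring.
by apply: ler_wpM2l; [exact: K0|exact: geo_sum].
Qed.

Lemma sersum_cvg P : series (fun j => x j P) @ \oo --> sersum P.
Proof.
apply: normed_cvg; apply: (@series_le_cvg _ _ (fun j => K * q ^+ j)).
- by move=> j; exact: normr_ge0.
- by move=> j; rewrite mulr_ge0// exprn_ge0.
- by move=> j; apply: le_trans (xK j); exact: coord_le_nrm.
- by apply: (@is_cvg_geometric_series _ K q); rewrite ger0_norm// invf_lt1// ltr1n.
Qed.

(** A Fatou argument: [sersum] is only a coordinatewise limit, but every finite set of coordinates
    obeys the block bound at each stage [m], and the bound survives [m -> oo]. *)
Lemma sersum_tail n : sqbounded (fun P => sersum P - \sum_(j < n) x j P) ((2 * K * q ^+ n) ^+ 2).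
Proof.
move=> s.
have h : \sum_(P <- s) (series (fun j => x j P) m - \sum_(j < n) x j P) ^+ 2 @[m --> \oo]
   --> \sum_(P <- s) (sersum P - \sum_(j < n) x j P) ^+ 2.
  apply: (@cvgn_sum _ _ s (fun P m => (series (fun j => x j P) m - \sum_(j < n) x j P) ^+ 2)) => P.
  have hP : series (fun j => x j P) m - \sum_(j < n) x j P @[m --> \oo] -->
     sersum P - \sum_(j < n) x j P by apply: cvgB; [exact: sersum_cvg|exact: cvg_cst].
  by under eq_fun do rewrite expr2; rewrite expr2; exact: cvgM.
apply: (cvgr_to_le h); near=> m.
have nm : (n <= m)%N by near: m; exact: nbhs_infty_ge.
have : sqbounded (fun P => \sum_(n <= j < m) x j P) ((2 * K * q ^+ n) ^+ 2).
  move=> t; apply: le_trans (sqbounded_ip (ell2_sum _ x2) t) _.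
  rewrite -sqr_nrm; last exact: ell2_sum.
  apply: lerXn2r; rewrite ?nnegrE ?nrm_ge0 ?mulr_ge0 ?exprn_ge0//; exact: nrm_block.
move=> /(_ s); apply: le_trans; rewrite le_eqVlt; apply/orP; left; apply/eqP.
apply: eq_bigr => P _; congr (_ ^+ 2).
by rewrite /series/= -(big_mkord xpredT (fun j => x j P)) (big_cat_nat _ nm)//= addrAC subrr add0r.
Unshelve. all: by end_near.
Qed.

Lemma sersum_approx n : ell2 (fun P => sersum P - \sum_(j < n) x j P) /\
  nrm (fun P => sersum P - \sum_(j < n) x j P) <= 2 * K * q ^+ n.
Proof.
have h := sersum_tail n.
have h2 : ell2 (fun P => sersum P - \sum_(j < n) x j P) by apply/ell2P; eexists; exact: h.
by split=> //; rewrite nrm_le ?mulr_ge0 ?exprn_ge0//; exact: ip_sqbounded.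
Qed.

Lemma sersum_ell2 : ell2 sersum.
Proof.
have [h _] := sersum_approx 0; congr ell2: h; apply/funext => P.
by rewrite big_ord0 subr0.
Qed.

End Series.
End Ell2Series.

(** * Power series in an operator of norm at most 1/4 *)

Section PowerSeries.
Context {R : realType} {F : choiceType}.
Implicit Types (u v : F -> R) (s : {fset F}).
Local Notation q := (4^-1 : R).

Lemma l2op0 T (C : R) : l2op T C -> T (fun _ : F => 0) = (fun _ => 0).
Proof.
move=> [_ _ _ hZ _]; have := hZ 0 _ (@ell2_0 R F).
under eq_fun do rewrite mul0r; move=> ->; apply/funext => i; exact: mul0r.
Qed.

Lemma l2op_sum T (C : R) (J : Type) (r : seq J) (x : J -> F -> R) :
  l2op T C -> (forall j, ell2 (x j)) ->
  T (fun P => \sum_(j <- r) x j P) = (fun P => \sum_(j <- r) T (x j) P).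
Proof.
move=> hT hx; have [_ _ hD _ _] := hT; elim: r => [|j r IH].
  rewrite (_ : (fun P => \sum_(j <- [::]) x j P) = fun=> 0); last first.
    by apply/funext => P; rewrite big_nil.
  by rewrite (l2op0 hT); apply/funext => P; rewrite big_nil.
rewrite (_ : (fun P => \sum_(i <- _ :: _) x i P) = fun P => x j P + \sum_(i <- r) x i P); last first.
  by apply/funext => P; rewrite big_cons.
rewrite hD//; last exact: ell2_sum.
by rewrite IH; apply/funext => P; rewrite big_cons.
Qed.

Variables (B : (F -> R) -> (F -> R)).
Hypothesis hB : l2op B q.

Lemma iter_ell2 j u : ell2 u -> ell2 (iter j B u).
Proof. by move=> hu; elim: j => //= j IH; case: hB => _ h _ _ _; exact: h. Qed.

Lemma nrm_iter j u : ell2 u -> nrm (iter j B u) <= nrm u * q ^+ j.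
Proof.
move=> hu; elim: j => [|j IH]/=; first by rewrite expr0 mulr1.
case: hB => _ _ _ _ h; apply: le_trans (h _ (iter_ell2 j hu)) _.
by rewrite exprS mulrCA ler_wpM2l.
Qed.

Lemma iter_l2D j u v : ell2 u -> ell2 v ->
  iter j B (fun i => u i + v i) = fun i => iter j B u i + iter j B v i.
Proof.
move=> hu hv; elim: j => //= j ->; case: hB => _ _ h _ _.
by rewrite h//; exact: iter_ell2.
Qed.

Lemma iter_l2Z j c u : ell2 u -> iter j B (fun i => c * u i) = fun i => c * iter j B u i.
Proof.
move=> hu; elim: j => //= j ->; case: hB => _ _ _ h _.
by rewrite h//; exact: iter_ell2.
Qed.

Section Pser.
Variable c : nat -> R.
Hypothesis c1 : forall j, `|c j| <= 1.

(** The operator [sum_j c_j B^j]; convergence is geometric since [|c_j| <= 1] and [B] has norm at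
    most 1/4. *)
Definition pser u : F -> R := sersum (fun j P => c j * iter j B u P).
Definition ppol n u : F -> R := fun P => \sum_(j < n) c j * iter j B u P.

Let x2 u : ell2 u -> forall j, ell2 (fun P => c j * iter j B u P).
Proof. by move=> hu j; apply: ell2Z; exact: iter_ell2. Qed.

Let xK u : ell2 u -> forall j, nrm (fun P => c j * iter j B u P) <= nrm u * q ^+ j.
Proof.
move=> hu j; rewrite nrmZ; last exact: iter_ell2.
apply: le_trans (nrm_iter j hu); rewrite -[leRHS]mul1r; apply: ler_wpM2r => //; exact: nrm_ge0.
Qed.

Lemma pser_cvg u P : ell2 u -> series (fun j => c j * iter j B u P) @ \oo --> pser u P.
Proof. by move=> hu; exact: (sersum_cvg (x2 hu) (xK hu)). Qed.

Lemma pser_ell2 u : ell2 u -> ell2 (pser u).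
Proof. by move=> hu; exact: (sersum_ell2 (x2 hu) (xK hu)). Qed.

Lemma ppol_ell2 n u : ell2 u -> ell2 (ppol n u).
Proof. by move=> hu; apply: ell2_sum; exact: x2. Qed.

Lemma pser_approx u n : ell2 u ->
  nrm (fun P => pser u P - ppol n u P) <= 2 * nrm u * q ^+ n.
Proof. by move=> hu; have [] := sersum_approx (x2 hu) (xK hu) n. Qed.

Lemma pser_eq u P l : ell2 u -> series (fun j => c j * iter j B u P) @ \oo --> l -> pser u P = l.
Proof. by move=> hu; apply: cvg_unique; [exact: Rhausdorff|exact: pser_cvg]. Qed.

Lemma pser_l2op : l2op pser 2.
Proof.
split=> //; first exact: pser_ell2.
- move=> u v hu hv; apply/funext => P; apply: pser_eq; first exact: ell2D.
  rewrite (_ : series _ = fun n => series (fun j => c j * iter j B u P) n +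
     series (fun j => c j * iter j B v P) n).
    by apply: cvgD; exact: pser_cvg.
  apply/funext => n; rewrite /series/= -big_split/=; apply: eq_bigr => j _.
  by rewrite iter_l2D// mulrDr.
- move=> b u hu; apply/funext => P; apply: pser_eq; first exact: ell2Z.
  rewrite (_ : series _ = fun n => b * series (fun j => c j * iter j B u P) n).
    by apply: cvgMr; exact: pser_cvg.
  apply/funext => n; rewrite /series/= mulr_sumr; apply: eq_bigr => j _.
  by rewrite iter_l2Z// mulrCA.
- move=> u hu; have := pser_approx 0 hu; rewrite expr0 mulr1.
  by under eq_fun do rewrite /ppol big_ord0 subr0.
Qed.

Lemma ppol_comm n u : ell2 u -> B (ppol n u) = ppol n (B u).
Proof.
move=> hu; rewrite /ppol (@l2op_sum _ _ 'I_n _ (fun j P => c j * iter j B u P) hB); last by move=> j; exact: x2.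
apply/funext => P.
apply: eq_bigr => j _; case: hB => _ _ _ hZ _.
by rewrite (hZ (c j) (iter j B u) (iter_ell2 j hu)) -iterS iterSr.
Qed.

(** The partial sums commute with [B], and both sides are within a multiple of [4^-n] of them. *)
Lemma pser_comm u : ell2 u -> B (pser u) = pser (B u).
Proof.
move=> hu; have [_ B2 BD BZ Bn] := hB; have hBu := B2 _ hu.
have hL := pser_ell2 hu; have hLB := pser_ell2 hBu; have hBL := B2 _ hL.
suff /nrm_eq0 h : nrm (fun P => B (pser u) P - pser (B u) P) <= 0.
  apply/funext => P; apply/eqP; rewrite -subr_eq0; apply/eqP.
  by have := h (ell2B hBL hLB) => /(congr1 (fun f => f P)).
apply: (@le0_geometric _ _ (4 * nrm u) q) => [|n].
  by rewrite invr_ge0 ler0n/= invf_lt1// ltr1n.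
have hp := ppol_ell2 n hu; have hpB := ppol_ell2 n hBu.
rewrite (_ : (fun P => B (pser u) P - pser (B u) P) =
   (fun P => B (fun P => pser u P - ppol n u P) P - (pser (B u) P - ppol n (B u) P))); last first.
  by rewrite (l2opB hB hL hp) ppol_comm//; apply/funext => P; ring.
have h1 := ell2B hL hp; have h2 := ell2B hLB hpB.
apply: le_trans (nrmB (B2 _ h1) h2) _.
have := Bn _ h1; have := pser_approx n hu; have := pser_approx n hBu; have := Bn _ hu.
have : 0 <= q ^+ n by rewrite exprn_ge0.
set a := nrm (fun P => _ - _); set a' := nrm (fun P => _ - _).
set z := q ^+ n; move=> z0 e1 e2 e3 e4.
have e5 : nrm (B u) * z <= 4^-1 * nrm u * z by apply: ler_wpM2r.
have : 0 <= nrm u * z by rewrite mulr_ge0 ?nrm_ge0.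
lra.
Qed.

Lemma iter_sym j u v : l2sym B -> ell2 u -> ell2 v -> ip (iter j B u) v = ip u (iter j B v).
Proof.
move=> sB hu; elim: j v => //= j IH v hv; have [_ B2 _ _ _] := hB.
by rewrite sB ?IH -?iterSr//; [exact: B2|exact: iter_ell2].
Qed.

Lemma ip_suml (J : Type) (r : seq J) (x : J -> F -> R) v : (forall j, ell2 (x j)) ->
  ell2 v -> ip (fun P => \sum_(j <- r) x j P) v = \sum_(j <- r) ip (x j) v.
Proof.
move=> hx hv; elim: r => [|j r IH].
  under eq_fun do rewrite big_nil; rewrite big_nil ipC; exact: ip0r.
under eq_fun do rewrite big_cons; rewrite ipDl//; last exact: ell2_sum.
by rewrite IH big_cons.
Qed.

Lemma pser_sym : l2sym B -> l2sym pser.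
Proof.
move=> sB u v hu hv; have hL := pser_ell2 hu; have hLv := pser_ell2 hv.
apply/eqP; rewrite -subr_eq0 -normr_le0; apply/eqP/eqP.
apply: (@le0_geometric _ _ (4 * nrm u * nrm v) q) => [|n].
  by rewrite invr_ge0 ler0n/= invf_lt1// ltr1n.
have hp := ppol_ell2 n hu; have hpv := ppol_ell2 n hv.
have E : ip (ppol n u) v = ip u (ppol n v).
  rewrite /ppol (@ip_suml 'I_n _ (fun j P => c j * iter j B u P)) => [|j|//]; last exact: x2.
  rewrite [RHS]ipC (@ip_suml 'I_n _ (fun j P => c j * iter j B v P)) => [|j|//]; last exact: x2.
  apply: eq_bigr => j _; rewrite !ipZl//; do ?exact: iter_ell2.
  by rewrite iter_sym// [in RHS]ipC.
have -> : ip (pser u) v - ip u (pser v) =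
   ip (fun P => pser u P - ppol n u P) v - ip u (fun P => pser v P - ppol n v P).
  by rewrite ipBl// ipBr// E; ring.
apply: le_trans (ler_normB _ _) _.
have := cauchy_schwarz (ell2B hL hp) hv; have := cauchy_schwarz hu (ell2B hLv hpv).
have := pser_approx n hu; have := pser_approx n hv.
set f := fun P => pser u P - ppol n u P; set g := fun P => pser v P - ppol n v P.
set y := `|ip f v|; set y' := `|ip u g|; set a := nrm f; set a' := nrm g.
move=> /(ler_wpM2l (nrm_ge0 u)) e1 /(ler_wpM2r (nrm_ge0 v)) e2 e3 e4; lra.
Qed.
End Pser.

Let one_le (j : nat) : `|(fun _ => 1 : R) j| <= 1. Proof. by rewrite normr1. Qed.

(** With all coefficients 1 this is the Neumann series: putting [u] in front of the series for [B u]
    gives the series for [u]. *)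
Lemma neumann u : ell2 u ->
  (fun P => pser (fun _ => 1) u P - B (pser (fun _ => 1) u) P) = u.
Proof.
move=> hu; have [_ B2 _ _ _] := hB; have hBu := B2 _ hu.
rewrite pser_comm//; apply/funext => P; apply/eqP; rewrite subr_eq addrC; apply/eqP.
apply: pser_eq => //; rewrite -cvg_shiftS/=.
rewrite (_ : (fun n => _) = fun n => series (fun j => 1 * iter j B (B u) P) n + u P).
  by apply: cvgD; [exact: pser_cvg|exact: cvg_cst].
apply/funext => n; rewrite /series/= big_nat_recl//= mul1r addrC; congr (_ + _).
by apply: eq_bigr => j _; rewrite -iterS iterSr.
Qed.

Let isc_norm (j : nat) : `|isc j : R| <= 1.
Proof. by rewrite ger0_norm ?isc_ge0// isc_le1. Qed.

(** Cauchy product over the triangle [i + j < n]; each diagonal [i + j = k] has total weight 1 by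
    [isc_conv]. *)
Lemma isc_triangle (x : nat -> R) n :
  \sum_(i < n) isc i * (\sum_(j < n - i) isc j * x (j + i)%N) = \sum_(k < n) x k.
Proof.
elim: n => [|n IH]; first by rewrite !big_ord0.
rewrite [RHS]big_ord_recr/= -IH big_ord_recr/= subSn// subnn.
rewrite (big_ord_recl 0) big_ord0 addr0 add0n.
have -> : \sum_(i < n) isc i * (\sum_(j < n.+1 - i) isc j * x (j + i)%N) =
  \sum_(i < n) (isc i * (\sum_(j < n - i) isc j * x (j + i)%N) + isc i * isc (n - i) * x n).
  apply: eq_bigr => i _; rewrite subSn; last exact: ltnW.
  by rewrite big_ord_recr/= mulrDr subnK ?mulrA//; exact: ltnW.
rewrite big_split/= -addrA; congr (_ + _).
rewrite -mulr_suml mulrA -mulrDl -[RHS]mul1r; congr (_ * _).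
by rewrite -[RHS](isc_conv n) big_ord_recr/= subnn.
Qed.

(** By [isc_triangle] the n-th Neumann sum is a double sum whose inner series is cut at length
    [n - i]. Completing the [n] inner series costs at most [2 |u| 4^-n] each, and [n 4^-n <= 2^-n]
    tends to 0. *)
Lemma pser_isc_square u : ell2 u -> pser isc (pser isc u) = pser (fun _ => 1) u.
Proof.
move=> hu; have hL := pser_ell2 isc_norm hu.
apply/funext => P; apply/esym/pser_eq => //.
have Lcomm i : iter i B (pser isc u) = pser isc (iter i B u).
  by elim: i => //= i ->; rewrite pser_comm//; exact: iter_ell2.
have h1 := pser_cvg isc_norm (P := P) hL.
have h0 : (fun n => series (fun j => 1 * iter j B u P) n -
   series (fun j => isc j * iter j B (pser isc u) P) n) @ \oo --> (0 : R).
  apply/cvgr0Pnorm_le => e e0.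
  have hq : (fun n => (4 * nrm u + 1) * (2^-1) ^+ n) @ \oo --> (0 : R).
    rewrite -[X in _ --> X](mulr0 (4 * nrm u + 1)); apply: cvgMr.
    by apply: cvg_expr; rewrite ger0_norm// invf_lt1// ltr1n.
  have /cvgr0Pnorm_le/(_ _ e0) hq' := hq.
  near=> n; apply: le_trans (_ : (4 * nrm u + 1) * (2^-1) ^+ n <= e); last first.
    by apply: le_trans (ler_norm _) _; near: n.
  rewrite /series/= !big_mkord (eq_bigr (fun j : 'I_n => iter j B u P)); last by move=> j _; rewrite mul1r.
  rewrite -(isc_triangle (fun k => iter k B u P))/= -sumrB; apply: le_trans (ler_norm_sum _ _ _) _.
  have st (i : 'I_n) : `|isc i * (\sum_(j < n - i) isc j * iter (j + i) B u P) -
     isc i * iter i B (pser isc u) P| <= 2 * nrm u * q ^+ n.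
    rewrite -mulrBr normrM Lcomm -[leRHS]mul1r; apply: ler_pM => //.
    have hi := iter_ell2 i hu.
    rewrite distrC; under eq_bigr do rewrite iterD.
    have h := @coord_le_nrm _ _ _ P (ell2B (pser_ell2 isc_norm hi) (ppol_ell2 isc (n - i) hi)).
    apply: le_trans h _.
    apply: le_trans (pser_approx isc_norm (n - i) hi) _.
    apply: le_trans (_ : 2 * (nrm u * q ^+ i) * q ^+ (n - i) <= _).
      by apply: ler_wpM2r; [rewrite exprn_ge0|apply: ler_wpM2l => //; exact: nrm_iter].
    by rewrite -!mulrA -exprD subnKC// ltnW.
  apply: le_trans (ler_sum _ (fun i _ => st i)) _.
  rewrite sumr_const card_ord -[leLHS]mulr_natl.
  have n2 : n%:R * q ^+ n <= (2^-1) ^+ n :> R.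
    have -> : q = 2^-1 * 2^-1 :> R by rewrite -invfM -natrM.
    rewrite exprMn mulrA -[leRHS]mul1r; apply: ler_wpM2r; first by rewrite exprn_ge0.
    rewrite exprVn ler_pdivrMr ?exprn_gt0// mul1r -natrX ler_nat ltnW// ltn_expl//.
  have := ler_wpM2l (mulr_ge0 (ler0n R 2) (nrm_ge0 u)) n2.
  have : 0 <= (2^-1 : R) ^+ n by rewrite exprn_ge0.
  have := nrm_ge0 u => u0 p0; have := mulr_ge0 u0 p0; move: p0; set y := 2^-1 ^+ n; set z := q ^+ n; set k := n%:R; lra.
have h2 := cvgD h0 h1; rewrite add0r in h2.
rewrite (_ : series _ = fun n => (series (fun j => 1 * iter j B u P) n -
   series (fun j => isc j * iter j B (pser isc u) P) n) +
   series (fun j => isc j * iter j B (pser isc u) P) n); first exact: h2.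
by apply/funext => n; rewrite subrK.
Unshelve. all: by end_near.
Qed.

(** The series starts with the identity and the rest has norm at most [2 / 4]. *)
Lemma pser_isc_pos u : ell2 u -> 2^-1 * ip u u <= ip u (pser isc u).
Proof.
move=> hu; have hL := pser_ell2 isc_norm hu.
have := pser_approx isc_norm 1 hu; rewrite expr1.
rewrite (_ : ppol isc 1 u = u); last first.
  by apply/funext => P; rewrite /ppol big_ord_recl big_ord0/= mul1r addr0.
have := cauchy_schwarz hu (ell2B hL hu); rewrite ipBr// ler_norml => /andP[h _] h2.
have := ler_wpM2l (nrm_ge0 u) h2; have := sqr_nrm hu; rewrite expr2; lra.
Qed.

Lemma pser_isc_l2op : l2op (pser isc) 2. Proof. exact: pser_l2op isc_norm. Qed.

Lemma pser_isc_sym : l2sym B -> l2sym (pser isc). Proof. exact: pser_sym isc_norm. Qed.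

Lemma pser_isc_inv u : ell2 u ->
  (fun P => pser isc (pser isc u) P - B (pser isc (pser isc u)) P) = u.
Proof. by move=> hu; rewrite pser_isc_square//; exact: neumann. Qed.

Lemma pser_isc_comm u : ell2 u -> B (pser isc u) = pser isc (B u).
Proof. by move=> hu; rewrite (pser_comm isc_norm hu). Qed.

Lemma pser_isc_cvg u P : ell2 u ->
  series (fun j => isc j * iter j B u P) @ \oo --> pser isc u P.
Proof. by move=> hu; exact: (pser_cvg isc_norm hu). Qed.

Lemma pser_isc_eq u P l : ell2 u ->
  series (fun j => isc j * iter j B u P) @ \oo --> l -> pser isc u P = l.
Proof. by move=> hu; exact: (pser_eq isc_norm hu). Qed.
End PowerSeries.

(** * Matrices as operators on ell2 *)

Section Matrices.
Context {R : realType} {F : choiceType}.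
Implicit Types (u v : F -> R) (s t : {fset F}) (A G : F -> F -> R).

Lemma fsbounded_summable (u : F -> R) :
  summable [set: F] (fun Q => (u Q)%:E) <-> exists B, fsbounded (fun Q => `|u Q|) B.
Proof.
rewrite /summable; split=> [h|[B h]].
  exists (fine (\esum_(x in [set: F]) `|(u x)%:E|))%E.
  apply/esum_EFin_fsbounded => //.
  by rewrite [leRHS](_ : _ = \esum_(x in [set: F]) `|(u x)%:E|)%E// fineK// ge0_fin_numE// esum_ge0.
rewrite (le_lt_trans _ (ltry B))//.
by move/esum_EFin_fsbounded : h; exact.
Qed.

Lemma mxapp_hsum A u P : bounded_mx A -> ell2 u ->
  hsum (fun Q => A P Q * u Q) (mxapp A u P).
Proof.
move=> [C h] hu; have [/(_ P) /fsbounded_summable[B hB] _] := h _ hu.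
exact: hsum_usum hB.
Qed.

(** The constant in [bounded_mx] bounds squared norms and its sign is not prescribed, hence the root
    of its absolute value. *)
Lemma bounded_mx_l2op A : bounded_mx A -> exists C, l2op (mxapp A) C.
Proof.
move=> hA; have [C h] := hA.
have key u : ell2 u -> sqbounded (mxapp A u) ((Num.sqrt `|C| * nrm u) ^+ 2).
  move=> hu; have [_] := h _ hu.
  rewrite (normE2_ip hu) -EFinM => /normE2_le h2 s; apply: le_trans (h2 s) _.
  rewrite exprMn sqr_sqrtr// sqr_nrm//; apply: ler_wpM2r; [exact: ip_ge0|exact: ler_norm].
have key2 u : ell2 u -> ell2 (mxapp A u) by move=> hu; apply/ell2P; eexists; exact: key hu.
exists (Num.sqrt `|C|); split=> //.
- move=> u v hu hv; apply/funext => P; apply: hsum_unique (mxapp_hsum P hA (ell2D hu hv)) _.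
  by under eq_fun do rewrite mulrDr; apply: hsumD; exact: mxapp_hsum.
- move=> c u hu; apply/funext => P; apply: hsum_unique (mxapp_hsum P hA (ell2Z c hu)) _.
  by under eq_fun do rewrite mulrCA; apply: hsumZ; exact: mxapp_hsum.
- move=> u hu; rewrite nrm_le; [|exact: key2|by rewrite mulr_ge0 ?sqrtr_ge0 ?nrm_ge0].
  exact: ip_sqbounded (key _ hu).
Qed.

Lemma hsum_edelta (a : F -> R) Q : hsum (fun P => a P * edelta Q P) (a Q).
Proof.
have := @hsum_fin _ _ (fun i => a i * edelta Q i) [fset Q]%fset.
rewrite big_seq_fset1 /edelta eqxx mulr1; apply => i; rewrite inE => /negbTE ->.
by rewrite mulr0.
Qed.

Lemma mxapp_edelta A P Q : bounded_mx A -> mxapp A (edelta Q) P = A P Q.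
Proof.
by move=> hA; exact: hsum_unique (mxapp_hsum P hA (ell2_edelta Q)) (hsum_edelta _ _).
Qed.

(** Against finite combinations of unit vectors the claim reduces to the entries; it extends by
    density ([ell2_approx]) and boundedness. *)
Lemma mxapp_sym A : bounded_mx A -> (forall P Q, A P Q = A Q P) -> l2sym (mxapp A).
Proof.
move=> hA sA; have [C hC] := bounded_mx_l2op hA; have [C0 A2 AD AZ Ab] := hC.
have fin u s (v : F -> R) : ell2 u ->
   ip (mxapp A u) (fun P => \sum_(Q <- s) v Q * edelta Q P) =
   ip u (mxapp A (fun P => \sum_(Q <- s) v Q * edelta Q P)).
  move=> hu; have e2 Q := ell2Z (v Q) (@ell2_edelta R F Q).
  have hAu := A2 _ hu; have Ae2 Q := A2 _ (e2 Q).
  rewrite (l2op_sum _ hC e2) ipC [RHS]ipC.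
  rewrite (ip_suml _ e2 hAu) (ip_suml _ Ae2 hu).
  apply: eq_bigr => Q _; rewrite AZ; last exact: ell2_edelta.
  have heQ := @ell2_edelta R F Q.
  rewrite (ipZl _ heQ hAu) (ipZl _ (A2 _ heQ) hu).
  congr (_ * _); rewrite ipC (ip_edelta _ hAu).
  apply: hsum_unique (mxapp_hsum Q hA hu) _.
  rewrite (_ : (fun P => _) = (fun P => mxapp A (edelta Q) P * u P)); last first.
    by apply/funext => P; rewrite mxapp_edelta// sA.
  by apply: ip_hsum => //; apply: A2; exact: ell2_edelta.
move=> u v hu hv; apply/eqP; rewrite -subr_eq0 -normr_le0; apply/ler_addgt0Pr => e e0.
rewrite add0r.
pose K := (C * nrm u + nrm u * C) + 1; have K0 : 0 < K.
  by rewrite ltr_wpDl// addr_ge0// mulr_ge0 ?nrm_ge0.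
have eK : 0 < (e / K) ^+ 2 by rewrite exprn_gt0// divr_gt0.
have [s] := ell2_approx hv eK; set z := (fun i => if _ then _ else _) => hs.
have z2 : ell2 z by apply: ell2_le hv => i; rewrite /z; case: ifP => _ //; rewrite normr0.
have zn : nrm z <= e / K by rewrite nrm_le// ltW// divr_gt0.
have y2 : ell2 (fun P => \sum_(Q <- s) v Q * edelta Q P).
  by apply: ell2_sum => Q; apply: ell2Z; exact: ell2_edelta.
have -> : v = fun P => z P + \sum_(Q <- s) v Q * edelta Q P.
  apply/funext => P; rewrite /z /edelta; case: ifPn => Ps.
    rewrite add0r (big_fsetD1 P)//= eqxx mulr1 big1_seq ?addr0// => Q /=.
    by rewrite !inE => /andP[/negbTE]; rewrite eq_sym => -> _; rewrite mulr0.
  rewrite big1_seq ?addr0// => Q /= Qs; case: eqP => [PQ|_]; last by rewrite mulr0.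
  by rewrite PQ Qs in Ps.
have hAu := A2 _ hu.
have hz := A2 _ z2; have hy := A2 _ y2.
rewrite (AD _ _ z2 y2) (ipDr z2 y2 hAu) (ipDr hz hy hu) (fin _ _ _ hu) opprD addrACA subrr addr0.
apply: le_trans (ler_normB _ _) _.
have e1 := cauchy_schwarz hAu z2; have e2 := cauchy_schwarz hu (A2 _ z2).
apply: le_trans (lerD e1 e2) _.
apply: le_trans (_ : (C * nrm u + nrm u * C) * nrm z <= _).
  rewrite mulrDl; apply: lerD; first by apply: ler_wpM2r; [exact: nrm_ge0|exact: Ab].
  by rewrite -mulrA; apply: ler_wpM2l; [exact: nrm_ge0|exact: Ab].
apply: le_trans (_ : K * (e / K) <= _); last by rewrite mulrC divfK// gt_eqF.
apply: ler_pM => //; last by rewrite /K lerDl.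
- by rewrite addr_ge0// mulr_ge0 ?nrm_ge0.
- exact: nrm_ge0.
Qed.

(** Recognises a matrix by the operator it represents: its rows need only sum absolutely, against
    ell2, to the values of an operator already known to be bounded. *)
Lemma bounded_mx_intro A L (C : R) : l2op L C ->
  (forall u P, ell2 u -> exists B, fsbounded (fun Q => `|A P Q * u Q|) B) ->
  (forall u P, ell2 u -> hsum (fun Q => A P Q * u Q) (L u P)) ->
  bounded_mx A /\ forall u, ell2 u -> mxapp A u = L u.
Proof.
move=> [C0 L2 _ _ Lb] hb hs.
have E u : ell2 u -> mxapp A u = L u.
  move=> hu; apply/funext => P; have [B hB] := hb _ P hu.
  exact: usum_eq hB (hs _ _ hu).
split=> //; exists (C ^+ 2) => u hu; split.
  by move=> P; apply/fsbounded_summable; exact: hb.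
rewrite E// (normE2_ip hu) -EFinM; apply/normE2_le => s.
apply: le_trans (sqbounded_ip (L2 _ hu) s) _.
rewrite -(sqr_nrm (L2 _ hu)) -(sqr_nrm hu) -exprMn.
by apply: lerXn2r; rewrite ?nnegrE ?mulr_ge0 ?nrm_ge0//; exact: Lb.
Qed.
End Matrices.

(** * Schur's test for a symmetric matrix and a positive weight *)

Section Schur.
Context {R : realType} {F : choiceType}.
Implicit Types (u v : F -> R) (s t : {fset F}).
Variables (E : F -> F -> R) (w : F -> R) (eps : R).
Hypothesis symE : forall P Q, E P Q = E Q P.
Hypothesis w0 : forall P, 0 < w P.
Hypothesis eps0 : 0 < eps.
Hypothesis schur : forall Q, fsbounded (fun P => `|E P Q| * w P) (eps * w Q).

(** Young's inequality with the ratio of the weights, [2 |u_Q v_P| <= (w_P / w_Q) u_Q^2 + (w_Q /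
    w_P) v_P^2]; the Schur condition sums the first term over [P] and, by symmetry, the second over
    [Q]. *)
Lemma schur_bilinear u v s t :
  \sum_(P <- s) \sum_(Q <- t) `|E P Q| * `|u Q| * `|v P| <=
  eps / 2 * (\sum_(Q <- t) u Q ^+ 2 + \sum_(P <- s) v P ^+ 2).
Proof.
have h1 : \sum_(P <- s) \sum_(Q <- t) 2 * (`|E P Q| * `|u Q| * `|v P|) <=
   \sum_(P <- s) \sum_(Q <- t) (`|E P Q| * w P * (u Q ^+ 2 / w Q) + `|E Q P| * w Q * (v P ^+ 2 / w P)).
  apply: ler_sum => P _; apply: ler_sum => Q _.
  rewrite -(real_normK (num_real (u Q))) -(real_normK (num_real (v P))) (symE Q P).
  have -> : `|E P Q| * w P * (`|u Q| ^+ 2 / w Q) + `|E P Q| * w Q * (`|v P| ^+ 2 / w P) =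
     `|E P Q| * ((w P / w Q) * `|u Q| ^+ 2 + (w Q / w P) * `|v P| ^+ 2) by ring.
  rewrite (_ : 2 * _ = `|E P Q| * (2 * `|v P| * `|u Q|)); last by ring.
  apply: ler_wpM2l => //; rewrite -subr_ge0.
  rewrite (_ : _ - _ = (w Q / w P) * ((w P / w Q) * `|u Q| - `|v P|) ^+ 2).
    by rewrite mulr_ge0 ?sqr_ge0// divr_ge0// ltW.
  by field; rewrite !gt_eqF.
have h2 : \sum_(P <- s) \sum_(Q <- t) (`|E P Q| * w P * (u Q ^+ 2 / w Q) + `|E Q P| * w Q * (v P ^+ 2 / w P))
   <= \sum_(Q <- t) eps * u Q ^+ 2 + \sum_(P <- s) eps * v P ^+ 2.
  under eq_bigr do rewrite big_split/=; rewrite big_split/= exchange_big/=; apply: lerD.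
    apply: ler_sum => Q _; rewrite -mulr_suml.
    apply: le_trans (_ : (eps * w Q) * (u Q ^+ 2 / w Q) <= _).
      by apply: ler_wpM2r; [rewrite divr_ge0 ?sqr_ge0// ltW|exact: schur].
    by rewrite le_eqVlt; apply/orP; left; apply/eqP; field; rewrite gt_eqF.
  apply: ler_sum => P _; rewrite -mulr_suml.
  apply: le_trans (_ : (eps * w P) * (v P ^+ 2 / w P) <= _).
    by apply: ler_wpM2r; [rewrite divr_ge0 ?sqr_ge0// ltW|exact: schur].
  by rewrite le_eqVlt; apply/orP; left; apply/eqP; field; rewrite gt_eqF.
have := le_trans h1 h2; under eq_bigr do rewrite -mulr_sumr; rewrite -!mulr_sumr.
lra.
Qed.

Lemma schur_row u P : ell2 u ->
  fsbounded (fun Q => `|E P Q * u Q|) (eps / 2 * (ip u u + 1)).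
Proof.
move=> hu t; have := schur_bilinear u (fun _ => 1) [fset P]%fset t.
rewrite !big_seq_fset1 normr1 expr1n => h.
apply: le_trans (le_trans h _).
  by apply: ler_sum => Q _; rewrite normrM mulr1.
by apply: ler_wpM2l; [rewrite divr_ge0// ltW|rewrite lerD2r sqbounded_ip].
Qed.

Lemma schur_hsum u P : ell2 u -> hsum (fun Q => E P Q * u Q) (mxapp E u P).
Proof. by move=> hu; apply: hsum_usum; exact: schur_row. Qed.

Lemma schur_pairing u s (c : F -> R) B : ell2 u ->
  (forall t, \sum_(Q <- t) \sum_(P <- s) `|c P| * `|E P Q| * `|u Q| <= B) ->
  \sum_(P <- s) c P * mxapp E u P <= B.
Proof.
move=> hu hB.
have h : hsum (fun Q => \sum_(P <- s) c P * (E P Q * u Q)) (\sum_(P <- s) c P * mxapp E u P).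
  by apply: hsum_sum => P; apply: hsumZ; exact: schur_hsum.
apply: hsum_le h _ => t; apply: le_trans (hB t).
apply: ler_sum => Q _; apply: ler_sum => P _.
by rewrite -mulrA -!normrM ler_norm.
Qed.

(** The transposed estimate: multiplying by the signs of the output turns the weighted l1 norm into
    a pairing in which [|E|] acts on the weight [z] instead of on [u]. It serves for [z = w] and for
    [w] restricted to coarse levels. *)
Lemma schur_l1 u s (z zeta : F -> R) B : ell2 u -> (forall P, 0 <= z P) ->
  (forall Q, \sum_(P <- s) `|E P Q| * z P <= zeta Q) ->
  (forall t, \sum_(Q <- t) `|u Q| * zeta Q <= B) ->
  \sum_(P <- s) `|mxapp E u P| * z P <= B.
Proof.
move=> hu z0 hz hB.
rewrite (eq_bigr (fun P => Num.sg (mxapp E u P) * z P * mxapp E u P)); last first.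
  by move=> P _; rewrite normrEsg mulrAC.
apply: schur_pairing => // t; apply: le_trans (hB t).
apply: ler_sum => Q _; apply: le_trans (_ : \sum_(P <- s) `|u Q| * (`|E P Q| * z P) <= _).
  apply: ler_sum => P _; rewrite normrM (ger0_norm (z0 P)) mulrC; apply: ler_wpM2l => //.
  rewrite mulrC; apply: ler_wpM2l => //; rewrite -[leRHS]mul1r; apply: ler_wpM2r => //.
  by rewrite normr_sg lern1 leq_b1.
by rewrite -mulr_sumr; apply: ler_wpM2l.
Qed.

(** Testing the bilinear estimate on [v = eps^-1 E u] gives [sum v^2 <= (|u|^2 + sum v^2) / 2]. The
    sum runs over a finite set, so it can be absorbed before [E u] is known to be in ell2. *)
Lemma schur_l2 u : ell2 u -> sqbounded (mxapp E u) (eps ^+ 2 * ip u u).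
Proof.
move=> hu s; pose v P := eps^-1 * mxapp E u P.
have yv P : mxapp E u P = eps * v P by rewrite /v mulrA divff ?mul1r// gt_eqF.
have : \sum_(P <- s) v P * mxapp E u P <= eps / 2 * (ip u u + \sum_(P <- s) v P ^+ 2).
  apply: schur_pairing => // t; apply: le_trans (le_trans (schur_bilinear u v s t) _).
    rewrite exchange_big/=; apply: ler_sum => P _; apply: ler_sum => Q _.
    by rewrite [leLHS](_ : _ = `|E P Q| * `|u Q| * `|v P|)//; ring.
  by apply: ler_wpM2l; [rewrite divr_ge0// ltW|rewrite lerD2r sqbounded_ip].
under eq_bigr do rewrite yv mulrCA -expr2.
rewrite -mulr_sumr => h.
have h4 : \sum_(P <- s) v P ^+ 2 <= ip u u.
  by rewrite -(ler_pM2l eps0); lra.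
rewrite (eq_bigr (fun P => eps ^+ 2 * v P ^+ 2)); last by move=> P _; rewrite yv exprMn.
by rewrite -mulr_sumr; apply: ler_wpM2l => //; exact: sqr_ge0.
Qed.

Lemma schur_l2op : l2op (mxapp E) eps.
Proof.
have E2 u : ell2 u -> ell2 (mxapp E u).
  by move=> hu; apply/ell2P; eexists; exact: schur_l2.
split=> //; first exact: ltW.
- move=> u v hu hv; apply/funext => P; apply: hsum_unique (schur_hsum P (ell2D hu hv)) _.
  by under eq_fun do rewrite mulrDr; apply: hsumD; exact: schur_hsum.
- move=> c u hu; apply/funext => P; apply: hsum_unique (schur_hsum P (ell2Z c hu)) _.
  by under eq_fun do rewrite mulrCA; apply: hsumZ; exact: schur_hsum.
- move=> u hu; rewrite nrm_le; [|exact: E2|by rewrite mulr_ge0 ?nrm_ge0// ltW].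
  by apply: ip_sqbounded; rewrite exprMn sqr_nrm//; exact: schur_l2.
Qed.

Lemma schur_bounded_mx : bounded_mx E.
Proof.
apply: (@bounded_mx_intro _ _ E (mxapp E) eps _ _ _).1.
- exact: schur_l2op.
- by move=> u P hu; eexists; exact: schur_row.
- by move=> u P hu; exact: schur_hsum.
Qed.

Lemma schur_sym : l2sym (mxapp E).
Proof. exact: mxapp_sym schur_bounded_mx symE. Qed.
End Schur.

(** * The inverse square root of a perturbed diagonal matrix *)

Section InverseSquareRoot.
Context {R : realType} {F : choiceType}.
Implicit Types (u v : F -> R) (s t : {fset F}).
Local Notation q := (4^-1 : R).
Variables (N : F -> F -> R) (w dg : F -> R) (D : R).
Hypothesis symN : forall P Q, N P Q = N Q P.
Hypothesis w0 : forall P, 0 < w P.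
Hypothesis schur : forall Q, fsbounded (fun P => `|N P Q| * w P) (q * w Q).
Hypothesis dg0 : forall P, 0 < dg P.
Hypothesis dgD : forall P, dg P <= D.
Hypothesis dgVD : forall P, (dg P)^-1 <= D.
Hypothesis dgN : forall P Q, N P Q != 0 -> dg P = dg Q.

Let q0 : 0 < q. Proof. by rewrite invr_gt0. Qed.
Let hN := schur_l2op symN w0 q0 schur.
Let sN : l2sym (mxapp N) := schur_sym symN w0 q0 schur.
Local Notation L := (pser (mxapp N) isc).

Let D0 (P : F) : 0 <= D. Proof. exact: le_trans (ltW (dg0 P)) (dgD P). Qed.

Lemma ell2_mul (f u : F -> R) (K : R) : (forall P, `|f P| <= K) -> ell2 u -> ell2 (fun P => f P * u P).
Proof.
move=> fK hu; apply: ell2_le (ell2Z K hu) => P; rewrite !normrM; apply: ler_wpM2r => //.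
exact: le_trans (fK P) (ler_norm _).
Qed.

(** The hypothesis on [f] says that [N] is block diagonal with respect to the level sets of [f]. *)
Lemma schur_mul_comm (f u : F -> R) (K : R) : (forall P, `|f P| <= K) ->
  (forall P Q, N P Q != 0 -> f P = f Q) -> ell2 u ->
  mxapp N (fun P => f P * u P) = fun P => f P * mxapp N u P.
Proof.
move=> fK fN hu; apply/funext => P.
apply: hsum_unique (schur_hsum symN w0 q0 schur P (ell2_mul fK hu)) _.
rewrite (_ : (fun Q => _) = (fun Q => f P * (N P Q * u Q))).
  apply: hsumZ; exact: (schur_hsum symN w0 q0 schur).
apply/funext => Q; have [->|/fN ->] := eqVneq (N P Q) 0; first by rewrite !mul0r mulr0.
by rewrite mulrCA.
Qed.

Lemma invsqrt_mul_comm (f u : F -> R) (K : R) : (forall P, `|f P| <= K) ->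
  (forall P Q, N P Q != 0 -> f P = f Q) -> ell2 u ->
  L (fun P => f P * u P) = fun P => f P * L u P.
Proof.
move=> fK fN hu; apply/funext => P; have hfu := ell2_mul fK hu.
have E j : iter j (mxapp N) (fun P => f P * u P) = fun P => f P * iter j (mxapp N) u P.
  by elim: j => //= j ->; apply: schur_mul_comm fK fN _; exact: (iter_ell2 hN).
apply: (pser_isc_eq hN hfu).
rewrite (_ : series _ = fun n => f P * series (fun j => isc j * iter j (mxapp N) u P) n).
  by apply: cvgMr; exact: (pser_isc_cvg hN).
by apply/funext => n; rewrite /series/= mulr_sumr; apply: eq_bigr => j _; rewrite E mulrCA.
Qed.

(** The matrix [dg^-1 (I - N)^(-1/2)]. A diagonal is carried along because the constant function
    attached to the whole space is not normalised in L2, whereas the other [phi_Q] are. *)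
Definition invsqrt_mx P Q : R := (dg P)^-1 * L (edelta Q) P.
Definition perturbed_mx P Q : R := dg P ^+ 2 * ((P == Q)%:R - N P Q).
Local Notation A := invsqrt_mx.
Local Notation G := perturbed_mx.

Let hL := pser_isc_l2op hN.
Let L2 u (hu : ell2 u) : ell2 (L u). Proof. by have [_ h _ _ _] := hL; exact: h. Qed.
Let N2 u (hu : ell2 u) : ell2 (mxapp N u). Proof. by have [_ h _ _ _] := hN; exact: h. Qed.
Let sL := pser_isc_sym hN sN.

Let dgVabs P : `|(dg P)^-1| <= D. Proof. by rewrite ger0_norm// invr_ge0 ltW. Qed.
Let dgabs P : `|dg P| <= D. Proof. by rewrite ger0_norm// ltW. Qed.
Let dgVN P Q : N P Q != 0 -> (dg P)^-1 = (dg Q)^-1. Proof. by move=> /dgN ->. Qed.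

Lemma pser_entry_sym P Q : L (edelta Q) P = L (edelta P) Q.
Proof.
have eP := @ell2_edelta R F P; have eQ := @ell2_edelta R F Q.
by rewrite -(ip_edelta P (L2 eQ)) sL// ipC ip_edelta//; exact: L2.
Qed.

Lemma l2op_mul (f : F -> R) (K : R) : 0 <= K -> (forall P, `|f P| <= K) ->
  l2op (fun u P => f P * u P) K.
Proof.
move=> K0 fK; split=> //.
- by move=> u; exact: ell2_mul fK.
- by move=> u v _ _; apply/funext => P; rewrite mulrDr.
- by move=> c u _; apply/funext => P; rewrite mulrCA.
- move=> u hu; rewrite nrm_le ?mulr_ge0 ?nrm_ge0//; last exact: ell2_mul fK hu.
  apply: ip_sqbounded; rewrite exprMn sqr_nrm//.
  apply: sqbounded_le (sqboundedZ K (sqbounded_ip hu)) => P; rewrite !normrM.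
  by apply: ler_wpM2r => //; apply: le_trans (fK P) (ler_norm _).
Qed.

Let opA : l2op (fun u P => (dg P)^-1 * L u P) (`|D| * 2).
Proof.
apply: (@l2op_comp _ _ (fun u P => (dg P)^-1 * u P) L) => //.
by apply: l2op_mul => // P; apply: le_trans (dgVabs P) (ler_norm _).
Qed.

Lemma invsqrt_bounded : bounded_mx A /\
  forall u, ell2 u -> mxapp A u = fun P => (dg P)^-1 * L u P.
Proof.
have AE u P Q : A P Q * u Q = (dg P)^-1 * (L (edelta P) Q * u Q).
  by rewrite /A pser_entry_sym mulrA.
apply: bounded_mx_intro opA _ _ => u P hu; have eP := @ell2_edelta R F P.
  have /ell2P[B hB] := L2 eP; have /ell2P[C hC] := hu.
  exists ((dg P)^-1 * ((B + C) / 2)) => t.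
  have d0 : 0 <= (dg P)^-1 by rewrite invr_ge0 ltW.
  under eq_bigr do rewrite AE normrM; rewrite -mulr_sumr (ger0_norm d0).
  by apply: ler_wpM2l => //; exact: fsbounded_mul hB hC t.
under eq_fun do rewrite AE.
by apply: hsumZ; rewrite -(ip_edelta P (L2 hu)) sL// ipC; apply: ip_hsum => //; exact: L2.
Qed.

Let opG : l2op (fun u P => dg P ^+ 2 * (u P - mxapp N u P)) (`|D| ^+ 2 * (1 + q)).
Proof.
apply: (@l2op_comp _ _ (fun u P => dg P ^+ 2 * u P) (fun u P => u P - mxapp N u P)).
  apply: l2op_mul => [|P]; first exact: sqr_ge0.
  by rewrite normrX lerXn2r ?nnegrE//; apply: le_trans (dgabs P) (ler_norm _).
by apply: l2op_sub hN; split=> // u hu; rewrite mul1r.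
Qed.

Lemma perturbed_bounded : bounded_mx G /\
  forall u, ell2 u -> mxapp G u = fun P => dg P ^+ 2 * (u P - mxapp N u P).
Proof.
apply: bounded_mx_intro opG _ _ => u P hu.
  exists (dg P ^+ 2 * (`|u P| + q / 2 * (ip u u + 1))) => t.
  rewrite /G; under eq_bigr do rewrite -mulrA normrM (ger0_norm (sqr_ge0 _)).
  rewrite -mulr_sumr; apply: ler_wpM2l; first exact: sqr_ge0.
  apply: le_trans (_ : \sum_(Q <- t) ((P == Q)%:R * `|u P| + `|N P Q * u Q|) <= _).
    apply: ler_sum => Q _; rewrite mulrBl; apply: le_trans (ler_normB _ _) _.
    by rewrite lerD2r; case: eqP => [->|_]; rewrite ?mul0r ?normr0// !mul1r.
  rewrite big_split/=; apply: lerD; last exact: (schur_row symN w0 q0 schur).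
  rewrite -mulr_suml -[leRHS]mul1r; apply: ler_wpM2r => //.
  have [Pt|Pt] := boolP (P \in t).
    by rewrite (big_fsetD1 P)//= eqxx big1_seq ?addr0// => Q /=; rewrite !inE eq_sym => /andP[/negbTE ->].
  by rewrite big1_seq// => Q /= Qt; case: eqP => // PQ; rewrite PQ Qt in Pt.
rewrite (_ : (fun Q => _) = fun Q => dg P ^+ 2 * (u Q * edelta P Q - N P Q * u Q)); last first.
  by apply/funext => Q; rewrite /G/edelta (eq_sym Q) -mulrA mulrBl [u Q * _]mulrC.
by apply: hsumZ; apply: hsumB; [exact: hsum_edelta|exact: (schur_hsum symN w0 q0 schur)].
Qed.

(** [dg^-1] is the square of [f = dg^(-1/2)], which commutes with the series; [pser_isc_pos] is then
    applied to [f u]. *)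
Lemma invsqrt_pos u : ell2 u -> (2^-1 / `|D| ) * ip u u <= ip u (mxapp A u).
Proof.
move=> hu; rewrite invsqrt_bounded.2//.
pose f P := Num.sqrt (dg P)^-1.
have f2 P : f P * f P = (dg P)^-1 by rewrite -expr2 sqr_sqrtr// invr_ge0 ltW.
have fK P : `|f P| <= Num.sqrt D by rewrite ger0_norm ?sqrtr_ge0// ler_wsqrtr.
have fN P Q : N P Q != 0 -> f P = f Q by move=> /dgN h; rewrite /f h.
have hfu := ell2_mul fK hu; have hLu := L2 hu.
have -> : ip u (fun P => (dg P)^-1 * L u P) = ip (fun P => f P * u P) (L (fun P => f P * u P)).
  rewrite (invsqrt_mul_comm fK fN hu) /ip; congr usum; apply/funext => P.
  by rewrite -f2; ring.
apply: le_trans (pser_isc_pos hN hfu); rewrite -mulrA; apply: ler_wpM2l => //.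
rewrite -(ipZl _ hu hu); apply: (@hsum_le _ _ (fun P => `|D|^-1 * u P * u P)).
  by apply: ip_hsum => //; exact: ell2Z.
move=> s; apply: le_trans (sqbounded_ip hfu s); apply: ler_sum => P _.
rewrite exprMn !expr2 f2 -mulrA; apply: ler_wpM2r; first by rewrite -expr2 sqr_ge0.
rewrite lef_pV2 ?posrE//; last exact: lt_le_trans (dg0 P) (le_trans (dgD P) (ler_norm _)).
exact: le_trans (dgD P) (ler_norm _).
Qed.

(** As [dg] commutes with [N], the square of the candidate is [dg^-2 (I - N)^-1], the inverse of [G]
    on either side. *)
Lemma invsqrtP : is_inv_sqrt_mx G A.
Proof.
have [bA EA] := invsqrt_bounded; have [bG EG] := perturbed_bounded.
have A2 u : ell2 u -> ell2 (mxapp A u).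
  by move=> hu; rewrite EA//; exact: ell2_mul dgVabs (L2 hu).
have sqE u : ell2 u -> mxapp A (mxapp A u) = fun P => (dg P)^-2 * L (L u) P.
  move=> hu; rewrite (EA _ (A2 _ hu)) (EA _ hu) (invsqrt_mul_comm dgVabs dgVN (L2 hu)).
  by apply/funext => P; rewrite mulrA -expr2 exprVn.
have dgn P : dg P != 0 by rewrite gt_eqF.
split=> //.
- split=> [P Q|u hu]; last first.
    by apply: le_trans (invsqrt_pos hu); rewrite mulr_ge0 ?ip_ge0// divr_ge0.
  rewrite /A pser_entry_sym; have [->|n0] := eqVneq (L (edelta P) Q) 0; first by rewrite !mulr0.
  congr (_^-1 * _); apply: (mulIf n0); have eP := @ell2_edelta R F P.
  have := congr1 (fun f => f Q) (invsqrt_mul_comm dgabs dgN eP) => /= <-.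
  rewrite (_ : (fun i => _) = fun i => dg P * edelta P i); last first.
    by apply/funext => i; rewrite /edelta; case: eqP => [->|]//; rewrite !mulr0.
  by have [_ _ _ -> //] := hL.
- move=> u hu; rewrite sqE// EG; last first.
    apply: (@ell2_mul _ _ (D ^+ 2)) => [P|]; last by apply: L2; exact: L2.
    by rewrite -exprVn normrX; apply: lerXn2r; rewrite ?nnegrE// (D0 P).
  rewrite (@schur_mul_comm _ _ (D ^+ 2)); last 3 first.
  + by move=> P; rewrite -exprVn normrX; apply: lerXn2r; rewrite ?nnegrE// (D0 P).
  + by move=> P Q /dgN ->.
  + by apply: L2; exact: L2.
  rewrite -[RHS](pser_isc_inv hN hu); apply/funext => P.
  by field; rewrite dgn.
- move=> u hu; have hNu := N2 hu; have hs := ell2B hu hNu.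
  rewrite EG// sqE; last first.
    apply: (@ell2_mul _ _ (D ^+ 2)) => [P|//].
    by rewrite normrX; apply: lerXn2r; rewrite ?nnegrE// (D0 P).
  have f2 P : `|dg P ^+ 2| <= D ^+ 2.
    by rewrite normrX; apply: lerXn2r; rewrite ?nnegrE// (D0 P).
  have fN P Q : N P Q != 0 -> dg P ^+ 2 = dg Q ^+ 2 by move=> /dgN ->.
  rewrite (invsqrt_mul_comm f2 fN hs) (invsqrt_mul_comm f2 fN (L2 hs)).
  rewrite (l2opB hL hu hNu) (l2opB hL (L2 hu) (L2 hNu)).
  rewrite -!(pser_isc_comm hN)//; last exact: L2.
  rewrite -[RHS](pser_isc_inv hN hu); apply/funext => P.
  by field; rewrite dgn.
Qed.

(** [inv_sqrt_mx] selects some matrix meeting its specification. Any such matrix has the same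
    square, the inverse of [G]; the candidate is bounded below by [invsqrt_pos], so
    [positive_sqrt_unique] identifies the two. *)
Lemma inv_sqrt_mxE : inv_sqrt_mx G = A.
Proof.
apply: xget_unique; first exact: invsqrtP.
move=> A' [bG bA' [sA' pA'] h1 h2]; have [_ bA [sA pA] h3 h4] := invsqrtP.
have [CA opA'] := bounded_mx_l2op bA; have [CB opB] := bounded_mx_l2op bA'.
have [_ aell2 _ _ _] := opA'.
apply/funext => P; apply/funext => Q; have eQ := @ell2_edelta R F Q.
rewrite -(mxapp_edelta P Q bA') -(mxapp_edelta P Q bA); congr (_ P); apply/esym.
have D0' : 0 < 2^-1 / `|D|.
  by rewrite divr_gt0// normr_gt0 gt_eqF// (lt_le_trans (dg0 P)).
apply: (positive_sqrt_unique opA' opB (mxapp_sym bA' sA') D0') => //.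
- by move=> u hu; exact: invsqrt_pos.
- by move=> u hu; rewrite -[in RHS](h3 u hu) (h2 _ (aell2 _ (aell2 _ hu))).
Qed.
End InverseSquareRoot.

(** * Decay of the entries of the inverse square root *)

Section EntryDecay.
Context {R : realType} {F : choiceType}.
Implicit Types (u v : F -> R) (s t : {fset F}).
Local Notation q := (4^-1 : R).
Variables (N : F -> F -> R) (w v dg : F -> R) (D : R).
Hypothesis symN : forall P Q, N P Q = N Q P.
Hypothesis w0 : forall P, 0 < w P.
Hypothesis schurw : forall Q, fsbounded (fun P => `|N P Q| * w P) (q * w Q).
Hypothesis v0 : forall P, 0 < v P.
Hypothesis schurv : forall Q, fsbounded (fun P => `|N P Q| * v P) (q * v Q).
Hypothesis dg0 : forall P, 0 < dg P.
Hypothesis dgVD : forall P, (dg P)^-1 <= D.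

Let q0 : 0 < q. Proof. by rewrite invr_gt0. Qed.

(** The Schur condition for [v] iterates: the entries of [N^j] are at most [4^-j v_P / v_Q], and the
    coefficients [isc] are at most 1. *)
Lemma invsqrt_mx_decay P Q : `|invsqrt_mx N dg P Q| <= D * (2 * (v P / v Q)).
Proof.
have hN := schur_l2op symN w0 q0 schurw; have eQ := @ell2_edelta R F Q.
have it j P' : `|iter j (mxapp N) (edelta Q) P'| <= q ^+ j * (v P' / v Q).
  elim: j P' => [|j IH] P' /=.
    rewrite mul1r /edelta; case: eqP => [->|_]; first by rewrite normr1 divff// gt_eqF.
    by rewrite normr0 divr_ge0// ltW.
  have hs := schur_hsum symN w0 q0 schurw P' (iter_ell2 hN j eQ).
  apply: hsum_norm hs _ => t.
  apply: le_trans (_ : \sum_(i <- t) (q ^+ j / v Q) * (`|N i P'| * v i) <= _).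
    apply: ler_sum => i _; rewrite normrM symN mulrC.
    apply: le_trans (ler_wpM2r _ (IH i)) _ => //; rewrite le_eqVlt; apply/orP; left; apply/eqP; ring.
  rewrite -mulr_sumr exprS; apply: le_trans (ler_wpM2l _ (schurv P' t)) _.
    by rewrite divr_ge0 ?exprn_ge0// ltW.
  by rewrite le_eqVlt; apply/orP; left; apply/eqP; ring.
rewrite /invsqrt_mx normrM ger0_norm ?invr_ge0; last exact: ltW.
apply: ler_pM => //; first by rewrite invr_ge0 ltW.
have vv : 0 <= v P / v Q by rewrite divr_ge0// ltW.
have h : (fun n => `|series (fun j => isc j * iter j (mxapp N) (edelta Q) P) n|) @ \oo -->
    `|pser (mxapp N) isc (edelta Q) P| by apply: cvg_norm; exact: pser_isc_cvg.
apply: (cvgr_to_le h); apply: nearW => n; rewrite /series/=.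
apply: le_trans (ler_norm_sum _ _ _) _.
apply: le_trans (_ : \sum_(0 <= j < n) q ^+ j * (v P / v Q) <= _).
  apply: ler_sum => j _; rewrite normrM; apply: le_trans (it j P); rewrite ger0_norm ?isc_ge0//.
  by rewrite -[leRHS]mul1r; apply: ler_wpM2r => //; exact: isc_le1.
rewrite -mulr_suml; apply: ler_wpM2r => //.
by have := @geo_sum R 0 n; rewrite expr0 mulr1.
Qed.
End EntryDecay.

(** * Molecules: how the coefficients of an atom evolve under powers of [N] *)

Section Molecules.
Context {R : realType} {F : choiceType}.
Implicit Types (u v a b : F -> R) (s t : {fset F}).
Variables (N : F -> F -> R) (w : F -> R) (lev : F -> nat).
Variables (eps theta delta : R).
Hypothesis symN : forall P Q, N P Q = N Q P.
Hypothesis w0 : forall P, 0 < w P.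
Hypothesis theta01 : 0 < theta <= 1.
Hypothesis delta01 : 0 < delta <= 1.
Hypothesis eps0 : 0 < eps.
Hypothesis eps_delta : eps <= delta / 4.
Let v P := w P * theta ^+ lev P.
Hypothesis schurw : forall Q, fsbounded (fun P => `|N P Q| * w P) (eps * w Q).
Hypothesis schurv : forall Q, fsbounded (fun P => `|N P Q| * v P) (eps * v Q).
(** [n0] is the scale of an atom. [Loc n P] will mean that [P] has level at least [n] and lies
    within a multiple of [delta^n] of the atom. [p] is the seminorm to be bounded: [p_l1] handles
    families small in weighted l1, and [p_l2] families carried by a set of measure about [delta^n],
    where the free parameter [t] of Young's inequality replaces square roots. *)
Variables (Loc : nat -> F -> Prop) (n0 : nat) (K1 K2 K3 K4 K5 : R).
Hypothesis Loc_step : forall n P Q, Loc n P -> N Q P != 0 -> (n <= lev Q)%N -> Loc n.-1 Q.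
Hypothesis Loc_sum : forall n t, (n <= n0)%N ->
  (forall P, P \in t -> Loc n P) ->
  \sum_(P <- t) (v P / theta ^+ n) ^+ 2 <= K1 * delta ^+ n.
Variable p : (F -> R) -> R.
Hypothesis pD : forall u v, p (fun i => u i + v i) <= p u + p v.
Hypothesis pZ : forall c u, p (fun i => c * u i) <= `|c| * p u.
Hypothesis p_fin : exists (S : {fset F}) (k : R), 0 <= k /\ forall u, p u <= k * \sum_(P <- S) `|u P|.
Hypothesis p_l1 : forall u B, fsbounded (fun P => `|u P| * w P) B -> p u <= K2 * B.
Hypothesis p_l2 : forall n u (U t : R), (n <= n0)%N -> (forall P, u P != 0 -> Loc n P) ->
  sqbounded u U -> 0 < t -> p u <= K3 * (t * U + t^-1 * delta ^+ n).
Hypothesis K1_ge0 : 0 <= K1.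
Hypothesis K2_ge0 : 0 <= K2.
Hypothesis K3_ge0 : 0 <= K3.
Hypothesis K4_ge0 : 0 <= K4.
Hypothesis K5_ge0 : 0 <= K5.

Let d0 : 0 < delta. Proof. by case/andP: delta01. Qed.
Let th0 : 0 < theta. Proof. by case/andP: theta01. Qed.
Let hN := schur_l2op symN w0 eps0 schurw.

(** Shape after [j] applications of [N]: [a] is localised at scale [n0 - j] and its l2 norm has
    gained [(delta / 4)^j]; [b] collects everything else and is small in weighted l1. *)
Definition molecule j u := exists a b, [/\ u = fun i => a i + b i, ell2 b,
  forall P, a P != 0 -> Loc (n0 - j) P,
  sqbounded a (16^-1 ^+ j * (delta ^+ j) ^+ 2 * (K4 / delta ^+ n0))
  & fsbounded (fun P => `|b P| * w P) ((K5 + K4 + K1) * 2^-1 ^+ j)].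

Let dj j : 0 < delta ^+ j. Proof. exact: exprn_gt0. Qed.

(** Subtraction truncates: for [j > n0] the left side is [delta^j], still at most [delta^n0]. *)
Lemma delta_trunc j : delta ^+ j * delta ^+ (n0 - j) <= delta ^+ n0.
Proof.
rewrite -exprD; apply: ler_wiXn2l; [exact: ltW|by case/andP: delta01|].
by rewrite -leq_subLR.
Qed.

Lemma pow4 j : (4^-1 ^+ j : R) <= 2^-1 ^+ j.
Proof. by apply: lerXn2r; rewrite ?nnegrE// lef_pV2 ?posrE// ler_nat. Qed.

(** [N a] is cut at the level [n] of the current scale. Its finer part is localised at scale
    [n - 1], and [eps <= delta / 4] supplies the gain. Its coarser part joins [b]: at levels below
    [n] one has [w <= v / theta^n], so the Schur condition for [v] together with [Loc_sum] bounds it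
    in weighted l1. *)
Lemma molecule_step j u : molecule j u -> molecule j.+1 (mxapp N u).
Proof.
move=> [a [b [-> hb aLoc a2 b1]]]; set n := (n0 - j)%N.
have ha : ell2 a by apply/ell2P; eexists; exact: a2.
have [_ N2 ND _ _] := hN; have hNa := N2 _ ha; have hNb := N2 _ hb.
pose a' P := if (n <= lev P)%N then mxapp N a P else 0.
pose c' P := if (n <= lev P)%N then 0 else mxapp N a P.
exists a', (fun i => c' i + mxapp N b i); split.
- rewrite ND//; apply/funext => P; rewrite /a' /c'; case: ifP => _; first by rewrite add0r.
  by rewrite add0r.
- apply: ell2D => //; apply: ell2_le hNa => P; rewrite /c'; case: ifP => _ //.
  by rewrite normr0.
- move=> P; rewrite /a'; case: ifPn => nP; last by rewrite eqxx.
  (* A nonzero coordinate of [N a] is reached from some [Q] with both [N P Q] and [a Q] nonzero. *)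
  move=> h; rewrite subnS; have [Q Qh] : exists Q, N P Q * a Q != 0.
    apply: contrapT => /forallNP H; move/eqP : h; apply.
    apply: hsum_unique (schur_hsum symN w0 eps0 schurw P ha) _.
    have E Q : N P Q * a Q = 0 by apply/eqP; have := H Q; case: eqP.
    have := @hsum_fin R F (fun Q => N P Q * a Q) fset0; rewrite big_seq_fset0; apply => i _.
    by rewrite E.
  apply: (@Loc_step _ Q) => //.
    by apply: aLoc; apply: contraNneq Qh => ->; rewrite mulr0.
  by apply: contraNneq Qh => ->; rewrite mul0r.
- have h : sqbounded (mxapp N a) (eps ^+ 2 * (16^-1 ^+ j * (delta ^+ j) ^+ 2 * (K4 / delta ^+ n0))).
    move=> s; apply: le_trans (schur_l2 symN w0 eps0 schurw ha s) _.
    by apply: ler_wpM2l; [exact: sqr_ge0|exact: ip_sqbounded].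
  apply: (@sqbounded_le _ _ _ (mxapp N a)).
    by move=> P; rewrite /a'; case: ifP => _ //; rewrite normr0.
  move=> s; apply: le_trans (h s) _.
  apply: le_trans (_ : (delta / 4) ^+ 2 * (16^-1 ^+ j * (delta ^+ j) ^+ 2 * (K4 / delta ^+ n0)) <= _).
    apply: ler_wpM2r.
      apply: mulr_ge0; last by apply: divr_ge0 => //; exact: ltW.
      by apply: mulr_ge0; [rewrite exprn_ge0|exact: sqr_ge0].
    by apply: lerXn2r; rewrite ?nnegrE// ltW// divr_gt0.
  rewrite !exprS (_ : (16^-1 : R) = 4^-1 * 4^-1); last by rewrite -invfM -natrM.
  by rewrite le_eqVlt; apply/orP; left; apply/eqP; ring.
- move=> s; apply: le_trans (_ : \sum_(P <- s) (`|c' P| * w P + `|mxapp N b P| * w P) <= _).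
    by apply: ler_sum => P _; rewrite -mulrDl; apply: ler_wpM2r; [exact: ltW|exact: ler_normD].
  rewrite big_split/=.
  have h1 : \sum_(P <- s) `|mxapp N b P| * w P <= 4^-1 * ((K5 + K4 + K1) * 2^-1 ^+ j).
    apply: (schur_l1 symN w0 eps0 schurw hb (zeta := fun Q => eps * w Q)).
    - by move=> P; exact: ltW.
    - by move=> Q; exact: schurw.
    move=> t; apply: le_trans (_ : eps * ((K5 + K4 + K1) * 2^-1 ^+ j) <= _).
      rewrite (eq_bigr (fun Q => eps * (`|b Q| * w Q))); last by move=> Q _; rewrite mulrCA.
      by rewrite -mulr_sumr; apply: ler_wpM2l; [exact: ltW|exact: b1].
    apply: ler_wpM2r; first by rewrite mulr_ge0 ?exprn_ge0// !addr_ge0.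
    apply: le_trans eps_delta _; rewrite ler_pdivrMr// mulVf ?pnatr_eq0//.
    by case/andP: delta01.
  have h2 : \sum_(P <- s) `|c' P| * w P <= 8^-1 * ((K4 + K1) * 4^-1 ^+ j).
    rewrite (eq_bigr (fun P => `|mxapp N a P| * (if (n <= lev P)%N then 0 else w P))); last first.
      by move=> P _; rewrite /c'; case: ifP => _ //; rewrite normr0 mul0r mulr0.
    apply: (schur_l1 symN w0 eps0 schurw ha (zeta := fun Q => eps * (v Q / theta ^+ n))).
    - by move=> P; case: ifP => _ //; exact: ltW.
    - move=> Q; rewrite mulrA ler_pdivlMr; last exact: exprn_gt0.
      apply: le_trans (schurv Q s); rewrite mulr_suml; apply: ler_sum => P _.
      rewrite -mulrA; apply: ler_wpM2l => //; case: ifPn => nP.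
        by rewrite mul0r /v mulr_ge0 ?exprn_ge0// ltW.
      rewrite /v; apply: ler_wpM2l; first exact: ltW.
      apply: ler_wiXn2l; [exact: ltW|by case/andP: theta01|by rewrite ltnW// ltnNge].
    (* This [tau] balances Young's inequality: the energy of [a] and the bound of [Loc_sum] both
       become multiples of [4^-j]. *)
    move=> t; pose tau := 4 ^+ j * delta ^+ n0 / delta ^+ j.
    have tau0 : 0 < tau by rewrite divr_gt0// mulr_gt0// exprn_gt0.
    apply: le_trans (_ : \sum_(Q <- t | a Q != 0) eps / 2 * (tau * a Q ^+ 2 + tau^-1 * (v Q / theta ^+ n) ^+ 2) <= _).
      rewrite (bigID (fun Q => a Q != 0))/= addrC big1 ?add0r; last first.
        by move=> Q; rewrite negbK => /eqP ->; rewrite normr0 mul0r.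
      apply: ler_sum => Q _; rewrite mulrCA -mulrA; apply: ler_wpM2l; first exact: ltW.
      rewrite -(real_normK (num_real (a Q))).
      set x := `|a Q|; set y := v Q / _; rewrite -subr_ge0.
      rewrite (_ : _ - _ = 2^-1 * (tau^-1 * (tau * x - y) ^+ 2)); last by field; rewrite gt_eqF.
      apply: mulr_ge0 => //; apply: mulr_ge0; last exact: sqr_ge0.
      by rewrite invr_ge0; exact: ltW.
    rewrite -mulr_sumr big_split/= -!mulr_sumr.
    have s1 : \sum_(Q <- t | a Q != 0) a Q ^+ 2 <= 16^-1 ^+ j * (delta ^+ j) ^+ 2 * (K4 / delta ^+ n0).
      apply: le_trans (a2 t); rewrite [leRHS](bigID (fun Q => a Q != 0))/= lerDl.
      by apply: sumr_ge0 => Q _; exact: sqr_ge0.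
    have s2 : \sum_(Q <- t | a Q != 0) (v Q / theta ^+ n) ^+ 2 <= K1 * delta ^+ n.
      rewrite -big_filter; pose t' := [fset Q in t | a Q != 0]%fset.
      rewrite (_ : \sum_(Q <- _) _ = \sum_(Q <- t') (v Q / theta ^+ n) ^+ 2).
        by apply: Loc_sum; [exact: leq_subr|move=> P; rewrite !inE/= => /andP[_]; exact: aLoc].
      apply: perm_big; apply: uniq_perm; rewrite ?filter_uniq ?fset_uniq//.
      by move=> Q; rewrite mem_filter !inE/= andbC.
    apply: le_trans (_ : eps / 2 * (tau * (16^-1 ^+ j * (delta ^+ j) ^+ 2 * (K4 / delta ^+ n0)) +
       tau^-1 * (K1 * delta ^+ n)) <= _).
      apply: ler_wpM2l; first by rewrite divr_ge0// ltW.
      by apply: lerD; apply: ler_wpM2l => //; rewrite ?invr_ge0 ltW.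
    have e1 : tau * (16^-1 ^+ j * (delta ^+ j) ^+ 2 * (K4 / delta ^+ n0)) <= 4^-1 ^+ j * K4.
      have -> : tau * (16^-1 ^+ j * (delta ^+ j) ^+ 2 * (K4 / delta ^+ n0)) = 4^-1 ^+ j * K4 * delta ^+ j.
        rewrite /tau (_ : (16^-1 : R) = 4^-1 * 4^-1); last by rewrite -invfM -natrM.
        rewrite exprMn exprVn; field; rewrite !gt_eqF ?exprn_gt0//.
      rewrite -[leRHS]mulr1; apply: ler_wpM2l; first by rewrite mulr_ge0// exprn_ge0.
      by apply: exprn_ile1; [exact: ltW|case/andP: delta01].
    have e2 : tau^-1 * (K1 * delta ^+ n) <= 4^-1 ^+ j * K1.
      rewrite (_ : _ * _ = (4^-1 ^+ j * K1) * (delta ^+ j * delta ^+ n / delta ^+ n0)); last first.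
        by rewrite /tau exprVn; field; rewrite !gt_eqF ?exprn_gt0//.
      rewrite -[leRHS]mulr1; apply: ler_wpM2l; first by rewrite mulr_ge0// exprn_ge0.
      by rewrite ler_pdivrMr// mul1r delta_trunc.
    have e3 : eps <= 4^-1.
      apply: le_trans eps_delta _; rewrite ler_pdivrMr// mulVf ?pnatr_eq0//.
      by case/andP: delta01.
    have : 0 <= (4^-1 ^+ j * (K4 + K1) : R) by rewrite mulr_ge0 ?addr_ge0// exprn_ge0.
    have := lerD e1 e2; set S := _ + _; rewrite -mulrDr; set T := 4^-1 ^+ j * _.
    move=> ST T0; apply: le_trans (_ : 8^-1 * T <= _); last by rewrite /T [_ * (K4 + K1)]mulrC.
    apply: le_trans (_ : eps / 2 * T <= _).
      by apply: ler_wpM2l => //; rewrite divr_ge0// ltW.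
    by apply: ler_wpM2r => //; lra.
  apply: le_trans (lerD h2 h1) _; rewrite exprS.
  have : (K4 + K1) * 4^-1 ^+ j <= (K4 + K1) * 2^-1 ^+ j.
    by apply: ler_wpM2l; [exact: addr_ge0|exact: pow4].
  have : 0 <= K5 * 2^-1 ^+ j by rewrite mulr_ge0// exprn_ge0.
  have : 0 <= (K4 + K1) * 2^-1 ^+ j by rewrite mulr_ge0 ?addr_ge0// exprn_ge0.
  set x := 2^-1 ^+ j; set y := 4^-1 ^+ j; lra.
Qed.

Definition molK := K3 * (K4 + 1) + K2 * (K5 + K4 + K1).

(** On the localised part [p_l2] acts as Cauchy-Schwarz: the norm [4^-j delta^j delta^(-n0/2)] meets
    the root of the measure [delta^(n0 - j)]. *)
Lemma molecule_p j u : molecule j u -> p u <= molK * 2^-1 ^+ j.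
Proof.
move=> [a [b [-> hb aLoc a2 b1]]]; apply: le_trans (pD _ _) _.
rewrite /molK mulrDl; apply: lerD; last by rewrite -mulrA; exact: p_l1.
pose tau := 4 ^+ j * delta ^+ n0 / delta ^+ j.
have tau0 : 0 < tau by rewrite divr_gt0// mulr_gt0// exprn_gt0.
apply: le_trans (p_l2 (leq_subr j n0) aLoc a2 tau0) _; rewrite -[leRHS]mulrA.
apply: ler_wpM2l => //; rewrite mulrDl mul1r; apply: lerD.
  have -> : tau * (16^-1 ^+ j * (delta ^+ j) ^+ 2 * (K4 / delta ^+ n0)) = 4^-1 ^+ j * K4 * delta ^+ j.
    rewrite /tau (_ : (16^-1 : R) = 4^-1 * 4^-1); last by rewrite -invfM -natrM.
    rewrite exprMn exprVn; field; rewrite !gt_eqF ?exprn_gt0//.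
  apply: le_trans (_ : 4^-1 ^+ j * K4 * 1 <= _).
    apply: ler_wpM2l; first by rewrite mulr_ge0// exprn_ge0.
    by apply: exprn_ile1; [exact: ltW|case/andP: delta01].
  by rewrite mulr1 mulrC; apply: ler_wpM2l => //; exact: pow4.
rewrite (_ : tau^-1 * _ = 4^-1 ^+ j * (delta ^+ j * delta ^+ (n0 - j) / delta ^+ n0)); last first.
  by rewrite /tau exprVn; field; rewrite !gt_eqF ?exprn_gt0//.
apply: le_trans (pow4 j); rewrite -[leRHS]mulr1; apply: ler_wpM2l; first by rewrite exprn_ge0.
by rewrite ler_pdivrMr// mul1r delta_trunc.
Qed.

(** [N^j u] costs [molK 2^-j] and [isc j <= 1], so every partial sum costs at most [2 molK]. The
    limit is harmless because [p] is controlled by finitely many coordinates ([p_fin]). *)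
Lemma molecule_invsqrt u : ell2 u -> molecule 0 u -> p (pser (mxapp N) isc u) <= 2 * molK.
Proof.
move=> hu mu; have hq : l2op (mxapp N) (4^-1).
  have [h1 h2 h3 h4 h5] := hN; split=> // x hx; apply: le_trans (h5 x hx) _.
  apply: ler_wpM2r; first exact: nrm_ge0.
  by apply: le_trans eps_delta _; rewrite ler_pdivrMr// mulVf ?pnatr_eq0//; case/andP: delta01.
have mj j : molecule j (iter j (mxapp N) u) by elim: j => //= j IH; exact: molecule_step.
have pj j := molecule_p (mj j).
have molK0 : 0 <= molK by rewrite addr_ge0// mulr_ge0// ?addr_ge0.
have [S [k [k0 hS]]] := p_fin.
have p0 : p (fun _ => 0) <= 0.
  apply: le_trans (hS _) _; rewrite big1 ?mulr0// => P _; exact: normr0.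
have part n : p (fun P => \sum_(j < n) isc j * iter j (mxapp N) u P) <= 2 * molK.
  suff : p (fun P => \sum_(j < n) isc j * iter j (mxapp N) u P) <= 2 * molK - 2 * molK * 2^-1 ^+ n.
    move=> h; apply: le_trans h _; rewrite gerBl; apply: mulr_ge0; last by rewrite exprn_ge0.
    exact: mulr_ge0.
  elim: n => [|n IH].
    rewrite expr0 mulr1 subrr; apply: le_trans p0; rewrite le_eqVlt; apply/orP; left; apply/eqP.
    by congr p; apply/funext => P; rewrite big_ord0.
  rewrite (_ : (fun P => _) = fun P => (\sum_(j < n) isc j * iter j (mxapp N) u P) + isc n * iter n (mxapp N) u P); last first.
    by apply/funext => P; rewrite big_ord_recr.
  apply: le_trans (pD _ _) _; apply: le_trans (lerD IH (pZ _ _)) _.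
  have e : `|isc n| * p (iter n (mxapp N) u) <= molK * 2^-1 ^+ n.
    rewrite ger0_norm ?isc_ge0//; apply: le_trans (ler_wpM2l (isc_ge0 n) (pj n)) _.
    rewrite -[leRHS]mul1r; apply: ler_wpM2r; last exact: isc_le1.
    by rewrite mulr_ge0// exprn_ge0.
  rewrite exprS; move: e; set y := 2^-1 ^+ n; set z := `|_| * _; lra.
apply/ler_addgt0Pr => e e0.
have h0 : (fun n => k * \sum_(P <- S) `|pser (mxapp N) isc u P - series (fun j => isc j * iter j (mxapp N) u P) n|) @ \oo --> (0 : R).
  rewrite -[X in _ --> X](mulr0 k); apply: cvgMr.
  have z : \sum_(P <- S) (0 : R) = 0 by rewrite big1.
  rewrite -[X in _ --> X]z.
  apply: (@cvgn_sum _ _ S (fun P n => `|pser (mxapp N) isc u P - series (fun j => isc j * iter j (mxapp N) u P) n|)) => P.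
  rewrite -[X in _ --> X](normr0 R) -[X in `|X|](subrr (pser (mxapp N) isc u P)).
  by apply: cvg_norm; apply: cvgB; [exact: cvg_cst|exact: pser_isc_cvg].
have /cvgr0Pnorm_le/(_ _ e0)[n _ /(_ n (leqnn n)) hn] := h0.
have -> : pser (mxapp N) isc u = fun P => (\sum_(j < n) isc j * iter j (mxapp N) u P) +
   (pser (mxapp N) isc u P - series (fun j => isc j * iter j (mxapp N) u P) n).
  by apply/funext => P; rewrite /series/= big_mkord addrC subrK.
apply: le_trans (pD _ _) _; apply: lerD (part n) _; apply: le_trans (hS _) _.
exact: le_trans (ler_norm _) hn.
Qed.
End Molecules.

(** * Integrals of bounded, integrable and square integrable functions on a finite measure space *)

Section Integration.
Context {R : realType} {disp : measure_display} {X : measurableType disp}.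
Variable mu : {measure set X -> \bar R}.
Hypothesis mufin : (mu [set: X] < +oo)%E.
Implicit Types (f g : X -> R).
Local Notation Int f := (Rintegral mu [set: X] f).
Local Notation L1 := (integrableR mu).

(** The bound holds everywhere and not just almost everywhere, so products with integrable functions
    need no exceptional sets. *)
Definition bm f := measurable_fun [set: X] f /\ exists B, forall x, `|f x| <= B.

Lemma bm_L1 f : bm f -> L1 f.
Proof.
move=> [mf [B hB]]; apply: measurable_bounded_integrable => //.
exists B; split; first exact: num_real.
by move=> M BM x _ /=; apply: le_trans (hB x) (ltW BM).
Qed.

Lemma bmD f g : bm f -> bm g -> bm (fun x => f x + g x).
Proof.
move=> [mf [B hB]] [mg [C hC]]; split; first exact: measurable_funD.
by exists (B + C) => x; apply: le_trans (ler_normD _ _) _; apply: lerD.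
Qed.

Lemma bm_cst (c : R) : bm (fun _ => c).
Proof. by split; [exact: measurable_cst|exists `|c|]. Qed.

Lemma bmM f g : bm f -> bm g -> bm (fun x => f x * g x).
Proof.
move=> [mf [B hB]] [mg [C hC]]; split; first exact: measurable_funM.
by exists (B * C) => x; rewrite normrM; apply: ler_pM.
Qed.

Lemma bmZ c f : bm f -> bm (fun x => c * f x).
Proof. by move=> hf; apply: bmM => //; exact: bm_cst. Qed.

Lemma bmN f : bm f -> bm (fun x => - f x).
Proof. by move=> /(bmZ (-1)); under eq_fun do rewrite mulN1r. Qed.

Lemma bmB f g : bm f -> bm g -> bm (fun x => f x - g x).
Proof. by move=> hf /bmN; exact: bmD. Qed.

Lemma bmX f : bm f -> bm (fun x => f x ^+ 2).
Proof. by move=> hf; under eq_fun do rewrite expr2; exact: bmM. Qed.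

Lemma bm_norm f : bm f -> bm (fun x => `|f x|).
Proof.
move=> [mf [B hB]]; split; last by exists B => x; rewrite normr_id.
exact: measurableT_comp.
Qed.

Lemma bm_sum (J : Type) (r : seq J) (f : J -> X -> R) :
  (forall j, bm (f j)) -> bm (fun x => \sum_(j <- r) f j x).
Proof.
move=> h; elim: r => [|j r IH].
  by under eq_fun do rewrite big_nil; exact: bm_cst.
by under eq_fun do rewrite big_cons; exact: bmD.
Qed.

Lemma bm_sqrt f : bm f -> bm (fun x => Num.sqrt (f x)).
Proof.
move=> [mf [B hB]]; split; last first.
  exists (Num.sqrt `|B|) => x; rewrite ger0_norm ?sqrtr_ge0// ler_wsqrtr//.
  exact: le_trans (le_trans (ler_norm _) (hB x)) (ler_norm _).
by apply: measurableT_comp => //; apply: continuous_measurable_fun; exact: sqrt_continuous.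
Qed.

Lemma bm_indic (S : set X) : measurable S -> bm (\1_S : X -> R).
Proof.
move=> mS; split; first exact: measurable_indic.
by exists 1 => x; rewrite indicE; case: (_ \in _); rewrite ?normr1 ?normr0.
Qed.

Lemma L1D f g : L1 f -> L1 g -> L1 (fun x => f x + g x).
Proof. by move=> hf hg; have := integrableD measurableT hf hg; exact. Qed.

Lemma L1Z c f : L1 f -> L1 (fun x => c * f x).
Proof. by move=> hf; have := integrableZl measurableT c hf; exact. Qed.

Lemma L1N f : L1 f -> L1 (fun x => - f x).
Proof. by move=> /(L1Z (-1)); under eq_fun do rewrite mulN1r. Qed.

Lemma L1B f g : L1 f -> L1 g -> L1 (fun x => f x - g x).
Proof. by move=> hf /L1N; exact: L1D. Qed.

Lemma L1_norm f : L1 f -> L1 (fun x => `|f x|).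
Proof. by move=> hf; have := integrable_abse hf; exact. Qed.

Lemma L1_meas f : L1 f -> measurable_fun [set: X] f.
Proof. by move=> /measurable_int/measurable_EFinP. Qed.

Lemma L1_le f g : measurable_fun [set: X] f -> (forall x, `|f x| <= g x) -> L1 g -> L1 f.
Proof.
move=> mf fg; apply: le_integrable => //; first exact/measurable_EFinP.
by move=> x _ /=; rewrite lee_fin (le_trans (fg x))// ler_norm.
Qed.

Lemma L1M f g : L1 f -> bm g -> L1 (fun x => f x * g x).
Proof.
move=> hf [mg [B hB]]; apply: (@L1_le _ (fun x => `|B| * `|f x|)).
- by apply: measurable_funM => //; exact: L1_meas.
- move=> x; rewrite normrM mulrC; apply: ler_wpM2r => //.
  exact: le_trans (hB x) (ler_norm _).
- exact: L1Z (L1_norm hf).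
Qed.

Lemma L1_sum (J : Type) (r : seq J) (f : J -> X -> R) :
  (forall j, L1 (f j)) -> L1 (fun x => \sum_(j <- r) f j x).
Proof.
move=> h; elim: r => [|j r IH].
  by under eq_fun do rewrite big_nil; apply: bm_L1; exact: bm_cst.
by under eq_fun do rewrite big_cons; exact: L1D.
Qed.

Lemma IntD f g : L1 f -> L1 g -> Int (fun x => f x + g x) = Int f + Int g.
Proof. exact: RintegralD. Qed.

Lemma IntB f g : L1 f -> L1 g -> Int (fun x => f x - g x) = Int f - Int g.
Proof. exact: RintegralB. Qed.

Lemma IntZ c f : L1 f -> Int (fun x => c * f x) = c * Int f.
Proof. exact: RintegralZl. Qed.

Lemma Int_cst c : Int (fun _ => c) = c * fine (mu [set: X]).
Proof. exact: Rintegral_cst. Qed.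

Lemma Int0 : Int (fun _ => 0) = 0. Proof. by rewrite Int_cst mul0r. Qed.

Lemma IntN f : L1 f -> Int (fun x => - f x) = - Int f.
Proof. by move=> /(IntZ (-1)); rewrite mulN1r => <-; under eq_fun do rewrite -mulN1r. Qed.

Lemma Int_sum (J : Type) (r : seq J) (f : J -> X -> R) :
  (forall j, L1 (f j)) -> Int (fun x => \sum_(j <- r) f j x) = \sum_(j <- r) Int (f j).
Proof.
move=> h; elim: r => [|j r IH].
  by rewrite big_nil; under eq_fun do rewrite big_nil; exact: Int0.
rewrite big_cons -IH -IntD//; last exact: L1_sum.
by under eq_fun do rewrite big_cons.
Qed.

Lemma le_Int f g : L1 f -> L1 g -> (forall x, f x <= g x) -> Int f <= Int g.
Proof. by move=> hf hg fg; apply: le_Rintegral => // x _; exact: fg. Qed.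

Lemma Int_ge0 f : (forall x, 0 <= f x) -> 0 <= Int f.
Proof. by move=> h; apply: Rintegral_ge0 => x _; exact: h. Qed.

Lemma norm_Int f : L1 f -> `|Int f| <= Int (fun x => `|f x|).
Proof. exact: le_normr_Rintegral. Qed.

Lemma Int_EFin f : L1 f -> (Int f)%:E = (\int[mu]_x (f x)%:E)%E.
Proof. by move=> hf; rewrite /Rintegral fineK//; exact: integrable_fin_num. Qed.

Lemma Int_ae f g : measurable_fun [set: X] f -> measurable_fun [set: X] g ->
  f = g %[ae mu] -> Int f = Int g.
Proof.
move=> mf mg fg; rewrite /Rintegral; congr fine; apply: ae_eq_integral => //.
- exact/measurable_EFinP.
- exact/measurable_EFinP.
- by apply: filterS fg => x /= h _; rewrite h.
Qed.

Lemma L1_ae f g : measurable_fun [set: X] g -> L1 f -> f = g %[ae mu] -> L1 g.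
Proof.
move=> mg hf fg; apply/integrableP; split; first exact/measurable_EFinP.
have /integrableP[_] := hf; apply: le_lt_trans; rewrite le_eqVlt; apply/orP; left; apply/eqP.
have mf := L1_meas hf.
apply: ae_eq_integral => //.
- by apply: measurableT_comp => //; exact/measurable_EFinP.
- by apply: measurableT_comp => //; exact/measurable_EFinP.
- by apply: filterS fg => x /= h _; rewrite h.
Qed.

Lemma Int_norm_eq0 f : L1 f -> Int (fun x => `|f x|) <= 0 -> f = (fun _ => 0) %[ae mu].
Proof.
move=> hf h0; have mf := L1_meas hf.
have : (\int[mu]_x `|(f x)%:E| = 0)%E.
  apply/eqP; rewrite eq_le; apply/andP; split; last by apply: integral_ge0.
  by rewrite -(Int_EFin (L1_norm hf)) lee_fin.
move/(ae_eq_integral_abs mu measurableT).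
have mfe : measurable_fun [set: X] (EFin \o f) by exact/measurable_EFinP.
move=> /(_ mfe); apply: filterS => x /= /(_ Logic.I) [->]//.
Qed.

Lemma Int_indic (S : set X) : measurable S -> Int (\1_S : X -> R) = fine (mu S).
Proof. by move=> mS; rewrite /Rintegral integral_indic// setIT. Qed.

(* [2 |Int (f g)| <= t Int f^2 + t^-1 Int g^2] without square roots. *)
Lemma Int_amgm f g t : 0 < t -> L1 (fun x => f x ^+ 2) -> L1 (fun x => g x ^+ 2) ->
  L1 (fun x => f x * g x) ->
  `|Int (fun x => f x * g x)| <= (t * Int (fun x => f x ^+ 2) + t^-1 * Int (fun x => g x ^+ 2)) / 2.
Proof.
move=> t0 hf hg hfg; apply: le_trans (norm_Int hfg) _.
rewrite -!IntZ// -IntD; do ?exact: L1Z.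
rewrite -mulrC -IntZ; last by apply: L1D; exact: L1Z.
apply: le_Int; [exact: L1_norm|by apply: L1Z; apply: L1D; exact: L1Z|move=> x].
rewrite normrM -(real_normK (num_real (f x))) -(real_normK (num_real (g x))) -subr_ge0.
rewrite (_ : _ - _ = 2^-1 * (t^-1 * (t * `|f x| - `|g x|) ^+ 2)); last by field; rewrite gt_eqF.
by apply: mulr_ge0 => //; apply: mulr_ge0; [rewrite invr_ge0; exact: ltW|exact: sqr_ge0].
Qed.

Lemma sqrt_Int_L2norm f : L1 (fun x => f x ^+ 2) -> L2norm mu f = (Num.sqrt (Int (fun x => f x ^+ 2)))%:E.
Proof.
move=> hf; rewrite /L2norm unlock /Lnorm/=.
rewrite (_ : (\int[mu]_x _)%E = (\int[mu]_x (f x ^+ 2)%:E)%E); last first.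
  by apply: eq_integral => x _; rewrite powR_mulrn// real_normK// num_real.
by rewrite -Int_EFin// poweR_EFin powR12_sqrt// Int_ge0// => x; exact: sqr_ge0.
Qed.

Lemma L2norm_fin f : measurable_fun [set: X] f -> (L2norm mu f < +oo)%E -> L1 (fun x => f x ^+ 2).
Proof.
move=> mf h; apply/integrableP; split.
  by apply/measurable_EFinP; exact: measurable_funX.
have : (L2norm mu f `^ 2 < +oo)%E by exact: poweR_lty.
rewrite /L2norm poweR_Lnorm//; apply: le_lt_trans; rewrite le_eqVlt; apply/orP; left; apply/eqP.
by apply: eq_integral => x _ /=; rewrite powR_mulrn// ger0_norm ?sqr_ge0// real_normK// num_real.
Qed.

Lemma L2norm_lt f e : measurable_fun [set: X] f -> (L2norm mu f < e%:E)%E ->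
  L1 (fun x => f x ^+ 2) /\ Int (fun x => f x ^+ 2) <= e ^+ 2.
Proof.
move=> mf h; have hf : L1 (fun x => f x ^+ 2).
  by apply: L2norm_fin => //; apply: lt_trans h (ltry _).
split=> //; move: h; rewrite sqrt_Int_L2norm// lte_fin => h.
have I0 : 0 <= Int (fun x => f x ^+ 2) by apply: Int_ge0 => x; exact: sqr_ge0.
rewrite -[leLHS](sqr_sqrtr I0); apply: lerXn2r; rewrite ?nnegrE ?sqrtr_ge0//; last exact: ltW.
by apply: le_trans (ltW h); exact: sqrtr_ge0.
Qed.

Lemma L2_L1 f : measurable_fun [set: X] f -> L1 (fun x => f x ^+ 2) -> L1 f.
Proof.
move=> mf hf; apply: (@L1_le _ (fun x => 1 + f x ^+ 2)) => //.
  move=> x; rewrite -(real_normK (num_real (f x))); have := sqr_ge0 (`|f x| - 1).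
  by have := normr_ge0 (f x); nra.
by apply: L1D => //; apply: bm_L1; exact: bm_cst.
Qed.
End Integration.

(** * The orthonormalised system and its coefficients *)

Section Orthonormalization.
Context {R : realType} {disp : measure_display} {X : measurableType disp}.
Variable mu : {measure set X -> \bar R}.
Hypothesis mufin : (mu [set: X] < +oo)%E.
Context {F : choiceType}.
Implicit Types (g : X -> R) (s : {fset F}).
Local Notation Int f := (Rintegral mu [set: X] f).
Local Notation L1 := (integrableR mu).
Variables (phi f : F -> X -> R).
Hypothesis bphi : forall P, bm (phi P).
Hypothesis fphi : gram_orthonormalization mu phi f.
Local Notation G := (gram_mx mu phi).
Local Notation A := (inv_sqrt_mx G).

Definition coef g P : R := Int (fun x => phi P x * g x).

Let bu Q P : bm (fun x => A P Q * phi P x). Proof. exact: bmZ. Qed.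

Lemma orth_meas Q : measurable_fun [set: X] (f Q).
Proof. by have [] := fphi Q. Qed.

Lemma orth_approx Q e : 0 < e -> exists s0 : {fset F}, forall s, (s0 `<=` s)%fset ->
  L1 (fun x => (f Q x - \sum_(P <- s) A P Q * phi P x) ^+ 2) /\
  Int (fun x => (f Q x - \sum_(P <- s) A P Q * phi P x) ^+ 2) <= e ^+ 2.
Proof.
move=> e0; have [mf _ h] := fphi Q; have [s0 hs] := h e e0; exists s0 => s ss.
apply: (L2norm_lt _ (hs _ ss)); apply: measurable_funB => //.
by have [] := @bm_sum _ _ _ _ s _ (bu Q).
Qed.

Lemma orth_sq Q : L1 (fun x => f Q x ^+ 2).
Proof. by have [mf hf _] := fphi Q; exact: L2norm_fin. Qed.

Lemma orth_L1 Q : L1 (f Q).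
Proof. by apply: (L2_L1 mufin); [exact: orth_meas|exact: orth_sq]. Qed.

(** Pairing with a bounded [g] is continuous in L2, so the L2 expansion of [f Q] can be integrated
    term by term. *)
Lemma orth_coef Q g : bm g -> hsum (fun P => A P Q * coef g P) (Int (fun x => f Q x * g x)).
Proof.
move=> bg e e0; have bg2 := bm_L1 mufin (bmX bg).
pose K := 1 + Int (fun x => g x ^+ 2).
have K0 : 0 < K by rewrite ltr_pwDl// Int_ge0// => x; exact: sqr_ge0.
have eK : 0 < e / K by rewrite divr_gt0.
have [s0 hs] := orth_approx Q eK; exists s0 => s ss; have [h1 h2] := hs _ ss.
have bS := @bm_sum _ _ _ _ s _ (bu Q).
have mfs : measurable_fun [set: X] (fun x => f Q x - \sum_(P <- s) A P Q * phi P x).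
  by apply: measurable_funB; [exact: orth_meas|case: bS].
have L1d := L2_L1 mufin mfs h1.
have -> : \sum_(P <- s) A P Q * coef g P - Int (fun x => f Q x * g x) =
  - Int (fun x => (f Q x - \sum_(P <- s) A P Q * phi P x) * g x).
  rewrite (_ : (fun x => (_ - _) * g x) = fun x => f Q x * g x - \sum_(P <- s) A P Q * (phi P x * g x)).
    rewrite IntB; [|exact: L1M (orth_L1 Q) bg|]; last first.
      by apply: bm_L1 => //; apply: bm_sum => P; apply: bmZ; exact: bmM.
    rewrite Int_sum//; last by move=> P; apply: bm_L1 => //; apply: bmZ; exact: bmM.
    rewrite opprB; congr (_ - _); apply: eq_bigr => P _.
    by rewrite IntZ//; apply: bm_L1 => //; exact: bmM.
  by apply/funext => x; rewrite mulrBl mulr_suml; congr (_ - _); apply: eq_bigr => P _; rewrite mulrA.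
(* With this parameter the two terms of Young's inequality add up to [e / 2]. *)
rewrite normrN; have := Int_amgm (t := K / e) _ h1 bg2 (L1M L1d bg).
move=> /(_ (divr_gt0 K0 e0)); move=> /le_trans; apply.
apply: le_trans (_ : (K / e * (e / K) ^+ 2 + (K / e)^-1 * Int (fun x => g x ^+ 2)) / 2 <= _).
  by apply: ler_wpM2r => //; rewrite lerD2r; apply: ler_wpM2l => //; rewrite divr_ge0// ltW.
rewrite (_ : _ / 2 = (e / K) * K / 2); last by rewrite /K; field; rewrite !gt_eqF.
by rewrite divfK ?gt_eqF// ler_pdivrMr// ler_peMr// ?ler1n// ltW.
Qed.

(** The excess of [|f Q|] over [B] is at most the distance to any partial sum, so its square has
    arbitrarily small integral; clipping [f Q] at [B] changes it only on a null set. *)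
Lemma orth_bounded Q : (exists B, forall s x, `|\sum_(P <- s) A P Q * phi P x| <= B) ->
  exists f', bm f' /\ f Q = f' %[ae mu].
Proof.
move=> [B hB]; have B0 : 0 <= B by apply: le_trans (hB fset0 point).
pose f' x := Num.max (Num.min (f Q x) B) (- B).
have mf := orth_meas Q.
exists f'; split.
  split; last first.
    exists B => x; rewrite /f' ler_norml le_max lexx orbT/= ge_max ge_min lexx orbT/=; lra.
  apply: measurable_maxr; last exact: measurable_cst.
  by apply: measurable_minr => //; exact: measurable_cst.
pose k x := Num.max (`|f Q x| - B) 0.
have mk : measurable_fun [set: X] k.
  apply: measurable_maxr; last exact: measurable_cst.
  apply: measurable_funB; last exact: measurable_cst.
  exact: measurableT_comp.
have kle s x : k x ^+ 2 <= (f Q x - \sum_(P <- s) A P Q * phi P x) ^+ 2.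
  rewrite -(real_normK (num_real (f Q x - _))); apply: lerXn2r; rewrite ?nnegrE//.
    by rewrite /k le_max lexx orbT.
  rewrite /k ge_max normr_ge0 andbT; have := hB s x.
  have := ler_normD (f Q x - \sum_(P <- s) A P Q * phi P x) (\sum_(P <- s) A P Q * phi P x).
  by rewrite subrK; lra.
have Lk : L1 (fun x => k x ^+ 2).
  have [s0 /(_ s0 (fsubset_refl _))[h _]] := @orth_approx Q 1 ltr01.
  apply: L1_le h; first exact: measurable_funX.
  by move=> x; rewrite ger0_norm ?sqr_ge0.
have Ik : Int (fun x => k x ^+ 2) <= 0.
  apply/ler_addgt0Pr => e e0; rewrite add0r.
  have se : 0 < Num.sqrt e by rewrite sqrtr_gt0.
  have [s0 /(_ s0 (fsubset_refl _))[h1 h2]] := orth_approx Q se.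
  rewrite sqr_sqrtr in h2; last exact: ltW.
  by apply: le_trans h2; exact: le_Int.
have : Int (fun x => `|k x ^+ 2|) <= 0 by under eq_fun do rewrite ger0_norm ?sqr_ge0//.
move/(Int_norm_eq0 Lk); apply: filterS => x /= /(_ Logic.I)/eqP; rewrite sqrf_eq0 => /eqP kx _.
have : `|f Q x| <= B.
  by have : `|f Q x| - B <= k x; [rewrite /k le_max lexx|rewrite kx; lra].
rewrite ler_norml /f' => /andP[h1 h2].
by rewrite (min_idPl h2) (max_idPl h1).
Qed.

(** Expand the integral of [(g - K^-1 sum_P <g, phi_P> phi_P)^2], which is nonnegative, and bound
    the Gram form by [K]. *)
Lemma bessel K g : 0 < K ->
  (forall s (u : F -> R), \sum_(P <- s) \sum_(Q <- s) u P * u Q * G P Q <= K * \sum_(P <- s) u P ^+ 2) ->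
  bm g -> sqbounded (coef g) (K * Int (fun x => g x ^+ 2)).
Proof.
move=> K0 hG bg s; pose u := coef g; pose gs x := \sum_(P <- s) u P * phi P x.
have bgs : bm gs by apply: bm_sum => P; exact: bmZ.
have bpg P : bm (fun x => phi P x * g x) by exact: bmM.
have Igg : Int (fun x => gs x * g x) = \sum_(P <- s) u P ^+ 2.
  rewrite (_ : (fun x => _) = fun x => \sum_(P <- s) u P * (phi P x * g x)); last first.
    by apply/funext => x; rewrite mulr_suml; apply: eq_bigr => P _; rewrite mulrA.
  rewrite Int_sum//; last by move=> P; apply: bm_L1 => //; exact: bmZ.
  by apply: eq_bigr => P _; rewrite IntZ ?expr2//; exact: bm_L1.
have Igs : Int (fun x => gs x ^+ 2) = \sum_(P <- s) \sum_(Q <- s) u P * u Q * G P Q.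
  rewrite (_ : (fun x => _) = fun x => \sum_(P <- s) \sum_(Q <- s) u P * u Q * (phi P x * phi Q x)).
    rewrite Int_sum//; last first.
      by move=> P; apply: bm_L1 => //; apply: bm_sum => Q; apply: bmZ; exact: bmM.
    apply: eq_bigr => P _; rewrite Int_sum//; last first.
      by move=> Q; apply: bm_L1 => //; apply: bmZ; exact: bmM.
    by apply: eq_bigr => Q _; rewrite IntZ//; apply: bm_L1 => //; exact: bmM.
  apply/funext => x; rewrite expr2 /gs mulr_suml; apply: eq_bigr => P _.
  by rewrite mulr_sumr; apply: eq_bigr => Q _; ring.
have : 0 <= Int (fun x => (g x - K^-1 * gs x) ^+ 2) by apply: Int_ge0 => x; exact: sqr_ge0.
rewrite (_ : (fun x => _) = fun x => g x ^+ 2 + (K^-1 ^+ 2 * gs x ^+ 2 + (- 2 * K^-1) * (gs x * g x))); last first.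
  by apply/funext => x; ring.
have l1 := bm_L1 mufin (bmX bg). have l2 := bm_L1 mufin (bmX bgs).
have l3 := bm_L1 mufin (bmM bgs bg).
rewrite IntD//; last by apply: L1D; exact: L1Z.
rewrite IntD//; do ?exact: L1Z; rewrite !IntZ// Igg Igs.
have := hG s u; set U := \sum_(P <- s) u P ^+ 2; set V := \sum_(P <- s) _; set W := Int _.
move=> VU h; have KK : K * K^-1 = 1 by rewrite divff// gt_eqF.
have h2 : K^-1 ^+ 2 * V <= K^-1 * U.
  rewrite expr2 -mulrA; apply: ler_wpM2l; first by rewrite invr_ge0 ltW.
  by rewrite mulrC ler_pdivrMr// mulrC.
have h3 : 0 <= W - K^-1 * U by move: h h2; lra.
have := mulr_ge0 (ltW K0) h3; rewrite mulrBr mulrA KK mul1r; rewrite /U /u; lra.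
Qed.

Hypothesis invA : is_inv_sqrt_mx G A.

Lemma coef_orth Q g : bm g -> ell2 (coef g) -> Int (fun x => f Q x * g x) = mxapp A (coef g) Q.
Proof.
move=> bg hg; have [_ bA [sA _] _ _] := invA.
apply: hsum_unique (orth_coef Q bg) _.
by have := mxapp_hsum Q bA hg; under [X in hsum X]eq_fun do rewrite sA.
Qed.

(** The coefficients of [f Q] against [phi] are [G A e_Q], and [A G A = I]. One factor is replaced
    by its bounded version so that [coef_orth] applies. *)
Lemma orth_orthonormal Q P f' : bm f' -> f Q = f' %[ae mu] -> Int (fun x => f P x * f' x) = (P == Q)%:R.
Proof.
move=> bf' ff'; have [bG bA [sA _] h1 h2] := invA.
have [CA [_ A2 _ _ _]] := bounded_mx_l2op bA; have [CG [_ G2 _ _ _]] := bounded_mx_l2op bG.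
have eQ := @ell2_edelta R F Q; have hAe := A2 _ eQ.
have cE : coef f' = mxapp G (mxapp A (edelta Q)).
  apply/funext => S; apply: hsum_unique (mxapp_hsum S bG hAe).
  rewrite /coef.
  have -> : Int (fun x => phi S x * f' x) = Int (fun x => f Q x * phi S x).
    apply: Int_ae.
    - by have [] := bmM (bphi S) bf'.
    - by apply: measurable_funM; [exact: orth_meas|case: (bphi S)].
    - by apply: filterS ff' => x /= h _; rewrite h// mulrC.
  have := orth_coef Q (bphi S); congr (hsum _ _); apply/funext => T.
  rewrite mxapp_edelta// mulrC /coef /gram_mx; congr (_ * _); congr Rintegral.
  by apply/funext => x; rewrite mulrC.
rewrite (coef_orth _ bf'); last by rewrite cE; exact: G2.
(* [G A A = I = A A G] forces [G A = A G]. *)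
have comm : mxapp G (mxapp A (edelta Q)) = mxapp A (mxapp G (edelta Q)).
  by rewrite -{1}(h2 _ eQ) h1//; apply: A2; exact: G2.
by rewrite cE comm h2.
Qed.
End Orthonormalization.

(** * L1 limits of fast Cauchy sequences and conditional expectations *)

Section Limits.
Context {R : realType} {disp : measure_display} {X : measurableType disp}.
Variable mu : {measure set X -> \bar R}.
Hypothesis mufin : (mu [set: X] < +oo)%E.
Implicit Types (f g : X -> R) (S : set (set X)).
Local Notation Int f := (Rintegral mu [set: X] f).
Local Notation L1 := (integrableR mu).

Lemma limn_einf_le (u : nat -> \bar R) K N :
  (forall n, (N <= n)%N -> (u n <= K)%E) -> (limn_einf u <= K)%E.
Proof.
move=> h; rewrite limn_einf_lim; apply: lime_le; first exact: is_cvg_einfs.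
exists N => // n /= Nn; apply: le_trans (h _ Nn).
by apply: ereal_inf_lbound; exists n => /=.
Qed.

Lemma sub_measurable S : (forall A, S A -> measurable A) -> forall A, <<s S >> A -> measurable A.
Proof.
by move=> h; apply: smallest_sub => //; exact: sigma_algebra_measurable.
Qed.

Lemma sub_measurable_fun S g : (forall A, S A -> measurable A) ->
  measurable_fun [set: g_sigma_algebraType S] (g : g_sigma_algebraType S -> R) ->
  measurable_fun [set: X] g.
Proof.
move=> hS mg mT Y mY; apply: (sub_measurable hS).
by have := mg measurableT Y mY.
Qed.

Lemma L1_ler f g : L1 f -> L1 g -> Int (fun x => `|f x + g x|) <= Int (fun x => `|f x|) + Int (fun x => `|g x|).
Proof.
move=> hf hg; rewrite -IntD; [|exact: L1_norm|exact: L1_norm].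
apply: le_Int; [by apply: L1_norm; exact: L1D|by apply: L1D; exact: L1_norm|].
by move=> x; exact: ler_normD.
Qed.

Lemma L1_dist f g k : L1 f -> L1 g -> L1 k ->
  Int (fun x => `|f x - k x|) <= Int (fun x => `|f x - g x|) + Int (fun x => `|g x - k x|).
Proof.
move=> hf hg hk; have := L1_ler (L1B hf hg) (L1B hg hk).
by under eq_fun do rewrite addrA subrK.
Qed.

Section Complete.
Variables (V : nat -> X -> R).
Hypothesis LV : forall j, L1 (V j).
Hypothesis dV : forall j, Int (fun x => `|V j.+1 x - V j x|) <= 2^-1 ^+ j.

(** A limsup is defined at every point, so measurability for a sub-sigma-algebra is inherited
    without completing it by null sets. *)
Definition fast_limit x : R := fine (limn_esup (fun j => (V j x)%:E)).

Lemma fast_limit_measurable S :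
  (forall j, measurable_fun [set: g_sigma_algebraType S] (V j : g_sigma_algebraType S -> R)) ->
  measurable_fun [set: g_sigma_algebraType S] (fast_limit : g_sigma_algebraType S -> R).
Proof.
move=> mV; apply: measurableT_comp; first exact: fine_measurable.
by apply: measurable_fun_limn_esup => j; exact/measurable_EFinP.
Qed.

Let mlim : measurable_fun [set: X] fast_limit.
Proof.
apply: measurableT_comp; first exact: fine_measurable.
by apply: measurable_fun_limn_esup => j; apply/measurable_EFinP; exact: L1_meas.
Qed.

Lemma half_sum n m : \sum_(n <= j < m) (2^-1 : R) ^+ j <= 2 * 2^-1 ^+ n.
Proof.
have q0 k : 0 <= (2^-1 : R) ^+ k by rewrite exprn_ge0.
case: (leqP m n) => [mn|nm]; first by rewrite big_geq// mulr_ge0.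
suff : \sum_(n <= j < m) (2^-1 : R) ^+ j <= 2 * 2^-1 ^+ n - 2 * 2^-1 ^+ m.
  by move=> /le_trans; apply; rewrite gerBl mulr_ge0.
elim: m nm => // m IH; rewrite ltnS leq_eqVlt => /predU1P[<-|nm].
  rewrite big_nat1 exprS; have := q0 n; set y := _ ^+ n; lra.
rewrite big_nat_recr ?(ltnW nm)//= exprS; have := IH nm; have := q0 m.
set y := _ ^+ m; set z := _ ^+ n; set T := \sum_(_ <= _ < _) _; lra.
Qed.

Lemma fast_cauchy i j : (i <= j)%N -> Int (fun x => `|V j x - V i x|) <= 2 * 2^-1 ^+ i.
Proof.
move=> ij; apply: le_trans (half_sum i j).
elim: j ij => [|j IH]; rewrite ?leqn0.
  move=> /eqP ->; rewrite big_geq//; under eq_fun do rewrite subrr normr0; by rewrite Int0.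
rewrite leq_eqVlt => /predU1P[->|].
  by rewrite big_geq//; under eq_fun do rewrite subrr normr0; rewrite Int0.
rewrite ltnS => ij; rewrite big_nat_recr//=.
apply: le_trans (L1_dist (LV j.+1) (LV j) (LV i)) _.
by rewrite [leRHS]addrC; apply: lerD; [exact: dV|exact: IH].
Qed.

(** The sum of [|V (j+1) - V j|] has finite integral, so it is finite almost everywhere and the
    telescoping series converges absolutely there. *)
Lemma fast_limit_cvg : {ae mu, forall x, V j x @[j --> \oo] --> fast_limit x}.
Proof.
pose D j x : \bar R := (`|V j.+1 x - V j x|)%:E.
have mD j : measurable_fun [set: X] (D j).
  by apply/measurable_EFinP; apply: L1_meas; apply: L1_norm; exact: L1B.
have D0 j x : (0 <= D j x)%E by rewrite lee_fin.
have mS : measurable_fun [set: X] (fun x => (\sum_(0 <= j <oo) D j x)%E).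
  by apply: ge0_emeasurable_sum => // j x _ _; exact: D0.
have iS : mu.-integrable [set: X] (fun x => (\sum_(0 <= j <oo) D j x)%E).
  apply/integrableP; split => //.
  rewrite (_ : (\int[mu]_x _)%E = (\int[mu]_x \sum_(0 <= j <oo) D j x)%E); last first.
    by apply: eq_integral => x _; rewrite gee0_abs//; apply: nneseries_ge0 => j _ _; exact: D0.
  rewrite integral_nneseries//.
  apply: (@le_lt_trans _ _ (2%:E)); last exact: ltry.
  apply: lime_le; first by apply: is_cvg_nneseries => j _ _; apply: integral_ge0 => x _; exact: D0.
  apply: nearW => n; apply: (@le_trans _ _ (\sum_(0 <= j < n) (2^-1 ^+ j)%:E)%E).
    apply: lee_sum => j _; rewrite /D -Int_EFin; last by apply: L1_norm; exact: L1B.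
    by rewrite lee_fin.
  by rewrite sumEFin lee_fin; have := half_sum 0 n; rewrite expr0 mulr1.
apply: filterS (integrable_ae measurableT iS) => x /(_ Logic.I) fin.
have cv : cvgn (fun j => V j x).
  have cs : cvgn (series (fun j => V j.+1 x - V j x)).
    apply: normed_cvg; apply: nondecreasing_is_cvgn.
      by apply: nondecreasing_series => j _ _; exact: normr_ge0.
    exists (fine (\sum_(0 <= j <oo) D j x)%E) => _ [n _ <-].
    rewrite -lee_fin fineK// /series/= -sumEFin; apply: nneseries_lim_ge => j _ _; exact: D0.
  have E : (fun j => V j x) = fun j => V 0%N x + series (fun j => V j.+1 x - V j x) j.
    by apply/funext => j; rewrite /series/= telescope_sumr// addrC subrK.
  by rewrite E; apply: is_cvgD => //; exact: is_cvg_cst.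
have cl : (fun j => (V j x)%:E) @ \oo --> (limn (fun j => V j x))%:E.
  by apply: cvg_EFin => //; exact: nearW.
by rewrite /fast_limit (cvg_limn_einf_sup cl).2.
Qed.

(** Fatou's lemma for [|V j - V i|]. *)
Lemma fast_limit_dist i : L1 (fun x => fast_limit x - V i x) /\
  Int (fun x => `|fast_limit x - V i x|) <= 2 * 2^-1 ^+ i.
Proof.
have mi : measurable_fun [set: X] (fun x => fast_limit x - V i x).
  by apply: measurable_funB => //; exact: L1_meas.
have key : (\int[mu]_x `|(fast_limit x - V i x)%:E| <= (2 * 2^-1 ^+ i)%:E)%E.
  have mj j : measurable_fun [set: X] (fun x => (`|V j x - V i x|)%:E).
    by apply/measurable_EFinP; apply: L1_meas; apply: L1_norm; exact: L1B.
  have fat := @fatou _ _ _ mu _ measurableT (fun j x => (`|V j x - V i x|)%:E) mj (fun _ _ _ => normr_ge0 _).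
  have E : (\int[mu]_x `|(fast_limit x - V i x)%:E| = \int[mu]_x limn_einf (fun j => (`|V j x - V i x|)%:E))%E.
    apply: ae_eq_integral => //.
    - by apply: measurableT_comp => //; exact/measurable_EFinP.
    - rewrite /limn_einf; apply: measurableT_comp => //.
      by apply: measurable_fun_limn_esup => j; apply: measurableT_comp.
    - apply: filterS fast_limit_cvg => x cx _.
      have : (fun j => (`|V j x - V i x|)%:E) @ \oo --> (`|fast_limit x - V i x|)%:E.
        apply: cvg_EFin; first exact: nearW.
        by apply: cvg_norm; apply: cvgB => //; exact: cvg_cst.
      by move=> /cvg_limn_einf_sup[-> _].
  rewrite E; apply: le_trans fat _; apply: (@limn_einf_le _ _ i) => j ij.
  by rewrite -Int_EFin ?lee_fin ?fast_cauchy//; apply: L1_norm; exact: L1B.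
have L : L1 (fun x => fast_limit x - V i x).
  by apply/integrableP; split; [exact/measurable_EFinP|apply: le_lt_trans key (ltry _)].
split=> //; rewrite -lee_fin Int_EFin//; exact: L1_norm.
Qed.

Lemma fast_limit_L1 : L1 fast_limit.
Proof.
have [h _] := fast_limit_dist 0; have := L1D h (LV 0).
by under eq_fun do rewrite subrK.
Qed.
End Complete.

(** The set where one version lies strictly below the other belongs to the sigma-algebra; the two
    integrals over it agree, so it is null. *)
Lemma cond_exp_unique S f g1 g2 : (forall A, S A -> measurable A) ->
  is_cond_exp mu S f g1 -> is_cond_exp mu S f g2 -> g1 = g2 %[ae mu].
Proof.
move=> hS [m1 i1 e1] [m2 i2 e2].
pose A := [set x | g1 x < g2 x]; pose B := [set x | g2 x < g1 x].
have hm (k1 k2 : X -> R) :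
    measurable_fun [set: g_sigma_algebraType S] (k1 : g_sigma_algebraType S -> R) ->
    measurable_fun [set: g_sigma_algebraType S] (k2 : g_sigma_algebraType S -> R) ->
    <<s S >> [set x | k1 x < k2 x].
  move=> h1 h2.
  have -> : [set x | k1 x < k2 x] = [set: g_sigma_algebraType S] `&`
      (fun x : g_sigma_algebraType S => k1 x < k2 x) @^-1` [set true].
    by rewrite setTI; apply/seteqP; split => x /=.
  exact: (measurable_fun_ltr h1 h2 measurableT).
have half (k1 k2 : X -> R) : L1 k1 -> L1 k2 ->
    measurable_fun [set: g_sigma_algebraType S] (k1 : g_sigma_algebraType S -> R) ->
    measurable_fun [set: g_sigma_algebraType S] (k2 : g_sigma_algebraType S -> R) ->
    (forall A, <<s S >> A -> \int[mu]_(x in A) k1 x = \int[mu]_(x in A) k2 x) ->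
    {ae mu, forall x, k2 x <= k1 x}.
  move=> l1 l2 h1 h2 hI; pose E := [set x | k1 x < k2 x].
  have sE : <<s S >> E by exact: hm.
  have mE : measurable E := sub_measurable hS sE.
  pose k x := (k2 x - k1 x) * \1_E x.
  have lk : L1 k by exact: (L1M (L1B l2 l1) (bm_indic mE)).
  have k0 x : 0 <= k x.
    rewrite /k indicE; case: (boolP (x \in E)) => [/set_mem Ex|_]; last by rewrite mulr0.
    by rewrite mulr1 subr_ge0 ltW.
  have : Int (fun x => `|k x|) <= 0.
    under eq_fun do rewrite ger0_norm//.
    have -> : Int k = \int[mu]_(x in E) k2 x - \int[mu]_(x in E) k1 x.
      rewrite -RintegralB//; [|exact: integrableS l2|exact: integrableS l1].
      rewrite [RHS]Rintegral_mkcond; congr Rintegral; apply/funext => x.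
      by rewrite /k patchE indicE; case: ifP; rewrite ?mulr1 ?mulr0.
    by rewrite hI// subrr.
  move=> /(Int_norm_eq0 lk); apply: filterS => x /= /(_ Logic.I) kx.
  rewrite leNgt; apply/negP => Ex.
  move: kx; rewrite /k indicE mem_set// mulr1 => /eqP; rewrite subr_eq0 => /eqP kk.
  by move: Ex; rewrite kk ltxx.
have a1 := half _ _ i1 i2 m1 m2 (fun A hA => etrans (e1 A hA) (esym (e2 A hA))).
have a2 := half _ _ i2 i1 m2 m1 (fun A hA => etrans (e2 A hA) (esym (e1 A hA))).
apply: filterS2 a1 a2 => x h1 h2 _; apply/eqP; by rewrite eq_le h1 h2.
Qed.

Lemma cond_expP S f g : (forall A, S A -> measurable A) -> is_cond_exp mu S f g ->
  is_cond_exp mu S f (cond_exp mu S f) /\ cond_exp mu S f = g %[ae mu].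
Proof.
move=> hS hg; have h : is_cond_exp mu S f (cond_exp mu S f).
  by rewrite /cond_exp; apply: xgetPex; exists g.
by split=> //; exact: cond_exp_unique hS h hg.
Qed.
End Limits.

(** * From atoms to functions with an atomic representation *)

Section Transfer.
Context {R : realType} {disp : measure_display} {X : measurableType disp}.
Variable mu : {measure set X -> \bar R}.
Hypothesis mufin : (mu [set: X] < +oo)%E.
Variable d : X -> X -> R.
Context {F : choiceType}.
Implicit Types (g : X -> R) (s : {fset F}) (u v : F -> R).
Local Notation Int f := (Rintegral mu [set: X] f).
Local Notation L1 := (integrableR mu).
Variable f' : F -> X -> R.
Hypothesis bf' : forall P, bm (f' P).

(** The coefficient of [g] along [f_P], computed with a bounded version so that it is defined for
    every integrable [g]. *)
Definition dualcoef g P : R := Int (fun x => g x * f' P x).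
Local Notation c := dualcoef.

Lemma dualcoefD g1 g2 : L1 g1 -> L1 g2 ->
  c (fun x => g1 x + g2 x) = fun P => c g1 P + c g2 P.
Proof.
move=> h1 h2; apply/funext => P; rewrite /c -IntD; [|exact: L1M|exact: L1M].
by congr Rintegral; apply/funext => x; rewrite mulrDl.
Qed.

Lemma dualcoefZ k g : L1 g -> c (fun x => k * g x) = fun P => k * c g P.
Proof.
move=> h; apply/funext => P; rewrite /c -IntZ; last exact: L1M.
by congr Rintegral; apply/funext => x; rewrite mulrA.
Qed.

Lemma dualcoef_le : exists B : F -> R, (forall P, 0 <= B P) /\
  forall g P, L1 g -> `|c g P| <= B P * Int (fun x => `|g x|).
Proof.
have [B hB] : {B : F -> R & forall P x, `|f' P x| <= B P}.
  by apply: (@choice _ _ (fun P B => forall x, `|f' P x| <= B)) => P; have [_] := bf' P.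
exists (fun P => `|B P|); split=> // g P hg.
apply: le_trans (norm_Int (L1M hg (bf' P))) _; rewrite -IntZ; last exact: L1_norm.
apply: le_Int; [by apply: L1_norm; exact: L1M|by apply: L1Z; exact: L1_norm|move=> x].
rewrite normrM mulrC; apply: ler_wpM2r => //; exact: le_trans (hB P x) (ler_norm _).
Qed.

(** Control by finitely many coordinates makes the seminorm of [dualcoef g] continuous for L1
    convergence of [g]; this is what lets bounds on atoms pass to infinite atomic sums. *)
Definition fseminorm (q : (F -> R) -> R) :=
  [/\ forall u v, q (fun i => u i + v i) <= q u + q v,
      forall k u, q (fun i => k * u i) <= `|k| * q u
    & exists (s : {fset F}) (k : R), 0 <= k /\ forall u, q u <= k * \sum_(P <- s) `|u P|].

Lemma fseminorm0 q : fseminorm q -> q (fun _ => 0) <= 0.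
Proof.
by move=> [_ _ [s [k [_ h]]]]; apply: le_trans (h _) _; rewrite big1 ?mulr0// => P _; exact: normr0.
Qed.

Hypothesis atom_L1 : forall a, H1_atom mu d a -> L1 a.

Lemma rep_L1 (lam : nat -> R) (a : nat -> X -> R) n : (forall i, H1_atom mu d (a i)) ->
  L1 (fun x => \sum_(i < n) lam i * a i x).
Proof.
by move=> ha; apply: (@L1_sum _ _ _ _ mufin 'I_n _ (fun i x => lam i * a i x)) => i; apply: L1Z; exact: atom_L1.
Qed.

Lemma rep_approx g lam a : L1 g -> H1_representation mu d g lam a ->
  forall e, 0 < e -> exists N, forall n, (N <= n)%N ->
    Int (fun x => `|g x - \sum_(i < n) lam i * a i x|) <= e.
Proof.
move=> hg [ha _ hl] e e0; have /fine_cvgP[_ /cvgr0Pnorm_le/(_ _ e0)[N _ hN]] := hl.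
exists N => n Nn; have := hN n Nn; apply: le_trans; apply: le_trans (ler_norm _).
by rewrite /Rintegral.
Qed.

Lemma rep_sum_le g lam a n : H1_representation mu d g lam a ->
  \sum_(i < n) `|lam i| <= fine (\sum_(0 <= i <oo) `|lam i|%:E)%E.
Proof.
move=> [_ hs _]; rewrite -lee_fin fineK.
  by rewrite -sumEFin -(big_mkord xpredT (fun i => `|lam i|%:E)); apply: nneseries_lim_ge => i _ _; rewrite lee_fin.
by rewrite ge0_fin_numE//; apply: nneseries_ge0 => i _ _; rewrite lee_fin.
Qed.

Lemma fseminorm_sum q (C0 : R) (lam : nat -> R) (a : nat -> X -> R) n : fseminorm q -> 
  (forall i, H1_atom mu d (a i)) -> (forall i, (i < n)%N -> q (c (a i)) <= C0) ->
  q (c (fun x => \sum_(i < n) lam i * a i x)) <= C0 * \sum_(i < n) `|lam i|.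
Proof.
move=> hq ha; have [qD qZ _] := hq; elim: n => [_|n IH hC].
  rewrite big_ord0 mulr0; apply: le_trans (fseminorm0 hq).
  rewrite le_eqVlt; apply/orP; left; apply/eqP; congr q; apply/funext => P.
  rewrite /c (_ : (fun x => _) = fun=> 0) ?Int0//.
  by apply/funext => x; rewrite big_ord0 mul0r.
rewrite (_ : (fun x => _) = fun x => \sum_(i < n) lam i * a i x + lam n * a n x); last first.
  by apply/funext => x; rewrite big_ord_recr.
have hn := atom_L1 (ha n).
rewrite dualcoefD; [|exact: rep_L1|exact: L1Z].
apply: le_trans (qD _ _) _; rewrite big_ord_recr/= mulrDr; apply: lerD; first by apply: IH => i /ltnW; exact: hC.
rewrite dualcoefZ//; apply: le_trans (qZ _ _) _; rewrite mulrC.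
by apply: ler_wpM2r => //; exact: hC.
Qed.

(** Subadditivity treats the finite partial sums of the representation, smallness in L1 the
    remainder. *)
Lemma fseminorm_transfer q C0 g lam a : fseminorm q -> 0 <= C0 ->
  (forall i, q (c (a i)) <= C0) -> L1 g -> H1_representation mu d g lam a ->
  q (c g) <= C0 * fine (\sum_(0 <= i <oo) `|lam i|%:E)%E.
Proof.
move=> hq C0_ge0 hC hg hr; have [qD qZ [s [k [k0 hk]]]] := hq; have [ha _ _] := hr.
have [B [B0 hB]] := dualcoef_le.
apply/ler_addgt0Pr => e e0; pose K := k * \sum_(P <- s) B P + 1.
have K0 : 0 < K by rewrite ltr_wpDl// mulr_ge0// sumr_ge0.
have [N hN] := rep_approx hg hr (divr_gt0 e0 K0); have {}hN := hN N (leqnn N).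
have l1 := @rep_L1 lam a N ha; have l2 := L1B hg l1.
have -> : c g = fun P => c (fun x => \sum_(i < N) lam i * a i x) P +
    c (fun x => g x - \sum_(i < N) lam i * a i x) P.
  by rewrite -dualcoefD//; congr c; apply/funext => x; rewrite addrC subrK.
apply: le_trans (qD _ _) _; apply: lerD.
  apply: le_trans (fseminorm_sum lam hq ha (fun i _ => hC i)) _; apply: ler_wpM2l => //; exact: rep_sum_le hr.
apply: le_trans (hk _) _.
apply: le_trans (_ : k * (\sum_(P <- s) B P * (e / K)) <= _).
  apply: ler_wpM2l => //; apply: ler_sum => P _; apply: le_trans (hB _ P l2) _.
  by apply: ler_wpM2l.
rewrite -mulr_suml mulrA mulrCA -[leRHS]mulr1; apply: ler_wpM2l; first exact: ltW.
by rewrite ler_pdivrMr// mul1r /K lerDl.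
Qed.

(** The remainder after [k] atoms is represented by the remaining atoms, so its atomic mass is a
    tail of a convergent series. *)
Lemma rep_shift g lam a k : L1 g -> H1_representation mu d g lam a ->
  H1_representation mu d (fun x => g x - \sum_(i < k) lam i * a i x)
    (fun i => lam (i + k)%N) (fun i => a (i + k)%N).
Proof.
move=> hg [ha hs hl]; split=> //.
  have := hs; rewrite (nneseries_split 0 k); last by move=> i _; rewrite lee_fin.
  rewrite add0n => h; apply: le_lt_trans h.
  rewrite -[leLHS]add0e; apply: leeD; first by apply: sume_ge0 => i _; rewrite lee_fin.
  rewrite -nneseries_addn; last by move=> i; rewrite lee_fin.
  by [].
rewrite -(cvg_shiftn k) in hl; apply: cvg_trans hl; apply: near_eq_cvg; apply: nearW => n /=.
apply: eq_integral => x _; congr (`|_|%:E)%E; rewrite -addrA; congr (_ + _).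
rewrite -opprD; congr (- _).
rewrite -!(big_mkord xpredT (fun i => lam i * a i x)) (big_cat_nat _ (leq_addl n k))//=; congr (_ + _).
have E (G : nat -> R) : \sum_(k <= i < n + k) G i = \sum_(0 <= i < n) G (i + k)%N.
  by rewrite -[X in \sum_(X <= _ < _) _]add0n big_addn addnK.
by rewrite E big_mkord.
Qed.
End Transfer.

(** Views a finite Euclidean norm as an ell2 norm, from which it inherits the triangle
    inequality. *)
Lemma sqrt_sum_sqr (R : realType) (F : choiceType) (s : {fset F}) (y : F -> R) :
  Num.sqrt (\sum_(P <- s) y P ^+ 2) = nrm (fun P => if P \in s then y P else 0).
Proof.
have h2 : ell2 (fun P => if P \in s then y P else 0).
  by apply: (@ell2_fin _ _ _ s) => P /negbTE ->.
rewrite /nrm; congr Num.sqrt; apply/esym/ip_eq => //.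
rewrite (eq_big_seq (fun P => (if P \in s then y P else 0) * (if P \in s then y P else 0))).
  by apply: hsum_fin => P /negbTE ->; rewrite mul0r.
by move=> P /= ->; rewrite expr2.
Qed.

Lemma sqrt_sum_sqrD (R : realType) (F : choiceType) (s : {fset F}) (y z : F -> R) :
  Num.sqrt (\sum_(P <- s) (y P + z P) ^+ 2) <=
  Num.sqrt (\sum_(P <- s) y P ^+ 2) + Num.sqrt (\sum_(P <- s) z P ^+ 2).
Proof.
have h2 (t : F -> R) : ell2 (fun P => if P \in s then t P else 0).
  by apply: (@ell2_fin _ _ _ s) => P /negbTE ->.
rewrite !sqrt_sum_sqr; apply: le_trans (nrmD (h2 y) (h2 z)).
by rewrite (_ : (fun P => _) = (fun P => (if P \in s then y P else 0) + (if P \in s then z P else 0)))//;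
  apply/funext => P; case: ifP; rewrite ?addr0.
Qed.

Lemma sqrt_sum_sqr_le (R : realType) (F : choiceType) (s : {fset F}) (y : F -> R) :
  Num.sqrt (\sum_(P <- s) y P ^+ 2) <= \sum_(P <- s) `|y P|.
Proof.
rewrite -[leRHS]ger0_norm ?sumr_ge0// -sqrtr_sqr ler_wsqrtr//.
elim: (enum_fset s) => [|P r IH]; first by rewrite !big_nil expr0n.
rewrite !big_cons; set S := \sum_(j <- r) `|y j| in IH *.
have S0 : 0 <= S by apply: sumr_ge0.
apply: le_trans (lerD (lexx _) IH) _; rewrite -(real_normK (num_real (y P))) sqrrD.
by rewrite lerD2r lerDl mulrn_wge0// mulr_ge0.
Qed.

(** * The synthesis operator into the martingale Hardy space *)

Section Synthesis.
Context {R : realType} {disp : measure_display} {X : measurableType disp}.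
Variable mu : {measure set X -> \bar R}.
Hypothesis mufin : (mu [set: X] < +oo)%E.
Variable d : X -> X -> R.
Context {F : choiceType}.
Implicit Types (g : X -> R) (s : {fset F}) (u v : F -> R).
Local Notation Int f := (Rintegral mu [set: X] f).
Local Notation L1 := (integrableR mu).
(** [birth P] is a stage of the filtration at which [h P] is measurable; at earlier stages its
    conditional expectation vanishes. [lvl n] lists the finitely many [P] born by stage [n]. *)
Variables (f' h : F -> X -> R) (birth : F -> nat) (lvl : nat -> {fset F}).
Variable S : nat -> set (set X).
Variables (C0 Ch : R).
Hypothesis bf' : forall P, bm (f' P).
Hypothesis bh : forall P, bm (h P).
Hypothesis mS : forall n A, S n A -> measurable A.
Hypothesis S_mono : forall n m, (n <= m)%N -> S n `<=` S m.
Hypothesis mh : forall P,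
  measurable_fun [set: g_sigma_algebraType (S (birth P))] (h P : g_sigma_algebraType _ -> R).
Hypothesis lvlP : forall n P, (P \in lvl n) = (birth P <= n)%N.
Hypothesis h_mart : forall n A P, <<s S n >> A -> (n < birth P)%N -> \int[mu]_(x in A) h P x = 0.
Hypothesis h_disj : forall P Q x, P != Q -> birth P = birth Q -> h P x * h Q x = 0.
Hypothesis h_orth : forall P Q, P != Q -> Int (fun x => h P x * h Q x) = 0.
Hypothesis h_norm : forall P, Int (fun x => h P x ^+ 2) <= Ch.
Hypothesis atom_L1 : forall a, H1_atom mu d a -> L1 a.
Local Notation c := (dualcoef mu f').
Hypothesis atom_sq : forall a, H1_atom mu d a -> exists B, sqbounded (c a) B.
Hypothesis atom_M : forall a s, H1_atom mu d a ->
  Int (fun x => `|\sum_(P <- s) c a P * h P x|) <= C0.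
Hypothesis atom_S : forall a s, H1_atom mu d a ->
  Int (fun x => Num.sqrt (\sum_(P <- s) (c a P * h P x) ^+ 2)) <= C0.
Hypothesis C0_ge0 : 0 <= C0.

Definition psum n g x : R := \sum_(P <- lvl n) c g P * h P x.
(** [qM] gives the convergence of the partial sums in L1; [qS], the L1 norm of a square function,
    gives the martingale norm. *)
Definition qM s u : R := Int (fun x => `|\sum_(P <- s) u P * h P x|).
Definition qS s u : R := Int (fun x => Num.sqrt (\sum_(P <- s) (u P * h P x) ^+ 2)).

Let bsum s u : bm (fun x => \sum_(P <- s) u P * h P x).
Proof. by apply: bm_sum => P; exact: bmZ. Qed.
Let bS s u : bm (fun x => Num.sqrt (\sum_(P <- s) (u P * h P x) ^+ 2)).
Proof. by apply: bm_sqrt; apply: bm_sum => P; apply: bmX; exact: bmZ. Qed.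

Lemma sum_norm_fin s u : Int (fun x => \sum_(P <- s) `|u P * h P x|) <=
  (\sum_(P <- s) Int (fun x => `|h P x|)) * \sum_(P <- s) `|u P|.
Proof.
have lh P : L1 (fun x => `|h P x|) by apply: bm_L1 => //; exact: bm_norm.
rewrite Int_sum//; last by move=> P; apply: bm_L1 => //; apply: bm_norm; exact: bmZ.
rewrite mulr_sumr !big_seq; apply: ler_sum => P Ps.
under eq_fun do rewrite normrM; rewrite IntZ// mulrC; apply: ler_wpM2r => //.
rewrite -big_seq (big_fsetD1 P)//= lerDl; apply: sumr_ge0 => Q _; apply: Int_ge0 => x; exact: normr_ge0.
Qed.

Lemma qM_seminorm s : fseminorm (qM s).
Proof.
split.
- move=> u v; rewrite /qM; have H := L1_ler (bm_L1 mufin (bsum s u)) (bm_L1 mufin (bsum s v)).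
  apply: le_trans (_ : _ <= _) H.
  rewrite le_eqVlt; apply/orP; left; apply/eqP; congr Rintegral; apply/funext => x.
  by rewrite -big_split/=; congr `|_|; apply: eq_bigr => P _; rewrite mulrDl.
- move=> k u; rewrite /qM -IntZ; last by apply: bm_L1 => //; exact: bm_norm.
  rewrite le_eqVlt; apply/orP; left; apply/eqP; congr Rintegral; apply/funext => x.
  by rewrite -normrM mulr_sumr; congr `|_|; apply: eq_bigr => P _; rewrite mulrA.
- exists s, (\sum_(P <- s) Int (fun x => `|h P x|)); split.
    by apply: sumr_ge0 => P _; apply: Int_ge0 => x; exact: normr_ge0.
  move=> u; apply: le_trans (sum_norm_fin s u); apply: le_Int => //.
  + by apply: bm_L1 => //; exact: bm_norm.
  + by apply: bm_L1 => //; apply: bm_sum => P; apply: bm_norm; exact: bmZ.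
  + by move=> x; exact: ler_norm_sum.
Qed.

Lemma qS_seminorm s : fseminorm (qS s).
Proof.
split.
- move=> u v; rewrite /qS -IntD; [|exact: bm_L1|exact: bm_L1].
  apply: le_Int => [||x]; [exact: bm_L1|by apply: L1D; exact: bm_L1|].
  under eq_bigr do rewrite mulrDl; exact: sqrt_sum_sqrD.
- move=> k u; rewrite /qS -IntZ; last exact: bm_L1.
  rewrite le_eqVlt; apply/orP; left; apply/eqP; congr Rintegral; apply/funext => x.
  rewrite -sqrtr_sqr -sqrtrM ?sqr_ge0// mulr_sumr; congr Num.sqrt; apply: eq_bigr => P _.
  by rewrite -mulrA [in LHS]exprMn.
- exists s, (\sum_(P <- s) Int (fun x => `|h P x|)); split.
    by apply: sumr_ge0 => P _; apply: Int_ge0 => x; exact: normr_ge0.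
  move=> u; apply: le_trans (sum_norm_fin s u); apply: le_Int => //.
  + exact: bm_L1.
  + by apply: bm_L1 => //; apply: bm_sum => P; apply: bm_norm; exact: bmZ.
  + by move=> x; exact: sqrt_sum_sqr_le.
Qed.

Lemma sum_sq s u : Int (fun x => (\sum_(P <- s) u P * h P x) ^+ 2) <= Ch * \sum_(P <- s) u P ^+ 2.
Proof.
have l P Q k : L1 (fun x => k * (h P x * h Q x)).
  by apply: bm_L1 => //; apply: bmZ; exact: bmM.
rewrite (_ : (fun x => _) = fun x => \sum_(P <- s) \sum_(Q <- s) (u P * u Q) * (h P x * h Q x)); last first.
  apply/funext => x; rewrite expr2 mulr_suml; apply: eq_bigr => P _.
  by rewrite mulr_sumr; apply: eq_bigr => Q _; ring.
rewrite Int_sum//; last by move=> P; exact: L1_sum.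
rewrite mulr_sumr !big_seq; apply: ler_sum => P Ps.
rewrite Int_sum// (big_fsetD1 P)//= [X in _ + X]big1_seq ?addr0; last first.
  move=> Q /=; rewrite !inE => /andP[QP _]; rewrite IntZ; last by apply: bm_L1 => //; exact: bmM.
  by rewrite h_orth ?mulr0// eq_sym.
rewrite IntZ; last by apply: bm_L1 => //; exact: bmM.
by rewrite -expr2 mulrC; apply: ler_wpM2r; [exact: sqr_ge0|exact: h_norm].
Qed.

Lemma sum_L1_sq s u t : 0 < t -> qM s u <= (t * (Ch * \sum_(P <- s) u P ^+ 2) + t^-1 * fine (mu [set: X])) / 2.
Proof.
move=> t0; have bs := bsum s u.
apply: le_trans (_ : Int (fun x => (t / 2) * (\sum_(P <- s) u P * h P x) ^+ 2 + t^-1 / 2) <= _).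
  apply: le_Int => [||x].
  - by apply: bm_L1 => //; exact: bm_norm.
  - by apply: bm_L1 => //; apply: bmD; [apply: bmZ; exact: bmX|exact: bm_cst].
  - set y := \sum_(P <- s) _; rewrite -(real_normK (num_real y)) -subr_ge0.
    rewrite (_ : _ - _ = 2^-1 * (t^-1 * (t * `|y| - 1) ^+ 2)); last by field; rewrite gt_eqF.
    by apply: mulr_ge0 => //; apply: mulr_ge0; [rewrite invr_ge0; exact: ltW|exact: sqr_ge0].
rewrite IntD; [|by apply: bm_L1 => //; apply: bmZ; exact: bmX|by apply: bm_L1 => //; exact: bm_cst].
rewrite Int_cst IntZ; last by apply: bm_L1 => //; exact: bmX.
have := ler_wpM2l (ltW t0) (sum_sq s u); lra.
Qed.

Lemma lvl_sub n m : (n <= m)%N -> (lvl n `<=` lvl m)%fset.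
Proof. by move=> nm; apply/fsubsetP => P; rewrite !lvlP => /leq_trans; apply. Qed.

Lemma psum_diff n m g x : (n <= m)%N ->
  psum m g x - psum n g x = \sum_(P <- lvl m) (if P \in lvl n then 0 else c g P) * h P x.
Proof.
move=> nm; rewrite /psum.
have -> : \sum_(P <- lvl n) c g P * h P x = \sum_(P <- lvl m) (if P \in lvl n then c g P * h P x else 0).
  rewrite -(big_fset_incl _ (lvl_sub nm))/=; last by move=> P _ /negbTE ->.
  by apply: eq_big_seq => P ->.
by rewrite -sumrB; apply: eq_bigr => P _; case: ifP => _; rewrite ?subrr ?mul0r ?subr0.
Qed.

Let psum_bm n g : bm (psum n g). Proof. exact: bsum. Qed.
Let psum_L1 n g : L1 (psum n g). Proof. exact: bm_L1. Qed.

(** The coefficients of one atom are square summable and the [h_P] are orthogonal, so the partial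
    sums are Cauchy in L2, hence in L1 on a finite measure space. *)
Lemma atom_cauchy a e : H1_atom mu d a -> 0 < e -> exists N, forall n m, (N <= n)%N -> (n <= m)%N ->
  Int (fun x => `|psum m a x - psum n a x|) <= e.
Proof.
move=> ha e0; have [B hB] := atom_sq ha.
pose M := fine (mu [set: X]); have M0 : 0 <= M by exact: fine_ge0.
(* This [t] makes the measure term of [sum_L1_sq] at most [e]; the threshold in [eta0] does the same
   for the energy term. *)
pose t := (M + 1) / e; have t0 : 0 < t by rewrite divr_gt0// ltr_wpDl.
have hl : ell2 (c a) by apply/ell2P; exists B.
have hs := ip_hsum hl hl.
have eta0 : 0 < e / (2 * (t * (`|Ch| + 1))).
  by apply: divr_gt0 => //; apply: mulr_gt0 => //; apply: mulr_gt0 => //; rewrite ltr_wpDl.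
have [s0 hs0] := hs _ eta0.
pose N := (\max_(P <- s0) birth P)%N.
have s0N : (s0 `<=` lvl N)%fset.
  by apply/fsubsetP => P Ps; rewrite lvlP /N; exact: (@leq_bigmax_seq _ _ xpredT birth P Ps).
exists N => n m Nn nm.
have h1 := hs0 _ (fsubset_trans s0N (lvl_sub Nn)).
have h2 := hs0 _ (fsubset_trans s0N (lvl_sub (leq_trans Nn nm))).
pose u P := if P \in lvl n then 0 else c a P.
have -> : (fun x => `|psum m a x - psum n a x|) = fun x => `|\sum_(P <- lvl m) u P * h P x|.
  by apply/funext => x; rewrite psum_diff.
have hu : \sum_(P <- lvl m) u P ^+ 2 <= 2 * (e / (2 * (t * (`|Ch| + 1)))).
  have -> : \sum_(P <- lvl m) u P ^+ 2 = \sum_(P <- lvl m) c a P * c a P - \sum_(P <- lvl n) c a P * c a P.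
    have -> : \sum_(P <- lvl n) c a P * c a P = \sum_(P <- lvl m) (if P \in lvl n then c a P * c a P else 0).
      rewrite -(big_fset_incl _ (lvl_sub nm))/=; last by move=> P _ /negbTE ->.
      by apply: eq_big_seq => P ->.
    rewrite -sumrB; apply: eq_bigr => P _; rewrite /u; case: ifP => _.
      by rewrite expr2 mul0r subrr.
    by rewrite subr0 expr2.
  move: h1 h2; rewrite !ler_distlC; lra.
apply: le_trans (sum_L1_sq (lvl m) u t0) _.
have e1 : t * (Ch * \sum_(P <- lvl m) u P ^+ 2) <= e.
  apply: le_trans (_ : t * ((`|Ch| + 1) * (2 * (e / (2 * (t * (`|Ch| + 1)))))) <= _).
    apply: ler_wpM2l; first exact: ltW.
    apply: le_trans (_ : (`|Ch| + 1) * \sum_(P <- lvl m) u P ^+ 2 <= _).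
      apply: ler_wpM2r; first by apply: sumr_ge0 => P _; exact: sqr_ge0.
      by apply: le_trans (ler_norm _) _; rewrite lerDl.
    by apply: ler_wpM2l => //; apply: addr_ge0.
  rewrite le_eqVlt; apply/orP; left; apply/eqP; field.
  by rewrite !gt_eqF// ltr_wpDl.
have e2 : t^-1 * M <= e.
  rewrite /t invf_div mulrC mulrA ler_pdivrMr; last by rewrite ltr_wpDl.
  by rewrite mulrC; apply: ler_wpM2l; [exact: ltW|rewrite lerDl].
rewrite -/M; lra.
Qed.

Lemma measurable_fun_mono (A B : set (set X)) (k : X -> R) : A `<=` B ->
  measurable_fun [set: g_sigma_algebraType A] (k : g_sigma_algebraType A -> R) ->
  measurable_fun [set: g_sigma_algebraType B] (k : g_sigma_algebraType B -> R).
Proof.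
move=> AB mk mT Y mY; apply: (sub_sigma_algebra2 AB).
by have := mk measurableT Y mY.
Qed.

Lemma psum_measurable n g :
  measurable_fun [set: g_sigma_algebraType (S n)] (psum n g : g_sigma_algebraType (S n) -> R).
Proof.
rewrite (_ : psum n g = fun x => \sum_(P <- lvl n) (if (birth P <= n)%N then c g P * h P x else 0)).
  apply: (@measurable_sum _ (g_sigma_algebraType (S n)) R setT F (lvl n)
    (fun P x => if (birth P <= n)%N then c g P * h P x else 0)) => P.
  have [Pn|Pn] := leqP (birth P) n; last exact: measurable_cst.
  apply: (@measurable_funM _ (g_sigma_algebraType (S n)) R setT (fun=> c g P) (h P)).
    exact: measurable_cst.
  exact: (measurable_fun_mono (S_mono Pn) (@mh P)).
by apply/funext => x; apply: eq_big_seq => P /=; rewrite lvlP => ->.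
Qed.

Section Limit.
Variables (g : X -> R) (lam : nat -> R) (a : nat -> X -> R).
Hypothesis gL1 : L1 g.
Hypothesis grep : H1_representation mu d g lam a.
Local Notation Lam := (fine (\sum_(0 <= i <oo) `|lam i|%:E)%E).

Let ha i : H1_atom mu d (a i). Proof. by have [h1 _ _] := grep. Qed.

Lemma qM_bound s : qM s (c g) <= C0 * Lam.
Proof. by apply: (fseminorm_transfer mufin bf' atom_L1 (qM_seminorm s) C0_ge0 _ gL1 grep) => i; exact: atom_M. Qed.

Lemma qS_bound s : qS s (c g) <= C0 * Lam.
Proof. by apply: (fseminorm_transfer mufin bf' atom_L1 (qS_seminorm s) C0_ge0 _ gL1 grep) => i; exact: atom_S. Qed.

(** Finitely many atoms are treated by [atom_cauchy]. On the remainder the difference of two partial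
    sums is at most [2 C0] times its atomic mass, which is small. *)
Lemma psum_cauchy e : 0 < e -> exists N, forall n m, (N <= n)%N -> (n <= m)%N ->
  Int (fun x => `|psum m g x - psum n g x|) <= e.
Proof.
move=> e0.
have [_ hs _] := grep.
have [k hk] : exists k, forall j, (k <= j)%N ->
    fine (\sum_(0 <= i <oo) `|lam (i + j)%N|%:E)%E <= e / (2 * (2 * C0 + 1)).
  have E0 : 0 < e / (2 * (2 * C0 + 1)) by rewrite divr_gt0// mulr_gt0// ltr_wpDl// mulr_ge0.
  have := @nneseries_tail_cvg _ (fun i => (`|lam i|)%:E) xpredT hs.
  have nn : forall i, xpredT i -> (0 <= (`|lam i|)%:E)%E by move=> i _; rewrite lee_fin.
  move=> /(_ nn) /fine_cvgP[_ /cvgr0Pnorm_le/(_ _ E0)[k _ hk]]; exists k => j kj.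
  have := hk j kj; apply: le_trans; apply: le_trans (ler_norm _); rewrite /=.
  by rewrite (@nneseries_addn _ (fun i => (`|lam i|)%:E)).
have {}hk := hk k (leqnn k).
have hsh := rep_shift k gL1 grep.
set g2 := (fun x => _ - _) in hsh.
have l1 := @rep_L1 _ _ _ _ mufin d atom_L1 lam a k ha.
have l2 : L1 g2 by exact: L1B.
have [N hN] : exists N, forall i n m, (i < k)%N -> (N <= n)%N -> (n <= m)%N ->
    Int (fun x => `|psum m (a i) x - psum n (a i) x|) <= e / (2 * (Lam + 1)).
  have L0 : 0 <= Lam by apply: fine_ge0; apply: nneseries_ge0 => i _ _; rewrite lee_fin.
  have E0 : 0 < e / (2 * (Lam + 1)) by rewrite divr_gt0// mulr_gt0// ltr_wpDl.
  elim: k {hk hsh g2 l1 l2} => [|k [N IH]]; first by exists 0%N.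
  have [N' hN'] := atom_cauchy (ha k) E0; exists (maxn N N') => i n m.
  rewrite ltnS leq_eqVlt geq_max => /predU1P[->|ik] /andP[n1 n2] nm; first exact: hN'.
  exact: IH.
have L0 : 0 <= Lam by apply: fine_ge0; apply: nneseries_ge0 => i _ _; rewrite lee_fin.
exists N => n m Nn nm.
(* The difference of two partial sums as a seminorm in the coefficients: those already present at
   stage [n] are dropped. *)
pose q u := Int (fun x => `|\sum_(P <- lvl m) (if P \in lvl n then 0 else u P) * h P x|).
have qE g0 : Int (fun x => `|psum m g0 x - psum n g0 x|) = q (c g0).
  by congr Rintegral; apply/funext => x; rewrite psum_diff.
have hq : fseminorm q.
  have [qD qZ [s [K [K0 hK]]]] := qM_seminorm (lvl m).
  split.
  - move=> u v; apply: le_trans (qD _ _); rewrite le_eqVlt; apply/orP; left; apply/eqP.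
    rewrite /q /qM; congr Rintegral; apply/funext => x; congr `|_|; apply: eq_bigr => P _.
    by case: ifP => _; rewrite ?addr0.
  - move=> r u; apply: le_trans (qZ _ _); rewrite le_eqVlt; apply/orP; left; apply/eqP.
    rewrite /q /qM; congr Rintegral; apply/funext => x; congr `|_|; apply: eq_bigr => P _.
    by case: ifP => _; rewrite ?mulr0.
  - exists s, K; split=> // u; apply: le_trans (hK _) _; apply: ler_wpM2l => //.
    by apply: ler_sum => P _; case: ifP => _ //; rewrite normr0.
have qa i : q (c (a i)) <= 2 * C0.
  rewrite -qE; apply: le_trans (_ : qM (lvl m) (c (a i)) + qM (lvl n) (c (a i)) <= _).
    have H := L1_ler (psum_L1 m (a i)) (L1N (psum_L1 n (a i))).
    rewrite [X in _ <= _ + X](_ : _ = Int (fun x => `|psum n (a i) x|)) in H; first exact: H.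
    by congr Rintegral; apply/funext => x; rewrite normrN.
  by have := atom_M (lvl m) (ha i); have := atom_M (lvl n) (ha i); rewrite /qM; lra.
have [qD qZ _] := hq.
rewrite qE (_ : c g = fun P => c (fun x => \sum_(i < k) lam i * a i x) P + c g2 P); last first.
  by rewrite -dualcoefD//; congr dualcoef; apply/funext => x; rewrite addrC subrK.
apply: le_trans (qD _ _) _; rewrite [leRHS](splitr e); apply: lerD.
  have E0 : 0 <= e / (2 * (Lam + 1)) by rewrite divr_ge0 ?mulr_ge0 ?addr_ge0// ltW.
  apply: le_trans (fseminorm_sum mufin bf' atom_L1 lam hq ha (C0 := e / (2 * (Lam + 1))) _) _.
    by move=> i ik; rewrite -qE; exact: hN.
  apply: le_trans (ler_wpM2l E0 (rep_sum_le k grep)) _.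
  rewrite mulrAC ler_pdivrMr; last by rewrite mulr_gt0// ltr_wpDl.
  rewrite -mulrA; apply: ler_wpM2l; first exact: ltW.
  by rewrite mulKf// lerDl.
apply: le_trans (fseminorm_transfer mufin bf' atom_L1 hq _ _ l2 hsh) _.
- exact: mulr_ge0 (ler0n R 2) C0_ge0.
- by move=> i; exact: qa.
have C1 : 0 < 2 * C0 + 1 by rewrite ltr_wpDl// mulr_ge0.
apply: le_trans (ler_wpM2l _ hk) _; first exact: mulr_ge0.
rewrite mulrA ler_pdivrMr; last by rewrite mulr_gt0.
rewrite (_ : e / 2 * _ = (2 * C0 + 1) * e); last by field.
by apply: ler_wpM2r; [exact: ltW|rewrite lerDl].
Qed.

Definition L1lim (f : X -> R) := forall e, 0 < e -> exists N, forall n, (N <= n)%N ->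
  Int (fun x => `|f x - psum n g x|) <= e.

Lemma psum_limit : exists f, [/\ L1 f,
  measurable_fun [set: g_sigma_algebraType (\bigcup_n S n)] (f : g_sigma_algebraType (\bigcup_n S n) -> R)
  & L1lim f].
Proof.
have q0 j : 0 < (2^-1 : R) ^+ j by rewrite exprn_gt0.
have [N hN] : {N : nat -> nat & forall j n m, (N j <= n)%N -> (n <= m)%N ->
    Int (fun x => `|psum m g x - psum n g x|) <= 2^-1 ^+ j}.
  by apply: (@choice _ _ (fun j N => forall n m, (N <= n)%N -> (n <= m)%N -> _)) => j; exact: psum_cauchy.
(* Summing the thresholds makes the chosen stages nondecreasing. *)
pose k j := (\sum_(i < j.+1) N i)%N.
have Nk j : (N j <= k j)%N by rewrite /k big_ord_recr/= leq_addl.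
have kk j : (k j <= k j.+1)%N by rewrite /k [leqRHS]big_ord_recr/= leq_addr.
pose V j := psum (k j) g.
have LV j : L1 (V j) by exact: psum_L1.
have dV j : Int (fun x => `|V j.+1 x - V j x|) <= 2^-1 ^+ j by exact: hN.
exists (fast_limit V); split; first exact: fast_limit_L1 LV dV.
  apply: fast_limit_measurable => j.
  have SB : S (k j) `<=` \bigcup_n S n by move=> A SA; exists (k j).
  exact: (measurable_fun_mono SB (@psum_measurable (k j) g)).
move=> e e0.
have [j hj] : exists j, 3 * (2^-1 : R) ^+ j <= e.
  have hc : (fun n => 3 * (2^-1 : R) ^+ n) @ \oo --> (0 : R).
    rewrite -[X in _ --> X](mulr0 3); apply: cvgMr; apply: cvg_expr.
    by rewrite ger0_norm// invf_lt1// ltr1n.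
  have /cvgr0Pnorm_le/(_ _ e0)[j _ /(_ j (leqnn j)) hj] := hc.
  by exists j; apply: le_trans hj; exact: ler_norm.
exists (k j) => n kn.
have hl := L1_dist (fast_limit_L1 LV dV) (LV j) (psum_L1 n g).
apply: le_trans hl _; apply: le_trans hj.
have h1 := (fast_limit_dist LV dV j).2.
have h2 : Int (fun x => `|V j x - psum n g x|) <= 2^-1 ^+ j.
  under eq_fun do rewrite distrC; exact: hN.
by apply: le_trans (lerD h1 h2) _; set y := 2^-1 ^+ j; lra.
Qed.

Section CondExp.
Variable f : X -> R.
Hypothesis fL1 : L1 f.
Hypothesis flim : L1lim f.

Lemma L1lim_unique f2 : L1 f2 -> L1lim f2 -> f = f2 %[ae mu].
Proof.
move=> f2L1 h2; have : Int (fun x => `|f x - f2 x|) <= 0.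
  apply/ler_addgt0Pr => e e0; rewrite add0r.
  have [N1 hN1] := flim (divr_gt0 e0 (ltr0Sn R 1)); have [N2 hN2] := h2 _ (divr_gt0 e0 (ltr0Sn R 1)).
  pose n := maxn N1 N2.
  apply: le_trans (L1_dist fL1 (psum_L1 n g) f2L1) _; rewrite [leRHS]splitr; apply: lerD.
    by apply: hN1; exact: leq_maxl.
  by under eq_fun do rewrite distrC; apply: hN2; exact: leq_maxr.
move=> /(Int_norm_eq0 (L1B fL1 f2L1)); apply: filterS => x /= /(_ Logic.I)/eqP.
by rewrite subr_eq0 => /eqP.
Qed.

(** Functions born after stage [n] integrate to 0 over sets of the n-th sigma-algebra. All later
    partial sums thus have the same integral over such a set, and so has their L1 limit. *)
Lemma psum_cond_exp n : is_cond_exp mu (S n) f (psum n g).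
Proof.
split; [exact: (@psum_measurable n g)|exact: psum_L1|move=> A SA].
have mA : measurable A := sub_measurable (@mS n) SA.
apply/eqP; rewrite -subr_eq0 -normr_le0; apply/ler_addgt0Pr => e e0; rewrite add0r.
have [N hN] := flim e0; pose m := maxn N n.
have nm : (n <= m)%N by exact: leq_maxr.
have lA k : L1 k -> mu.-integrable A (EFin \o k) by move=> hk; apply: integrableS hk.
have e1 : \int[mu]_(x in A) psum n g x = \int[mu]_(x in A) psum m g x.
  apply/eqP; rewrite eq_sym -subr_eq0 -RintegralB//; [|exact: lA|exact: lA].
  rewrite (_ : (fun x => _) = fun x => \sum_(P <- lvl m) (if P \in lvl n then 0 else c g P) * h P x); last first.
    by apply/funext => x; exact: psum_diff.
  rewrite Rintegral_mkcond (_ : _ \_ A = fun x => \sum_(P <- lvl m) (if P \in lvl n then 0 else c g P) * (h P \_ A) x).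
    rewrite Int_sum//; last first.
      move=> P; apply: L1Z; have := lA _ (bm_L1 mufin (bh P)).
      by move=> /(integrable_mkcond _ mA); rewrite /integrableR; congr integrable; apply/funext => x; rewrite /= !patchE; case: ifP.
    rewrite big1// => P _; case: ifPn => Pn.
      by under eq_fun do rewrite mul0r; rewrite Int0.
    rewrite IntZ; last first.
      have := lA _ (bm_L1 mufin (bh P)).
      by move=> /(integrable_mkcond _ mA); rewrite /integrableR; congr integrable; apply/funext => x; rewrite /= !patchE; case: ifP.
    by rewrite -Rintegral_mkcond (h_mart SA) ?mulr0// ltnNge -lvlP.
  apply/funext => x; rewrite patchE; case: ifP => xA; first by apply: eq_bigr => P _; rewrite patchE xA.
  by rewrite big1// => P _; rewrite patchE xA mulr0.
rewrite e1 -RintegralB//; [|exact: lA|exact: lA].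
have lB := L1B (psum_L1 m g) fL1.
apply: le_trans (le_normr_Rintegral mA (lA _ lB)) _.
apply: le_trans (_ : Int (fun x => `|f x - psum m g x|) <= _); last by apply: hN; exact: leq_maxl.
rewrite Rintegral_mkcond; apply: le_Int.
- have := lA _ (L1_norm lB).
  by move=> /(integrable_mkcond _ mA); rewrite /integrableR; congr integrable; apply/funext => x; rewrite /= !patchE; case: ifP.
- by apply: L1_norm; exact: L1B.
- by move=> x; rewrite patchE; case: ifP => _; [rewrite distrC|exact: normr_ge0].
Qed.

Definition psum_step n x : R :=
  if n is n'.+1 then psum n'.+1 g x - psum n' g x else psum 0 g x.

Lemma sqr_sum_disj s (z : F -> R) :
  (forall P Q, P \in s -> Q \in s -> P != Q -> z P * z Q = 0) ->
  (\sum_(P <- s) z P) ^+ 2 = \sum_(P <- s) z P ^+ 2.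
Proof.
move=> hz; rewrite expr2 mulr_suml; apply: eq_big_seq => P /= Ps.
rewrite mulr_sumr (big_fsetD1 P)//= big1_seq ?addr0 ?expr2// => Q /=.
by rewrite !inE => /andP[QP Qs]; apply: hz => //; rewrite eq_sym.
Qed.

(** Functions born at the same stage have vanishing products, so the square of an increment has no
    cross terms. *)
Lemma sum_psum_step N x :
  \sum_(n < N.+1) psum_step n x ^+ 2 = \sum_(P <- lvl N) (c g P * h P x) ^+ 2.
Proof.
elim: N => [|N IH].
  rewrite big_ord_recl big_ord0 addr0 /=; apply: sqr_sum_disj => P Q.
  rewrite !lvlP !leqn0 => /eqP bP /eqP bQ PQ.
  by rewrite mulrACA h_disj ?mulr0// bP bQ.
rewrite big_ord_recr/= IH psum_diff// sqr_sum_disj; last first.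
  move=> P Q; rewrite !lvlP => P1 Q1 PQ; case: ifPn => [_|Pn]; first by rewrite !mul0r.
  case: ifPn => [_|Qn]; first by rewrite mul0r mulr0.
  rewrite mulrACA h_disj ?mulr0//.
  by apply/eqP; rewrite eqn_leq !(leq_trans P1, leq_trans Q1)// ltnNge.
have -> : \sum_(P <- lvl N) (c g P * h P x) ^+ 2 =
    \sum_(P <- lvl N.+1) (if P \in lvl N then (c g P * h P x) ^+ 2 else 0).
  rewrite -(big_fset_incl _ (lvl_sub (leqnSn N)))/=; last by move=> P _ /negbTE ->.
  by apply: eq_big_seq => P ->.
rewrite -big_split/=; apply: eq_bigr => P _; case: ifP => _; last by rewrite add0r.
by rewrite mul0r expr0n addr0.
Qed.

Lemma mart_diff_psum n : measurable_fun [set: X] (mart_diff mu S f n) /\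
  mart_diff mu S f n = psum_step n %[ae mu].
Proof.
have ce k := cond_expP (@mS k) (psum_cond_exp k).
have mce k : measurable_fun [set: X] (cond_exp mu (S k) f).
  by have [[mk _ _] _] := ce k; exact: (sub_measurable_fun (@mS k) mk).
case: n => [|n] /=; first by have [_ h0] := ce 0%N.
split; first exact: measurable_funB.
have [_ h1] := ce n.+1; have [_ h0] := ce n.
by apply: filterS2 h1 h0 => x /= e1 e2 _; rewrite e1// e2.
Qed.

Lemma sqrt_series_le (y : nat -> R) :
  ((\sum_(0 <= n <oo) (`|y n| ^+ 2)%:E) `^ (2^-1) <=
   limn (fun N => (Num.sqrt (\sum_(n < N) y n ^+ 2))%:E))%E.
Proof.
have nd : {homo (fun N => (Num.sqrt (\sum_(n < N) y n ^+ 2))%:E) : n m / (n <= m)%N >-> (n <= m)%E}.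
  move=> n m nm; rewrite lee_fin ler_wsqrtr// -!(big_mkord xpredT (fun i => y i ^+ 2)).
  by rewrite (big_cat_nat _ nm)//= lerDl sumr_ge0// => i _; exact: sqr_ge0.
have cv := ereal_nondecreasing_is_cvgn nd.
set L := limn (fun N => (Num.sqrt (\sum_(n < N) y n ^+ 2))%:E); have Lub N : ((Num.sqrt (\sum_(n < N) y n ^+ 2))%:E <= L)%E.
  by apply: lime_ge => //; exists N => // n Nn; exact: (nd N n Nn).
have L0 : (0 <= L)%E by apply: le_trans (Lub 0%N); rewrite lee_fin sqrtr_ge0.
move: Lub L0; case: L => [l| |]; last 2 first.
- by move=> _ _; rewrite leey.
- by move=> _.
move=> Lub l0; rewrite lee_fin in l0.
have hser : (\sum_(0 <= n <oo) (`|y n| ^+ 2)%:E <= (l ^+ 2)%:E)%E.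
  apply: lime_le; first by apply: is_cvg_nneseries => i _ _; rewrite lee_fin sqr_ge0.
  apply: nearW => N; rewrite sumEFin lee_fin big_mkord.
  have := Lub N; rewrite lee_fin => hN.
  under eq_bigr do rewrite real_normK ?num_real//.
  have S0 : 0 <= \sum_(n < N) y n ^+ 2 by apply: sumr_ge0 => i _; exact: sqr_ge0.
  by rewrite -[leLHS](sqr_sqrtr S0); apply: lerXn2r; rewrite ?nnegrE ?sqrtr_ge0.
have := @gt0_ler_poweR R 2^-1 _ _ _ _ _ hser.
rewrite poweR_EFin powR12_sqrt ?sqr_ge0// sqrtr_sqr ger0_norm//; apply.
- by rewrite invr_ge0.
- by rewrite in_itv/= leey andbT; apply: nneseries_ge0 => i _ _; rewrite lee_fin sqr_ge0.
- by rewrite in_itv/= leey andbT lee_fin sqr_ge0.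
Qed.

(** The martingale differences of [f] are almost everywhere the increments of [psum]. The truncated
    square functions are monotone in [N], and [qS_bound] bounds their integrals uniformly. *)
Lemma mart_H1norm_bound : (mart_H1norm mu S f <= (C0 * Lam)%:E)%E.
Proof.
rewrite /mart_H1norm.
have md n : measurable_fun [set: X] (mart_diff mu S f n) by have [] := mart_diff_psum n.
pose Psi N x := (Num.sqrt (\sum_(n < N) psum_step n x ^+ 2))%:E.
have bstep n : bm (psum_step n) by case: n => [|n] /=; [exact: psum_bm|exact: bmB].
have bPsi N : bm (fun x => Num.sqrt (\sum_(n < N) psum_step n x ^+ 2)).
  by apply: bm_sqrt; apply: (@bm_sum _ _ _ _ _ (fun (n : 'I_N) x => psum_step n x ^+ 2)) => n; exact: bmX.
have mPsi N : measurable_fun [set: X] (Psi N).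
  by apply/measurable_EFinP; have [] := bPsi N.
have Psi0 N x : [set: X] x -> (0 <= Psi N x)%E by move=> _; rewrite lee_fin sqrtr_ge0.
have nd x : [set: X] x -> {homo Psi ^~ x : n m / (n <= m)%N >-> (n <= m)%E}.
  move=> _ n m nm; rewrite lee_fin ler_wsqrtr// -!(big_mkord xpredT (fun i => psum_step i x ^+ 2)).
  by rewrite (big_cat_nat _ nm)//= lerDl sumr_ge0// => i _; exact: sqr_ge0.
have mlim : measurable_fun [set: X] (fun x => limn (Psi ^~ x)).
  apply: (emeasurable_fun_cvg Psi) => // x _; apply: ereal_nondecreasing_is_cvgn; exact: nd.
have ae_eq : {ae mu, forall x, forall n, mart_diff mu S f n x = psum_step n x}.
  apply: ae_foralln => n; have [_] := mart_diff_psum n.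
  by apply: filterS => x /(_ Logic.I).
have mI : measurable_fun [set: X]
   (fun x => ((\sum_(0 <= n <oo) ((`|mart_diff mu S f n x| ^+ 2)%R)%:E) `^ (2^-1))%E).
  apply: (@measurableT_comp _ _ _ _ _ _ (fun y : \bar R => (y `^ 2^-1)%E)); first exact: measurable_poweR.
  apply: ge0_emeasurable_sum => [n x _ _|n _]; first by rewrite lee_fin sqr_ge0.
  by apply/measurable_EFinP; apply: measurable_funX; exact: measurableT_comp.
apply: (@le_trans _ _ (\int[mu]_x limn (Psi ^~ x))%E).
  apply: ae_ge0_le_integral => //.
  - by move=> x _; exact: poweR_ge0.
  - move=> x _; apply: lime_ge; first by apply: ereal_nondecreasing_is_cvgn; exact: nd.
    by apply: nearW => N; exact: Psi0.
  apply: filterS ae_eq => x hx _; under eq_eseriesr do rewrite hx.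
  exact: sqrt_series_le.
have cm := @cvg_monotone_convergence _ _ _ mu _ measurableT _ mPsi Psi0 nd.
rewrite -(cvg_lim _ cm)//; apply: lime_le; first by apply/cvg_ex; eexists; exact: cm.
apply: nearW => -[|N].
  have E x : Psi 0%N x = 0%E by rewrite /Psi big_ord0 sqrtr0.
  under eq_integral do rewrite E; rewrite integral0.
  rewrite lee_fin mulr_ge0// fine_ge0//; apply: nneseries_ge0 => i _ _; exact: normr_ge0.
rewrite /Psi -Int_EFin; last exact: bm_L1.
rewrite lee_fin; apply: le_trans (qS_bound (lvl N)); rewrite /qS.
by under eq_fun do rewrite sum_psum_step.
Qed.

End CondExp.
End Limit.

Let Sinf := \bigcup_n S n.

(** An L1 limit is determined only up to null sets; [xget] fixes a version, and [L1lim_unique] makes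
    the choice immaterial almost everywhere. *)
Definition synth g : X -> R := xget (cst 0) [set f | [/\ L1 f,
  measurable_fun [set: g_sigma_algebraType Sinf] (f : g_sigma_algebraType Sinf -> R)
  & L1lim g f]].

Lemma H1_rep g : atomic_H1 mu d g -> exists lam a, H1_representation mu d g lam a.
Proof.
by move=> [_ /ereal_inf_lt[_ [lam [a [hr _]]] _]]; exists lam, a.
Qed.

Lemma synthP g : (exists f, [/\ L1 f,
    measurable_fun [set: g_sigma_algebraType Sinf] (f : g_sigma_algebraType Sinf -> R) & L1lim g f]) ->
  [/\ L1 (synth g), measurable_fun [set: g_sigma_algebraType Sinf] (synth g : g_sigma_algebraType Sinf -> R)
    & L1lim g (synth g)].
Proof.
move=> [f hf]; rewrite /synth.
set A := [set f | _]; have : A (xget (cst 0) A) by apply: xgetPex; exists f.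
exact.
Qed.

Lemma synth_H1 g : atomic_H1 mu d g ->
  [/\ L1 (synth g), measurable_fun [set: g_sigma_algebraType Sinf] (synth g : g_sigma_algebraType Sinf -> R)
    & L1lim g (synth g)].
Proof.
move=> hg; have [lam [a hr]] := H1_rep hg; apply: synthP.
by have [f hf] := psum_limit hg.1 hr; exists f.
Qed.

(** From stage [birth P] on, the partial sums are equal to [h P]. *)
Lemma synth_unit g P : c g = edelta P -> synth g = h P %[ae mu].
Proof.
move=> hc.
have mP : measurable_fun [set: g_sigma_algebraType Sinf] (h P : g_sigma_algebraType Sinf -> R).
  have SB : S (birth P) `<=` Sinf by move=> A SA; exists (birth P).
  exact: (measurable_fun_mono SB (@mh P)).
have lP : L1lim g (h P).
  move=> e e0; exists (birth P) => n bn.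
  rewrite (_ : (fun x => _) = fun=> 0) ?Int0 ?ltW//; apply/funext => x.
  rewrite /psum hc (big_fsetD1 P) ?lvlP//= /edelta eqxx mul1r big1_seq ?addr0 ?subrr ?normr0// => Q /=.
  by rewrite !inE => /andP[/negbTE -> _]; rewrite mul0r.
have hP := bm_L1 mufin (bh P).
have [l1 _ l2] : [/\ L1 (synth g), measurable_fun [set: g_sigma_algebraType Sinf]
    (synth g : g_sigma_algebraType Sinf -> R) & L1lim g (synth g)].
  by apply: synthP; exists (h P).
exact: (L1lim_unique l1 l2 hP lP).
Qed.

(** Compatibility with almost everywhere equality and linearity follow from uniqueness of L1 limits,
    the bound from an infimum over representations. *)
Lemma synth_bounded (Y : set (X -> R)) : Y `<=` atomic_H1 mu d ->
  bounded_linear_operator mu Y (atomic_H1norm mu d) (mart_H1 mu S) (mart_H1norm mu S) synth.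
Proof.
move=> hY; split.
- move=> g /hY hg; have [lam [a hr]] := H1_rep hg; have [l1 m1 e1] := synth_H1 hg.
  split=> //; first by exists (synth g) => //; apply: aeW.
  by apply: le_lt_trans (mart_H1norm_bound hg.1 hr l1 e1) (ltry _).
- move=> g1 g2 /hY h1 /hY h2 e.
  have [l1 _ e1] := synth_H1 h1; have [l2 _ e2] := synth_H1 h2.
  apply: (L1lim_unique l1 e1 l2).
  suff cE : c g1 = c g2 by rewrite /L1lim /psum cE; exact: e2.
  apply/funext => P; apply: Int_ae.
  + by apply: L1_meas; apply: L1M (bf' P); exact: h1.1.
  + by apply: L1_meas; apply: L1M (bf' P); exact: h2.1.
  + by apply: filterS e => x /= hx _; rewrite hx.
- move=> c1 c2 g1 g2 /hY h1 /hY h2.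
  have [l1 m1 e1] := synth_H1 h1; have [l2 m2 e2] := synth_H1 h2.
  have lT : L1 (fun x => c1 * synth g1 x + c2 * synth g2 x) by apply: L1D; exact: L1Z.
  have mT : measurable_fun [set: g_sigma_algebraType Sinf]
      ((fun x => c1 * synth g1 x + c2 * synth g2 x) : g_sigma_algebraType Sinf -> R).
    apply: (@measurable_funD _ (g_sigma_algebraType Sinf) R setT (fun x => c1 * synth g1 x) (fun x => c2 * synth g2 x)).
      exact: (@measurable_funM _ (g_sigma_algebraType Sinf) R setT (fun=> c1) (synth g1) (@measurable_cst _ _ (g_sigma_algebraType Sinf) _ setT c1) m1).
    exact: (@measurable_funM _ (g_sigma_algebraType Sinf) R setT (fun=> c2) (synth g2) (@measurable_cst _ _ (g_sigma_algebraType Sinf) _ setT c2) m2).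
  have eT : L1lim (fun x => c1 * g1 x + c2 * g2 x) (fun x => c1 * synth g1 x + c2 * synth g2 x).
    have pE n x : psum n (fun x => c1 * g1 x + c2 * g2 x) x = c1 * psum n g1 x + c2 * psum n g2 x.
      rewrite /psum dualcoefD//; [|by apply: L1Z; exact: h1.1|by apply: L1Z; exact: h2.1].
      rewrite !dualcoefZ//; [|exact: h2.1|exact: h1.1].
      by rewrite !mulr_sumr -big_split/=; apply: eq_bigr => P _; ring.
    move=> e e0; have K0 : 0 < e / (2 * (`|c1| + `|c2| + 1)).
      by rewrite divr_gt0// mulr_gt0// ltr_wpDl// addr_ge0.
    have [N1 hN1] := e1 _ K0; have [N2 hN2] := e2 _ K0.
    exists (maxn N1 N2) => n; rewrite geq_max => /andP[n1 n2].
    have a1 := hN1 _ n1; have a2 := hN2 _ n2.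
    have d1 := L1B l1 (psum_L1 n g1); have d2 := L1B l2 (psum_L1 n g2).
    rewrite (_ : (fun x => _) = fun x => `|c1 * (synth g1 x - psum n g1 x) + c2 * (synth g2 x - psum n g2 x)|); last first.
      apply/funext => x; rewrite pE.
      move: (synth g1 x) (synth g2 x) (psum n g1 x) (psum n g2 x) => s1 s2 p1 p2.
      by congr `|_|; ring.
    apply: le_trans (L1_ler (L1Z c1 d1) (L1Z c2 d2)) _.
    have nE (k : R) (u : X -> R) : L1 u -> Int (fun x => `|k * u x|) = `|k| * Int (fun x => `|u x|).
      by move=> hu; rewrite -IntZ; [congr Rintegral; apply/funext => x; rewrite normrM|exact: L1_norm].
    rewrite !nE//; apply: le_trans (lerD (ler_wpM2l _ a1) (ler_wpM2l _ a2)) _ => //.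
    rewrite -mulrDl mulrA ler_pdivrMr; last by rewrite mulr_gt0// ltr_wpDl// addr_ge0.
    rewrite mulrC; apply: ler_wpM2l; first exact: ltW.
    by have := normr_ge0 c1; have := normr_ge0 c2; lra.
  have [l3 _ e3] : [/\ L1 (synth (fun x => c1 * g1 x + c2 * g2 x)),
      measurable_fun [set: g_sigma_algebraType Sinf]
        (synth (fun x => c1 * g1 x + c2 * g2 x) : g_sigma_algebraType Sinf -> R)
      & L1lim (fun x => c1 * g1 x + c2 * g2 x) (synth (fun x => c1 * g1 x + c2 * g2 x))].
    by apply: synthP; exists (fun x => c1 * synth g1 x + c2 * synth g2 x).
  exact: (L1lim_unique l3 e3 lT eT).
(* A positive constant can be divided out before the infimum is taken. *)
- exists (C0 + 1) => g /hY hg; have C1 : 0 < C0 + 1 by rewrite ltr_wpDl.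
  have [l1 m1 e1] := synth_H1 hg.
  rewrite -lee_pdivrMl//; apply: le_ereal_inf_tmp => _ [lam [a [hr ->]]].
  rewrite lee_pdivrMl//; apply: le_trans (mart_H1norm_bound hg.1 hr l1 e1) _.
  have fs : (\sum_(0 <= i <oo) `|lam i|%:E \is a fin_num)%E.
    rewrite ge0_fin_numE; first by case: hr.
    by apply: nneseries_ge0 => i _ _; rewrite lee_fin.
  rewrite EFinM fineK//; apply: lee_wpmul2r; last by rewrite lee_fin lerDl.
  by apply: nneseries_ge0 => i _ _; rewrite lee_fin.
Qed.
End Synthesis.

Lemma sum_by_level (R : realType) (F : choiceType) (lev : F -> nat) (s : {fset F}) (x : F -> R) :
  exists n, \sum_(P <- s) x P = \sum_(k < n) \sum_(P <- s | lev P == k) x P.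
Proof.
pose n := (\max_(P <- s) lev P).+1; exists n.
under [RHS]eq_bigr do rewrite big_mkcond.
rewrite exchange_big/=; apply: eq_big_seq => P Ps.
have lP : (lev P < n)%N by rewrite ltnS; exact: (@leq_bigmax_seq _ _ xpredT lev P Ps).
rewrite (bigD1 (Ordinal lP))//= eqxx big1 ?addr0// => k /negbTE kP.
by rewrite -[lev P]/(val (Ordinal lP)) eq_sym val_eqE kP.
Qed.

Lemma half_sum_ord (R : realType) (th : R) n : 0 <= th <= 2^-1 -> \sum_(k < n) th ^+ k <= 2.
Proof.
move=> /andP[t0 t1]; apply: le_trans (_ : \sum_(k < n) (2^-1 : R) ^+ k <= _).
  by apply: ler_sum => k _; apply: lerXn2r; rewrite ?nnegrE.
by have := @half_sum R 0 n; rewrite big_mkord expr0 mulr1.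
Qed.

(* At most one summand per level: a geometric series over the levels. *)
Lemma sum_level_le (R : realType) (F : choiceType) (lev : F -> nat) (s : {fset F}) (x : F -> R)
    (y : nat -> R) :
  (forall P, 0 <= x P) -> (forall k, 0 <= y k) -> (forall P, x P <= y (lev P)) ->
  (forall P Q, P \in s -> Q \in s -> x P != 0 -> x Q != 0 -> lev P = lev Q -> P = Q) ->
  exists n, \sum_(P <- s) x P <= \sum_(k < n) y k.
Proof.
move=> x0 y0 xy uniq; have [n ->] := sum_by_level lev s x; exists n.
apply: ler_sum => k _.
have [[P [Ps xP Pk]]|no] := pselect (exists P, [/\ P \in s, x P != 0 & lev P = k]).
  rewrite big_mkcond (big_fsetD1 P)//= Pk eqxx big1_seq ?addr0; first by rewrite -Pk.
  move=> Q /=; rewrite !inE => /andP[QP Qs]; case: eqP => // Qk; apply/eqP/negPn/negP => xQ.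
  by move/eqP : QP; apply; apply: uniq => //; rewrite Qk.
rewrite big1_seq// => Q /= /andP[/eqP Qk Qs]; apply/eqP/negPn/negP => xQ.
by apply: no; exists Q.
Qed.

(** * Uniform bounds on atoms from an abstract description of the cube system *)

Section CubeSystem.
Context {R : realType} {disp : measure_display} {X : measurableType disp}.
Variable mu : {measure set X -> \bar R}.
Hypothesis mufin : (mu [set: X] < +oo)%E.
Variable d : X -> X -> R.
Context {F : choiceType}.
Implicit Types (g : X -> R) (s : {fset F}) (u : F -> R).
Local Notation Int f := (Rintegral mu [set: X] f).
Local Notation L1 := (integrableR mu).
Variables (phi f h : F -> X -> R) (lev : F -> nat) (w dg : F -> R) (N : F -> F -> R).
Variables (D Cphi Ch Kh eps theta delta K1 K4 K5 K6 : R).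
Let v P := w P * theta ^+ lev P.
Hypothesis symN : forall P Q, N P Q = N Q P.
Hypothesis w0 : forall P, 0 < w P.
Hypothesis theta01 : 0 < theta <= 2^-1.
Hypothesis delta01 : 0 < delta <= 1.
Hypothesis eps0 : 0 < eps.
Hypothesis eps_delta : eps <= delta / 4.
Hypothesis schurw : forall Q, fsbounded (fun P => `|N P Q| * w P) (eps * w Q).
Hypothesis schurv : forall Q, fsbounded (fun P => `|N P Q| * v P) (eps * v Q).
Hypothesis dg0 : forall P, 0 < dg P.
Hypothesis dgD : forall P, dg P <= D.
Hypothesis dgVD : forall P, (dg P)^-1 <= D.
Hypothesis dgN : forall P Q, N P Q != 0 -> dg P = dg Q.
Hypothesis D1 : 1 <= D.
Hypothesis bphi : forall P, bm (phi P).
Hypothesis bh : forall P, bm (h P).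
Hypothesis gramE : gram_mx mu phi = perturbed_mx N dg.
Hypothesis f_orth : gram_orthonormalization mu phi f.
Hypothesis phi_le : forall P x, `|phi P x| <= Cphi / w P.
Hypothesis phi_disj : forall P Q x, phi P x != 0 -> phi Q x != 0 -> lev P = lev Q -> P = Q.
Hypothesis h_orth : forall P Q, P != Q -> Int (fun x => h P x * h Q x) = 0.
Hypothesis h_norm : forall P, Int (fun x => h P x ^+ 2) <= Ch.
Hypothesis h_L1 : forall P, Int (fun x => `|h P x|) <= Kh * w P.
Hypothesis Cphi0 : 0 <= Cphi.
Hypothesis Ch0 : 0 <= Ch.
Hypothesis Kh0 : 0 <= Kh.
Hypothesis K10 : 0 <= K1.
Hypothesis K40 : 0 <= K4.
Hypothesis K50 : 0 <= K5.
Hypothesis K60 : 0 <= K6.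

(** What geometry has to supply for an atom on a ball of measure about [delta^n0]: a bounded
    version; neighbourhoods [Loc n] that grow by one scale under [N]; localisation of the
    coefficients at levels [>= n0]; a weighted l1 bound for the coarser ones; the energy bound; and
    sets of measure about [delta^n] that carry the local [h P]. *)
Definition atom_data (a : X -> R) := exists a' (Loc : nat -> F -> Prop) n0,
  [/\ bm a', a = a' %[ae mu] &
   [/\ forall n P Q, Loc n P -> N Q P != 0 -> (n <= lev Q)%N -> Loc n.-1 Q,
      forall n (t : {fset F}), (n <= n0)%N -> (forall P, P \in t -> Loc n P) ->
        \sum_(P <- t) (v P / theta ^+ n) ^+ 2 <= K1 * delta ^+ n,
      forall P, coef mu phi a' P != 0 -> (n0 <= lev P)%N -> Loc n0 P,
      forall s, (forall P, P \in s -> (lev P < n0)%N) -> \sum_(P <- s) `|coef mu phi a' P| * w P <= K5 &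
      [/\ Int (fun x => a' x ^+ 2) <= K4 / delta ^+ n0 &
      forall n, (n <= n0)%N -> exists B : set X, [/\ measurable B, fine (mu B) <= K6 * delta ^+ n &
        forall P x, Loc n P -> h P x != 0 -> B x]]]].

Hypothesis atomP : forall a, H1_atom mu d a -> atom_data a.

Let q0 : 0 < (4^-1 : R). Proof. by rewrite invr_gt0. Qed.
Let d0 : 0 < delta. Proof. by case/andP: delta01. Qed.
Let eps4 : eps <= 4^-1.
Proof.
by apply: le_trans eps_delta _; rewrite ler_pdivrMr// mulVf ?pnatr_eq0//; case/andP: delta01.
Qed.
Let th0 : 0 < theta. Proof. by case/andP: theta01. Qed.
Let v0 P : 0 < v P. Proof. by rewrite mulr_gt0// exprn_gt0. Qed.
Let schurw4 Q : fsbounded (fun P => `|N P Q| * w P) (4^-1 * w Q).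
Proof. by move=> s; apply: le_trans (schurw Q s) _; apply: ler_wpM2r => //; exact: ltW. Qed.
Let schurv4 Q : fsbounded (fun P => `|N P Q| * v P) (4^-1 * v Q).
Proof. by move=> s; apply: le_trans (schurv Q s) _; apply: ler_wpM2r => //; exact: ltW. Qed.

Let AE : inv_sqrt_mx (gram_mx mu phi) = invsqrt_mx N dg.
Proof. by rewrite gramE; exact: inv_sqrt_mxE symN w0 schurw4 dg0 dgD dgVD dgN. Qed.

Let invA : is_inv_sqrt_mx (gram_mx mu phi) (inv_sqrt_mx (gram_mx mu phi)).
Proof. by rewrite AE gramE; exact: invsqrtP symN w0 schurw4 dg0 dgD dgVD dgN. Qed.

(** In [invsqrt_mx_decay] the factor [w P] cancels the size of [phi P], so a term is at most a
    constant times [theta^(lev P)]; at a given point at most one [P] per level contributes. *)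
Lemma orth_sum_bounded Q : exists B, forall s x,
  `|\sum_(P <- s) inv_sqrt_mx (gram_mx mu phi) P Q * phi P x| <= B.
Proof.
have D0 : 0 <= D by apply: le_trans D1.
have K0 : 0 <= D * (2 * Cphi / v Q) by apply: mulr_ge0 => //; apply: divr_ge0; [exact: mulr_ge0|exact: ltW].
exists (D * (2 * Cphi / v Q) * 2) => s x; rewrite AE.
apply: le_trans (ler_norm_sum _ _ _) _.
pose y P := if phi P x != 0 then theta ^+ lev P else 0.
apply: le_trans (_ : \sum_(P <- s) D * (2 * Cphi / v Q) * y P <= _).
  apply: ler_sum => P _; rewrite normrM /y; case: ifPn => [_|/negPn/eqP ->]; last first.
    by rewrite normr0 !mulr0.
  apply: le_trans (ler_pM _ _ (invsqrt_mx_decay symN w0 schurw4 v0 schurv4 dg0 dgVD P Q) (phi_le P x)) _ => //.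
  rewrite le_eqVlt; apply/orP; left; apply/eqP; rewrite /v; field.
  by rewrite !gt_eqF// exprn_gt0.
rewrite -mulr_sumr; apply: ler_wpM2l => //.
have y0 P : 0 <= y P by rewrite /y; case: ifP => // _; rewrite exprn_ge0// ltW.
have [||P|P P' _ _|n hn] := @sum_level_le _ _ lev s y (fun k => theta ^+ k).
- exact: y0.
- by move=> k; rewrite exprn_ge0// ltW.
- by rewrite /y; case: ifP => // _; rewrite exprn_ge0// ltW.
- rewrite /y; case: ifPn => [h1 _|]; last by rewrite eqxx.
  by case: ifPn => [h2 _|]; [exact: phi_disj h1 h2|rewrite eqxx].
- apply: le_trans hn _; apply: half_sum_ord; rewrite ltW//=; by case/andP: theta01.
Qed.

Lemma bounded_version : exists f' : F -> X -> R, (forall P, bm (f' P)) /\ forall P, f P = f' P %[ae mu].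
Proof.
have [f' hf'] : {f' : F -> X -> R & forall P, bm (f' P) /\ f P = f' P %[ae mu]}.
  apply: (@choice _ _ (fun P f' => bm f' /\ f P = f' %[ae mu])) => P.
  exact: (orth_bounded bphi f_orth (orth_sum_bounded P)).
by exists f'; split=> P; have [] := hf' P.
Qed.

Section Coefficients.
Variable f' : F -> X -> R.
Hypothesis bf' : forall P, bm (f' P).
Hypothesis ff' : forall P, f P = f' P %[ae mu].
Local Notation c := (dualcoef mu f').
Local Notation L := (pser (mxapp N) isc).

Lemma dualcoef_orth Q : c (f Q) = edelta Q.
Proof.
apply/funext => P; rewrite /dualcoef /edelta eq_sym.
exact: (orth_orthonormal mufin bphi f_orth invA Q (bf' P) (ff' P)).
Qed.

(** By the Schur test [I - N] has norm at most [1 + 1/4 <= 2]. *)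
Lemma gram_form s u : \sum_(P <- s) \sum_(Q <- s) u P * u Q * gram_mx mu phi P Q <=
  (D ^+ 2 * 2) * \sum_(P <- s) u P ^+ 2.
Proof.
have D0 : 0 <= D by exact: le_trans D1.
have D2 P : dg P ^+ 2 <= D ^+ 2 by apply: lerXn2r => //; rewrite nnegrE ltW.
have H := schur_bilinear symN w0 schurw4 u u s s.
apply: le_trans (_ : \sum_(P <- s) \sum_(Q <- s) D ^+ 2 * (`|N P Q| * `|u Q| * `|u P|) +
   \sum_(P <- s) D ^+ 2 * u P ^+ 2 <= _).
  rewrite -big_split/= !big_seq; apply: ler_sum => P Ps.
  apply: le_trans (_ : \sum_(Q <- s) (D ^+ 2 * (`|N P Q| * `|u Q| * `|u P|) + (P == Q)%:R * (D ^+ 2 * u P ^+ 2)) <= _).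
    apply: ler_sum => Q _; rewrite gramE /perturbed_mx.
    rewrite (_ : u P * u Q * (dg P ^+ 2 * ((P == Q)%:R - N P Q)) =
      dg P ^+ 2 * (- (N P Q * u Q * u P)) + (P == Q)%:R * (dg P ^+ 2 * (u P * u Q))); last by ring.
    apply: lerD.
      apply: le_trans (ler_norm _) _; rewrite normrM (ger0_norm (sqr_ge0 (dg P))) normrN !normrM.
      by apply: ler_wpM2r; [rewrite !mulr_ge0|exact: D2].
    case: eqP => [<-|_]; rewrite ?mul0r// !mul1r -expr2; apply: ler_wpM2r => //; exact: sqr_ge0.
  rewrite big_split/= lerD2l -mulr_suml (big_fsetD1 P)//= eqxx big1_seq ?addr0 ?mul1r//.
  by move=> Q /=; rewrite !inE eq_sym => /andP[/negbTE -> _].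
under eq_bigr do rewrite -mulr_sumr; rewrite -!mulr_sumr -mulrDr -mulrA.
apply: ler_wpM2l; first exact: sqr_ge0.
have S0 : 0 <= \sum_(P <- s) u P ^+ 2 by apply: sumr_ge0 => P _; exact: sqr_ge0.
by move: H S0; set S := \sum_(P <- s) u P ^+ 2; set T := \sum_(P <- s) _; lra.
Qed.

Let DD0 : 0 < D ^+ 2 * 2. Proof. by rewrite mulr_gt0// exprn_gt0// (lt_le_trans ltr01). Qed.

Lemma coef_sq g : bm g -> sqbounded (coef mu phi g) (D ^+ 2 * 2 * Int (fun x => g x ^+ 2)).
Proof. exact: (bessel mufin bphi DD0 gram_form). Qed.

Lemma coef_ell2 g : bm g -> ell2 (coef mu phi g).
Proof. by move=> bg; apply/ell2P; eexists; exact: coef_sq. Qed.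

(** Replaces pairings with [f_P] by [G^(-1/2)] applied to pairings with [phi_P], where the series in
    powers of [N] is available. *)
Lemma dualcoefE a a' : bm a' -> a = a' %[ae mu] -> measurable_fun [set: X] a ->
  c a = fun P => (dg P)^-1 * L (coef mu phi a') P.
Proof.
move=> ba aa' ma; have ha := coef_ell2 ba.
have [_ E] := invsqrt_bounded symN w0 schurw4 dg0 dgVD.
rewrite -(E _ ha) -AE; apply/funext => P; rewrite -(coef_orth mufin bphi f_orth invA P ba ha).
apply: Int_ae.
- by apply: measurable_funM => //; case: (bf' P).
- by apply: measurable_funM; [exact: orth_meas f_orth P|case: ba].
- by apply: filterS2 aa' (ff' P) => x /= e1 e2 _; rewrite e1// e2// mulrC.
Qed.

Lemma atom_sqbounded a : H1_atom mu d a -> exists B, sqbounded (c a) B.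
Proof.
move=> ha; have [a' [Loc [n0 [ba aa' _]]]] := atomP ha.
rewrite (dualcoefE ba aa' ha.1); apply/ell2P.
have [_ E] := invsqrt_bounded symN w0 schurw4 dg0 dgVD.
have hc := coef_ell2 ba; rewrite -(E _ hc).
have [bA _] := invsqrt_bounded symN w0 schurw4 dg0 dgVD.
by have [C [_ A2 _ _ _]] := bounded_mx_l2op bA; exact: A2.
Qed.

Lemma atom_integrable a : H1_atom mu d a -> L1 a.
Proof.
move=> ha; have [a' [Loc [n0 [ba aa' _]]]] := atomP ha.
apply: L1_ae ha.1 (bm_L1 mufin ba) _.
by apply: filterS aa' => x /= e _; rewrite e.
Qed.

(** [molecule_invsqrt] for [p] composed with the diagonal [dg^-1]. [P2] and [P3] are the constants
    of [p] on weighted l1 families and on localised l2 families; the factors [D] come from the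
    diagonal. *)
Lemma fseminorm_atom p (P2 P3 : R) a : fseminorm p -> 0 <= P2 -> 0 <= P3 ->
  (forall u B, fsbounded (fun P => `|u P| * w P) B -> p u <= P2 * B) ->
  (forall u (U V t : R) (B : set X), measurable B -> fine (mu B) <= V ->
    (forall P x, u P != 0 -> h P x != 0 -> B x) -> sqbounded u U -> 0 < t ->
    p u <= P3 * (t * U + t^-1 * V)) ->
  H1_atom mu d a ->
  p (c a) <= 2 * (molK K1 (P2 * D) (P3 * (D ^+ 2 + K6)) (D ^+ 2 * 2 * K4) K5).
Proof.
move=> [pD pZ [s1 [k1 [k10 pf]]]] P20 P30 pl1 pl2 ha.
have D0 : 0 < D by exact: lt_le_trans D1.
have [a' [Loc [n0 [ba aa' [Lstep Lsum Lsupp Llow [a2 LB]]]]]] := atomP ha.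
rewrite (dualcoefE ba aa' ha.1).
pose p' u := p (fun P => (dg P)^-1 * u P).
change (p' (L (coef mu phi a')) <= 2 * molK K1 (P2 * D) (P3 * (D ^+ 2 + K6)) (D ^+ 2 * 2 * K4) K5).
have dV P : 0 <= (dg P)^-1 by rewrite invr_ge0 ltW.
have dVn P : `|(dg P)^-1| <= D by rewrite ger0_norm.
have hu := coef_ell2 ba.
have th1 : 0 < theta <= 1.
  by rewrite th0 /=; case/andP: theta01 => _ /le_trans; apply; rewrite invf_le1// ler1n.
apply: (@molecule_invsqrt _ _ N w lev eps theta delta symN w0 th1 delta01 eps0 eps_delta
  schurw schurv Loc n0 K1 (P2 * D) (P3 * (D ^+ 2 + K6)) (D ^+ 2 * 2 * K4) K5 Lstep Lsum p') => //.
- move=> u1 u2; rewrite /p'; apply: le_trans (pD _ _); rewrite le_eqVlt; apply/orP; left; apply/eqP.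
  by congr p; apply/funext => P; rewrite mulrDr.
- move=> k u; rewrite /p'; apply: le_trans (pZ _ _); rewrite le_eqVlt; apply/orP; left; apply/eqP.
  by congr p; apply/funext => P; rewrite mulrCA.
- exists s1, (k1 * D); split; first by rewrite mulr_ge0// ltW.
  move=> u; apply: le_trans (pf _) _; rewrite -mulrA; apply: ler_wpM2l => //.
  by rewrite mulr_sumr; apply: ler_sum => P _; rewrite normrM; apply: ler_wpM2r.
- move=> u B hB; rewrite -mulrA; apply: pl1 => t.
  apply: le_trans (_ : D * \sum_(P <- t) `|u P| * w P <= _).
    rewrite mulr_sumr; apply: ler_sum => P _; rewrite normrM -mulrA.
    by apply: ler_wpM2r => //; rewrite mulr_ge0// ltW.
  by apply: ler_wpM2l; [exact: ltW|exact: hB].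
- move=> n u U t nn0 uL uU t0; have [B [mB muB LocB]] := LB n nn0.
  have U0 : 0 <= U by have := uU fset0; rewrite big_seq_fset0.
  apply: le_trans (pl2 _ (D ^+ 2 * U) (K6 * delta ^+ n) t B mB muB _ _ t0) _.
  + by move=> P x uP; apply: LocB; apply: uL; apply: contraNneq uP => ->; rewrite mulr0.
  + apply: sqbounded_le (sqboundedZ D uU) => P; rewrite !normrM; apply: ler_wpM2r => //.
    by rewrite [leRHS]ger0_norm// ltW.
  rewrite -mulrA; apply: ler_wpM2l => //.
  have dn : 0 <= delta ^+ n by rewrite exprn_ge0// ltW.
  have tV : 0 <= t^-1 by rewrite invr_ge0 ltW.
  have h1 : 0 <= D ^+ 2 * (t^-1 * delta ^+ n) by rewrite mulr_ge0 ?sqr_ge0// mulr_ge0.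
  have h2 : 0 <= K6 * (t * U) by rewrite mulr_ge0// mulr_ge0// ltW.
  by move: h1 h2; set x := t^-1; set y := delta ^+ n; lra.
- by rewrite mulr_ge0// ltW.
- by rewrite mulr_ge0// addr_ge0// sqr_ge0.
- by rewrite mulr_ge0// ltW.
(* The initial molecule: the coefficients of the atom, cut at its own level [n0]. *)
- pose u := coef mu phi a'.
  exists (fun P => if (n0 <= lev P)%N then u P else 0), (fun P => if (n0 <= lev P)%N then 0 else u P).
  split.
  + by apply/funext => P; case: ifP => _; rewrite ?addr0 ?add0r.
  + by apply: ell2_le hu => P; case: ifP => _ //; rewrite normr0.
  + by move=> P; case: ifPn => [nP uP|]; [rewrite subn0; exact: Lsupp|rewrite eqxx].
  + rewrite !expr0 !mul1r ?expr1n mul1r -mulrA.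
    apply: (@sqbounded_le _ _ _ u); first by move=> P; case: ifP => _ //; rewrite normr0.
    by move=> s; apply: le_trans (coef_sq ba s) _; apply: ler_wpM2l; [exact: ltW|].
  + move=> s; rewrite expr0 mulr1; apply: le_trans (_ : K5 <= _); last first.
      by rewrite -addrA lerDl addr_ge0// mulr_ge0// ltW.
    apply: le_trans (Llow [fset P in s | (lev P < n0)%N]%fset _); last first.
      by move=> P; rewrite !inE => /andP[].
    rewrite big_fset/= [leRHS]big_mkcond/=; apply: ler_sum => P _.
    by rewrite ltnNge; case: ifP => _ //=; rewrite normr0 mul0r.
Qed.

(** Cauchy-Schwarz on the support, in the form [|y| <= (t y^2 + t^-1) / 2] on [B]. *)
Lemma h_support_L1 (y : X -> R) (V W t : R) (B : set X) : bm y -> measurable B -> fine (mu B) <= V ->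
  (forall x, y x != 0 -> B x) -> Int (fun x => y x ^+ 2) <= W -> 0 < t ->
  Int (fun x => `|y x|) <= (t * W + t^-1 * V) / 2.
Proof.
move=> byy mB muB yB yW t0.
have b1 : bm (\1_B : X -> R) by exact: bm_indic.
have l1 : L1 (fun x => y x ^+ 2) by apply: bm_L1 => //; exact: bmX.
have l2 : L1 (\1_B : X -> R) by exact: bm_L1.
apply: le_trans (_ : Int (fun x => (t / 2) * y x ^+ 2 + (t^-1 / 2) * \1_B x) <= _).
  apply: le_Int.
  - by apply: bm_L1 => //; exact: bm_norm.
  - by apply: L1D; exact: L1Z.
  - move=> x; have [y0|yn] := eqVneq (y x) 0.
      rewrite y0 normr0 expr0n/= mulr0 add0r; apply: mulr_ge0; last by rewrite indicE.
      by rewrite divr_ge0// invr_ge0 ltW.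
    rewrite indicE mem_set ?mulr1; last exact: yB.
    rewrite -(real_normK (num_real (y x))) -subr_ge0.
    rewrite (_ : _ - _ = 2^-1 * (t^-1 * (t * `|y x| - 1) ^+ 2)); last by field; rewrite gt_eqF.
    by apply: mulr_ge0 => //; apply: mulr_ge0; [rewrite invr_ge0; exact: ltW|exact: sqr_ge0].
rewrite IntD; [|exact: L1Z|exact: L1Z]; rewrite !IntZ// Int_indic//.
have := ler_wpM2l (ltW t0) yW; have tV : 0 <= t^-1 by rewrite invr_ge0 ltW.
by have := ler_wpM2l tV muB; lra.
Qed.

Let sumh_le s u B : fsbounded (fun P => `|u P| * w P) B ->
  \sum_(P <- s) `|u P| * Int (fun x => `|h P x|) <= Kh * B.
Proof.
move=> hB; apply: le_trans (_ : Kh * \sum_(P <- s) `|u P| * w P <= _); last by apply: ler_wpM2l.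
by rewrite mulr_sumr; apply: ler_sum => P _; rewrite mulrCA; apply: ler_wpM2l.
Qed.

Definition atomK := 2 * (molK K1 (Kh * D) ((Ch + 1) / 2 * (D ^+ 2 + K6)) (D ^+ 2 * 2 * K4) K5).

Let fin_L1 (y : X -> R) s u B : bm y -> (forall x, `|y x| <= \sum_(P <- s) `|u P * h P x|) ->
  fsbounded (fun P => `|u P| * w P) B -> Int (fun x => `|y x|) <= Kh * B.
Proof.
move=> byy yle hB; apply: le_trans (sumh_le s hB).
apply: le_trans (_ : Int (fun x => \sum_(P <- s) `|u P * h P x|) <= _).
  apply: le_Int => //; first by apply: bm_L1 => //; exact: bm_norm.
  by apply: bm_L1 => //; apply: bm_sum => P; apply: bm_norm; exact: bmZ.
rewrite Int_sum//; last by move=> P; apply: bm_L1 => //; apply: bm_norm; exact: bmZ.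
apply: ler_sum => P _; under eq_fun do rewrite normrM; rewrite IntZ//.
by apply: bm_L1 => //; exact: bm_norm.
Qed.

Let scale_half (U V t : R) : 0 <= U -> 0 <= V -> 0 < t ->
  (t * (Ch * U) + t^-1 * V) / 2 <= (Ch + 1) / 2 * (t * U + t^-1 * V).
Proof.
move=> U0 V0 t0; have tV : 0 <= t^-1 by rewrite invr_ge0 ltW.
have h1 : 0 <= t * U by rewrite mulr_ge0// ltW.
have h2 : 0 <= Ch * (t^-1 * V) by rewrite mulr_ge0// mulr_ge0.
by move: h1 h2; set x := t^-1; lra.
Qed.

Lemma atom_M_bound a s : H1_atom mu d a -> Int (fun x => `|\sum_(P <- s) c a P * h P x|) <= atomK.
Proof.
move=> ha; have bs u : bm (fun x => \sum_(P <- s) u P * h P x) by apply: bm_sum => P; exact: bmZ.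
apply: (fseminorm_atom (qM_seminorm mufin bh s)) => //.
- by rewrite divr_ge0// addr_ge0.
- by move=> u B hB; apply: (fin_L1 (s := s)) hB => // x; exact: ler_norm_sum.
- move=> u U V t B mB muB uB uU t0.
  have V0 : 0 <= V by apply: le_trans muB; exact: fine_ge0.
  have U0 : 0 <= U by have := uU fset0; rewrite big_seq_fset0.
  apply: le_trans (scale_half U0 V0 t0).
  apply: (h_support_L1 (bs u) mB muB _ _ t0).
    move=> x; apply: contraNP => nB; rewrite big1// => P _; apply/eqP; rewrite mulf_eq0.
    by apply/orP; apply: contra_notP nB => /not_orP[/negP uP /negP hP]; exact: uB uP hP.
  by apply: le_trans (sum_sq mufin bh h_orth h_norm s u) _; apply: ler_wpM2l.
Qed.

(** The square of the square function integrates exactly to [sum u_P^2] times the integral of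
    [h_P^2], which gives the same localised l2 bound as for [atom_M_bound]. *)
Lemma atom_S_bound a s : H1_atom mu d a ->
  Int (fun x => Num.sqrt (\sum_(P <- s) (c a P * h P x) ^+ 2)) <= atomK.
Proof.
move=> ha.
have bs u : bm (fun x => \sum_(P <- s) (u P * h P x) ^+ 2) by apply: bm_sum => P; apply: bmX; exact: bmZ.
have nE u : Int (fun x => Num.sqrt (\sum_(P <- s) (u P * h P x) ^+ 2)) =
    Int (fun x => `|Num.sqrt (\sum_(P <- s) (u P * h P x) ^+ 2)|).
  by congr Rintegral; apply/funext => x; rewrite ger0_norm ?sqrtr_ge0.
apply: (fseminorm_atom (qS_seminorm mufin bh s)) => //.
- by rewrite divr_ge0// addr_ge0.
- move=> u B hB; rewrite /qS nE; apply: (fin_L1 (s := s)) hB; first exact: bm_sqrt.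
  by move=> x; rewrite ger0_norm ?sqrtr_ge0//; exact: sqrt_sum_sqr_le.
- move=> u U V t B mB muB uB uU t0.
  have V0 : 0 <= V by apply: le_trans muB; exact: fine_ge0.
  have U0 : 0 <= U by have := uU fset0; rewrite big_seq_fset0.
  apply: le_trans (scale_half U0 V0 t0); rewrite /qS nE.
  apply: (h_support_L1 (bm_sqrt (bs u)) mB muB _ _ t0).
    move=> x; apply: contraNP => nB; rewrite big1 ?sqrtr0// => P _; apply/eqP; rewrite sqrf_eq0 mulf_eq0.
    by apply/orP; apply: contra_notP nB => /not_orP[/negP uP /negP hP]; exact: uB uP hP.
  have -> : (fun x => Num.sqrt (\sum_(P <- s) (u P * h P x) ^+ 2) ^+ 2) =
      fun x => \sum_(P <- s) u P ^+ 2 * h P x ^+ 2.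
    apply/funext => x; rewrite sqr_sqrtr; last by apply: sumr_ge0 => P _; exact: sqr_ge0.
    by apply: eq_bigr => P _; rewrite exprMn.
  rewrite Int_sum//; last by move=> P; apply: bm_L1 => //; apply: bmZ; exact: bmX.
  apply: le_trans (_ : \sum_(P <- s) Ch * u P ^+ 2 <= _).
    apply: ler_sum => P _; rewrite IntZ; last by apply: bm_L1 => //; exact: bmX.
    by rewrite mulrC; apply: ler_wpM2r; [exact: sqr_ge0|exact: h_norm].
  by rewrite -mulr_sumr; apply: ler_wpM2l.
Qed.

Lemma atomK_ge0 : 0 <= atomK.
Proof.
have D0 : 0 <= D by apply: le_trans D1.
rewrite /atomK /molK; apply: mulr_ge0 => //; apply: addr_ge0; apply: mulr_ge0.
- by apply: mulr_ge0; [rewrite divr_ge0// addr_ge0|rewrite addr_ge0// sqr_ge0].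
- by rewrite addr_ge0// mulr_ge0// mulr_ge0// sqr_ge0.
- exact: mulr_ge0.
- by rewrite !addr_ge0// mulr_ge0// mulr_ge0// sqr_ge0.
Qed.
End Coefficients.
End CubeSystem.

(** * Bounded functions belong to atomic H1 *)

Section BoundedFunctions.
Context {R : realType} {disp : measure_display} {X : measurableType disp}.
Variable mu : {measure set X -> \bar R}.
Hypothesis mufin : (mu [set: X] < +oo)%E.
Hypothesis mupos : (0 < mu [set: X])%E.
Variable d : X -> X -> R.
Local Notation Int f := (Rintegral mu [set: X] f).
Local Notation L1 := (integrableR mu).

(** A two-term combination becomes a sequence representation by padding with zero coefficients; from
    the second partial sum on the error is zero almost everywhere. *)
Lemma H1norm_two (f a0 a1 : X -> R) (l0 l1 : R) : measurable_fun [set: X] f ->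
  H1_atom mu d a0 -> H1_atom mu d a1 -> f = (fun x => l0 * a0 x + l1 * a1 x) %[ae mu] ->
  (atomic_H1norm mu d f <= (`|l0| + `|l1|)%:E)%E.
Proof.
move=> mf h0 h1 fE; apply: ereal_inf_lbound.
exists (fun n => if n is n'.+1 then (if n' is 0%N then l1 else 0) else l0).
exists (fun n => if n is 0%N then a0 else a1).
have S : (\sum_(0 <= i <oo) `|(if i is n'.+1 then (if n' is 0%N then l1 else 0) else l0)|%:E =
    (`|l0| + `|l1|)%:E)%E.
  rewrite (nneseries_split 0 2)/=; last by move=> k _; rewrite lee_fin.
  rewrite eseries0; last by move=> [|[|k]]// _ _; rewrite normr0.
  by rewrite adde0 big_nat_recr//= big_nat1.
split=> //; split; [by case|by rewrite S ltry|].
apply: cvg_near_cst; near_simpl; exists 2%N => // -[|[|n]]//= _.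
transitivity (\int[mu]_x (cst 0%E : X -> \bar R) x)%E; last by rewrite integral_cst// mul0e.
have m0 := h0.1; have m1 := h1.1.
apply: ae_eq_integral => //.
  apply/measurable_EFinP; apply: measurableT_comp => //; apply: measurable_funB => //.
  by apply: measurable_sum => i; apply: measurable_funM => //; case: i => -[].
apply: filterS fE => x /= E _; rewrite E//; congr (_%:E); apply/normr0P/eqP.
rewrite big_ord_recl/= big_ord_recl/= big1 ?addr0 ?subrr// => i _.
by rewrite mul0r.
Qed.

Lemma H1_atom_cst : H1_atom mu d (cst (fine (mu [set: X]))^-1).
Proof. by split=> //; right. Qed.

Lemma H1norm0 : (atomic_H1norm mu d (fun=> 0%R) <= 0)%E.
Proof.
have := @H1norm_two (fun=> 0) _ _ 0 0 _ H1_atom_cst H1_atom_cst.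
by rewrite normr0 addr0; apply => //; apply: nearW => x _; rewrite !mul0r addr0.
Qed.

(** The whole space is a ball, so [f] is its integral times the constant atom plus [t] times an atom
    of that ball. This puts the [f_Q] into [Y]. *)
Lemma bounded_H1 x0 r (f f' : X -> R) : 0 < r -> qball d x0 r = [set: X] ->
  measurable_fun [set: X] f -> bm f' -> f = f' %[ae mu] -> atomic_H1 mu d f.
Proof.
move=> r0 B0 mf bf' ff'; have Lf' := bm_L1 mufin bf'.
have Lf : L1 f by apply: L1_ae mf Lf' _; apply: filterS ff' => x /= h _; rewrite h.
split=> //.
have m0 : 0 < fine (mu [set: X]) by apply: fine_gt0; rewrite mupos mufin.
pose a := Int f / fine (mu [set: X]).
have [mf' [B hB]] := bf'.
pose K := `|B| + `|a| + 1.
have K0 : 0 < K by rewrite /K; have := normr_ge0 B; have := normr_ge0 a; lra.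
pose t := K * fine (mu [set: X]).
have t0 : 0 < t by rewrite mulr_gt0.
pose a1 x := t^-1 * (f x - a).
have ha1 : H1_atom mu d a1.
  split; first by apply: measurable_funM => //; apply: measurable_funB.
  left; exists x0, r; split=> //.
  - by move=> y _; rewrite B0.
  - rewrite B0 unlock /Lnorm mupos; apply/ess_supP; apply: filterS ff' => x /= h.
    rewrite lee_fin /a1 h// normrM (ger0_norm (ltW _)) ?invr_gt0//.
    rewrite (_ : (fine _)^-1 = t^-1 * K); last by rewrite /t invfM mulrAC mulVf ?mul1r// gt_eqF.
    apply: ler_wpM2l; first by rewrite invr_ge0 ltW.
    rewrite (le_trans (ler_normB _ _))// /K.
    by have := hB x; have := ler_norm B; have := normr_ge0 a; lra.
  - rewrite /a1 IntZ; last by apply: L1B => //; exact: bm_L1 (bm_cst _).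
    rewrite IntB//; last exact: bm_L1 (bm_cst _).
    by rewrite Int_cst// /a divfK ?gt_eqF// subrr mulr0.
apply: le_lt_trans (H1norm_two mf H1_atom_cst ha1 (l0 := Int f) (l1 := t) _) _; last by rewrite ltry.
apply: nearW => x _; rewrite /a1 mulrA mulfV ?gt_eqF// mul1r /= -/a.
by rewrite addrC subrK.
Qed.
End BoundedFunctions.

(** * The transfer operator for an abstract cube system *)

Section TransferOperator.
Context {R : realType} {disp : measure_display} {X : measurableType disp}.
Variable mu : {measure set X -> \bar R}.
Hypothesis mufin : (mu [set: X] < +oo)%E.
Hypothesis mupos : (0 < mu [set: X])%E.
Variable d : X -> X -> R.
Hypothesis ballX : exists x r, 0 < r /\ qball d x r = [set: X].
Context {F : choiceType}.
Implicit Types (g : X -> R) (s : {fset F}) (u : F -> R).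
Local Notation Int f := (Rintegral mu [set: X] f).
Local Notation L1 := (integrableR mu).
Variables (phi f h : F -> X -> R) (lev : F -> nat) (w dg : F -> R) (N : F -> F -> R).
Variables (D Cphi Ch Kh eps theta delta K1 K4 K5 K6 : R).
Hypothesis symN : forall P Q, N P Q = N Q P.
Hypothesis w0 : forall P, 0 < w P.
Hypothesis theta01 : 0 < theta <= 2^-1.
Hypothesis delta01 : 0 < delta <= 1.
Hypothesis eps0 : 0 < eps.
Hypothesis eps_delta : eps <= delta / 4.
Hypothesis schurw : forall Q, fsbounded (fun P => `|N P Q| * w P) (eps * w Q).
Hypothesis schurv : forall Q, fsbounded (fun P => `|N P Q| * (w P * theta ^+ lev P)) (eps * (w Q * theta ^+ lev Q)).
Hypothesis dg0 : forall P, 0 < dg P.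
Hypothesis dgD : forall P, dg P <= D.
Hypothesis dgVD : forall P, (dg P)^-1 <= D.
Hypothesis dgN : forall P Q, N P Q != 0 -> dg P = dg Q.
Hypothesis D1 : 1 <= D.
Hypothesis bphi : forall P, bm (phi P).
Hypothesis bh : forall P, bm (h P).
Hypothesis gramE : gram_mx mu phi = perturbed_mx N dg.
Hypothesis f_orth : gram_orthonormalization mu phi f.
Hypothesis phi_le : forall P x, `|phi P x| <= Cphi / w P.
Hypothesis phi_disj : forall P Q x, phi P x != 0 -> phi Q x != 0 -> lev P = lev Q -> P = Q.
Hypothesis h_orth : forall P Q, P != Q -> Int (fun x => h P x * h Q x) = 0.
Hypothesis h_norm : forall P, Int (fun x => h P x ^+ 2) <= Ch.
Hypothesis h_L1 : forall P, Int (fun x => `|h P x|) <= Kh * w P.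
Hypothesis Cphi0 : 0 <= Cphi.
Hypothesis Ch0 : 0 <= Ch.
Hypothesis Kh0 : 0 <= Kh.
Hypothesis K10 : 0 <= K1.
Hypothesis K40 : 0 <= K4.
Hypothesis K50 : 0 <= K5.
Hypothesis K60 : 0 <= K6.

Hypothesis atomP : forall a, H1_atom mu d a ->
  atom_data mu phi h lev w N theta delta K1 K4 K5 K6 a.

Variables (birth : F -> nat) (lvl : nat -> {fset F}) (S : nat -> set (set X)).
Hypothesis mS : forall n A, S n A -> measurable A.
Hypothesis S_mono : forall n m, (n <= m)%N -> S n `<=` S m.
Hypothesis mh : forall P,
  measurable_fun [set: g_sigma_algebraType (S (birth P))] (h P : g_sigma_algebraType (S (birth P)) -> R).
Hypothesis lvlP : forall n P, (P \in lvl n) = (birth P <= n)%N.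
Hypothesis h_mart : forall n A P, <<s S n >> A -> (n < birth P)%N -> \int[mu]_(x in A) h P x = 0.
Hypothesis h_disj : forall P Q x, P != Q -> birth P = birth Q -> h P x * h Q x = 0.

Lemma transfer_operator : let Y := atomic_H1_closed_span mu d f in exists T : (X -> R) -> (X -> R),
  bounded_linear_operator mu Y (atomic_H1norm mu d) (mart_H1 mu S) (mart_H1norm mu S) T /\
  forall Q, Y (f Q) /\ T (f Q) = h Q %[ae mu].
Proof.
move=> Y.
have [f' [bf' ff']] : exists f' : F -> X -> R, (forall P, bm (f' P)) /\ forall P, f P = f' P %[ae mu].
  exact: (bounded_version symN w0 theta01 delta01 eps_delta schurw schurv dg0 dgD dgVD dgN D1 bphi
    gramE f_orth phi_le phi_disj Cphi0).
exists (synth mu f' h lvl S); split.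
  apply: (@synth_bounded _ _ _ _ mufin d _ f' h birth lvl S (atomK D Ch Kh K1 K4 K5 K6) Ch) => //.
  - move=> a ha; exact: (atom_integrable mufin atomP ha).
  - move=> a ha; exact: (atom_sqbounded mufin symN w0 delta01 eps_delta schurw dg0 dgD dgVD dgN D1 bphi
      gramE f_orth atomP bf' ff' ha).
  - move=> a s ha; exact: (atom_M_bound mufin symN w0 theta01 delta01 eps0 eps_delta
      schurw schurv dg0 dgD dgVD dgN D1 bphi bh gramE f_orth h_orth h_norm h_L1
      Ch0 Kh0 K10 K40 K50 K60 atomP bf' ff' s ha).
  - move=> a s ha; exact: (atom_S_bound mufin symN w0 theta01 delta01 eps0 eps_delta
      schurw schurv dg0 dgD dgVD dgN D1 bphi bh gramE f_orth h_norm h_L1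
      Ch0 Kh0 K10 K40 K50 K60 atomP bf' ff' s ha).
  - exact: atomK_ge0.
  - by move=> g [].
move=> Q; split; last by apply: (synth_unit mufin bh mh lvlP); exact: (dualcoef_orth mufin symN w0 delta01 eps_delta schurw dg0 dgD dgVD dgN bphi gramE f_orth bf' ff').
have [x0 [r [r0 B0]]] := ballX.
split; first exact: (bounded_H1 mufin mupos r0 B0 (orth_meas f_orth Q) (bf' Q) (ff' Q)).
move=> e e0; exists [fset Q]%fset, (fun=> 1).
under eq_fun do rewrite big_seq_fset1 mul1r subrr.
by apply: le_lt_trans (H1norm0 mu d) _; rewrite lte_fin.
Qed.
End TransferOperator.

Lemma lev_arith1 k m q : (k + m <= q)%N -> (k <= q - m)%N. Proof. lia. Qed.
Lemma lev_arith2 k m q : (k + m <= q)%N -> (q - k = m + (q - m - k))%N. Proof. lia. Qed.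
Lemma lev_arith3 k m q : (q + m <= k)%N -> (k - q = m + (k - (q + m)))%N. Proof. lia. Qed.

(** * Schur's condition from decay across levels *)

Section LevelSchur.
Context {R : realType} {F : choiceType}.
Variable th : R.
Hypothesis th01 : 0 < th <= 2^-1.
Let th0 : 0 < th. Proof. by case/andP: th01. Qed.
Let th1 : th <= 1. Proof. by case/andP: th01 => _ /le_trans; apply; rewrite invf_le1// ler1n. Qed.

Lemma geo_up n a : \sum_(k < n | (a <= k)%N) th ^+ (k - a) <= 2.
Proof.
have -> : \sum_(k < n | (a <= k)%N) th ^+ (k - a) = \sum_(j < n - a) th ^+ j.
  elim: n => [|n IH]; first by rewrite sub0n !big_ord0.
  rewrite big_mkcond big_ord_recr/= -big_mkcond IH; case: leqP => an.
    by rewrite subSn// big_ord_recr.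
  by rewrite addr0 (eqP an) (eqP (ltnW an)).
by apply: half_sum_ord; rewrite ltW//=; case/andP: th01.
Qed.

Lemma geo_down n a : \sum_(k < n | (k <= a)%N) th ^+ (a - k) <= 2.
Proof.
apply: le_trans (_ : \sum_(k < n | (k <= a)%N) (2^-1 : R) ^+ (a - k) <= _).
  apply: ler_sum => k _; apply: lerXn2r; rewrite ?nnegrE ?invr_ge0//; first exact: ltW.
  by case/andP: th01.
suff H : \sum_(k < n | (k <= a)%N) (2^-1 : R) ^+ (a - k) <= 2 * (2^-1) ^+ (a.+1 - n).
  apply: le_trans H _; rewrite ler_piMr//; apply: exprn_ile1; rewrite ?invr_ge0// invf_le1// ler1n//.
elim: n => [|n IH]; first by rewrite big_ord0 mulr_ge0// exprn_ge0// invr_ge0.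
rewrite big_mkcond big_ord_recr/= -big_mkcond; case: leqP => an.
  move: IH; rewrite subSS subSn// exprS; set x := (2^-1 : R) ^+ _.
  by rewrite mulrA mulfV// mul1r => IH; rewrite mulrDl mul1r lerD2r.
rewrite addr0 subSS; apply: le_trans IH _.
by move: (an); rewrite -subn_eq0 => /eqP ->; move: (ltnW an); rewrite -subn_eq0 => /eqP ->.
Qed.

Variables (N : F -> F -> R) (w : F -> R) (lev : F -> nat) (m : nat) (CE CF : R).
Hypothesis w0 : forall P, 0 < w P.
Hypothesis symN : forall P Q, N P Q = N Q P.
Hypothesis CE0 : 0 <= CE.
Hypothesis CF0 : 0 <= CF.
Hypothesis gap : forall P Q, N P Q != 0 -> (lev P + m <= lev Q)%N \/ (lev Q + m <= lev P)%N.
Hypothesis N_le : forall P Q, (lev Q <= lev P)%N ->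
  `|N P Q| <= CE * (w P / w Q) * (th ^+ 2) ^+ (lev P - lev Q).
Hypothesis coarse_uniq : forall P P' Q, N P Q != 0 -> N P' Q != 0 -> lev P = lev P' ->
  (lev P < lev Q)%N -> P = P'.
Hypothesis fine_sum : forall Q n (s : {fset F}),
  (forall P, P \in s -> [/\ lev P = n, N P Q != 0 & (lev Q < n)%N]) ->
  \sum_(P <- s) w P ^+ 2 <= CF * w Q ^+ 2.
Hypothesis m0 : (0 < m)%N.

Lemma level_schur e Q : (e <= 1)%N ->
  fsbounded (fun P => `|N P Q| * (w P * th ^+ (e * lev P)))
    (4 * CE * (CF + 1) * th ^+ m * (w Q * th ^+ (e * lev Q))).
Proof.
move=> e1 s; have [n ->] := sum_by_level lev s (fun P => `|N P Q| * (w P * th ^+ (e * lev P))).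
set q := lev Q; set W := w Q * th ^+ (e * q).
have W0 : 0 <= W by rewrite mulr_ge0 ?exprn_ge0 ?ltW.
set K := CE * (CF + 1).
have K0 : 0 <= K by rewrite mulr_ge0// addr_ge0.
pose up k := if (q + m <= k)%N then th ^+ (k - (q + m)) else 0.
pose dn k := if (k <= q)%N then th ^+ (q - k) else 0.
pose dm k := if (k <= q - m)%N then th ^+ (q - m - k) else 0.
have up0 k : 0 <= up k by rewrite /up; case: ifP => // _; rewrite exprn_ge0// ltW.
have dm0 k : 0 <= dm k by rewrite /dm; case: ifP => // _; rewrite exprn_ge0// ltW.
have tm : 0 <= th ^+ m by rewrite exprn_ge0// ltW.
apply: le_trans (_ : \sum_(k < n) K * W * th ^+ m * (up k + dm k) <= _).
  apply: ler_sum => k _.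
  have KW0 : 0 <= K * W by exact: mulr_ge0.
  have R0 : 0 <= K * W * th ^+ m by exact: mulr_ge0.
  have [qk|kq] := leqP (q + m) k; last first.
    have [kq'|qk'] := leqP (k + m) q; last first.
      rewrite big1_seq; first by apply: mulr_ge0 => //; exact: addr_ge0.
      move=> P /= /andP[/eqP Pk _].
      have [->|/gap[]] := eqVneq (N P Q) 0; first by rewrite normr0 mul0r.
        by rewrite Pk -/q leqNgt qk'.
      by rewrite Pk -/q leqNgt kq.
    (* coarser cubes: at most one term *)
    have kq2 : (k < q)%N by apply: leq_trans kq'; rewrite -addn1 leq_add2l.
    have kqm : (k <= q - m)%N by exact: lev_arith1.
    apply: le_trans (_ : CE * W * th ^+ (q - k) <= _); last first.
      have -> : (q - k = m + (q - m - k))%N.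
        exact: lev_arith2.
      rewrite exprD mulrA; apply: ler_pM => //.
      - by do 2 apply: mulr_ge0 => //.
      - by rewrite exprn_ge0// ltW.
      - rewrite /K; apply: ler_wpM2r => //; apply: ler_wpM2r => //.
        by rewrite ler_peMr// lerDr.
      - by rewrite /dm kqm lerDr.
    have [[P [Ps NP Pk]]|no] := pselect (exists P, [/\ P \in s, N P Q != 0 & lev P = k]).
      rewrite big_mkcond (big_fsetD1 P)//= Pk eqxx big1_seq ?addr0; last first.
        move=> P' /=; rewrite !inE => /andP[PP Ps']; case: eqP => // Pk'.
        have [->|NP'] := eqVneq (N P' Q) 0; first by rewrite normr0 mul0r.
        by move/eqP : PP => []; apply: (coarse_uniq NP' NP); rewrite ?Pk ?Pk'.
      rewrite symN; have := @N_le Q P; rewrite Pk -/q => /(_ (ltnW kq2)) h.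
      apply: le_trans (ler_wpM2r _ h) _; first by rewrite mulr_ge0 ?exprn_ge0 ?ltW.
      rewrite (_ : _ * _ * _ * _ = CE * w Q * ((th ^+ 2) ^+ (q - k) * th ^+ (e * k))); last first.
        by field; rewrite gt_eqF.
      rewrite /W -!mulrA; apply: ler_wpM2l => //; apply: ler_wpM2l; first exact: ltW.
      rewrite -exprM -!exprD; apply: ler_wiXn2l; [exact: ltW|exact: th1|].
      have -> : (e * q = e * k + e * (q - k))%N by rewrite -mulnDr subnKC// ltnW.
      rewrite -addnA addnC mul2n -addnn leq_add2r addnC leq_add2l.
      by rewrite -[leqRHS]mul1n leq_mul2r e1 orbT.
    rewrite big1_seq; first by apply: mulr_ge0; [exact: mulr_ge0|rewrite exprn_ge0// ltW].
    move=> P /= /andP[/eqP Pk Ps]; have [->|NP] := eqVneq (N P Q) 0; first by rewrite normr0 mul0r.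
    by case: no; exists P.
  (* finer cubes *)
  have qk' : (q < k)%N by apply: leq_trans qk; rewrite -addn1 leq_add2l.
  apply: le_trans (_ : \sum_(P <- s | (lev P == k) && (N P Q != 0))
      (CE * (th ^+ 2) ^+ (k - q) * th ^+ (e * k) / w Q) * w P ^+ 2 <= _).
    rewrite big_mkcondr/=; apply: ler_sum => P /eqP Pk.
    case: eqP => [->|_] /=; first by rewrite normr0 mul0r.
    have := @N_le P Q; rewrite Pk -/q => /(_ (ltnW qk')) h.
    apply: le_trans (ler_wpM2r _ h) _; first by rewrite mulr_ge0 ?exprn_ge0 ?ltW.
    by rewrite le_eqVlt; apply/orP; left; apply/eqP; field; rewrite gt_eqF.
  have c0 : 0 <= CE * (th ^+ 2) ^+ (k - q) * th ^+ (e * k) / w Q.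
    by rewrite !mulr_ge0// ?exprn_ge0 ?exprn_ge0 ?invr_ge0 ?ltW.
  rewrite -mulr_sumr -big_filter.
  have h := @fine_sum Q k [fset P in s | (lev P == k) && (N P Q != 0)]%fset.
  have E : \sum_(P <- [fset P in s | (lev P == k) && (N P Q != 0)]%fset) w P ^+ 2 =
      \sum_(P <- [seq P <- s | (lev P == k) && (N P Q != 0)]) w P ^+ 2.
    apply: perm_big; apply: uniq_perm; rewrite ?fset_uniq ?filter_uniq//.
    by move=> P; rewrite !inE mem_filter andbC.
  rewrite E in h; apply: le_trans (ler_wpM2l c0 (h _)) _.
    by move=> P; rewrite !inE => /andP[_ /andP[/eqP ? ?]]; split.
  have kE : (k - q = m + (k - (q + m)))%N by exact: lev_arith3.
  rewrite (_ : _ * (CF * _) = (CE * CF * (w Q * (th ^+ (k - q) * th ^+ (e * k)))) * th ^+ (k - q)); last first.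
    by rewrite -exprM mul2n -addnn exprD; field; rewrite gt_eqF.
  rewrite [X in _ * X <= _](_ : _ = th ^+ m * th ^+ (k - (q + m))); last by rewrite kE exprD.
  rewrite [leLHS]mulrA; apply: ler_pM.
  - by rewrite !mulr_ge0// ?exprn_ge0 ?ltW.
  - by apply: exprn_ge0; exact: ltW.
  - apply: ler_wpM2r => //; apply: ler_pM.
    + exact: mulr_ge0.
    + by rewrite !mulr_ge0// ?exprn_ge0 ?ltW.
    + by rewrite /K; apply: ler_wpM2l => //; rewrite lerDl.
    + rewrite /W; apply: ler_wpM2l; first exact: ltW.
      rewrite -exprD; apply: ler_wiXn2l; [exact: ltW|exact: th1|].
      by apply: leq_trans (leq_addl _ _); rewrite leq_mul2l (ltnW qk') orbT.
  - by rewrite /up qk lerDl.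
rewrite -mulr_sumr big_split/=.
have h1 : \sum_(k < n) up k <= 2 by rewrite -big_mkcond; exact: geo_up.
have h2 : \sum_(k < n) dm k <= 2 by rewrite -big_mkcond; exact: geo_down.
apply: le_trans (ler_wpM2l _ (lerD h1 h2)) _; first by apply: mulr_ge0 => //; apply: mulr_ge0.
by rewrite le_eqVlt; apply/orP; left; apply/eqP; rewrite /K /W; ring.
Qed.
End LevelSchur.

(** * Almost orthogonality and atoms in the cube geometry *)

Section CubeGeometry.
Context {R : realType} {disp : measure_display} {X : measurableType disp}.
Variable mu : {measure set X -> \bar R}.
Hypothesis mufin : (mu [set: X] < +oo)%E.
Hypothesis mupos : (0 < mu [set: X])%E.
Variable d : X -> X -> R.
Context {F : choiceType}.
Implicit Types (g : X -> R) (s : {fset F}) (u : F -> R).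
Local Notation Int f := (Rintegral mu [set: X] f).
Local Notation L1 := (integrableR mu).
Local Notation m A := (fine (mu A)).
Local Notation B := (qball d).

(* cancellation: only the oscillation of g on the support of a matters *)
Lemma osc_bound (a g : X -> R) (S : set X) (A G g0 : R) : bm a -> bm g -> measurable S ->
  Int a = 0 -> 0 <= A -> 0 <= G -> (forall x, `|a x| <= A) -> (forall x, a x != 0 -> S x) ->
  (forall x, S x -> `|g x - g0| <= G) -> `|Int (fun x => a x * g x)| <= A * G * m S.
Proof.
move=> ba bg mS a0 A0 G0 aA aS gG.
have bg' : bm (fun x => g x - g0) by apply: bmB => //; exact: bm_cst.
have bag := bmM ba bg'.
have -> : Int (fun x => a x * g x) = Int (fun x => a x * (g x - g0)).
  rewrite (_ : (fun x => a x * (g x - g0)) = fun x => a x * g x - a x * g0); last first.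
    by apply/funext => x; rewrite mulrBr.
  rewrite IntB; [|exact: bm_L1 (bmM ba bg)|exact: bm_L1 (bmM ba (bm_cst _))].
  have -> : (fun x => a x * g0) = (fun x => g0 * a x) by apply/funext => x; rewrite mulrC.
  by rewrite IntZ ?a0 ?mulr0 ?subr0//; exact: bm_L1.
apply: le_trans (norm_Int (bm_L1 mufin bag)) _.
have bi : bm (fun x => A * G * \1_S x) by apply: bmZ; exact: bm_indic.
apply: le_trans (_ : Int (fun x => A * G * \1_S x) <= _).
  apply: le_Int; [by apply: bm_L1 => //; exact: bm_norm|exact: bm_L1|] => x.
  have [->|ax] := eqVneq (a x) 0; first by rewrite mul0r normr0 mulr_ge0// mulr_ge0.
  rewrite indicE (mem_set (aS _ ax)) mulr1 normrM; apply: ler_pM => //.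
  exact: gG (aS _ ax).
by rewrite IntZ ?Int_indic//; apply: bm_L1 => //; exact: bm_indic.
Qed.

Variables (kq A2 DX cb : R).
Let V := m [set: X].
Hypothesis d_ge0 : forall x y, 0 <= d x y.
Hypothesis d_sym : forall x y, d x y = d y x.
Hypothesis d_xx : forall x, d x x = 0.
Hypothesis d_tri : forall x y z, d x y <= kq * (d x z + d z y).
Hypothesis kq1 : 1 <= kq.
Hypothesis mball : forall x r, measurable (B x r).
Hypothesis d_le : forall x y, d x y <= DX.
Hypothesis A20 : 0 <= A2.
Hypothesis cb0 : 0 <= cb.
Hypothesis ball_gt0 : forall x r, 0 < r -> 0 < m (B x r).
Hypothesis ball_rad : forall x r y, 0 < r -> B x r y -> d x y <= cb * m (B x r).
Hypothesis ball_upper : forall x r t, 0 < r -> m (B x r) <= t -> m (B x t) <= A2 * t.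

Variables (Qs : F -> set X) (phi h f : F -> X -> R) (lev : F -> nat) (dg : F -> R).
Variables (delta th beta c1 CD Dsep Cphi CL Ch D' D : R) (gapm : nat).
Let w P := Num.sqrt (m (Qs P)).
(** [c2 delta^lev] is a radius that reaches the support of [phi P] from any point of the cube [P].
    [Dsep] measures the separation of cubes of one level, and [D'] the size of the neighbourhoods
    [Loc]. *)
Variable c2 : R.
Hypothesis c2E : c2 = kq * (CD + 1).
Hypothesis delta01 : 0 < delta <= 1.
Hypothesis th01 : 0 < th <= 2^-1.
Hypothesis beta0 : 0 < beta.
Hypothesis thE : forall n, (delta ^+ n) `^ beta = (th ^+ 2) ^+ n.
Hypothesis c10 : 0 < c1.
Hypothesis CD0 : 0 < CD.
Hypothesis Cphi0 : 0 < Cphi.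
Hypothesis CL0 : 0 < CL.
Hypothesis Ch0 : 0 <= Ch.
Hypothesis mQ : forall P, measurable (Qs P).
Hypothesis Q_ne : forall P, exists z, Qs P z.
Hypothesis Q_lower : forall P, c1 * delta ^+ lev P <= m (Qs P).
Hypothesis Q_diam : forall P y z, Qs P y -> Qs P z -> d y z <= CD * delta ^+ lev P.
Hypothesis Q_upper : forall P z t, Qs P z -> 2 * CD * delta ^+ lev P <= t -> m (B z t) <= A2 * t.
Hypothesis Q_sep : forall P Q p q, P != Q -> lev P = lev Q -> Qs P p -> Qs Q q ->
  Dsep * delta ^+ lev P <= d p q.
Hypothesis Dsep_gt : 4 * kq ^+ 3 * (c2 + cb * V) < Dsep.
Hypothesis phi_supp : forall P x, phi P x != 0 -> exists2 y, Qs P y & d x y <= delta ^+ lev P.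
Hypothesis phi_bd : forall P x, `|phi P x| <= Cphi / w P.
Hypothesis phi_hol : forall P x y, `|phi P x - phi P y| <= CL / w P * (d x y / delta ^+ lev P) `^ beta.
Hypothesis phi_int : forall P, (0 < lev P)%N -> Int (phi P) = 0.
Hypothesis phi_cst : forall P, lev P = 0%N -> phi P = cst 1.
Hypothesis phi_sq : forall P, Int (fun x => phi P x * phi P x) = dg P ^+ 2.
Hypothesis bphi : forall P, bm (phi P).
Hypothesis bh : forall P, bm (h P).
Hypothesis h_supp : forall P x, h P x != 0 -> Qs P x.
Hypothesis lev0 : forall P Q, lev P = 0%N -> lev Q = 0%N -> P = Q.
Hypothesis gap_lev : forall P Q, (0 < lev P)%N -> (0 < lev Q)%N -> lev P <> lev Q ->
  (lev P + gapm <= lev Q)%N \/ (lev Q + gapm <= lev P)%N.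
Hypothesis gapm0 : (0 < gapm)%N.
Hypothesis dg0 : forall P, 0 < dg P.
Hypothesis dgD : forall P, dg P <= D.
Hypothesis dgVD : forall P, (dg P)^-1 <= D.
Hypothesis D1 : 1 <= D.
Hypothesis dg1 : forall P, (0 < lev P)%N -> dg P = 1.
Hypothesis D'_ge : DX <= D' /\ V <= D'.
Hypothesis D'_ge2 : kq * (cb * V + c2) <= D'.
Hypothesis D'_step : delta * (kq * (D' + 2 * kq * c2)) <= D'.
Hypothesis f_orth : gram_orthonormalization mu phi f.

Let G := gram_mx mu phi.
Let N P Q := (P == Q)%:R - G P Q / (dg P * dg Q).
Let CE := Cphi * CL * (2 * c2) `^ beta * (2 * A2 * c2 / c1).
Let CF := 4 * A2 * kq * c2 / c1.
Let dl0 : 0 < delta. Proof. by case/andP: delta01. Qed.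
Let dl n : 0 < delta ^+ n. Proof. exact: exprn_gt0. Qed.
Let dl_le n k : (n <= k)%N -> delta ^+ k <= delta ^+ n.
Proof. by move=> nk; apply: ler_wiXn2l => //; [exact: ltW|case/andP: delta01]. Qed.
Let kq0 : 0 < kq. Proof. exact: lt_le_trans kq1. Qed.
Let c2_ge1 : 1 <= c2.
Proof. by rewrite c2E; apply: le_trans kq1 _; rewrite ler_peMr ?lerDr// ltW. Qed.
Let c20 : 0 < c2. Proof. exact: lt_le_trans c2_ge1. Qed.
Let CD_c2 : 2 * CD <= 2 * c2.
Proof. by rewrite ler_pM2l// c2E; apply: le_trans (ler_peMl _ kq1); rewrite ?lerDl// addr_ge0// ltW. Qed.
Let mQ0 P : 0 < m (Qs P).
Proof. by apply: lt_le_trans (Q_lower P); exact: mulr_gt0. Qed.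
Let w0 P : 0 < w P. Proof. by rewrite sqrtr_gt0. Qed.
Let w2 P : w P ^+ 2 = m (Qs P). Proof. by rewrite sqr_sqrtr// ltW. Qed.
Let V0 : 0 < V. Proof. by apply: fine_gt0; rewrite mupos mufin. Qed.
Let fineE A : measurable A -> mu A \is a fin_num.
Proof.
by move=> mA; rewrite ge0_fin_numE//; apply: le_lt_trans mufin; apply: le_measure; rewrite ?inE.
Qed.
Let m_le A A' : measurable A -> measurable A' -> A `<=` A' -> m A <= m A'.
Proof. by move=> mA mA' AA; apply: fine_le; rewrite ?fineE//; apply: le_measure; rewrite ?inE. Qed.

Let tri_le x y z a b : d x z <= a -> d z y <= b -> d x y <= kq * (a + b).
Proof.
move=> h1 h2; apply: le_trans (d_tri x y z) _; apply: ler_wpM2l; [exact: ltW|exact: lerD].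
Qed.

Lemma supp_dist P x z : phi P x != 0 -> Qs P z -> d z x <= c2 * delta ^+ lev P.
Proof.
move=> /phi_supp[y Py xy] Pz; rewrite c2E -mulrA mulrDl mul1r; apply: tri_le (Q_diam Pz Py) _.
by rewrite d_sym.
Qed.

Lemma N_diag P : N P P = 0.
Proof. by rewrite /N eqxx /G /gram_mx phi_sq -expr2 divff ?subrr// expf_neq0// gt_eqF. Qed.

Lemma N_sym P Q : N P Q = N Q P.
Proof.
rewrite /N eq_sym [dg P * _]mulrC /G /gram_mx; congr (_ - _ / _).
by congr (Rintegral _ _ _); apply/funext => x; rewrite mulrC.
Qed.

(** The constant function is orthogonal to all other [phi_P], which have mean zero. So the whole
    space does not interact, and its [dg] may differ from 1. *)
Lemma G_lev0 P Q : P != Q -> G P Q != 0 -> (0 < lev P)%N /\ (0 < lev Q)%N.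
Proof.
move=> PQ G0; rewrite !lt0n; split; apply: contraNN G0 => /eqP l0; rewrite /G /gram_mx (phi_cst l0)/=.
- under eq_fun do rewrite mul1r.
  by rewrite phi_int// lt0n; apply: contra PQ => /eqP l1; rewrite (lev0 l0 l1).
- under eq_fun do rewrite mulr1.
  by rewrite phi_int// lt0n; apply: contra PQ => /eqP l1; rewrite (lev0 l0 l1).
Qed.

Lemma N_neq0 P Q : N P Q != 0 -> [/\ P != Q, (0 < lev P)%N, (0 < lev Q)%N &
  exists x, phi P x != 0 /\ phi Q x != 0].
Proof.
move=> N0; have PQ : P != Q by apply: contraNneq N0 => ->; rewrite N_diag.
have G0 : G P Q != 0.
  by apply: contraNneq N0 => G0; rewrite /N G0 mul0r (negbTE PQ) subrr.
have [lP lQ] := G_lev0 PQ G0; split=> //.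
apply: contra_notP (elimN eqP G0) => no; rewrite /G /gram_mx.
rewrite (_ : (fun x => _) = (fun=> 0)) ?Int_cst ?mul0r//.
apply/funext => x; apply/eqP; rewrite mulf_eq0; apply: contra_notT no => /norP[h1 h2].
by exists x.
Qed.

Lemma gramE : G = perturbed_mx N dg.
Proof.
apply/funext => P; apply/funext => Q; rewrite /perturbed_mx /N opprB addrCA subrr addr0.
have [<-|PQ] := eqVneq P Q.
  by rewrite -expr2 mulrCA divff ?mulr1// expf_neq0// gt_eqF.
have [->|G0] := eqVneq (G P Q) 0; first by rewrite mul0r mulr0.
by have [lP lQ] := G_lev0 PQ G0; rewrite !dg1// mulr1 expr1n divr1 mul1r.
Qed.

Lemma dgN P Q : N P Q != 0 -> dg P = dg Q.
Proof. by move=> /N_neq0[_ lP lQ _]; rewrite !dg1. Qed.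

Let kq3 : kq <= kq ^+ 3 /\ kq ^+ 2 <= kq ^+ 3.
Proof.
by split; [rewrite -[leLHS]expr1|]; apply: ler_weXn2l.
Qed.

Let cV0 : 0 <= cb * V. Proof. by rewrite mulr_ge0// ltW. Qed.

(** The separation of distinct cubes of one level exceeds what the supports can bridge. Applied with
    [t = 0] for one common point, [t = c2] for two functions meeting one finer function, and
    [t = cb V] for two functions meeting one atom. *)
Lemma close_eq P P' p p' x x' t : lev P = lev P' -> Qs P p -> Qs P' p' ->
  phi P x != 0 -> phi P' x' != 0 -> d x x' <= 2 * kq * t * delta ^+ lev P -> 0 <= t ->
  t <= c2 + cb * V -> P = P'.
Proof.
move=> lE Pp Pp' hx hx' xx t0 tc2; apply/eqP/negPn/negP => PP.
have h1 := supp_dist hx Pp; have h2 := supp_dist hx' Pp'; rewrite -lE d_sym in h2.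
have h3 := tri_le h1 (tri_le xx h2).
have h4 := le_trans (Q_sep PP lE Pp Pp') h3.
suff : kq * (c2 + kq * (2 * kq * t + c2)) < Dsep.
  apply/negP; rewrite -leNgt -(ler_pM2r (dl (lev P))); apply: le_trans h4 _.
  by rewrite le_eqVlt; apply/orP; left; apply/eqP; ring.
apply: le_lt_trans Dsep_gt.
have [k1 k2] := kq3.
have -> : kq * (c2 + kq * (2 * kq * t + c2)) = kq * c2 + kq ^+ 2 * c2 + 2 * kq ^+ 3 * t by ring.
have e1 : kq * c2 <= kq ^+ 3 * c2 by rewrite ler_pM2r.
have e2 : kq ^+ 2 * c2 <= kq ^+ 3 * c2 by rewrite ler_pM2r.
have e3 : kq ^+ 3 * t <= kq ^+ 3 * (c2 + cb * V) by apply: ler_wpM2l => //; rewrite exprn_ge0// ltW.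
have e4 : 0 <= kq ^+ 3 * (cb * V) by rewrite mulr_ge0// exprn_ge0// ltW.
move: e1 e2 e3 e4; rewrite -!(mulrA 4) -(mulrA 2) (mulrDr (kq ^+ 3)).
set a := kq ^+ 3 * c2; set b := kq ^+ 3 * (cb * V); set c := kq ^+ 3 * t.
by set e := kq * c2; set g := kq ^+ 2 * c2; lra.
Qed.

Lemma phi_disj P Q x : phi P x != 0 -> phi Q x != 0 -> lev P = lev Q -> P = Q.
Proof.
move=> h1 h2 lE; have [p Pp] := Q_ne P; have [q Qq] := Q_ne Q.
apply: (close_eq (t := 0) lE Pp Qq h1 h2); rewrite ?d_xx ?mulr0 ?mul0r//.
by rewrite addr_ge0// ltW.
Qed.

Lemma coarse_uniq P P' Q : N P Q != 0 -> N P' Q != 0 -> lev P = lev P' ->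
  (lev P < lev Q)%N -> P = P'.
Proof.
move=> /N_neq0[_ _ _ [x [Px Qx]]] /N_neq0[_ _ _ [x' [Px' Qx']]] lE lPQ.
have [p Pp] := Q_ne P; have [p' Pp'] := Q_ne P'; have [z Qz] := Q_ne Q.
apply: (close_eq (t := c2) lE Pp Pp' Px Px'); [|exact: ltW|by rewrite lerDl].
have h1 := supp_dist Qx Qz; have h2 := supp_dist Qx' Qz; rewrite d_sym in h1.
apply: le_trans (tri_le h1 h2) _.
have : delta ^+ lev Q <= delta ^+ lev P by apply: dl_le; exact: ltnW.
move=> /(ler_wpM2l (ltW (mulr_gt0 kq0 c20))) => h3.
rewrite [leLHS](_ : _ = 2 * (kq * c2 * delta ^+ lev Q)); last by ring.
by rewrite -!(mulrA 2) ler_pM2l.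
Qed.

(* the supports of interacting functions are comparable at the coarser scale *)
Lemma near_cubes P Q p q n : N P Q != 0 -> (n <= lev P)%N -> (n <= lev Q)%N -> Qs P p -> Qs Q q ->
  d p q <= 2 * kq * c2 * delta ^+ n.
Proof.
move=> /N_neq0[_ _ _ [x [Px Qx]]] nP nQ Pp Qq.
have h1 := supp_dist Px Pp; have h2 := supp_dist Qx Qq; rewrite d_sym in h2.
apply: le_trans (tri_le (le_trans h1 (_ : _ <= c2 * delta ^+ n)) (le_trans h2 (_ : _ <= c2 * delta ^+ n))) _.
- by apply: ler_wpM2l; [exact: ltW|exact: dl_le].
- by apply: ler_wpM2l; [exact: ltW|exact: dl_le].
by rewrite le_eqVlt; apply/orP; left; apply/eqP; ring.
Qed.

(** Cubes of one level are a positive distance apart, so their indicators add up to at most the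
    indicator of [S]. *)
Lemma sum_cubes s S n : (forall P, P \in s -> lev P = n) -> measurable S ->
  (forall P x, P \in s -> Qs P x -> S x) -> \sum_(P <- s) w P ^+ 2 <= m S.
Proof.
move=> sn mS sS; under eq_bigr do rewrite w2 -Int_indic//.
rewrite -(Int_sum mufin); last by move=> P; apply: bm_L1 => //; exact: bm_indic.
rewrite -Int_indic//; apply: le_Int.
- by apply: bm_L1 => //; apply: bm_sum => P; exact: bm_indic.
- by apply: bm_L1 => //; exact: bm_indic.
move=> x; have [[P [Ps Px]]|no] := pselect (exists P, P \in s /\ Qs P x); last first.
  rewrite big1_seq ?indicE ?ler0n// => P /= Ps; rewrite indicE memNset// => Px.
  by apply: no; exists P.
rewrite (big_fsetD1 P)//= !indicE (mem_set Px) (mem_set (sS P x Ps Px)) big1_seq ?addr0//.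
move=> Q /=; rewrite !inE => /andP[QP Qs']; rewrite indicE memNset// => Qx.
have := Q_sep QP (_ : lev Q = lev P) Qx Px; rewrite d_xx => /(_ _)/(fun k => k).
move=> h'; have : Dsep * delta ^+ lev Q <= 0 by apply: h'; rewrite !sn.
rewrite leNgt mulr_gt0//; apply: le_lt_trans Dsep_gt.
by rewrite !mulr_ge0 ?exprn_ge0 ?addr_ge0// ltW.
Qed.

(** All finer cubes interacting with [Q] lie in one ball of radius comparable to [delta^(lev Q)]. *)
Lemma fine_sum Q n s : (forall P, P \in s -> [/\ lev P = n, N P Q != 0 & (lev Q < n)%N]) ->
  \sum_(P <- s) w P ^+ 2 <= CF * w Q ^+ 2.
Proof.
move=> hs; have [z Qz] := Q_ne Q.
pose t := 4 * kq * c2 * delta ^+ lev Q.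
apply: le_trans (@sum_cubes s (B z t) n _ _ _) _ => //.
- by move=> P /hs[].
- move=> P x Ps Px; have [lP NP lQ] := hs P Ps; rewrite /qball/=.
  rewrite N_sym in NP; apply: le_lt_trans (near_cubes NP (leqnn _) _ Qz Px) _.
    by rewrite lP ltnW.
  rewrite /t -!(mulrA _ c2) -!(mulrA _ kq) ltr_pM2r ?ltr_nat//.
  by apply: mulr_gt0 => //; exact: mulr_gt0.
- apply: le_trans (Q_upper Qz (_ : _ <= t)) _.
    rewrite /t; apply: ler_wpM2r; first exact: ltW.
    apply: le_trans CD_c2 _; apply: ler_wpM2r; first exact: ltW.
    by have := kq1; lra.
  rewrite w2; apply: le_trans (ler_wpM2l _ (Q_lower Q)); last first.
    by rewrite /CF !mulr_ge0// ?invr_ge0//; exact: ltW.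
  by rewrite le_eqVlt; apply/orP; left; apply/eqP; rewrite /CF /t; field; rewrite gt_eqF.
Qed.

(** The finer function has mean zero and lives in a ball of radius [2 c2 delta^(lev P)]; over this
    radius the Hoelder bound on the coarser function yields the factor [th^2] per level. *)
Lemma N_le P Q : (lev Q <= lev P)%N ->
  `|N P Q| <= CE * (w P / w Q) * (th ^+ 2) ^+ (lev P - lev Q).
Proof.
move=> lQP; have CE0 : 0 <= CE.
  by rewrite /CE !mulr_ge0// ?powR_ge0 ?invr_ge0// ltW.
have th0 : 0 <= th by apply: ltW; case/andP: th01.
have [->|NPQ] := eqVneq (N P Q) 0.
  rewrite normr0; apply: mulr_ge0; last by rewrite exprn_ge0// sqr_ge0.
  by apply: mulr_ge0 => //; apply: divr_ge0; exact: ltW.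
have [PQ lP lQ [x [Px Qx]]] := N_neq0 NPQ.
rewrite /N (negbTE PQ) sub0r normrN !dg1// mulr1 divr1.
have [z Pz] := Q_ne P; pose t := 2 * c2 * delta ^+ lev P.
have t0 : 0 <= t by rewrite !mulr_ge0// ltW.
have tP : m (B z t) <= A2 * t.
  apply: (Q_upper Pz); rewrite /t; apply: ler_wpM2r; first exact: ltW.
  exact: CD_c2.
have suppB y : phi P y != 0 -> B z t y.
  move=> /supp_dist/(_ Pz) h1; apply: le_lt_trans h1 _; rewrite /t.
  have : 0 < c2 * delta ^+ lev P by exact: mulr_gt0.
  by lra.
have q1 : (t / delta ^+ lev Q) `^ beta = (2 * c2) `^ beta * (th ^+ 2) ^+ (lev P - lev Q).
  rewrite -thE -powRM ?mulr_ge0 ?exprn_ge0 ?ltW//; congr (_ `^ _).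
  by rewrite /t -{1}(subnKC lQP) exprD; field; rewrite gt_eqF.
apply: le_trans (@osc_bound (phi P) (phi Q) (B z t) (Cphi / w P)
   (CL / w Q * (t / delta ^+ lev Q) `^ beta) (phi Q z) _ _ _ _ _ _ _ _ _) _ => //.
- exact: phi_int.
- by rewrite divr_ge0// ltW.
- by rewrite mulr_ge0 ?powR_ge0// divr_ge0// ltW.
- move=> y yB; apply: le_trans (phi_hol Q y z) _.
  apply: ler_wpM2l; first by rewrite divr_ge0// ltW.
  apply: ge0_ler_powR; rewrite ?nnegrE ?divr_ge0//; [exact: ltW|exact: ltW|exact: ltW|].
  by apply: ler_wpM2r; [rewrite invr_ge0 ltW|rewrite d_sym ltW].
apply: le_trans (_ : Cphi / w P * (CL / w Q * (t / delta ^+ lev Q) `^ beta) * (2 * A2 * c2 / c1 * w P ^+ 2) <= _).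
  apply: ler_wpM2l.
    by rewrite !mulr_ge0 ?powR_ge0 ?invr_ge0// ltW.
  apply: le_trans tP _; rewrite w2; apply: le_trans (ler_wpM2l _ (Q_lower P)); last first.
    by rewrite !mulr_ge0// ?invr_ge0// ltW.
  by rewrite le_eqVlt; apply/orP; left; apply/eqP; rewrite /t; field; rewrite gt_eqF.
rewrite q1 /CE; set p := (_ `^ _); set p2 := _ ^+ (_ - _).
by rewrite le_eqVlt; apply/orP; left; apply/eqP; field; rewrite !gt_eqF.
Qed.

Hypothesis delta_lt1 : delta < 1.
Hypothesis ballX : exists x r, 0 < r /\ B x r = [set: X].
Let K1 := 4 * A2 * D'.
Let K4 := (V * delta)^-1.
Let K5 := 2 * (CL * (cb * V) `^ beta).
Let K6 := 2 * A2 * D'.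
Let th0 : 0 < th. Proof. by case/andP: th01. Qed.
Let D'0 : 0 < D'. Proof. by case: D'_ge => _; exact: lt_le_trans. Qed.

(** Fixes the level at which cubes have the size of a ball of measure [rho]. *)
Lemma scale_index rho : 0 < rho -> rho <= V ->
  exists n, V * delta ^+ n.+1 < rho /\ rho <= V * delta ^+ n.
Proof.
move=> r0 rV.
have ex : exists n, V * delta ^+ n.+1 < rho.
  have : (fun n => delta ^+ n) @ \oo --> (0 : R).
    by apply: cvg_expr; rewrite ger0_norm// ltW.
  move=> /cvgr0Pnorm_lt/(_ (rho / V) (divr_gt0 r0 V0))[n _ hn]; exists n.
  have := hn n.+1 (leqnSn n); rewrite /= ger0_norm; last exact: ltW.
  by rewrite ltr_pdivlMr// mulrC.
case: (ex_minnP ex) => n hn min; exists n; split=> //.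
case: n hn min => [|n] hn min; first by rewrite expr0 mulr1.
by rewrite leNgt; apply/negP => /min; rewrite ltnn.
Qed.

(** The alternative of full measure covers the constant atom: there [n0 = 0], so the coarser levels,
    where cancellation enters, are absent. *)
Lemma cube_atom_data (a a' : X -> R) x0 r : 0 < r -> bm a' -> a = a' %[ae mu] ->
  (forall x, `|a' x| <= (m (B x0 r))^-1) -> (forall x, a' x != 0 -> B x0 r x) ->
  Int a' = 0 \/ m (B x0 r) = V -> atom_data mu phi h lev w N th delta K1 K4 K5 K6 a.
Proof.
move=> r0 ba aa' ale asupp a0.
set rho := m (B x0 r) in ale a0 *.
have rho0 : 0 < rho by exact: ball_gt0.
have rhoV : rho <= V by apply: m_le.
have [n0 [n01 n02]] := scale_index rho0 rhoV.
have upper n : (n <= n0)%N -> m (B x0 (2 * D' * delta ^+ n)) <= A2 * (2 * D' * delta ^+ n).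
  move=> nn; apply: (ball_upper r0); apply: le_trans n02 _.
  apply: ler_pM; [exact: ltW|exact: ltW| |exact: dl_le].
  by case: D'_ge => _ h1; have := D'0; lra.
(* All points of the cube are required to be close, so that the cubes of [Loc n] lie in one ball of
   measure about [delta^n]. *)
pose Loc n P := (n <= lev P)%N /\ forall y, Qs P y -> d x0 y <= D' * delta ^+ n.
have locB n P x : Loc n P -> Qs P x -> B x0 (2 * D' * delta ^+ n) x.
  move=> [_ h1] Px; apply: le_lt_trans (h1 _ Px) _; rewrite -mulrA.
  by have := mulr_gt0 D'0 (dl n); lra.
have near_supp x : a' x != 0 -> d x0 x <= cb * V * delta ^+ n0.
  move=> /asupp h1; apply: le_trans (ball_rad r0 h1) _; rewrite -mulrA.
  exact: ler_wpM2l.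
exists a', Loc, n0; split=> //; split.
(* One application of [N] moves by at most [2 kq c2 delta^n], which [D'_step] absorbs into the next
   coarser neighbourhood. At [n = 0] the bound [DX] on all distances suffices. *)
- move=> n P Q [nP hP] NQ nQ; split; first exact: leq_trans (leq_pred n) nQ.
  move=> y Qy; case: n nP hP nQ => [|n] nP hP nQ /=.
    by rewrite expr0 mulr1; case: D'_ge => h1 _; apply: le_trans h1; exact: d_le.
  have [p Pp] := Q_ne P; rewrite N_sym in NQ.
  apply: le_trans (tri_le (hP p Pp) (near_cubes NQ nP nQ Pp Qy)) _.
  rewrite -mulrDl exprS mulrA mulrA; apply: ler_wpM2r; first exact: ltW.
  by rewrite mulrC.
(* The cubes of one level [k >= n] are disjoint inside a ball of measure at most [M], and their
   weights decay geometrically in [k - n]. *)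
- move=> n t nn0 tL.
  have [k0 ->] := sum_by_level lev t (fun P => (w P * th ^+ lev P / th ^+ n) ^+ 2).
  pose M := A2 * (2 * D' * delta ^+ n).
  have M0 : 0 <= M by rewrite !mulr_ge0// ltW.
  apply: le_trans (_ : \sum_(k < k0) M * (if (n <= k)%N then th ^+ (k - n) else 0) <= _).
    apply: ler_sum => k _; case: ifPn => [nk|]; last first.
      rewrite -ltnNge => kn; rewrite mulr0 big1_seq// => P /= /andP[/eqP Pk /tL[]].
      by rewrite Pk leqNgt kn.
    apply: le_trans (_ : \sum_(P <- t | lev P == k) th ^+ (k - n) * w P ^+ 2 <= _).
      apply: ler_sum => P /eqP ->; rewrite -mulrA -expfB_cond; last by rewrite gt_eqF.
      rewrite exprMn mulrC; apply: ler_wpM2r; first exact: sqr_ge0.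
      rewrite expr2; apply: ler_piMl; first by rewrite exprn_ge0// ltW.
      apply: exprn_ile1; first exact: ltW.
      by case/andP: th01 => _ /le_trans; apply; rewrite invf_le1// ler1n.
    rewrite -mulr_sumr mulrC; apply: ler_wpM2r; first by rewrite exprn_ge0// ltW.
    have -> : \sum_(P <- t | lev P == k) w P ^+ 2 =
        \sum_(P <- [fset P in t | lev P == k]%fset) w P ^+ 2.
      rewrite -big_filter; apply: perm_big; apply: uniq_perm; rewrite ?fset_uniq ?filter_uniq//.
      by move=> P; rewrite !inE mem_filter andbC.
    apply: le_trans (upper n nn0); apply: (@sum_cubes _ _ k) => //.
    + by move=> P; rewrite !inE => /andP[_ /eqP].
    + by move=> P x; rewrite !inE => /andP[/tL LP _]; exact: locB.
  rewrite -mulr_sumr -big_mkcond; apply: le_trans (ler_wpM2l M0 (geo_up th01 k0 n)) _.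
  by rewrite le_eqVlt; apply/orP; left; apply/eqP; rewrite /M /K1; ring.
- move=> P cP n0P; split=> // y Py.
  have [x [ax Px]] : exists x, a' x != 0 /\ phi P x != 0.
    apply: contra_notP (elimN eqP cP) => no; rewrite /coef.
    rewrite (_ : (fun x => _) = (fun=> 0)) ?Int_cst ?mul0r//.
    apply/funext => x; apply/eqP; rewrite mulf_eq0; apply: contra_notT no => /norP[h1 h2].
    by exists x.
  have h1 := supp_dist Px Py; rewrite d_sym in h1.
  apply: le_trans (tri_le (near_supp x ax) (le_trans h1 (_ : _ <= c2 * delta ^+ n0))) _.
    by apply: ler_wpM2l; [exact: ltW|exact: dl_le].
  rewrite -mulrDl mulrA; apply: ler_wpM2r; [exact: ltW|exact: D'_ge2].
- move=> s sn0.
  have [n00|n00] := eqVneq n0 0%N.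
    rewrite big1_seq ?mulr_ge0 ?powR_ge0 ?ltW// => P /= /sn0; by rewrite n00.
  have Ia0 : Int a' = 0.
    case: a0 => // rV; exfalso; move: n02; rewrite rV leNgt; apply/negP/negPn.
    by rewrite gtr_pMr// exprn_ilt1// ltW.
  pose x P := `|coef mu phi a' P| * w P.
  (* Cancellation of the atom against the Hoelder bound of [phi] gives decay [th^2] per level; one
     factor [th] is kept. *)
  pose y k := CL * (cb * V) `^ beta * (if (k <= n0)%N then th ^+ (n0 - k) else 0).
  have C0 : 0 <= CL * (cb * V) `^ beta by rewrite mulr_ge0 ?powR_ge0// ltW.
  have y0 k : 0 <= y k by rewrite /y mulr_ge0//; case: ifP => // _; rewrite exprn_ge0// ltW.
  have x0' P : 0 <= x P by rewrite mulr_ge0// ltW.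
  have ex P : x P != 0 -> exists x, a' x != 0 /\ phi P x != 0.
    move=> xP; apply: contra_notP (elimN eqP xP) => no; rewrite /x /coef.
    rewrite (_ : (fun x => _) = (fun=> 0)) ?Int_cst ?mul0r ?normr0 ?mul0r//.
    apply/funext => z; apply/eqP; rewrite mulf_eq0; apply: contra_notT no => /norP[h1 h2].
    by exists z.
  have xy P : (lev P < n0)%N -> x P <= y (lev P).
    move=> Pn0; pose t := cb * V * delta ^+ n0.
    have t0 : 0 <= t by rewrite mulr_ge0// ltW.
    have q1 : (t / delta ^+ lev P) `^ beta = (cb * V) `^ beta * (th ^+ 2) ^+ (n0 - lev P).
      rewrite -thE -powRM//; last by apply: ltW; exact: dl.
      congr (_ `^ _).
      by rewrite /t -{1}(subnKC (ltnW Pn0)) exprD; field; rewrite gt_eqF.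
    have -> : x P = `|Int (fun z => a' z * phi P z)| * w P.
      by rewrite /x /coef; congr (`|Rintegral _ _ _| * _); apply/funext => z; rewrite mulrC.
    apply: le_trans (ler_wpM2r _ (@osc_bound a' (phi P) (B x0 r) rho^-1
       (CL / w P * (t / delta ^+ lev P) `^ beta) (phi P x0) _ _ _ _ _ _ _ _ _)) _ => //.
    + exact: ltW.
    + by rewrite invr_ge0 ltW.
    + by rewrite mulr_ge0 ?powR_ge0// divr_ge0// ltW.
    + move=> z zB; apply: le_trans (phi_hol P z x0) _.
      apply: ler_wpM2l; first by rewrite divr_ge0// ltW.
      apply: ge0_ler_powR; rewrite ?nnegrE ?divr_ge0//; [exact: ltW|exact: ltW|exact: ltW|].
      apply: ler_wpM2r; [by rewrite invr_ge0 ltW|rewrite d_sym].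
      apply: le_trans (ball_rad r0 zB) _; rewrite /t -mulrA; exact: ler_wpM2l.
    rewrite q1 -/rho /y (ltnW Pn0) -exprM mul2n -addnn exprD; set p := _ `^ _; set p2 := th ^+ _.
    rewrite (_ : _ * w P = CL * p * p2 * p2); last by field; rewrite !gt_eqF.
    rewrite ler_piMr//.
      by rewrite mulr_ge0// /p2 exprn_ge0// ltW.
    apply: exprn_ile1; first exact: ltW.
    by case/andP: th01 => _ /le_trans; apply; rewrite invf_le1// ler1n.
  pose x' P := if (lev P < n0)%N then x P else 0.
  have -> : \sum_(P <- s) x P = \sum_(P <- s) x' P.
    by apply: eq_big_seq => P Ps; rewrite /x' sn0.
  have [||P|P Q _ _|k0 hk0] := @sum_level_le _ _ lev s x' y.
  + by move=> P; rewrite /x'; case: ifP.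
  + exact: y0.
  + by rewrite /x'; case: ifP => // h1; exact: xy.
  + rewrite /x'; case: ifP; last by rewrite eqxx.
    move=> lP /ex[z [az Pz]]; case: ifP; last by rewrite eqxx.
    move=> lQ /ex[z' [az' Qz']] lE.
    have [p Pp] := Q_ne P; have [q Qq] := Q_ne Q.
    (* Both supports meet the ball of the atom, which leaves one cube per level. *)
    apply: (close_eq (t := cb * V) lE Pp Qq Pz Qz'); [|exact: cV0|by rewrite lerDr ltW].
    have h1 := near_supp _ az; have h2 := near_supp _ az'; rewrite d_sym in h1.
    apply: le_trans (tri_le h1 h2) _.
    rewrite [leLHS](_ : _ = 2 * kq * (cb * V) * delta ^+ n0); last by ring.
    by apply: ler_wpM2l; [rewrite !mulr_ge0// ltW|apply: dl_le; exact: ltnW].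
  apply: le_trans hk0 _; rewrite /y -mulr_sumr -big_mkcond mulrC.
  by apply: ler_wpM2r => //; exact: geo_down.
- split.
    (* The integral of the square is at most [1 / rho], and [rho > V delta^(n0 + 1)]. *)
    have bi : bm (fun x => rho^-1 ^+ 2 * \1_(B x0 r) x) by apply: bmZ; exact: bm_indic.
    apply: le_trans (_ : Int (fun x => rho^-1 ^+ 2 * \1_(B x0 r) x) <= _).
      apply: le_Int; [by apply: bm_L1 => //; exact: bmX|exact: bm_L1|] => x.
      have [->|ax] := eqVneq (a' x) 0; first by rewrite expr0n mulr_ge0// sqr_ge0.
      rewrite indicE (mem_set (asupp _ ax)) mulr1 -real_normK ?num_real//.
      by apply: lerXn2r; rewrite ?nnegrE ?invr_ge0// ltW.
    rewrite IntZ ?Int_indic//; last by apply: bm_L1 => //; exact: bm_indic.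
    rewrite -/rho expr2 -mulrA mulVf ?gt_eqF// mulr1 /K4 -invfM lef_pV2 ?posrE ?mulr_gt0//.
    by rewrite -mulrA -exprS ltW.
  move=> n nn0; exists (B x0 (2 * D' * delta ^+ n)); split=> //.
  + by apply: le_trans (upper n nn0) _; rewrite le_eqVlt; apply/orP; left; apply/eqP; rewrite /K6; ring.
  + by move=> P x LP /h_supp; exact: locB.
Qed.

(** The bound on an atom is an essential supremum; clipping at [c] gives a version bounded
    everywhere, with the same support and integral. *)
Lemma cube_atomP a : H1_atom mu d a -> atom_data mu phi h lev w N th delta K1 K4 K5 K6 a.
Proof.
move=> [ma [[x0 [r [r0 asupp aN a0]]]|aE]].
  set c := (m (B x0 r))^-1.
  have c0 : 0 < c by rewrite invr_gt0 ball_gt0.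
  move: aN; rewrite unlock /Lnorm mupos => /ess_supP aN.
  pose a' x := Num.max (Num.min (a x) c) (- c).
  have a'le x : `|a' x| <= c.
    rewrite /a' ler_norml le_max lexx orbT/= ge_max; apply/andP; split; last by lra.
    by rewrite ge_min lexx orbT.
  have ma' : measurable_fun [set: X] a'.
    by apply: measurable_maxr => //; apply: measurable_minr.
  have ba' : bm a' by split=> //; exists c.
  have aa' : a = a' %[ae mu].
    apply: filterS aN => x /=; rewrite lee_fin ler_norml => /andP[h1 h2] _.
    by rewrite /a' min_l// max_l.
  apply: (cube_atom_data r0 ba' aa' a'le).
    move=> x /eqP a'x; apply: asupp => ax; apply: a'x.
    by rewrite /a' ax min_l ?ltW// max_l// oppr_le0 ltW.
  by left; rewrite -a0; apply/esym; exact: Int_ae.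
have [x0 [r [r0 BX]]] := ballX.
apply: (@cube_atom_data a a x0 r) => //.
- by rewrite aE; exact: bm_cst.
- by apply: nearW.
- by move=> x; rewrite aE BX /= ger0_norm// invr_ge0 ltW.
- by move=> x _; rewrite BX.
- by right; rewrite BX.
Qed.

Let eps := 4 * CE * (CF + 1) * th ^+ gapm.
Hypothesis eps_delta : eps <= delta / 4.
Variable Kh : R.
Hypothesis h_orth : forall P Q, P != Q -> Int (fun x => h P x * h Q x) = 0.
Hypothesis h_norm : forall P, Int (fun x => h P x ^+ 2) <= Ch.
Hypothesis h_L1 : forall P, Int (fun x => `|h P x|) <= Kh * w P.
Hypothesis Kh0 : 0 <= Kh.
Hypothesis A2_gt0 : 0 < A2.
Variables (birth : F -> nat) (lvl : nat -> {fset F}) (S : nat -> set (set X)).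
Hypothesis mS : forall n A, S n A -> measurable A.
Hypothesis S_mono : forall n m, (n <= m)%N -> S n `<=` S m.
Hypothesis mh : forall P,
  measurable_fun [set: g_sigma_algebraType (S (birth P))] (h P : g_sigma_algebraType (S (birth P)) -> R).
Hypothesis lvlP : forall n P, (P \in lvl n) = (birth P <= n)%N.
Hypothesis h_mart : forall n A P, <<s S n >> A -> (n < birth P)%N -> \int[mu]_(x in A) h P x = 0.
Hypothesis h_disj : forall P Q x, P != Q -> birth P = birth Q -> h P x * h Q x = 0.

Lemma cube_transfer : let Y := atomic_H1_closed_span mu d f in exists T : (X -> R) -> (X -> R),
  bounded_linear_operator mu Y (atomic_H1norm mu d) (mart_H1 mu S) (mart_H1norm mu S) T /\
  forall Q, Y (f Q) /\ T (f Q) = h Q %[ae mu].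
Proof.
have CE0 : 0 < CE.
  by rewrite /CE !mulr_gt0// ?powR_gt0 ?invr_gt0// !mulr_gt0.
have CF0 : 0 <= CF by rewrite /CF !mulr_ge0// ?invr_ge0; exact: ltW.
have gap P Q : N P Q != 0 -> (lev P + gapm <= lev Q)%N \/ (lev Q + gapm <= lev P)%N.
  move=> /N_neq0[PQ lP lQ [x [Px Qx]]]; apply: gap_lev => // lE.
  by move/eqP : PQ; apply; exact: phi_disj Px Qx lE.
have sch e Q := @level_schur _ _ th th01 N w lev gapm CE CF w0 N_sym (ltW CE0) CF0 gap N_le
  coarse_uniq fine_sum gapm0 e Q.
have V0' := V0.
apply: (@transfer_operator _ _ _ mu mufin mupos d ballX F phi f h lev w dg N D Cphi Ch Kh eps th delta
  K1 K4 K5 K6) => //.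
- exact: N_sym.
- have CF1 : 0 < CF + 1 by rewrite ltr_wpDl.
  apply: mulr_gt0; last exact: exprn_gt0.
  by apply: mulr_gt0 => //; exact: mulr_gt0.
- move=> Q; have := sch 0%N Q isT.
  by under eq_fun do rewrite mul0n expr0 mulr1; rewrite mul0n expr0 mulr1.
- move=> Q; have := sch 1%N Q isT.
  by under eq_fun do rewrite mul1n; rewrite mul1n.
- exact: dgN.
- exact: gramE.
- exact: phi_disj.
- exact: ltW.
- by rewrite /K1 !mulr_ge0// ltW.
- by rewrite /K4 invr_ge0 mulr_ge0// ltW.
- by rewrite /K5 !mulr_ge0 ?powR_ge0// ltW.
- by rewrite /K6 !mulr_ge0// ltW.
- exact: cube_atomP.
Qed.
End CubeGeometry.

(** * Consequences of normality *)

Section NormalSpace.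
Context {R : realType} {disp : measure_display} {X : measurableType disp}.
Variable mu : {measure set X -> \bar R}.
Hypothesis mufin : (mu [set: X] < +oo)%E.
Hypothesis mupos : (0 < mu [set: X])%E.
Variable d : X -> X -> R.
Local Notation m A := (fine (mu A)).
Local Notation B := (qball d).
Local Notation V := (m [set: X]).

Lemma fin_m A : measurable A -> mu A \is a fin_num.
Proof. by move=> mA; rewrite ge0_fin_numE//; apply: le_lt_trans mufin; apply: le_measure; rewrite ?inE. Qed.

Lemma m_le A A' : measurable A -> measurable A' -> A `<=` A' -> m A <= m A'.
Proof. by move=> mA mA' AA; apply: fine_le; rewrite ?fin_m//; apply: le_measure; rewrite ?inE. Qed.

Lemma V_gt0 : 0 < V. Proof. by apply: fine_gt0; rewrite mupos mufin. Qed.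

Lemma mE A : measurable A -> mu A = (m A)%:E.
Proof. by move=> mA; rewrite fineK// fin_m. Qed.

(** Normality in real-valued form. [nd_upper] and [nd_two] are the two situations in which the upper
    mass bound becomes available: a radius above the mass of some ball with the same centre, and a
    ball with more than one point. *)
Record normal_data (kq A1 A2 cb DX : R) : Prop := {
  nd_ge0 : forall x y, 0 <= d x y ;
  nd_sym : forall x y, d x y = d y x ;
  nd_xx : forall x, d x x = 0 ;
  nd_neq : forall x y, x <> y -> 0 < d x y ;
  nd_tri : forall x y z, d x y <= kq * (d x z + d z y) ;
  nd_kq : 1 <= kq ;
  nd_ball : forall x r, measurable (B x r) ;
  nd_le : forall x y, d x y <= DX ;
  nd_A1 : 0 < A1 ;
  nd_A2 : 0 < A2 ;
  nd_cb : 0 < cb ;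
  nd_DX : 0 < DX ;
  nd_pos : forall x r, 0 < r -> 0 < m (B x r) ;
  nd_lower : forall x r, 0 < r -> r <= DX -> A1 * r <= m (B x r) ;
  nd_rad : forall x r y, 0 < r -> B x r y -> d x y <= cb * m (B x r) ;
  nd_upper : forall x r t, 0 < r -> m (B x r) <= t -> m (B x t) <= A2 * t ;
  nd_two : forall x y r, x <> y -> B x r y -> m (B x r) <= A2 * r ;
  nd_open : forall a t x, d a x < t -> exists2 e, 0 < e & forall y, d x y < e -> d a y < t
}.

(** [DX = K1 mu(X)] bounds all distances because larger balls are the whole space. Balls are open by
    the Hoelder regularity of [d]; a quasi-metric alone would not give this. *)
Lemma normal_dataP theta : normal_qmspace mu d theta ->
  exists kq A1 A2 cb DX, normal_data kq A1 A2 cb DX.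
Proof.
move=> [[K' [dge dsym deq dtri]] mB th0 [A1 [A2 [K1 [K2 [K0 [[A10 A20 K20 K00] K12 H]]]]]]].
have [K21 K11] := andP K12.
have V0 := V_gt0.
have K1V : (K1%:E * mu [set: X] = (K1 * V)%:E)%E by rewrite mE// EFinM.
pose kq := Num.max K' 1; pose DX := K1 * V; pose cb := A1^-1 + K1.
have kq1 : 1 <= kq by rewrite le_max lexx orbT.
have DX0 : 0 < DX by rewrite mulr_gt0// (lt_le_trans _ K11).
have cb0 : 0 < cb by rewrite addr_gt0 ?invr_gt0// (lt_le_trans _ K11).
have dxx x : d x x = 0 by apply/deq.
have neq x y : x <> y -> 0 < d x y.
  by move=> xy; rewrite lt_neqAle dge andbT eq_sym; apply/eqP => /deq.
have tri x y z : d x y <= kq * (d x z + d z y).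
  by apply: le_trans (dtri x y z) _; apply: ler_wpM2r; [exact: addr_ge0|rewrite le_max lexx].
have lower x r : 0 < r -> r <= DX -> A1 * r <= m (B x r).
  move=> r0 rD; have [h _ _ _ _] := H x r r0.
  by rewrite -lee_fin -mE//; apply: h; rewrite K1V lee_fin.
have full x r : DX < r -> B x r = [set: X].
  move=> rD; have [_ h _ _ _] := H x r (lt_trans DX0 rD).
  by apply: h; rewrite K1V lte_fin.
have dle x y : d x y <= DX.
  rewrite leNgt; apply/negP => h; have := full x _ h => /seteqP[_ /(_ y Logic.I)].
  by rewrite /qball/= ltxx.
have m1 (x : X) : measurable [set x].
  have -> : [set x] = \bigcap_n B x n.+1%:R^-1.
    apply/seteqP; split=> [y -> n _|y h]; first by rewrite /qball/= dxx invr_gt0.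
    apply: contrapT => yx; have := neq x y (fun e => yx (esym e)) => dxy.
    have [n _ /(_ n (leqnn n))/=] := near_infty_natSinv_lt (PosNum dxy).
    have := h n Logic.I; rewrite /qball/= => h1 h2.
    by have := lt_trans h1 h2; rewrite ltxx.
  exact: bigcapT_measurable.
have upper x r t : 0 < r -> m (B x r) <= t -> m (B x t) <= A2 * t.
  move=> r0 rt.
  have xB : m [set x] <= m (B x r) by apply: m_le => // y ->; rewrite /qball/= dxx.
  have [t0|t0] := ltP 0 t; last first.
    have -> : B x t = set0.
      by apply/seteqP; split=> // y; rewrite /qball/= ltNge (le_trans t0).
    have -> : t = 0 by apply/eqP; rewrite eq_le t0/=; apply: le_trans rt; exact: fine_ge0.
    by rewrite measure0 mulr0.
  have [_ _ h _ _] := H x t t0.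
  rewrite -lee_fin -mE//; apply: h; rewrite mE// -EFinM lee_fin.
  apply: le_trans (le_trans xB rt); rewrite ler_piMl//; exact: fine_ge0.
have pos x r : 0 < r -> 0 < m (B x r).
  move=> r0; have [rD|rD] := leP r DX.
    by apply: lt_le_trans (lower x r r0 rD); exact: mulr_gt0.
  by rewrite full.
exists kq, A1, A2, cb, DX; split=> //.
- move=> x r y r0 yB; have [rD|rD] := leP r DX.
    apply: le_trans (ltW yB) _; apply: le_trans (_ : A1^-1 * m (B x r) <= _).
      by rewrite mulrC ler_pdivlMr// mulrC; exact: lower.
    apply: ler_wpM2r; first exact: fine_ge0.
    by rewrite lerDl (le_trans _ K11).
  rewrite full// (le_trans (dle x y))// /DX; apply: ler_wpM2r; first exact: ltW.
  by rewrite lerDr invr_ge0 ltW.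
- move=> x y r xy yB.
  have r0 : 0 < r by apply: le_lt_trans yB.
  have [_ _ h1 h2 _] := H x r r0.
  rewrite -lee_fin -mE//; apply: h1; rewrite leNgt; apply/negP => h3.
  by have := yB; rewrite (h2 h3) => /esym.
- move=> a t x axt.
  have t0 : 0 < t by apply: le_lt_trans axt.
  pose r := kq * (1 + t).
  have r0 : 0 < r by rewrite mulr_gt0 ?addr_gt0// (lt_le_trans _ kq1).
  pose eta := (t - d a x) / 2.
  have eta0 : 0 < eta by rewrite divr_gt0 ?subr_gt0.
  pose c := K0 * r `^ (1 - theta).
  have c0 : 0 < c by rewrite mulr_gt0// powR_gt0.
  (* The 1 keeps [d y a] below [r]; the power makes the Hoelder bound at most half of the margin
     [t - d a x]. *)
  exists (Num.min 1 ((eta / c) `^ theta^-1)).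
    by rewrite lt_min ltr01 powR_gt0// divr_gt0.
  move=> y; rewrite lt_min => /andP[y1 y2].
  have [_ _ _ _ h] := H x r r0.
  have tr : t <= r.
    rewrite /r; apply: le_trans (_ : 1 * t <= _); first by rewrite mul1r.
    by apply: ler_pM => //; [exact: ltW|rewrite lerDr].
  have yr : d y a < r.
    apply: le_lt_trans (tri y a x) _; rewrite ltr_pM2l; last exact: lt_le_trans kq1.
    by apply: ltrD; [rewrite dsym|rewrite dsym].
  have := h y a (lt_le_trans (_ : d x a < t) tr) yr; rewrite dsym => /(_ axt) hh.
  have p1 : d x y `^ theta <= eta / c.
    apply: le_trans (_ : ((eta / c) `^ theta^-1) `^ theta <= _).
      by apply: ge0_ler_powR; rewrite ?nnegrE ?powR_ge0// ltW.
    by rewrite -powRrM mulVf ?gt_eqF// powRr1// ltW// divr_gt0.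
  have h2 := ler_wpM2l (ltW c0) p1; rewrite (mulrC c (eta / c)) divfK ?gt_eqF// in h2.
  move: hh; rewrite -/c (dsym y a) => /ler_normlP[h1 _].
  by move: h1 h2 axt; rewrite /eta; set u := _ * _; lra.
Qed.
End NormalSpace.

(** * Dyadic cubes: masses, disjointness, boundary layers *)

Section DyadicCubes.
Context {R : realType} {disp : measure_display} {X : measurableType disp}.
Variable mu : {measure set X -> \bar R}.
Hypothesis mufin : (mu [set: X] < +oo)%E.
Hypothesis mupos : (0 < mu [set: X])%E.
Variable d : X -> X -> R.
Local Notation m A := (fine (mu A)).
Local Notation B := (qball d).
Local Notation V := (m [set: X]).
Local Notation Int f := (Rintegral mu [set: X] f).
Variables (kq A1 A2 cb DX : R).
Hypothesis nd : normal_data mu d kq A1 A2 cb DX.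
Variables (delta a0 eta C1 C2 : R).
Hypothesis delta01 : 0 < delta < 1.
Hypothesis a00 : 0 < a0.
Hypothesis C10 : 0 < C1.
Hypothesis C20 : 0 < C2.
Hypothesis a0_small : a0 * delta <= DX.
Context {I : nat -> choiceType}.
Variable E : forall k, I k -> set X.
Hypothesis dc : dyadic_cubes mu d E delta a0 eta C1 C2.

Let dl0 : 0 < delta. Proof. by case/andP: delta01. Qed.
Let dl n : 0 < delta ^+ n. Proof. exact: exprn_gt0. Qed.
Let mEc k (i : I k) : measurable (E i). Proof. exact: (cube_measurable dc). Qed.

Lemma cube_dist k (i : I k) x y : E i x -> E i y -> d x y <= C1 * delta ^+ k.
Proof.
move=> xE yE; rewrite -lee_fin; apply: le_trans (cube_diam dc i).
by apply: ereal_sup_ubound; exists (x, y).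
Qed.

Lemma cube_center k (i : I k) : exists2 z, E i z & B z (a0 * delta ^+ k) `<=` E i.
Proof.
have [z hz] := cube_ball dc i; exists z => //; apply: hz.
by rewrite /qball/= (nd_xx nd) mulr_gt0.
Qed.

Lemma cube_gt0 k (i : I k) : 0 < m (E i).
Proof.
have [z _ hz] := cube_center i.
apply: lt_le_trans (nd_pos nd z (mulr_gt0 a00 (dl k))) _.
by apply: m_le => //; exact: (nd_ball nd).
Qed.

Lemma cube_lower k (i : I k) : (0 < k)%N -> A1 * a0 * delta ^+ k <= m (E i).
Proof.
move=> k0; have [z _ hz] := cube_center i; rewrite -mulrA.
apply: le_trans (nd_lower nd z (mulr_gt0 a00 (dl k)) _) _; last first.
  by apply: m_le => //; exact: (nd_ball nd).
apply: le_trans a0_small; apply: ler_wpM2l; first exact: ltW.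
case: k k0 i hz => // k _ _ _; rewrite exprS; apply: ler_piMr; first exact: ltW.
by apply: exprn_ile1; [exact: ltW|case/andP: delta01 => _ /ltW].
Qed.

Lemma cube_meet k (S : set X) : measurable S -> 0 < m S -> exists (i : I k) x, S x /\ E i x.
Proof.
move=> mS S0; apply: contrapT => no.
have [A [mA A0 cA]] := cube_cover dc k.
have : m S <= m A.
  apply: m_le => // x Sx; apply: cA => -[i _ Ex]; apply: no; by exists i, x.
by rewrite A0 leNgt S0.
Qed.

(** Two cubes of one level with a common point are nested. The smaller one has positive measure, so
    it contains a cube of the next level, whose parent index is unique. *)
Lemma cube_disj k (i j : I k) x : E i x -> E j x -> i = j.
Proof.
move=> xi xj.
wlog ji : i j xi xj / E j `<=` E i.
  move=> H; have [h|h] := cube_nested dc i j (leqnn k); first exact: H.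
  by have : (E j `&` E i) x by []; rewrite h.
have [l [y [yj yl]]] := cube_meet k.+1 (mEc j) (cube_gt0 j).
have lj : E l `<=` E j.
  have [//|h] := cube_nested dc j l (leqnSn k).
  by have : (E l `&` E j) y by []; rewrite h.
have [p [_ hp]] := cube_ancestor dc l (ltnSn k).
by rewrite -(hp j lj); apply/esym/hp => z /lj/ji.
Qed.

Lemma sum_measure (T : choiceType) (s : {fset T}) (Q : T -> set X) S :
  (forall P, measurable (Q P)) -> measurable S ->
  (forall P P' x, P \in s -> P' \in s -> Q P x -> Q P' x -> P = P') ->
  (forall P x, P \in s -> Q P x -> S x) -> \sum_(P <- s) m (Q P) <= m S.
Proof.
move=> mQ mS disj sS; under eq_bigr do rewrite -Int_indic//.
rewrite -(Int_sum mufin); last by move=> P; apply: bm_L1 => //; exact: bm_indic.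
rewrite -Int_indic//; apply: le_Int.
- by apply: bm_L1 => //; apply: bm_sum => P; exact: bm_indic.
- by apply: bm_L1 => //; exact: bm_indic.
move=> x; have [[P [Ps Px]]|no] := pselect (exists P, P \in s /\ Q P x); last first.
  rewrite big1_seq ?indicE ?ler0n// => P /= Ps; rewrite indicE memNset// => Px.
  by apply: no; exists P.
rewrite (big_fsetD1 P)//= !indicE (mem_set Px) (mem_set (sS P x Ps Px)) big1_seq ?addr0//.
move=> P' /=; rewrite !inE => /andP[PP Ps']; rewrite indicE memNset// => Px'.
by move/eqP : PP; apply; exact: disj Px' Px.
Qed.

(** At a positive level the cubes are disjoint with mass bounded below, in a space of finite
    measure. *)
Lemma level_finite k : finite_set [set: I k].
Proof.
case: k => [|k]; first by have [i0 h0] := cube_top dc; apply: (@sub_finite_set _ _ [set i0]) => // i _; exact: h0.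
apply: contrapT => inf; pose c := A1 * a0 * delta ^+ k.+1.
have c0 : 0 < c by rewrite mulr_gt0// mulr_gt0// (nd_A1 nd).
have [s _ sn] := infinite_set_fset (Num.bound (V / c)) inf.
have h1 : \sum_(i <- s) m (E i) <= V.
  by apply: sum_measure => // P P' x _ _; exact: cube_disj.
have h2 : (#|` s|)%:R * c <= \sum_(i <- s) m (E i).
  apply: le_trans (_ : \sum_(i <- s) c <= _).
    by rewrite big_const_seq count_predT iter_addr_0 mulr_natl.
  by apply: ler_sum => i _; exact: cube_lower.
have := archi_boundP (ltW (divr_gt0 (V_gt0 mufin mupos) c0)).
rewrite ltr_pdivrMr// => h3; have := le_trans h2 h1; rewrite leNgt => /negP; apply.
by apply: lt_le_trans h3 _; apply: ler_wpM2r; [exact: ltW|rewrite ler_nat].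
Qed.

Let zc k (i : I k) : X := projT1 (cid2 (cube_center i)).
Let zcE k (i : I k) : E i (zc i). Proof. by rewrite /zc; case: cid2. Qed.

Lemma centers_dense x e : 0 < e -> exists k (i : I k), d x (zc i) < e.
Proof.
move=> e0; have kq0 : 0 < kq by exact: lt_le_trans (nd_kq nd).
pose e1 := e / (2 * kq).
have e10 : 0 < e1 by rewrite divr_gt0// mulr_gt0.
have [k hk] : exists k, C1 * delta ^+ k < e1.
  have : (fun n => delta ^+ n) @ \oo --> (0 : R).
    by apply: cvg_expr; rewrite ger0_norm ?ltW//; case/andP: delta01.
  move=> /cvgr0Pnorm_lt/(_ (e1 / C1) (divr_gt0 e10 C10))[n _ hn]; exists n.
  have := hn n (leqnn n); rewrite /= ger0_norm; last exact: ltW.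
  by rewrite ltr_pdivlMr// mulrC.
have [i [y [xy yE]]] := cube_meet k (nd_ball nd x e1) (nd_pos nd x e10).
exists k, i; apply: le_lt_trans (nd_tri nd x (zc i) y) _.
apply: lt_le_trans (_ : kq * (e1 + e1) <= _).
  rewrite ltr_pM2l//; apply: ltrD => //; apply: le_lt_trans hk; exact: cube_dist yE (zcE i).
by rewrite le_eqVlt; apply/orP; left; apply/eqP; rewrite /e1; field; rewrite gt_eqF.
Qed.

(** The sigma-algebra is only known to contain the balls. Cube centres form a countable dense set,
    so an open set is a countable union of balls around them. *)
Lemma open_measurable_qball (O : set X) :
  (forall x, O x -> exists2 e, 0 < e & B x e `<=` O) -> measurable O.
Proof.
move=> oO; pose U k (i : I k) n := if `[< B (zc i) n.+1%:R^-1 `<=` O >] then B (zc i) n.+1%:R^-1 else set0.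
have -> : O = \bigcup_k \bigcup_(i in [set: I k]) \bigcup_n U k i n.
  apply/seteqP; split=> [x Ox|x [k _ [i _ [n _]]]]; last first.
    by rewrite /U; case: asboolP => // h /h.
  have [e e0 eO] := oO x Ox.
  have kq0 : 0 < kq by exact: lt_le_trans (nd_kq nd).
  have e20 : 0 < e / (2 * kq) by rewrite divr_gt0// mulr_gt0.
  have [n _ /(_ n (leqnn n))/= hn] := near_infty_natSinv_lt (PosNum e20).
  have n0 : 0 < (n.+1%:R^-1 : R) by rewrite invr_gt0.
  have [k [i xi]] := centers_dense x n0.
  exists k => //; exists i => //; exists n => //; rewrite /U asboolT.
    by rewrite /qball/= (nd_sym nd).
  move=> y yi; apply: eO; apply: le_lt_trans (nd_tri nd x y (zc i)) _.
  have -> : e = kq * (e / (2 * kq) + e / (2 * kq)) by field; rewrite gt_eqF.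
  rewrite ltr_pM2l//; apply: ltrD; [exact: lt_trans hn|exact: lt_trans hn].
apply: bigcupT_measurable => k; apply: fin_bigcup_measurable; first exact: level_finite.
move=> i _; apply: bigcupT_measurable => n; rewrite /U; case: ifP => // _; exact: (nd_ball nd).
Qed.

(** A countable intersection of sets that are open by [nd_open]; it makes the boundary layers
    measurable. *)
Lemma near_set_measurable (A : set X) t : measurable [set x | (qdist d [set x] A <= t%:E)%E].
Proof.
pose O n := [set x | exists2 y, A y & d y x < t + n.+1%:R^-1].
have -> : [set x | (qdist d [set x] A <= t%:E)%E] = \bigcap_n O n.
  apply/seteqP; split=> x /=.
    move=> h n _; have : (qdist d [set x] A < (t + n.+1%:R^-1)%:E)%E.
      by apply: le_lt_trans h _; rewrite lte_fin ltrDl invr_gt0.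
    move=> /ereal_inf_lt[_ [[u y] [/= -> Ay] <-]]; rewrite lte_fin => xy.
    by exists y => //; rewrite (nd_sym nd).
  move=> h; apply/lee_addgt0Pr => e e0.
  have [n _ /(_ n (leqnn n))/= hn] := near_infty_natSinv_lt (PosNum e0).
  have [y Ay xy] := h n Logic.I.
  apply: le_trans (_ : ((d x y)%:E <= _)%E).
    by apply: ereal_inf_lbound; exists (x, y).
  rewrite lee_fin (nd_sym nd) ltW// (lt_trans xy)//; by rewrite ltrD2l.
apply: bigcapT_measurable => n; apply: open_measurable_qball => x [y Ay yx].
have [e e0 he] := nd_open nd yx; exists e => // z /he yz; by exists y.
Qed.

Lemma boundary_layer k (i : I k) t : 0 <= t ->
  let S := [set x | E i x /\ (qdist d [set x] (~` E i) <= (t * delta ^+ k)%:E)%E] in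
  measurable S /\ m S <= C2 * t `^ eta * m (E i).
Proof.
move=> t0 S; have mS : measurable S by apply: measurableI => //; exact: near_set_measurable.
by split=> //; rewrite -lee_fin EFinM -!mE//; exact: (cube_boundary dc).
Qed.

Lemma subcubesP n (i : I n) (j : I n.+1) x : E i x -> E j x -> subcubes E i j.
Proof.
move=> xi xj; have [//|h] := cube_nested dc i j (leqnSn n).
by have : (E j `&` E i) x by []; rewrite h.
Qed.

Lemma subcubes_ae n (i : I n) : \forall x \ae mu, E i x -> exists2 j, subcubes E i j & E j x.
Proof.
have [A [mA A0 cA]] := cube_cover dc n.+1; exists A; split=> // x /= h.
apply: cA => -[j _ xj]; apply: h => xi; exists j => //; exact: subcubesP xi xj.
Qed.

Lemma two_subcubes n (i : I n) : (1 <= Nsub E i)%N ->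
  exists j j' : I n.+1, [/\ j <> j', subcubes E i j & subcubes E i j'].
Proof.
rewrite /Nsub; set s := fset_set _ => h.
have fs : finite_set (subcubes E i) by apply: sub_finite_set (level_finite n.+1).
have sP j : (j \in s) = (j \in subcubes E i) by exact: in_fset_set.
have : (1 < #|` s|)%N by move: h; case: (#|` s|).
move=> s1; have /fset0Pn[j js] : s != fset0 by rewrite -cardfs_gt0 (ltn_trans _ s1).
have /fset0Pn[j' ] : (s `\ j)%fset != fset0.
  by rewrite -cardfs_gt0 -(ltn_add2l 1) addn0; move: s1; rewrite (cardfsD1 j s) js.
rewrite !inE => /andP[jj js']; exists j', j; split; [exact/eqP|move: js'|move: js]; by rewrite sP inE.
Qed.

(** A cube with two subcubes has a point other than [z], so a ball reaching across the cube is not a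
    singleton and the upper mass bound applies. Selected cubes have two subcubes because
    [i0 >= 1]. *)
Lemma ball_upper_cube n (i : I n) z t : (1 <= Nsub E i)%N -> E i z -> 2 * C1 * delta ^+ n <= t ->
  m (B z t) <= A2 * t.
Proof.
move=> /two_subcubes[j [j' [jj ji ji']]] zE ht.
have key (l : I n.+1) : subcubes E i l -> zc l <> z -> m (B z t) <= A2 * t.
  move=> li lz; apply: (nd_two nd (y := zc l)); first exact: nesym.
  apply: le_lt_trans (cube_dist zE (li _ (zcE l))) _; apply: lt_le_trans ht.
  by rewrite -mulrA ltr_pMl ?ltr1n// mulr_gt0.
have [e|ne] := pselect (zc j = z); last exact: key ne.
apply: (key j') => // e'; apply: jj; apply: (@cube_disj _ _ _ z); first by rewrite -e.
by rewrite -e'.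
Qed.
End DyadicCubes.

(** * Smoothing by a partition of unity *)

Section Smoothing.
Context {R : realType} {disp : measure_display} {X : measurableType disp}.
Variable mu : {measure set X -> \bar R}.
Hypothesis mufin : (mu [set: X] < +oo)%E.
Local Notation Int f := (Rintegral mu [set: X] f).
Local Notation L1 := (integrableR mu).

Lemma bounded_cvg (u : nat -> X -> R) (v : X -> R) H : (forall n, bm (u n)) ->
  (forall n x, `|u n x| <= H) -> (forall x, u n x @[n --> \oo] --> v x) ->
  bm v /\ Int (u n) @[n --> \oo] --> Int v.
Proof.
move=> bu uH uv.
have mv : measurable_fun [set: X] v.
  by apply: (@measurable_fun_cvg _ _ _ _ u) => // n; case: (bu n).
have vH x : `|v x| <= H.
  have h : `|u n x| @[n --> \oo] --> `|v x| by apply: cvg_norm; exact: uv.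
  rewrite -(cvg_lim _ h)//; apply: limr_le.
    by apply/cvg_ex; exists `|v x|.
  by apply: nearW => n; exact: uH.
have bv : bm v by split=> //; exists H.
split=> //; apply: fine_cvg; rewrite Int_EFin; last exact: bm_L1.
apply: (@dominated_cvg _ _ _ mu setT measurableT (fun n x => (u n x)%:E) _ (cst H%:E)) => //.
- by move=> n; apply/measurable_EFinP; case: (bu n).
- by move=> x _; apply/fine_cvgP; split; [exact: nearW|exact: uv].
- exact: bm_L1 (bm_cst H).
- by move=> n x _; rewrite lee_fin.
Qed.

Lemma powRV (x r : R) : 0 < x -> (x^-1) `^ r = (x `^ r)^-1.
Proof. by move=> x0; rewrite -powR_inv1 ?ltW// -powRrM mulN1r powRN. Qed.

Variable d : X -> X -> R.
Variables (sg beta H : R) (M nn : nat) (psi : nat -> nat -> X -> R) (g : X -> R).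
Let ps := psi nn.
Hypothesis d_ge0 : forall x y, 0 <= d x y.
Hypothesis d_neq : forall x y, x <> y -> 0 < d x y.
Hypothesis sg0 : 0 < sg.
Hypothesis beta0 : 0 < beta.
Hypothesis H0 : 0 <= H.
Hypothesis mps : forall k, measurable_fun [set: X] (ps k).
Hypothesis ps0 : forall k x, 0 <= ps k x.
Hypothesis psM : forall x, ([set k | ps k x != 0] #<= `I_M)%card.
Hypothesis ps1 : forall x, series (fun k => ps k x) @ \oo --> (1 : R).
Hypothesis ps_diam : forall k, (qdiam d [set x | ps k x != 0%R] <= sg%:E)%E.
Hypothesis ps_lip : forall k, (Lip d beta (ps k) <= (sg `^ (- beta))%:E)%E.
Hypothesis bg : bm g.
Hypothesis gH : forall x, `|g x| <= H.
Let T x := Int (fun y => smoothing_kernel mu psi nn x y * g y).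
(** The average of [g] against [ps k]; by the convention [x / 0 = 0] it is 0 when [ps k] has zero
    integral. *)
Let gk k := Int (fun y => ps k y * g y) / Int (fun y => `|ps k y|).

Let fin_ps x : exists N, forall k, (N <= k)%N -> ps k x = 0.
Proof.
have fs : finite_set [set k | ps k x != 0] by apply: card_le_finite (psM x) _.
exists (\max_(k <- fset_set [set k | ps k x != 0]) k).+1 => k.
rewrite ltnNge => /negP h; apply/eqP/negPn/negP => pk; apply: h.
have ks : k \in fset_set [set k | ps k x != 0] by rewrite in_fset_set// inE.
exact: (@leq_bigmax_seq _ _ xpredT id k ks).
Qed.

Let ps_sum x n : \sum_(k < n) ps k x <= 1.
Proof.
have nd : nondecreasing_seq (series (fun k => ps k x)).
  by apply/nondecreasing_seqP => k; rewrite /series/= !big_mkord big_ord_recr/= lerDl; exact: ps0.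
have := nondecreasing_cvgn_le nd (cvgP _ (ps1 x)) n.
by rewrite (cvg_lim _ (ps1 x))// /series/= big_mkord.
Qed.

Let ps_le1 k x : ps k x <= 1.
Proof.
by apply: le_trans (ps_sum x k.+1); rewrite big_ord_recr/= lerDr sumr_ge0.
Qed.

Let bps k : bm (ps k).
Proof. by split=> //; exists 1 => x; rewrite ger0_norm. Qed.

Let lim_fin (u : nat -> R) N : (forall k, (N <= k)%N -> u k = 0) ->
  series u @ \oo --> \sum_(k < N) u k.
Proof.
move=> uN; apply: cvg_near_cst; near_simpl; exists N => // n /= Nn.
rewrite /series/= (big_cat_nat (leq0n N) Nn)//= big_mkord.
rewrite [X in _ + X](_ : _ = 0) ?addr0// big_nat_cond big1// => k.
by move=> /andP[/andP[/uN]].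
Qed.

Let gk_le k : `|gk k| <= H.
Proof.
have bpg : bm (fun y => ps k y * g y) by exact: bmM.
have I0 : 0 <= Int (fun y => `|ps k y|) by apply: Int_ge0.
rewrite normrM normfV (ger0_norm I0).
have [->|Ik] := eqVneq (Int (fun y => `|ps k y|)) 0; first by rewrite invr0 mulr0.
rewrite ler_pdivrMr ?lt_def ?Ik// mulrC; apply: le_trans (norm_Int (bm_L1 mufin bpg)) _.
rewrite mulrC -IntZ; last by apply: bm_L1 => //; exact: bm_norm.
apply: le_Int; [by apply: bm_L1 => //; exact: bm_norm| |].
  by apply: bm_L1 => //; apply: bmZ; exact: bm_norm.
by move=> x; rewrite normrM mulrC; apply: ler_wpM2r.
Qed.

Lemma smoothE x N : (forall k, (N <= k)%N -> ps k x = 0) -> T x = \sum_(k < N) ps k x * gk k.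
Proof.
move=> xN; rewrite /T.
have -> : (fun y => smoothing_kernel mu psi nn x y * g y) =
    fun y => \sum_(k < N) (ps k x / Int (fun z => `|ps k z|)) * (ps k y * g y).
  apply/funext => y; rewrite /smoothing_kernel -/ps.
  have := @lim_fin (fun k => ps k x * ps k y / Int (fun z => `|ps k z|)) N _.
  move=> /(_ _)/cvg_lim -> //; last by move=> k /xN ->; rewrite !mul0r.
  by rewrite mulr_suml; apply: eq_bigr => k _; ring.
rewrite Int_sum//; last by move=> k; apply: bm_L1 => //; apply: bmZ; exact: bmM.
apply: eq_bigr => k _; rewrite IntZ; last by apply: bm_L1 => //; exact: bmM.
by rewrite /gk; ring.
Qed.

Lemma kernel_meas x : measurable_fun [set: X] (smoothing_kernel mu psi nn x).
Proof.
have [N xN] := fin_ps x.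
have -> : smoothing_kernel mu psi nn x = fun y => \sum_(k < N) (ps k x / Int (fun z => `|ps k z|)) * ps k y.
  apply/funext => y; rewrite /smoothing_kernel -/ps.
  have := @lim_fin (fun k => ps k x * ps k y / Int (fun z => `|ps k z|)) N _.
  move=> /(_ _)/cvg_lim -> //; last by move=> k /xN ->; rewrite !mul0r.
  by apply: eq_bigr => k _; ring.
by apply: measurable_sum => k; apply: measurable_funM.
Qed.

Let partial_le x n : `|\sum_(k < n) ps k x * gk k| <= H.
Proof.
apply: le_trans (ler_norm_sum _ _ _) _.
apply: le_trans (_ : \sum_(k < n) ps k x * H <= _).
  by apply: ler_sum => k _; rewrite normrM ger0_norm//; apply: ler_wpM2l.
by rewrite -mulr_suml; apply: ler_piMl.
Qed.

Lemma smooth_le x : `|T x| <= H.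
Proof. by have [N hN] := fin_ps x; rewrite (smoothE hN). Qed.

Let T_cvg x : \sum_(k < n) ps k x * gk k @[n --> \oo] --> T x.
Proof.
have [N hN] := fin_ps x; rewrite (smoothE hN).
have := @lim_fin (fun k => ps k x * gk k) N _; rewrite /series/=.
under eq_fun do rewrite big_mkord.
by apply => k /hN ->; rewrite mul0r.
Qed.

Let bT_cvg : bm T /\ Int (fun x => \sum_(k < n) ps k x * gk k) @[n --> \oo] --> Int T.
Proof.
apply: (@bounded_cvg (fun n x => \sum_(k < n) ps k x * gk k) T H) => //.
move=> n; apply: bm_sum => k; rewrite (_ : (fun x => _) = fun x => gk k * ps k x); first exact: bmZ.
by apply/funext => x; rewrite mulrC.
Qed.

Lemma bm_smooth : bm T. Proof. by case: bT_cvg. Qed.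

(** Both sides are the limit of the sums of the integrals of [ps k g]; a [ps k] of zero integral
    contributes 0 to either. *)
Lemma Int_smooth : Int T = Int g.
Proof.
have [_ h1] := bT_cvg.
have bpg n : bm (fun x => \sum_(k < n) ps k x * g x) by apply: bm_sum => k; exact: bmM.
have [_ h2] : bm g /\ Int (fun x => \sum_(k < n) ps k x * g x) @[n --> \oo] --> Int g.
  apply: (@bounded_cvg (fun n x => \sum_(k < n) ps k x * g x) g H) => //.
    move=> n x; rewrite -mulr_suml normrM ger0_norm; last by apply: sumr_ge0.
    by apply: le_trans (gH x); apply: ler_piMl.
  move=> x; under eq_fun do rewrite -mulr_suml.
  have h : \sum_(k < n) ps k x @[n --> \oo] --> (1 : R).
    by have := ps1 x; rewrite /series/=; under eq_fun do rewrite big_mkord.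
  have h' : (\sum_(k < n) ps k x) * g x @[n --> \oo] --> 1 * g x by apply: cvgM => //; exact: cvg_cst.
  by rewrite mul1r in h'; exact: h'.
have E : (fun n => Int (fun x => \sum_(k < n) ps k x * gk k)) =
    fun n => Int (fun x => \sum_(k < n) ps k x * g x).
  apply/funext => n.
  rewrite !Int_sum//; last 2 first.
  - by move=> k; apply: bm_L1 => //; exact: bmM.
  - move=> k; apply: bm_L1 => //; rewrite (_ : (fun x => _) = fun x => gk k * ps k x); first exact: bmZ.
    by apply/funext => x; rewrite mulrC.
  apply: eq_bigr => k _.
  rewrite (_ : (fun x => _) = fun x => gk k * ps k x); last by apply/funext => x; rewrite mulrC.
  rewrite IntZ; last exact: bm_L1.
  rewrite /gk (_ : (fun y => `|ps k y|) = ps k); last by apply/funext => y; rewrite ger0_norm.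
  have [I0|Ik] := eqVneq (Int (ps k)) 0; last by rewrite divfK.
  rewrite I0 mulr0; apply/esym/eqP; rewrite -normr_le0.
  have bk : bm (fun y => ps k y * g y) by exact: bmM.
  apply: le_trans (norm_Int (bm_L1 mufin bk)) _.
  apply: le_trans (_ : Int (fun y => H * ps k y) <= _).
    apply: le_Int; [by apply: bm_L1 => //; exact: bm_norm|by apply: bm_L1 => //; exact: bmZ|].
    by move=> x; rewrite normrM mulrC (ger0_norm (ps0 k x)); apply: ler_wpM2r.
  by rewrite IntZ ?I0 ?mulr0//; exact: bm_L1.
by rewrite E in h1; apply: (cvg_unique _ h1 h2).
Qed.

Let supp_dist k x y : ps k x != 0 -> ps k y != 0 -> d x y <= sg.
Proof.
move=> hx hy; rewrite -lee_fin; apply: le_trans (ps_diam k).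
by apply: ereal_sup_ubound; exists (x, y).
Qed.

Lemma smooth_supp x : T x != 0 -> exists2 y, g y != 0 & d x y <= sg.
Proof.
have [N hN] := fin_ps x; rewrite (smoothE hN) => T0.
apply: contra_notP (elimN eqP T0) => no; apply: big1 => k _.
have [->|pk] := eqVneq (ps k x) 0; first by rewrite mul0r.
rewrite /gk (_ : (fun y => ps k y * g y) = fun=> 0) ?Int_cst ?mul0r ?mulr0//.
apply/funext => y; apply/eqP; rewrite mulf_eq0; apply: contra_notT no => /norP[h1 h2].
by exists y => //; exact: supp_dist pk h1.
Qed.

Let ps_hol k x y : `|ps k x - ps k y| <= (d x y / sg) `^ beta.
Proof.
have [<-|xy] := pselect (x = y); first by rewrite subrr normr0 powR_ge0.
have h : ((`|ps k x - ps k y| / d x y `^ beta)%:E <= (sg `^ (- beta))%:E)%E.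
  by apply: le_trans (ps_lip k); apply: ereal_sup_ubound; exists (x, y).
rewrite lee_fin ler_pdivrMr ?powR_gt0 ?d_neq// in h.
by rewrite powRM ?invr_ge0 ?(ltW sg0)// powRV// -powRN mulrC.
Qed.

Let count_ps x N : \sum_(k < N) ((ps k x != 0)%:R : R) <= M%:R.
Proof.
have fs : finite_set [set k | ps k x != 0] by apply: card_le_finite (psM x) _.
apply: le_trans (_ : (#|` fset_set [set k | ps k x != 0]|)%:R <= _); last first.
  by rewrite ler_nat; exact: geq_card_fset_set.
rewrite -natr_sum ler_nat; set P := fun k => ps k x != 0.
rewrite -(big_mkord xpredT (fun k => nat_of_bool (P k))) -big_mkcond/= sum1_count -size_filter.
apply: uniq_leq_size; first by rewrite filter_uniq// iota_uniq.
by move=> k; rewrite mem_filter => /andP[Pk _]; rewrite in_fset_set// inE.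
Qed.

(** At most [2 M] of the functions are nonzero at [x] or [y], and each average is at most [H]. *)
Lemma smooth_hol x y : `|T x - T y| <= 2 * M%:R * H * (d x y / sg) `^ beta.
Proof.
have [N1 h1] := fin_ps x; have [N2 h2] := fin_ps y; pose N := maxn N1 N2.
rewrite (@smoothE x N) 1?(@smoothE y N); last 2 first.
- by move=> k kN; apply: h2; apply: leq_trans kN; exact: leq_maxr.
- by move=> k kN; apply: h1; apply: leq_trans kN; exact: leq_maxl.
rewrite -sumrB; apply: le_trans (ler_norm_sum _ _ _) _.
set D := (_ `^ _); have D0 : 0 <= D by exact: powR_ge0.
apply: le_trans (_ : \sum_(k < N) ((ps k x != 0)%:R + (ps k y != 0)%:R) * (H * D) <= _).
  apply: ler_sum => k _; rewrite -mulrBl normrM.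
  have HD : 0 <= H * D by exact: mulr_ge0.
  case: (boolP ((ps k x != 0) || (ps k y != 0))) => [h|].
    apply: le_trans (_ : 1 * (H * D) <= _).
      rewrite mul1r mulrC; apply: ler_pM => //; exact: ps_hol.
    apply: ler_wpM2r => //; rewrite -natrD ler1n addn_gt0 !lt0b.
    by move: h; do 2 case: (_ != _).
  by rewrite negb_or !negbK => /andP[/eqP -> /eqP ->]; rewrite subrr normr0 mul0r eqxx addr0 mul0r.
rewrite -mulr_suml big_split/= -mulrA; apply: ler_wpM2r; first exact: mulr_ge0.
have -> : (2 * M%:R : R) = M%:R + M%:R by ring.
by apply: lerD; exact: count_ps.
Qed.

(** If [g] is constant within reach of [x], the averages that matter equal this constant. The
    exceptional null set is where some [ps k] of zero integral is nonzero. *)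
Lemma smooth_ae : \forall x \ae mu, forall c, (forall y, d x y <= sg -> g y = c) -> T x = c.
Proof.
have : \forall x \ae mu, forall k, Int (ps k) = 0 -> ps k x = 0.
  apply: ae_foralln => k; have [I0|Ik] := pselect (Int (ps k) = 0); last by apply: nearW.
  have : Int (fun x => `|ps k x|) <= 0.
    by rewrite (_ : (fun y => `|ps k y|) = ps k) ?I0//; apply/funext => y; rewrite ger0_norm.
  by move=> /(Int_norm_eq0 (bm_L1 mufin (bps k))); apply: filterS => x /= h _; exact: h.
apply: filterS => x hx c gc; have [N hN] := fin_ps x; rewrite (smoothE hN).
have S1 : \sum_(k < N) ps k x = 1 by apply: (cvg_unique _ (lim_fin hN) (ps1 x)).
rewrite -[RHS]mul1r -S1 mulr_suml; apply: eq_bigr => k _.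
have [->|pk] := eqVneq (ps k x) 0; first by rewrite !mul0r.
congr (_ * _); rewrite /gk.
have -> : (fun y => ps k y * g y) = fun y => c * ps k y.
  apply/funext => y; rewrite mulrC; have [->|py] := eqVneq (ps k y) 0; first by rewrite !mulr0.
  by rewrite gc//; exact: supp_dist pk py.
rewrite (_ : (fun y => `|ps k y|) = ps k); last by apply/funext => y; rewrite ger0_norm.
rewrite IntZ; last exact: bm_L1.
by rewrite mulfK//; apply: contraNneq pk => /hx ->.
Qed.
End Smoothing.

(** * Haar functions and their smoothed versions *)

Section HaarFunctions.
Context {R : realType} {disp : measure_display} {X : measurableType disp}.
Variable mu : {measure set X -> \bar R}.
Hypothesis mufin : (mu [set: X] < +oo)%E.
Hypothesis mupos : (0 < mu [set: X])%E.
Variable d : X -> X -> R.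
Local Notation m A := (fine (mu A)).
Local Notation B := (qball d).
Local Notation V := (m [set: X]).
Local Notation Int f := (Rintegral mu [set: X] f).
Variables (kq A1 A2 cb DX : R).
Hypothesis nd : normal_data mu d kq A1 A2 cb DX.
Variables (delta a0 eta C1 C2 : R).
Hypothesis delta01 : 0 < delta < 1.
Hypothesis a00 : 0 < a0.
Hypothesis C10 : 0 < C1.
Hypothesis C20 : 0 < C2.
Hypothesis a0_small : a0 * delta <= DX.
Context {I : nat -> choiceType}.
Variable E : forall k, I k -> set X.
Hypothesis dc : dyadic_cubes mu d E delta a0 eta C1 C2.
Variables (C tau beta : R) (M : nat).
Hypothesis C_gt0 : 0 < C.
Variable h : forall n, I n -> nat -> X -> R.
Hypothesis haar : haar_system mu E C h.
Variable psi : nat -> nat -> X -> R.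
Hypothesis pou : partitions_of_unity d beta tau delta M psi.
Hypothesis tau01 : 0 < tau <= 1.
Hypothesis tau_eta : C2 * tau `^ eta <= 2^-1.
Hypothesis beta0 : 0 < beta.

Let dl0 : 0 < delta. Proof. by case/andP: delta01. Qed.
Let dl n : 0 < delta ^+ n. Proof. exact: exprn_gt0. Qed.
Let mEc k (i : I k) : measurable (E i). Proof. exact: (cube_measurable dc). Qed.
Let tau0 : 0 < tau. Proof. by case/andP: tau01. Qed.
Let A10 := nd_A1 nd.
Let A20 := nd_A2 nd.

Definition subunion n (i : I n) : set X := \bigcup_(j in subcubes E i) E j.

(* [h] may take arbitrary values on the null set of [E i] that is not covered by the subcubes. *)
Definition haar_trim n (i : I n) k x := h i k x * \1_(subunion i) x.

Let fin_sub n (i : I n) : finite_set (subcubes E i).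
Proof. exact: sub_finite_set (level_finite mufin mupos nd delta01 a00 a0_small dc n.+1). Qed.

Lemma subunion_meas n (i : I n) : measurable (subunion i).
Proof. exact: fin_bigcup_measurable. Qed.

Let disj k (i j : I k) x : E i x -> E j x -> i = j.
Proof. exact: (cube_disj mufin nd delta01 a00 dc). Qed.

Section OneCube.
Variables (n : nat) (i : I n) (k : nat).
Hypothesis kN : (1 <= k <= Nsub E i)%N.
Let g := haar_trim i k.
Let w := Num.sqrt (m (E i)).
Let s := fset_set (subcubes E i).
Let sP j : (j \in s) = (j \in subcubes E i). Proof. exact: in_fset_set. Qed.
Let mi0 : 0 < m (E i). Proof. exact: (cube_gt0 mufin nd delta01 a00 dc i). Qed.
Let w0 : 0 < w. Proof. by rewrite sqrtr_gt0. Qed.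
Let hk := (haar i).1 k kN.

Lemma trim_supp x : g x != 0 -> exists2 j, subcubes E i j & E j x.
Proof.
apply: contra_neqP => no; rewrite /g /haar_trim indicE memNset ?mulr0//.
Qed.

Lemma trim_supp_cube x : g x != 0 -> E i x.
Proof. by move=> /trim_supp[j ji /ji]. Qed.

Let trimE j x : subcubes E i j -> E j x -> g x = h i k x.
Proof. by move=> ji xj; rewrite /g /haar_trim indicE mem_set ?mulr1//; exists j. Qed.

Lemma trim_cst j x y : subcubes E i j -> E j x -> E j y -> g x = g y.
Proof. by move=> ji xj yj; rewrite !(trimE ji)//; have [_ _ H _ _] := hk; exact: H ji _ _ xj yj. Qed.

Lemma trim_ae : h i k = g %[ae mu].
Proof.
apply: filterS (subcubes_ae dc i) => x hx _.
have [hx0|hx0] := eqVneq (h i k x) 0; first by rewrite /g /haar_trim hx0 mul0r.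
have [_ H _ _ _] := hk; have [j ji xj] := hx (H _ (elimN eqP hx0)).
by rewrite (trimE ji xj).
Qed.

Let mg : measurable_fun [set: X] g.
Proof.
apply: measurable_funM; first by have [] := hk.
by apply: measurable_indic; exact: subunion_meas.
Qed.

Lemma trim_L2 : [/\ integrableR mu (fun x => g x ^+ 2), C^-1 ^+ 2 <= Int (fun x => g x ^+ 2) &
  Int (fun x => g x ^+ 2) <= C ^+ 2].
Proof.
have [mh _ _ _ _] := hk.
have := (haar i).2 (fun l => (l == k)%:R).
have kr : k \in index_iota 1 (Nsub E i).+1 by rewrite mem_index_iota ltnS.
rewrite (_ : (fun x => \sum_(1 <= l < _) _) = h i k); last first.
  apply/funext => x; rewrite (bigD1_seq k)//= ?iota_uniq// eqxx mul1r big1 ?addr0//.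
  by move=> l /negbTE ->; rewrite mul0r.
rewrite (bigD1_seq k)//= ?iota_uniq// eqxx expr1n big1 ?addr0; last first.
  by move=> l /negbTE ->; rewrite expr0n.
rewrite sqrtr1 !mulr1 => -[h1 h2].
have Lh : integrableR mu (fun x => h i k x ^+ 2).
  by apply: (L2norm_fin mh); apply: le_lt_trans h2 _; rewrite ltry.
have mg2 : measurable_fun [set: X] (fun x => g x ^+ 2) by exact: measurable_funX.
have mh2 : measurable_fun [set: X] (fun x => h i k x ^+ 2) by exact: measurable_funX.
have ae2 : (fun x => h i k x ^+ 2) = (fun x => g x ^+ 2) %[ae mu].
  by apply: filterS trim_ae => x /= H _; rewrite H.
have IE : Int (fun x => h i k x ^+ 2) = Int (fun x => g x ^+ 2) by exact: Int_ae.
have I0 : 0 <= Int (fun x => g x ^+ 2) by apply: Int_ge0 => x; exact: sqr_ge0.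
rewrite (sqrt_Int_L2norm Lh) IE !lee_fin in h1 h2; split.
- exact: L1_ae mg2 Lh ae2.
- by rewrite -[leRHS]sqr_sqrtr//; apply: lerXn2r => //; rewrite nnegrE ?invr_ge0 ?sqrtr_ge0// ltW.
- by rewrite -[leLHS]sqr_sqrtr//; apply: lerXn2r => //; rewrite nnegrE ?sqrtr_ge0// ltW.
Qed.

Let pt (j : I n.+1) : exists x, E j x.
Proof. by have [z zj _] := cube_center nd delta01 a00 dc j; exists z. Qed.

Lemma trim_cell j x : subcubes E i j -> E j x -> g x ^+ 2 * m (E j) <= C ^+ 2.
Proof.
move=> ji xj; have [Lg _ h2] := trim_L2; apply: le_trans h2.
rewrite -(@Int_indic _ _ _ mu)// -IntZ; last by apply: bm_L1 => //; exact: bm_indic.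
apply: le_Int => //; first by apply: bm_L1 => //; apply: bmZ; exact: bm_indic.
move=> y; rewrite indicE; have [yj|yj] := boolP (y \in E j); last by rewrite mulr0 sqr_ge0.
by rewrite mulr1 (trim_cst ji xj (set_mem yj)).
Qed.

(** Bounds the height of a Haar function times the root of the mass of its cube: [C] bounds the L2
    norm, and the root that of the ratio between the mass of a cube and that of a subcube. *)
Definition haar_const := C * Num.sqrt (2 * A2 * C1 / (A1 * a0 * delta)).

Lemma haar_const_gt0 : 0 < haar_const.
Proof. by rewrite mulr_gt0// sqrtr_gt0 divr_gt0// !mulr_gt0. Qed.

Lemma trim_le x : `|g x| <= haar_const / w.
Proof.
have w2 : w ^+ 2 = m (E i) by rewrite sqr_sqrtr// ltW.
have CH := haar_const_gt0.
have [->|gx] := eqVneq (g x) 0; first by rewrite normr0 divr_ge0// ltW.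
have [j ji xj] := trim_supp gx.
have CH' := ltW CH; have w0' := ltW w0.
rewrite ler_pdivlMr// -(@ler_pXn2r _ 2)// ?nnegrE ?mulr_ge0//.
rewrite exprMn real_normK ?num_real// w2 /haar_const [leRHS]exprMn sqr_sqrtr; last first.
  by rewrite ltW// divr_gt0// !mulr_gt0.
have h1 := trim_cell ji xj.
have h2 := cube_lower mufin nd delta01 a00 a0_small dc j (ltn0Sn n).
have h3 : m (E i) <= A2 * (2 * C1 * delta ^+ n).
  have [z zi _] := cube_center nd delta01 a00 dc i.
  have i1 : (1 <= Nsub E i)%N by case/andP: kN => /leq_trans; apply.
  apply: le_trans (ball_upper_cube mufin mupos nd delta01 a00 C10 a0_small dc i1 zi (lexx _)).
  apply: m_le => //; first exact: (nd_ball nd).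
  move=> y yi; apply: le_lt_trans (cube_dist dc zi yi) _.
  by rewrite -mulrA ltr_pMl ?ltr1n// mulr_gt0.
have p0 : 0 < A1 * a0 * delta by rewrite !mulr_gt0.
apply: le_trans (ler_wpM2l (sqr_ge0 _) h3) _.
rewrite [leRHS]mulrA ler_pdivlMr//.
apply: le_trans (_ : (2 * A2 * C1) * (g x ^+ 2 * (A1 * a0 * delta ^+ n.+1)) <= _).
  by rewrite le_eqVlt; apply/orP; left; apply/eqP; rewrite (exprS delta); ring.
rewrite mulrC; apply: ler_wpM2r; first by rewrite ltW// !mulr_gt0.
by apply: le_trans h1; apply: ler_wpM2l => //; exact: sqr_ge0.
Qed.

Lemma bm_trim : bm g.
Proof. by split=> //; exists (haar_const / w); exact: trim_le. Qed.

Lemma Int_trim : Int g = 0.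
Proof.
by have [mh _ _ _ <-] := hk; apply/esym/Int_ae => //; exact: trim_ae.
Qed.

Lemma trim_L1 : Int (fun x => `|g x|) <= haar_const * w.
Proof.
have CH := haar_const_gt0.
have bi := bmZ (haar_const / w) (bm_indic (mEc i) : bm (\1_(E i) : X -> R)).
apply: le_trans (_ : Int (fun x => haar_const / w * \1_(E i) x) <= _).
  apply: le_Int; [by apply: bm_L1 => //; exact: bm_norm bm_trim|exact: bm_L1|] => x.
  have [->|gx] := eqVneq (g x) 0; first by rewrite normr0 mulr_ge0// divr_ge0// ltW.
  rewrite indicE (mem_set (trim_supp_cube gx)) mulr1; exact: trim_le.
rewrite IntZ ?Int_indic//; last by apply: bm_L1 => //; exact: bm_indic.
have w2 : m (E i) = w ^+ 2 by rewrite sqr_sqrtr// ltW.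
by rewrite [X in _ * X <= _]w2 le_eqVlt; apply/orP; left; apply/eqP; field; rewrite gt_eqF.
Qed.

Let sg := tau * delta ^+ n.+1.
Let sg0 : 0 < sg. Proof. exact: mulr_gt0. Qed.
Let T := phi_tilde mu psi h i k.
Let H := haar_const / w.
Let H0 : 0 <= H. Proof. by rewrite divr_ge0// ltW// haar_const_gt0. Qed.
Let mps l : measurable_fun [set: X] (psi n.+1 l).
Proof. by have [hp _ _ _ _] := pou n.+1; have [] := hp l. Qed.
Let ps0 l x : 0 <= psi n.+1 l x.
Proof. by have [hp _ _ _ _] := pou n.+1; have [] := hp l. Qed.
Let psM x : ([set l | psi n.+1 l x != 0] #<= `I_M)%card.
Proof. by have [_ hp _ _ _] := pou n.+1. Qed.
Let ps1 x : series (fun l => psi n.+1 l x) @ \oo --> (1 : R).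
Proof. by have [_ _ hp _ _] := pou n.+1. Qed.
Let ps_diam l : (qdiam d [set x | psi n.+1 l x != 0%R] <= sg%:E)%E.
Proof. by have [_ _ _ hp _] := pou n.+1. Qed.
Let ps_lip l : (Lip d beta (psi n.+1 l) <= (sg `^ (- beta))%:E)%E.
Proof. by have [_ _ _ _ hp] := pou n.+1. Qed.

(** Altering [h] on a null set changes its smoothing at no point, so [phi_tilde] may be computed
    from the trimmed function. *)
Let TE : T = fun x => Int (fun y => smoothing_kernel mu psi n.+1 x y * g y).
Proof.
apply/funext => x; apply: Int_ae.
- apply: measurable_funM; last by have [] := hk.
  exact: (@kernel_meas _ _ _ mu M n.+1 psi mps psM x).
- by apply: measurable_funM => //; exact: (@kernel_meas _ _ _ mu M n.+1 psi mps psM x).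
- by apply: filterS trim_ae => y /= e _; rewrite e.
Qed.

Let bT : bm T.
Proof. by rewrite TE; exact: (bm_smooth mufin H0 mps ps0 psM ps1 bm_trim trim_le). Qed.
Let T_le x : `|T x| <= H.
Proof. by rewrite TE; exact: (smooth_le mufin H0 mps ps0 psM ps1 bm_trim trim_le). Qed.
Let T_int : Int T = 0.
Proof. by rewrite TE (Int_smooth mufin H0 mps ps0 psM ps1 bm_trim trim_le) Int_trim. Qed.
Let T_supp x : T x != 0 -> exists2 y, E i y & d x y <= delta ^+ n.
Proof.
rewrite TE => /(smooth_supp mufin mps ps0 psM ps1 ps_diam bm_trim)[y /trim_supp_cube yi xy].
exists y => //; apply: le_trans xy _; rewrite /sg exprS mulrA; apply: ler_piMl; first exact: ltW.
by apply: mulr_ile1; [exact: ltW|exact: ltW|case/andP: tau01|case/andP: delta01 => _ /ltW].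
Qed.
Let T_hol x y : `|T x - T y| <= 2 * M%:R * H * (d x y / sg) `^ beta.
Proof.
rewrite TE; exact: (smooth_hol mufin (nd_ge0 nd) (nd_neq nd) sg0 H0 mps ps0 psM ps1 ps_lip bm_trim trim_le).
Qed.

Let layer (j : I n.+1) := [set x | E j x /\ (qdist d [set x] (~` E j) <= (tau * delta ^+ n.+1)%:E)%E].

(* away from the boundary layers of the subcubes the smoothing reproduces h *)
Let T_L2 : Int (fun x => g x ^+ 2) <= 2 * Int (fun x => T x ^+ 2).
Proof.
have [c hc] := choice pt.
have L2T : integrableR mu (fun x => T x ^+ 2) by apply: bm_L1 => //; exact: bmX.
have [L2g _ _] := trim_L2.
have lay (j : I n.+1) := boundary_layer mufin mupos nd delta01 a00 C10 a0_small dc j (ltW tau0).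
have ml j : measurable (layer j) by case: (lay j).
have bl j (a : R) : bm (fun x => a * \1_(layer j) x) by apply: bmZ; exact: bm_indic.
have be j (a : R) : bm (fun x => a * \1_(E j) x) by apply: bmZ; exact: bm_indic.
have bS : bm (fun x => \sum_(j <- s) g (c j) ^+ 2 * \1_(layer j) x) by exact: bm_sum.
have h1 : Int (fun x => g x ^+ 2) <=
    Int (fun x => T x ^+ 2 + \sum_(j <- s) g (c j) ^+ 2 * \1_(layer j) x).
  (* The pointwise comparison holds almost everywhere; taking the minimum makes it hold
     everywhere. *)
  pose gmin x := Num.min (g x ^+ 2) (T x ^+ 2 + \sum_(j <- s) g (c j) ^+ 2 * \1_(layer j) x).
  have bgm : bm (fun x => T x ^+ 2 + \sum_(j <- s) g (c j) ^+ 2 * \1_(layer j) x).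
    by apply: bmD => //; exact: bmX.
  have mg2 : measurable_fun [set: X] (fun x => g x ^+ 2) by exact: measurable_funX.
  have mmin : measurable_fun [set: X] gmin by apply: measurable_minr => //; case: bgm.
  have aeg : (fun x => g x ^+ 2) = gmin %[ae mu].
    have hae := smooth_ae mufin mps ps0 psM ps1 ps_diam bm_trim.
    apply: filterS hae => x hx _; apply/esym/min_idPl.
    have S0 : 0 <= \sum_(j <- s) g (c j) ^+ 2 * \1_(layer j) x.
      by apply: sumr_ge0 => j _; rewrite mulr_ge0 ?sqr_ge0// indicE.
    have [->|gx] := eqVneq (g x) 0; first by rewrite expr0n addr_ge0// sqr_ge0.
    have [j ji xj] := trim_supp gx.
    have [lx|lx] := pselect (layer j x).
      rewrite (big_fsetD1 j)/=; last by rewrite sP inE.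
      rewrite indicE (mem_set lx) mulr1 (trim_cst ji (hc j) xj) addrCA lerDl addr_ge0 ?sqr_ge0//.
      by apply: sumr_ge0 => l _; rewrite mulr_ge0 ?sqr_ge0// indicE.
    rewrite (_ : T x = g x) ?lerDl// TE; apply: hx => y xy.
    apply: (trim_cst ji _ xj); apply: contrapT => yj; apply: lx; split; first exact: xj.
    by apply: (@le_trans _ _ (d x y)%:E); [apply: ereal_inf_lbound; exists (x, y)|rewrite lee_fin].
  rewrite (Int_ae mg2 mmin aeg); apply: le_Int; [exact: L1_ae mmin L2g aeg|exact: bm_L1|].
  by move=> x; rewrite ge_min lexx orbT.
(* By [tau_eta] the layer of each subcube has at most half of its mass. *)
have h2 : Int (fun x => \sum_(j <- s) g (c j) ^+ 2 * \1_(layer j) x) <=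
    2^-1 * Int (fun x => g x ^+ 2).
  rewrite (Int_sum mufin); last by move=> j; exact: bm_L1.
  apply: le_trans (_ : \sum_(j <- s) 2^-1 * Int (fun x => g (c j) ^+ 2 * \1_(E j) x) <= _).
    apply: ler_sum => j _.
    rewrite !IntZ ?Int_indic//; [|by apply: bm_L1 => //; exact: bm_indic..].
    rewrite mulrCA; apply: ler_wpM2l; first exact: sqr_ge0.
    have [_ hl] := lay j; apply: le_trans hl _; apply: ler_wpM2r => //; exact: fine_ge0.
  rewrite -mulr_sumr -(Int_sum mufin); last by move=> j; exact: bm_L1.
  apply: ler_wpM2l; first by rewrite invr_ge0.
  apply: le_Int => //; first by apply: bm_L1 => //; exact: bm_sum.
  move=> x; have [[j [js xj]]|no] := pselect (exists j, j \in s /\ E j x); last first.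
    rewrite big1_seq ?sqr_ge0// => j /= js; rewrite indicE memNset ?mulr0// => xj.
    by apply: no; exists j.
  rewrite (big_fsetD1 j)//= indicE (mem_set xj) mulr1 big1_seq ?addr0.
    by rewrite (@trim_cst j (c j) x)//; move: js; rewrite sP inE.
  move=> l /=; rewrite !inE => /andP[lj ls]; rewrite indicE memNset ?mulr0// => xl.
  by move/eqP : lj; apply; exact: disj xl xj.
rewrite (IntD L2T (bm_L1 mufin bS)) in h1.
by move: h1 h2; lra.
Qed.

Let L := fine (L2norm mu T).
Let L2T : integrableR mu (fun x => T x ^+ 2). Proof. by apply: bm_L1 => //; exact: bmX. Qed.
Let L_E : L = Num.sqrt (Int (fun x => T x ^+ 2)). Proof. by rewrite /L sqrt_Int_L2norm. Qed.
(** Normalisation multiplies by at most [2 C]: the squared norm is at least [C^-2] before smoothing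
    and loses at most half. *)
Let L_ge : (2 * C)^-1 <= L.
Proof.
have q : 0 <= (2 * C)^-1 by rewrite invr_ge0 mulr_ge0// ltW.
rewrite L_E -[leLHS](ger0_norm q) -sqrtr_sqr ler_sqrt; last first.
  by apply: Int_ge0 => x; exact: sqr_ge0.
have [_ h1 _] := trim_L2; have := le_trans h1 T_L2.
rewrite invfM exprMn; set y := C^-1 ^+ 2; have : 0 <= y by exact: sqr_ge0.
by rewrite (_ : (2^-1 : R) ^+ 2 = 4^-1); [lra|field].
Qed.
Let L0 : 0 < L. Proof. by apply: lt_le_trans L_ge; rewrite invr_gt0 mulr_gt0. Qed.

Lemma phi_props : let phi := phiQ mu psi h i k in
  [/\ bm phi, forall x, `|phi x| <= 2 * C * haar_const / w,
      forall x y, `|phi x - phi y| <=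
        2 * C * (2 * M%:R * haar_const * ((tau * delta)^-1) `^ beta) / w * (d x y / delta ^+ n) `^ beta,
      forall x, phi x != 0 -> exists2 y, E i y & d x y <= delta ^+ n &
      Int phi = 0 /\ Int (fun x => phi x * phi x) = 1].
Proof.
move=> phi.
have phiE : phi = fun x => L^-1 * T x by apply/funext => x; rewrite mulrC.
have LV : L^-1 <= 2 * C by rewrite -[leRHS]invrK lef_pV2 ?posrE// invr_gt0 mulr_gt0.
have LV0 : 0 <= L^-1 by rewrite invr_ge0 ltW.
rewrite phiE; split.
- exact: bmZ.
- by move=> x; rewrite normrM (ger0_norm LV0) -mulrA; apply: ler_pM => //; exact: T_le.
- move=> x y; rewrite -mulrBr normrM (ger0_norm LV0) -!(mulrA (2 * C)); apply: ler_pM => //.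
  apply: le_trans (T_hol x y) _; rewrite le_eqVlt; apply/orP; left; apply/eqP.
  have -> : d x y / sg = (tau * delta)^-1 * (d x y / delta ^+ n).
    by rewrite /sg exprS; field; rewrite !gt_eqF.
  have e1 : 0 <= (tau * delta)^-1 by rewrite invr_ge0 mulr_ge0// ltW.
  have e2 : 0 <= d x y / delta ^+ n by rewrite divr_ge0 ?(nd_ge0 nd)// ltW.
  rewrite (powRM _ e1 e2) /H; set a := _ `^ _; set b := _ `^ _; rewrite -/w; ring.
- by move=> x; rewrite mulf_eq0 negb_or => /andP[_ /T_supp].
- split; first by rewrite IntZ ?T_int ?mulr0//; exact: bm_L1.
  rewrite (_ : (fun x => _) = fun x => L^-1 ^+ 2 * T x ^+ 2); last first.
    by apply/funext => x; rewrite -exprMn expr2.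
  rewrite IntZ// exprVn (_ : Int _ = L ^+ 2) ?mulVf ?expf_neq0 ?gt_eqF//.
  by rewrite L_E sqr_sqrtr//; apply: Int_ge0 => x; exact: sqr_ge0.
Qed.
End OneCube.

(** A trimmed function is a finite combination of indicators of subcubes, hence measurable for the
    generated sigma-algebra itself and not only for its completion. *)
Lemma trim_adapted n (i : I n) k : (1 <= k <= Nsub E i)%N ->
  measurable_fun [set: g_sigma_algebraType (cubes_upto E n.+1)]
    (haar_trim i k : g_sigma_algebraType (cubes_upto E n.+1) -> R).
Proof.
move=> kN; pose s := fset_set (subcubes E i).
have sP j : (j \in s) = (j \in subcubes E i) by exact: in_fset_set.
have pt (j : I n.+1) : exists x, E j x.
  by have [z zj _] := cube_center nd delta01 a00 dc j; exists z.
have [c hc] := choice pt.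
have -> : haar_trim i k = fun x => \sum_(j <- s) haar_trim i k (c j) * \1_(E j) x.
  apply/funext => x; have [[j [js xj]]|no] := pselect (exists j, j \in s /\ E j x); last first.
    rewrite big1_seq; last first.
      move=> j /= js; rewrite indicE memNset ?mulr0// => xj; by apply: no; exists j.
    apply/eqP/negPn/negP => /trim_supp[j ji xj]; apply: no; exists j; split=> //.
    by rewrite sP inE.
  rewrite (big_fsetD1 j)//= indicE (mem_set xj) mulr1 big1_seq ?addr0.
    by apply: (trim_cst kN _ xj (hc j)); move: js; rewrite sP inE.
  move=> l /=; rewrite !inE => /andP[lj ls]; rewrite indicE memNset ?mulr0// => xl.
  by move/eqP : lj; apply; exact: disj xl xj.
apply: measurable_sum => j.
apply: (@measurable_funM _ (g_sigma_algebraType (cubes_upto E n.+1)) R setT (cst (haar_trim i k (c j))) (\1_(E j))).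
  exact: measurable_cst.
apply: (@measurable_indic _ (g_sigma_algebraType (cubes_upto E n.+1))).
by apply: sub_sigma_algebra; exists n.+1, j.
Qed.

(** The sets that contain or miss a given cube form a sigma-algebra, which contains all cubes of no
    finer level. *)
Lemma sigma_cube_dichotomy n p (i : I n) A : (p <= n)%N -> <<s cubes_upto E p >> A ->
  (E i `<=` A) \/ (E i `&` A = set0).
Proof.
move=> pn; pose D := [set S : set X | E i `<=` S \/ E i `&` S = set0].
have : <<s cubes_upto E p >> `<=` D.
  apply: smallest_sub.
    split.
    - by right; rewrite setI0.
    - move=> S [e|e]; rewrite setTD; [right|left].
        by apply/seteqP; split=> // x [/e].
      by move=> x xi Sx; have : (E i `&` S) x by []; rewrite e.
    - move=> S hS; have [[j hj]|no] := pselect (exists j, E i `<=` S j).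
        by left => x /hj; exists j.
      right; apply/seteqP; split=> // x [xi [j _ xj]]; case: (hS j) => e; first by apply: no; exists j.
      by have : (E i `&` S j) x by []; rewrite e.
  move=> S [q [j [qp ->]]]; have [e|e] := cube_nested dc j i (leq_trans qp pn); first by left.
  by right.
by move=> e /e.
Qed.

Lemma trim_mart n (i : I n) k p A : (1 <= k <= Nsub E i)%N -> (p <= n)%N ->
  <<s cubes_upto E p >> A -> \int[mu]_(x in A) haar_trim i k x = 0.
Proof.
move=> kN pn /(sigma_cube_dichotomy i pn) e; rewrite Rintegral_mkcond.
case: e => e.
  rewrite (_ : _ \_ A = haar_trim i k) ?Int_trim//.
  apply/funext => x; rewrite patchE; case: ifPn => // /negP xA.
  apply/esym/eqP/negPn/negP => /trim_supp_cube/e xA'; apply: xA; exact: mem_set.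
rewrite (_ : _ \_ A = cst 0) ?Int_cst ?mul0r//.
apply/funext => x; rewrite patchE; case: ifPn => // /set_mem xA.
apply/eqP/negPn/negP => /trim_supp_cube xi.
by have : (E i `&` A) x by []; rewrite e.
Qed.

Lemma trim_disj n (i j : I n) k l x : i <> j -> haar_trim i k x * haar_trim j l x = 0.
Proof.
move=> ij; apply/eqP; rewrite mulf_eq0; apply/negPn/negP => /norP[/trim_supp_cube h1 /trim_supp_cube h2].
by apply: ij; exact: disj h1 h2.
Qed.

(** The finer cube lies in one subcube of the coarser one, where the coarser function is constant
    and the finer one has mean zero, or else the product vanishes. *)
Lemma trim_orth n n' (i : I n) (i' : I n') k k' : (1 <= k <= Nsub E i)%N -> (1 <= k' <= Nsub E i')%N ->
  (n < n')%N -> Int (fun x => haar_trim i k x * haar_trim i' k' x) = 0.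
Proof.
move=> kN kN' nn.
have [[j ji ij]|no] := pselect (exists2 j, subcubes E i j & E i' `<=` E j).
  have [z zi _] := cube_center nd delta01 a00 dc i'.
  rewrite (_ : (fun x => _) = fun x => haar_trim i k z * haar_trim i' k' x); last first.
    apply/funext => x; have [->|/trim_supp_cube xi] := eqVneq (haar_trim i' k' x) 0; first by rewrite !mulr0.
    by rewrite (trim_cst kN ji (ij _ xi) (ij _ zi)).
  by rewrite IntZ ?Int_trim ?mulr0//; apply: bm_L1 => //; exact: bm_trim.
rewrite (_ : (fun x => _) = cst 0) ?Int_cst ?mul0r//.
apply/funext => x; apply/eqP; rewrite mulf_eq0; apply/negPn/negP => /norP[/trim_supp[j ji xj] /trim_supp_cube xi].
apply: no; exists j => //; have [//|e] := cube_nested dc j i' nn.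
by have : (E i' `&` E j) x by []; rewrite e.
Qed.
End HaarFunctions.

Lemma level_gap m s k k' : (m * k + s)%N <> (m * k' + s)%N ->
  (m * k + s + m <= m * k' + s)%N \/ (m * k' + s + m <= m * k + s)%N.
Proof.
move=> ne; case: (ltngtP k k') => kk.
- by left; rewrite addnAC leq_add2r addnC -mulnS leq_mul2l kk orbT.
- by right; rewrite addnAC leq_add2r addnC -mulnS leq_mul2l kk orbT.
- by case: ne; rewrite kk.
Qed.

(** * The family of selected cubes together with the whole space *)

Section CubeFamily.
Context {R : realType} {disp : measure_display} {X : measurableType disp}.
Variable mu : {measure set X -> \bar R}.
Hypothesis mufin : (mu [set: X] < +oo)%E.
Hypothesis mupos : (0 < mu [set: X])%E.
Variable d : X -> X -> R.
Local Notation m_ A := (fine (mu A)).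
Local Notation B := (qball d).
Local Notation V := (fine (mu [set: X])).
Local Notation Int f := (Rintegral mu [set: X] f).
Variables (kq A1 A2 cb DX : R).
Hypothesis nd : normal_data mu d kq A1 A2 cb DX.
Variables (delta a0 eta C1 C2 : R).
Hypothesis delta01 : 0 < delta < 1.
Hypothesis a00 : 0 < a0.
Hypothesis C10 : 0 < C1.
Hypothesis C20 : 0 < C2.
Hypothesis a0_small : a0 * delta <= DX.
Context {I : nat -> choiceType}.
Variable E : forall k, I k -> set X.
Hypothesis dc : dyadic_cubes mu d E delta a0 eta C1 C2.
Variables (C tau beta : R) (M : nat).
Hypothesis C_gt0 : 0 < C.
Variable h : forall n, I n -> nat -> X -> R.
Hypothesis haar : haar_system mu E C h.
Variable psi : nat -> nat -> X -> R.
Hypothesis pou : partitions_of_unity d beta tau delta M psi.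
Hypothesis tau01 : 0 < tau <= 1.
Hypothesis tau_eta : C2 * tau `^ eta <= 2^-1.
Hypothesis beta0 : 0 < beta.
Variables (K : R) (l : nat) (c : forall n, I n -> 'I_l).
Hypothesis sep : separated_classes mu d E K c.
Variables (m s : nat) (j : 'I_l) (i0 : nat).
Hypothesis m_gt0 : (0 < m)%N.
Hypothesis s_gt0 : (0 < s)%N.
Hypothesis i0_gt0 : (1 <= i0)%N.
Local Notation F := (cube_family E c m s j i0).
Variable f : F -> X -> R.
Hypothesis f_orth : gram_orthonormalization mu (phiF mu psi h (i0 := i0)) f.

Let Hc := haar_const A1 A2 delta a0 C1 C.
(** The summands [DX + V], like the minimum in [c1] and the extra terms in [Cphi], make the cube
    estimates hold for the whole space too, which is treated as a cube of level 0. *)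
Let CD := C1 + DX + V.
Let c2 := kq * (CD + 1).
Let c1 := Num.min (A1 * a0) V.
Let Cphi := 2 * C * Hc + Num.sqrt V.
Let CL := 2 * C * (2 * M%:R * Hc * ((tau * delta)^-1) `^ beta) + 1.
Let th := delta `^ (beta / 2).
Let D' := DX + V + kq * (cb * V + c2).
Hypothesis K_large : 4 * kq ^+ 3 * (c2 + cb * V) < K * c1.
Hypothesis m_large : 4 * (Cphi * CL * (2 * c2) `^ beta * (2 * A2 * c2 / c1)) *
  (4 * A2 * kq * c2 / c1 + 1) * th ^+ m <= delta / 4.
Hypothesis th_small : th <= 2^-1.
Hypothesis delta_small : delta * (kq * (D' + 2 * kq * c2)) <= D'.

Let dl0 : 0 < delta. Proof. by case/andP: delta01. Qed.
Let dl n : 0 < delta ^+ n. Proof. exact: exprn_gt0. Qed.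
Let V0 : 0 < V. Proof. exact: V_gt0. Qed.
Let A10 := nd_A1 nd.
Let A20 := nd_A2 nd.
Let DX0 := nd_DX nd.
Let kq0 : 0 < kq. Proof. exact: lt_le_trans (nd_kq nd). Qed.
Let CD0 : 0 < CD. Proof. by rewrite !addr_gt0. Qed.
Let c20 : 0 < c2. Proof. by rewrite mulr_gt0// addr_gt0. Qed.
Let cV0 : 0 <= cb * V. Proof. by apply: mulr_ge0; apply: ltW => //; exact: (nd_cb nd). Qed.
Let c10 : 0 < c1. Proof. by rewrite lt_min V0 mulr_gt0. Qed.
Let Hc0 : 0 < Hc. Proof. exact: (haar_const_gt0 nd delta01 a00 C10 C_gt0). Qed.
Let sV0 : 0 < Num.sqrt V. Proof. by rewrite sqrtr_gt0. Qed.
Let sV2 : Num.sqrt V ^+ 2 = V. Proof. by rewrite sqr_sqrtr// ltW. Qed.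
Let CL1 : 1 <= CL.
Proof.
rewrite lerDr; apply: mulr_ge0; first by apply: mulr_ge0 => //; exact: ltW.
apply: mulr_ge0; last exact: powR_ge0.
by apply: mulr_ge0; [exact: mulr_ge0|exact: ltW].
Qed.
Let D'0 : 0 < D'.
Proof.
apply: addr_gt0; first exact: addr_gt0.
by apply: mulr_gt0 => //; apply: addr_gt0 => //; apply: mulr_gt0 => //; exact: (nd_cb nd).
Qed.
Let mEc k (i : I k) : measurable (E i). Proof. exact: (cube_measurable dc). Qed.

Let Qs (q : F) := if q is Some p then E (tagged (val p)) else [set: X].
Let lev (q : F) := if q is Some p then tag (val p) else 0%N.
(** A Haar function of a level n cube is constant on cubes of level n + 1, so it enters one stage
    after its level; the constant enters at stage 0. *)
Let birth (q : F) := if q is Some p then (tag (val p)).+1 else 0%N.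
Let hh (q : F) : X -> R := if q is Some p then haar_trim E h (tagged (val p)) i0 else cst 1.
Let dg (q : F) := if q is Some p then 1 else Num.sqrt V.
Let phi : F -> X -> R := phiF mu psi h (i0 := i0).

Let selP (p : {q : {n : nat & I n} | q \in selected E c m s j i0}) :
  [/\ exists k, tag (val p) = (m * k + s)%N, c (tagged (val p)) = j & (1 <= i0 <= Nsub E (tagged (val p)))%N].
Proof. by have := valP p; rewrite inE => -[h1 h2 h3]; split=> //; rewrite i0_gt0. Qed.

Let tag_gt0 (p : {q : {n : nat & I n} | q \in selected E c m s j i0}) : (0 < tag (val p))%N.
Proof. by have [[k e] _ _] := selP p; rewrite e addn_gt0 s_gt0 orbT. Qed.

(** Distinct selected cubes with equal tags are moved into one index type [I n]; they share the
    class [j], so the separation property becomes applicable. *)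
Let tag_ne (p p' : {q : {n : nat & I n} | q \in selected E c m s j i0}) (P : forall n, I n -> I n -> Prop) :
  (forall n (i i' : I n), i <> i' -> c i = c i' -> P n i i') ->
  (Some p : F) != Some p' -> tag (val p) = tag (val p') ->
  exists n (i i' : I n), [/\ val p = Tagged I i, val p' = Tagged I i' & P n i i'].
Proof.
move=> hP pp; have [_ + _] := selP p; have [_ + _] := selP p'.
have : val p != val p'.
  by apply: contra pp => /eqP e; apply/eqP; congr Some; exact: val_inj.
case: (val p) => n i; case: (val p') => n' i' /= ne h1 h2 nn; move: i' ne h1; rewrite -nn => i' ne h1.
exists n, i, i'; split=> //; apply: hP; last by rewrite h1.
by apply/eqP; apply: contra ne => /eqP ->.
Qed.

Let lvl_fin n : finite_set [set q : F | (birth q <= n)%N].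
Proof.
pose g (q : F) : option {n : nat & I n} := omap val q.
have : finite_set (None |` (Some @` \bigcup_(k in `I_n) ((fun i : I k => Tagged I i) @` [set: I k]))).
  rewrite finite_setU; split=> //; apply: finite_image; apply: bigcup_finite => // k _.
  by apply: finite_image; exact: (level_finite mufin mupos nd delta01 a00 a0_small dc).
set S := (X in finite_set X) => fS.
have : finite_set (g @^-1` S).
  apply: finite_preimage fS => -[p|] [p'|] _ _ //= [e].
  by congr Some; exact: val_inj.
apply: sub_finite_set => -[p|] /= pn; last by left.
right; exists (val p) => //; exists (tag (val p)) => //; exists (tagged (val p)) => //.
by case: (val p).
Qed.

Let lvl n : {fset F} := fset_set [set q : F | (birth q <= n)%N].

Lemma family_transfer : let Y := atomic_H1_closed_span mu d f in exists T : (X -> R) -> (X -> R),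
  bounded_linear_operator mu Y (atomic_H1norm mu d) (mart_H1 mu (cubes_upto E)) (mart_H1norm mu (cubes_upto E)) T /\
  forall Q, Y (f Q) /\ T (f Q) = hF h Q %[ae mu].
Proof.
move=> Y.
(* The trimmed functions [hh] agree with the [hF h] almost everywhere and are exactly adapted to the
   filtration. *)
suff [T [bT hT]] : exists T : (X -> R) -> (X -> R),
  bounded_linear_operator mu Y (atomic_H1norm mu d) (mart_H1 mu (cubes_upto E)) (mart_H1norm mu (cubes_upto E)) T /\
  forall Q, Y (f Q) /\ T (f Q) = hh Q %[ae mu].
  exists T; split=> // Q; have [h1 h2] := hT Q; split=> //.
  apply: filterS2 h2 (_ : hF h Q = hh Q %[ae mu]); first by move=> x e1 e2 _; rewrite e1// e2.
  case: Q h1 => [p|] _ /=; last by apply: nearW.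
  by have [_ _ kN] := selP p; exact: (trim_ae dc haar kN).
have ne_Some p p' : (Some p : F) != Some p' -> tag (val p) = tag (val p') ->
    exists n (i i' : I n), [/\ val p = Tagged I i, val p' = Tagged I i' & i <> i' /\ c i = c i'].
  by apply: (@tag_ne p p' (fun n i i' => i <> i' /\ c i = c i')).
have d01 : 0 < delta <= 1 by rewrite dl0/=; case/andP: delta01 => _ /ltW.
have th01 : 0 < th <= 2^-1 by rewrite powR_gt0.
have thE n : (delta ^+ n) `^ beta = (th ^+ 2) ^+ n.
  have -> : th ^+ 2 = delta `^ beta.
    by rewrite /th -powR_mulrn ?powR_ge0// -powRrM divfK.
  by rewrite -(powR_mulrn n (ltW dl0)) -(powR_mulrn n (powR_ge0 delta beta)) -!powRrM mulrC.
have CP0 : 0 <= 2 * C * Hc by apply: mulr_ge0; [apply: mulr_ge0|]; exact: ltW.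
have Cphi0 : 0 < Cphi by rewrite ltr_wpDl.
have CL0 : 0 < CL by exact: lt_le_trans CL1.
have Ch0 : 0 <= C ^+ 2 + V by rewrite addr_ge0 ?sqr_ge0// ltW.
have mQ P : measurable (Qs P) by case: P => [p|]; [exact: mEc|exact: measurableT].
have Q_ne P : exists z, Qs P z.
  case: P => [p|] /=; last by exists point.
  by have [z zi _] := cube_center nd delta01 a00 dc (tagged (val p)); exists z.
have Q_lower P : c1 * delta ^+ lev P <= fine (mu (Qs P)).
  case: P => [p|] /=; last by rewrite expr0 mulr1 ge_min lexx orbT.
  apply: le_trans (cube_lower mufin nd delta01 a00 a0_small dc (tagged (val p)) (tag_gt0 p)).
  by apply: ler_wpM2r; [exact: ltW|rewrite ge_min lexx].
have Q_diam P y z : Qs P y -> Qs P z -> d y z <= CD * delta ^+ lev P.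
  case: P => [p|] /=.
    move=> yi zi; apply: le_trans (cube_dist dc yi zi) _; apply: ler_wpM2r; first exact: ltW.
    by rewrite /CD -addrA lerDl addr_ge0// ltW.
  move=> _ _; rewrite expr0 mulr1; apply: le_trans (nd_le nd y z) _.
  by rewrite /CD addrAC lerDr addr_ge0// ltW.
have Q_upper P z t : Qs P z -> 2 * CD * delta ^+ lev P <= t -> fine (mu (B z t)) <= A2 * t.
  case: P => [p|] /=.
    move=> zi ht; have [_ _ /andP[k1 k2]] := selP p.
    apply: (ball_upper_cube mufin mupos nd delta01 a00 C10 a0_small dc (leq_trans k1 k2) zi).
    apply: le_trans ht; apply: ler_wpM2r; first exact: ltW.
    by rewrite ler_pM2l// /CD -addrA lerDl addr_ge0// ltW.
  rewrite expr0 mulr1 => _ ht; apply: (nd_upper nd ltr01); apply: le_trans (_ : V <= _).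
    by apply: m_le => //; exact: (nd_ball nd).
  by apply: le_trans ht; rewrite /CD; have := C10; have := DX0; have := V0; lra.
have Q_sep P Q p q : P != Q -> lev P = lev Q -> Qs P p -> Qs Q q -> K * c1 * delta ^+ lev P <= d p q.
  case: P => [P|]; case: Q => [Q|] //=; last 2 first.
  - by move=> _ e; exfalso; have := tag_gt0 P; rewrite e.
  - by move=> _ e; exfalso; have := tag_gt0 Q; rewrite -e.
  move=> PQ lE; have [n [i [i' [e1 e2 [ii cc]]]]] := ne_Some P Q PQ lE.
  have K0 : 0 <= K.
    rewrite -(pmulr_lge0 _ c10) ltW// (le_lt_trans _ K_large)// mulr_ge0//.
      by rewrite mulr_ge0// exprn_ge0// ltW.
    by apply: addr_ge0 => //; exact: ltW.
  change (Qs (Some P) p -> Qs (Some Q) q -> K * c1 * delta ^+ lev (Some P) <= d p q).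
  have low := Q_lower (Some P); move: low; rewrite /lev /Qs e1 e2 /= => low pi qi.
  have := sep ii cc; rewrite (mE mufin (mEc i)) (mE mufin (mEc i')) -EFin_max -EFinM => h1.
  have h2 : (qdist d (E i) (E i') <= (d p q)%:E)%E by apply: ereal_inf_lbound; exists (p, q).
  have := le_trans h1 h2; rewrite lee_fin; apply: le_trans; rewrite -mulrA; apply: ler_wpM2l => //.
  by apply: le_trans low _; rewrite le_max lexx.
have props p := phi_props mufin mupos nd delta01 a00 C10 a0_small dc C_gt0 haar pou tau01 tau_eta
  (let: And3 _ _ kN := selP p in kN).
have phi_supp P x : phi P x != 0 -> exists2 y, Qs P y & d x y <= delta ^+ lev P.
  case: P => [p|] /=; first by have [_ _ _ H _] := props p; exact: H.
  by move=> _; exists x => //; rewrite (nd_xx nd) expr0.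
have wQ P : 0 < Num.sqrt (fine (mu (Qs P))).
  by rewrite sqrtr_gt0; apply: lt_le_trans (Q_lower P); exact: mulr_gt0.
have phi_bd P x : `|phi P x| <= Cphi / Num.sqrt (fine (mu (Qs P))).
  have wP := wQ P; case: P wP => [p|] /= wP; last first.
    by rewrite normr1 ler_pdivlMr// mul1r /Cphi lerDr.
  have [_ H _ _ _] := props p; apply: le_trans (H x) _; apply: ler_wpM2r; first by rewrite invr_ge0 ltW.
  by rewrite /Cphi lerDl ltW.
have phi_hol P x y : `|phi P x - phi P y| <=
    CL / Num.sqrt (fine (mu (Qs P))) * (d x y / delta ^+ lev P) `^ beta.
  have wP := wQ P; case: P wP => [p|] /= wP; last first.
    by rewrite subrr normr0 mulr_ge0 ?powR_ge0// divr_ge0// ltW.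
  have [_ _ H _ _] := props p; apply: le_trans (H x y) _; apply: ler_wpM2r; first exact: powR_ge0.
  by apply: ler_wpM2r; [rewrite invr_ge0 ltW|rewrite /CL lerDl].
have phi_int P : (0 < lev P)%N -> Int (phi P) = 0.
  by case: P => [p|] //= _; have [_ _ _ _ [H _]] := props p.
have phi_cst P : lev P = 0%N -> phi P = cst 1.
  by case: P => [p|] //= e; exfalso; have := tag_gt0 p; rewrite e.
have phi_sq P : Int (fun x => phi P x * phi P x) = dg P ^+ 2.
  case: P => [p|] /=; first by have [_ _ _ _ [_ ->]] := props p; rewrite expr1n.
  by under eq_fun do rewrite mulr1; rewrite Int_cst mul1r sV2.
have bphi P : bm (phi P).
  by case: P => [p|] /=; [have [H _ _ _ _] := props p|exact: bm_cst].
have bh P : bm (hh P).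
  case: P => [p|] /=; last exact: bm_cst.
  by have [_ _ kN] := selP p; exact: (bm_trim mufin mupos nd delta01 a00 C10 a0_small dc C_gt0 haar kN).
have h_supp P x : hh P x != 0 -> Qs P x.
  by case: P => [p|] //=; exact: trim_supp_cube.
have lev0 P Q : lev P = 0%N -> lev Q = 0%N -> P = Q.
  case: P => [p|]; case: Q => [q|] //=.
  - by move=> e; exfalso; have := tag_gt0 p; rewrite e.
  - by move=> e; exfalso; have := tag_gt0 p; rewrite e.
  - by move=> _ e; exfalso; have := tag_gt0 q; rewrite e.
have gap_lev P Q : (0 < lev P)%N -> (0 < lev Q)%N -> lev P <> lev Q ->
    (lev P + m <= lev Q)%N \/ (lev Q + m <= lev P)%N.
  case: P => [p|] //; case: Q => [q|] //= _ _.
  have [[k e] _ _] := selP p; have [[k' e'] _ _] := selP q; rewrite e e'; exact: level_gap.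
have dg0 P : 0 < dg P by case: P.
have sVV : 0 < (Num.sqrt V)^-1 by rewrite invr_gt0.
have D1 : 1 <= Num.sqrt V + (Num.sqrt V)^-1 + 1 by rewrite lerDr addr_ge0// ltW.
have dgD P : dg P <= Num.sqrt V + (Num.sqrt V)^-1 + 1.
  by case: P => [p|] //=; move: sVV; set y := _^-1; lra.
have dgVD P : (dg P)^-1 <= Num.sqrt V + (Num.sqrt V)^-1 + 1.
  by case: P => [p|] /=; [rewrite invr1|move: sVV sV0; set y := _^-1; lra].
have dg1 P : (0 < lev P)%N -> dg P = 1 by case: P.
have q0 : 0 <= kq * (cb * V + c2).
  by apply: mulr_ge0; [exact: ltW|apply: addr_ge0 => //; exact: ltW].
have D'_ge : DX <= D' /\ V <= D'.
  split; first by rewrite /D' -addrA lerDl addr_ge0// ltW.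
  by rewrite /D' addrAC lerDr addr_ge0// ltW.
have D'_ge2 : kq * (cb * V + c2) <= D' by rewrite /D' lerDr addr_ge0// ltW.
have ballX : exists x r, 0 < r /\ B x r = [set: X].
  exists point, (DX + 1); split; first by rewrite addr_gt0.
  by apply/seteqP; split=> // y _; apply: le_lt_trans (nd_le nd _ _) _; rewrite ltrDl.
have h_orth P Q : P != Q -> Int (fun x => hh P x * hh Q x) = 0.
  have I0 p : Int (hh (Some p)) = 0.
    by have [_ _ kN] := selP p; exact: (Int_trim mufin mupos nd delta01 a00 a0_small dc haar kN).
  wlog : P Q / (birth P <= birth Q)%N.
    move=> H PQ; have [le|le] := leqP (birth P) (birth Q); first exact: H.
    rewrite (_ : (fun x => _) = fun x => hh Q x * hh P x); last by apply/funext => x; rewrite mulrC.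
    by apply: H; [exact: ltnW|rewrite eq_sym].
  case: P => [p|]; case: Q => [q|] //.
  - move=> le pq; have [_ _ kp] := selP p; have [_ _ kq'] := selP q.
    have [lt|ge] := ltnP (tag (val p)) (tag (val q)).
      exact: (trim_orth mufin mupos nd delta01 a00 C10 a0_small dc C_gt0 haar kp kq' lt).
    have e : tag (val p) = tag (val q) by apply/eqP; rewrite eqn_leq ge andbT -ltnS.
    have [n [i [i' [e1 e2 [ii _]]]]] := ne_Some p q pq e.
    rewrite (_ : (fun x => _) = cst 0) ?Int_cst ?mul0r//; apply/funext => x.
    by rewrite /hh e1 e2 /= (trim_disj mufin nd delta01 a00 dc).
  - move=> _ _; rewrite (_ : (fun x => _) = hh (Some q)) ?I0//.
    by apply/funext => x; rewrite /= mul1r.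
have h_norm P : Int (fun x => hh P x ^+ 2) <= C ^+ 2 + V.
  case: P => [p|] /=; last first.
    by under eq_fun do rewrite expr1n; rewrite Int_cst mul1r lerDr sqr_ge0.
  have [_ _ kN] := selP p.
  have [_ _ H] := trim_L2 mufin mupos nd delta01 a00 a0_small dc C_gt0 haar kN.
  by apply: le_trans H _; rewrite lerDl ltW.
have h_L1 P : Int (fun x => `|hh P x|) <= (Hc + Num.sqrt V) * Num.sqrt (fine (mu (Qs P))).
  have wP := wQ P; case: P wP => [p|] /= wP.
    have [_ _ kN] := selP p.
    apply: le_trans (trim_L1 mufin mupos nd delta01 a00 C10 a0_small dc C_gt0 haar kN) _.
    by apply: ler_wpM2r; [exact: ltW|rewrite lerDl ltW].
  under eq_fun do rewrite normr1.
  by rewrite Int_cst mul1r mulrDl -expr2 sV2 lerDr mulr_ge0// ltW.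
have Kh0 : 0 <= Hc + Num.sqrt V by rewrite addr_ge0// ltW.
have mS n A : cubes_upto E n A -> measurable A by move=> [k [i [_ ->]]].
have S_mono n n' : (n <= n')%N -> cubes_upto E n `<=` cubes_upto E n'.
  by move=> nn A [k [i [kn ->]]]; exists k, i; split=> //; exact: leq_trans nn.
have mh P : measurable_fun [set: g_sigma_algebraType (cubes_upto E (birth P))]
    (hh P : g_sigma_algebraType (cubes_upto E (birth P)) -> R).
  case: P => [p|] /=; last exact: measurable_cst.
  by have [_ _ kN] := selP p; exact: (trim_adapted mufin mupos nd delta01 a00 a0_small dc haar kN).
have lvlP n P : (P \in lvl n) = (birth P <= n)%N.
  by rewrite /lvl in_fset_set//; apply/idP/idP; rewrite inE.
have h_mart n A P : <<s cubes_upto E n >> A -> (n < birth P)%N -> \int[mu]_(x in A) hh P x = 0.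
  case: P => [p|] //= sA np; have [_ _ kN] := selP p.
  exact: (trim_mart mufin mupos nd delta01 a00 a0_small dc haar kN _ sA).
have h_disj P Q x : P != Q -> birth P = birth Q -> hh P x * hh Q x = 0.
  case: P => [p|]; case: Q => [q|] //= pq [e].
  have [n [i [i' [e1 e2 [ii _]]]]] := ne_Some p q pq e.
  change (hh (Some p) x * hh (Some q) x = 0).
  by rewrite /hh e1 e2 /= (trim_disj mufin nd delta01 a00 dc).
exact: (@cube_transfer _ _ _ mu mufin mupos d F kq A2 DX cb (nd_ge0 nd) (nd_sym nd) (nd_xx nd) (nd_tri nd)
  (nd_kq nd) (nd_ball nd) (nd_le nd) (ltW A20) (ltW (nd_cb nd)) (nd_pos nd) (nd_rad nd) (nd_upper nd)
  Qs phi hh f lev dg delta th beta c1 CD (K * c1) Cphi CL (C ^+ 2 + V) D'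
  (Num.sqrt V + (Num.sqrt V)^-1 + 1) m c2 erefl d01 th01 beta0 thE c10 CD0 Cphi0 CL0 Ch0
  mQ Q_ne Q_lower Q_diam Q_upper Q_sep K_large phi_supp phi_bd phi_hol phi_int phi_cst phi_sq bphi bh h_supp
  lev0 gap_lev m_gt0 dg0 dgD dgVD D1 dg1 D'_ge D'_ge2 delta_small f_orth (andP delta01).2 ballX m_large
  (Hc + Num.sqrt V) h_orth h_norm h_L1 Kh0 A20 birth lvl (cubes_upto E) mS S_mono mh lvlP h_mart h_disj).
Qed.
End CubeFamily.

(** * Choice of the parameters *)

Theorem theorem8 (R : realType) (disp : measure_display)
    (X : measurableType disp) (mu : {measure set X -> \bar R})
    (d : X -> X -> R) (theta beta : R) :
  normal_qmspace mu d theta ->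
  (0 < mu [set: X])%E -> (mu [set: X] < +oo)%E ->
  0 < beta <= theta ->
  forall (a0 eta C1 C2 C : R) (M : nat),
  0 < a0 -> 0 < eta -> 0 < C1 -> 0 < C2 -> 0 < C ->
  exists tau0 : R, 0 < tau0 /\
  forall tau : R, 0 < tau < tau0 -> tau < (500 * C1)^-1 ->
  exists delta0 : R, 0 < delta0 /\
  forall delta : R, 0 < delta < delta0 -> delta < 1 ->
  exists K0 : R, 0 < K0 /\
  forall alpha : R, 0 < alpha < beta / 2 ->
  exists m0 : nat,
  forall (K : R) (m : nat), K0 <= K -> (2 <= m)%N -> (m0 <= m)%N ->
  forall (I : nat -> choiceType) (E : forall k, I k -> set X),
  dyadic_cubes mu d E delta a0 eta C1 C2 ->
  forall h : forall n, I n -> nat -> X -> R,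
  haar_system mu E C h ->
  forall psi : nat -> nat -> X -> R,
  partitions_of_unity d beta tau delta M psi ->
  forall (l : nat) (c : forall n, I n -> 'I_l),
  separated_classes mu d E K c ->
  forall (s : nat) (j : 'I_l) (i0 : nat),
  (0 < s <= m)%N -> (1 <= i0)%N ->
  forall f : cube_family E c m s j i0 -> X -> R,
  gram_orthonormalization mu (phiF mu psi h (i0 := i0)) f ->
  let Y := atomic_H1_closed_span mu d f in
  let G := cubes_upto E in
  exists T : (X -> R) -> (X -> R),
    bounded_linear_operator mu Y (atomic_H1norm mu d)
      (mart_H1 mu G) (mart_H1norm mu G) T /\
    forall Q, Y (f Q) /\ T (f Q) = hF h Q %[ae mu].

Proof.
move=> nq mupos mufin /andP[beta0 _] a0 eta C1 C2 C M a00 eta0 C10 C20 C_gt0.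
have [kq [A1 [A2 [cb [DX nd]]]]] := normal_dataP mufin mupos nq.
have V0 := V_gt0 mufin mupos; set V := fine (mu [set: X]) in V0.
have A10 := nd_A1 nd; have A20 := nd_A2 nd; have DX0 := nd_DX nd; have cb0 := nd_cb nd.
have kq0 : 0 < kq by exact: lt_le_trans (nd_kq nd).
(* Makes [C2 tau^eta <= 1/2]: the boundary layers carry at most half of the mass of a subcube. *)
exists (Num.min 1 ((2 * C2)^-1 `^ eta^-1)); split.
  by rewrite lt_min ltr01 powR_gt0// invr_gt0 mulr_gt0.
move=> tau /andP[tau0]; rewrite lt_min => /andP[tau1 tau2] _.
have tau_eta : C2 * tau `^ eta <= 2^-1.
  have : tau `^ eta <= ((2 * C2)^-1 `^ eta^-1) `^ eta.
    by apply: ge0_ler_powR; rewrite ?nnegrE ?powR_ge0// ltW.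
  rewrite -powRrM mulVf ?gt_eqF// powRr1; last by rewrite invr_ge0 mulr_ge0// ltW.
  move=> /(ler_wpM2l (ltW C20)) /le_trans; apply.
  by rewrite le_eqVlt; apply/orP; left; apply/eqP; field; rewrite gt_eqF.
pose CD := C1 + DX + V; pose c2 := kq * (CD + 1); pose D' := DX + V + kq * (cb * V + c2).
have c20 : 0 < c2 by rewrite mulr_gt0// !addr_gt0.
have D'0 : 0 < D' by rewrite addr_gt0 ?addr_gt0// mulr_gt0// addr_gt0// mulr_gt0.
have e0 : 0 < kq * (D' + 2 * kq * c2).
  by apply: mulr_gt0 => //; apply: addr_gt0 => //; apply: mulr_gt0 => //; exact: mulr_gt0.
(* In turn: the inner balls of cubes of positive level have radius at most [DX], where the lower
   mass bound holds; [th = delta^(beta/2)] is at most 1/2; and one step of the neighbourhoods [Loc]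
   is absorbed. *)
exists (Num.min (DX / a0) (Num.min (2^-1 `^ (beta / 2)^-1) (D' / (kq * (D' + 2 * kq * c2))))); split.
  by rewrite !lt_min (divr_gt0 DX0 a00) (divr_gt0 D'0 e0) powR_gt0 ?invr_gt0.
move=> delta /andP[delta0]; rewrite !lt_min => /and3P[d1 d2 d3] delta1.
have a0_small : a0 * delta <= DX by rewrite mulrC -ler_pdivlMr// ltW.
have delta_small : delta * (kq * (D' + 2 * kq * c2)) <= D' by rewrite -ler_pdivlMr// ltW.
have b2 : 0 < beta / 2 by rewrite divr_gt0.
have th_small : delta `^ (beta / 2) <= 2^-1.
  have : delta `^ (beta / 2) <= (2^-1 `^ (beta / 2)^-1) `^ (beta / 2).
    by apply: ge0_ler_powR; rewrite ?nnegrE ?powR_ge0// ltW.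
  by rewrite -powRrM mulVf ?gt_eqF// powRr1// invr_ge0.
pose c1 := Num.min (A1 * a0) V.
have c10 : 0 < c1 by rewrite lt_min V0 mulr_gt0.
(* Cubes have mass at least [c1 delta^n], so [K c1] is the separation constant, and it must exceed
   the one in [close_eq]. *)
exists ((4 * kq ^+ 3 * (c2 + cb * V) + 1) / c1); split.
  apply: divr_gt0 => //; apply: addr_gt0 => //; apply: mulr_gt0; first by rewrite mulr_gt0// exprn_gt0.
  by apply: addr_gt0 => //; exact: mulr_gt0.
move=> alpha _.
pose Hc := haar_const A1 A2 delta a0 C1 C.
pose Cphi := 2 * C * Hc + Num.sqrt V.
pose CL := 2 * C * (2 * M%:R * Hc * ((tau * delta)^-1) `^ beta) + 1.
pose Ce := 4 * (Cphi * CL * (2 * c2) `^ beta * (2 * A2 * c2 / c1)) * (4 * A2 * kq * c2 / c1 + 1).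
(* A gap of [m] levels multiplies the Schur constant by [th^m]; this brings it below [delta / 4]. *)
have [m0 hm0] : exists m0, forall m, (m0 <= m)%N -> Ce * (delta `^ (beta / 2)) ^+ m <= delta / 4.
  have th0 : 0 <= delta `^ (beta / 2) by exact: powR_ge0.
  have : (fun n => (delta `^ (beta / 2)) ^+ n) @ \oo --> (0 : R).
    by apply: cvg_expr; rewrite ger0_norm//; apply: le_lt_trans th_small _; rewrite invf_lt1// ltr1n.
  have t0 : 0 < delta / 4 / (`|Ce| + 1) by rewrite !divr_gt0// ltr_wpDl.
  move=> /cvgr0Pnorm_lt/(_ _ t0)[m0 _ hm]; exists m0 => m /hm /=.
  rewrite ger0_norm ?exprn_ge0// ltr_pdivlMr ?ltr_wpDl// => /ltW; apply: le_trans.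
  rewrite mulrC; apply: ler_wpM2l; first exact: exprn_ge0.
  by apply: le_trans (ler_norm _) _; rewrite lerDl.
exists m0 => K m K0 m2 mm0 I E dc h haar psi pou l c sep s j i0 /andP[s0 _] i00 f f_orth.
have K_large : 4 * kq ^+ 3 * (c2 + cb * V) < K * c1.
  by rewrite -ltr_pdivrMr//; apply: lt_le_trans K0; rewrite ltr_pM2r ?invr_gt0// ltrDl.
have tau01 : 0 < tau <= 1 by rewrite tau0 ltW.
have delta01 : 0 < delta < 1 by rewrite delta0.
exact: (family_transfer mufin mupos nd delta01 a00 C10 a0_small dc C_gt0 haar pou tau01 tau_eta beta0 sep
  (ltnW m2) s0 i00 f_orth K_large (hm0 m mm0) th_small delta_small).
Qed.
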